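(* Let $n\ge2$, let $\mathbb{B}$ be the open unit ball of $\mathbb{R}^n$, and let $a\in\mathbb{B}$ be a fixed point. For every $p\in(1,+\infty)$, $\mathbb{B}$ satisfies a $p$-Asymptotic Power Law with exponent $q=-k(p,n)$, where $k(p,n)$ is the critical singular quasiradial exponent; that is, $$\lim_{t\to0}\frac{\log\omega_p(\partial\mathbb{B}\cap B(\xi,t),a,\mathbb{B})}{\log t}=-k(p,n)\quad\text{for each }\xi\in\partial\mathbb{B}.$$ In particular, the unit disc $\mathbb{D}\subset\mathbb{R}^2$ satisfies, for every $p\in(1,+\infty)$, a $p$-Asymptotic Power Law with exponent $$q=\frac{3-p+2\sqrt{p^2-3p+3}}{3(p-1)}.$$
   Context: $B(\xi,t)$ is the Euclidean ball centered at $\xi$ of radius $t$. $p$-harmonic measure: for $1<p<\infty$, a domain $\Omega\subset\mathbb{R}^n$, $E\subset\partial\Omega$ and $x\in\Omega$, $\omega_p(E,x,\Omega)$ is the value at $x$ of the upper Perron solution for the $p$-Laplace equation $\mathrm{div}(|\nabla u|^{p-2}\nabla u)=0$ in $\Omega$ with boundary data $\chi_E$, i.e. $\omega_p(E,x,\Omega)=\inf u(x)$, the infimum being over all nonnegative $p$-superharmonic functions $u$ in $\Omega$ with $\liminf_{y\to\xi}u(y)\ge\chi_E(\xi)$ for every $\xi\in\partial\Omega$. $p$-Asymptotic Power Law: given a domain $\Omega\subset\mathbb{R}^n$ and a fixed point $a\in\Omega$, $\Omega$ satisfies a $p$-Asymptotic Power Law of exponent $q>0$ if $\lim_{t\to0}\frac{\log\omega_p(\partial\Omega\cap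 B(\xi,t),a,\Omega)}{\log t}=q$ for each $\xi\in\partial\Omega$. Critical exponent $k(p,n)$: for $1<p<\infty$ and $n\ge2$, it is known that there is a unique $k=k(p,n)<0$ for which there exists $f\in C^2[0,\pi/2]$, increasing in $(0,\pi/2)$, with $f(0)=0$, $f(\pi/2)=1$, $f'(\pi/2)=0$, $0<f'(0)<\infty$, satisfying on $[0,\pi/2)$ $$[(p-1)(f')^2+k^2f^2]f''+k[(2p-3)k+n-p]f(f')^2+k^3[k(p-1)+n-p]f^3-(n-2)[(f')^2+k^2f^2]f'\tan\alpha=0.$$ Equivalently, $h=r^kf(\alpha)$ is positive and $p$-harmonic in the upper half-space $\mathbb{R}^n_+=\{(x,y):x\in\mathbb{R}^{n-1},y>0\}$, where for $z=(x,y)$, $r=|z|$ and $\alpha\in[0,\pi/2]$ is the latitude angle between $z$ and the hyperplane $y=0$ (so $y=r\sin\alpha$). *)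

(* Defs.v *)
From HB Require Import structures.
From mathcomp Require Import all_boot all_order all_algebra.
From mathcomp Require Import all_classical all_reals all_analysis.

Set Implicit Arguments.
Unset Strict Implicit.
Unset Printing Implicit Defensive.

Import Order.TTheory GRing.Theory Num.Theory.
Import numFieldNormedType.Exports.

Local Open Scope classical_set_scope.
Local Open Scope ring_scope.

Section lebesgue_measure_Rn.
Context {R : realType}.

Lemma pushforward_semi_sigma_additive d d' (T1 : measurableType d)
    (T2 : measurableType d') (m : {measure set T1 -> \bar R}) (f : T1 -> T2) :
  measurable_fun [set: T1] f -> semi_sigma_additive (pushforward m f).
Proof.
move=> mf F mF tF mUF; rewrite /pushforward preimage_bigcup.
apply: measure_semi_sigma_additive.
- by move=> k; rewrite -[X in measurable X]setTI; exact: mf.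
- apply/trivIsetP => /= i j _ _ ij; rewrite -preimage_setI.
  by move/trivIsetP : tF => /(_ _ _ _ _ ij) ->//; rewrite preimage_set0.
- by rewrite -preimage_bigcup -[X in measurable X]setTI; exact: mf.
Qed.

Section cons_measure.
Variables (n : nat)
  (m : {sigma_finite_measure set (n.-tuple (measurableTypeR R)) -> \bar R}).

Let cons_pair (z : measurableTypeR R * n.-tuple (measurableTypeR R)) :
  n.+1.-tuple (measurableTypeR R) := [tuple of z.1 :: z.2].

Let measurable_cons_pair : measurable_fun [set: _] cons_pair.
Proof. exact: (measurable_cons measurable_fst measurable_snd). Qed.

Definition cons_measure : set (n.+1.-tuple (measurableTypeR R)) -> \bar R :=
  pushforward (@lebesgue_measure R \x m)%E cons_pair.

Let cons_measure0 : cons_measure set0 = 0%E.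
Proof. by rewrite /cons_measure /pushforward preimage_set0 measure0. Qed.

Let cons_measure_ge0 A : (0 <= cons_measure A)%E.
Proof. exact: measure_ge0. Qed.

Let cons_measure_sigma_additive : semi_sigma_additive cons_measure.
Proof. exact: pushforward_semi_sigma_additive measurable_cons_pair. Qed.

HB.instance Definition _ := isMeasure.Build _ _ _ cons_measure
  cons_measure0 cons_measure_ge0 cons_measure_sigma_additive.

Let cons_measure_sigma_finite : sigma_finite setT cons_measure.
Proof.
have /sigma_finiteP[F [TF ndF Foo]] := sigma_finiteT (@lebesgue_measure R).
have /sigma_finiteP[G [TG ndG Goo]] := sigma_finiteT m.
pose uncons (t : n.+1.-tuple (measurableTypeR R)) :=
  (thead t, [tuple of behead t]).
have unconsK : cancel cons_pair uncons.
  by move=> [x t]; congr pair => //; apply: val_inj.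
have muncons : measurable_fun [set: _] uncons.
  by apply: measurable_fun_pair; [exact: measurable_tnth|
    exact: measurable_behead].
exists (fun k => uncons @^-1` (F k `*` G k)).
  rewrite -preimage_bigcup (_ : \bigcup_k _ = setT) ?preimage_setT//.
  apply/seteqP; split => // -[x t] _.
  have [k _ Fkx] : (\bigcup_k F k) x by rewrite -TF.
  have [l _ Glt] : (\bigcup_k G k) t by rewrite -TG.
  exists (maxn k l) => //; split => /=.
    by move: x Fkx; exact/subsetPset/ndF/leq_maxl.
  by move: t Glt; exact/subsetPset/ndG/leq_maxr.
move=> k; have [mFk Fkoo] := Foo k; have [mGk Gkoo] := Goo k; split.
  by rewrite -[X in measurable X]setTI; apply: muncons => //;
    exact: measurableX.
rewrite /cons_measure /pushforward -comp_preimage.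
rewrite (_ : uncons \o cons_pair = id); last exact/funext.
by rewrite product_measure1E// lte_mul_pinfty// ge0_fin_numE.
Qed.

HB.instance Definition _ :=
  Measure_isSigmaFinite.Build _ _ _ cons_measure cons_measure_sigma_finite.

End cons_measure.

(* Lebesgue measure on R^n: the n-fold product of [lebesgue_measure], built on
   tuples (which carry the product sigma-algebra) and transported to row
   vectors (which carry the topology) equipped with the Borel sets. *)
Fixpoint lebesgue_tuple (n : nat) :
    {sigma_finite_measure set (n.-tuple (measurableTypeR R)) -> \bar R} :=
  match n with
  | 0 => \d_([tuple] : 0.-tuple (measurableTypeR R))
  | n'.+1 => cons_measure (lebesgue_tuple n')
  end.

Definition borelRn (n : nat) := g_sigma_algebraType (@open 'rV[R]_n).

Definition row_of_tuple (n : nat) (t : n.-tuple (measurableTypeR R)) :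
  borelRn n := \row_i tnth t i.

Lemma measurable_row_of_tuple (n : nat) :
  measurable_fun [set: _] (@row_of_tuple n).
Proof.
have := @measurability _ _ _ (g_sigma_algebraType (@open 'rV[R]_n))
  [set: _] (@row_of_tuple n) (@open 'rV[R]_n) erefl.
apply => _ [U oU <-]; rewrite setTI.
pose B (qk : 'rV[rat]_n * nat) : set 'rV[R]_n :=
  [set y : 'rV[R]_n | forall i, ball (ratr (qk.1 ord0 i) : R) qk.2.+1%:R^-1 (y ord0 i)].
rewrite (_ : _ @^-1` U =
  \bigcup_(qk in [set qk | B qk `<=` U]) (@row_of_tuple n @^-1` B qk)); last first.
  apply/seteqP; split => [t Ut|t [qk /= qkU] Bt]; last exact: qkU.
  have /nbhs_ballP[e /= e0 eU] : nbhs (row_of_tuple t : 'rV[R]_n) U.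
    exact: open_nbhs_nbhs.
  have [k ke] : exists k : nat, k.+1%:R^-1 < e / 2 :> R.
    exists (Num.truncn (e / 2)^-1).
    rewrite invf_plt ?posrE ?divr_gt0// ?ltr0Sn//.
    by rewrite truncnS_gt.
  have k0 : 0 < k.+1%:R^-1 :> R by rewrite invr_gt0 ltr0Sn.
  have /choice[q qP] : forall i, exists q : rat,
      ball (ratr q : R) k.+1%:R^-1 ((row_of_tuple t : 'rV[R]_n) ord0 i).
    move=> i; set x := (row_of_tuple t : 'rV[R]_n) ord0 i.
    have [|q] := @rat_in_itvoo R (x - k.+1%:R^-1) (x + k.+1%:R^-1).
      by rewrite ltrBlDr -addrA ltrDl addr_gt0.
    by rewrite in_itv/= => xq; exists q; apply: ball_sym; rewrite /ball/= ltr_distlC.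
  exists (\row_i q i, k).
    move=> y /= By; apply: eU; split => // i j; rewrite ord1.
    rewrite (splitr e); apply: (@ball_triangle _ _ (ratr (q j) : R)).
      by apply/ball_sym/(le_ball (ltW ke)); exact: qP.
    by apply: (le_ball (ltW ke)); have := By j; rewrite mxE.
  by move=> i /=; rewrite mxE; exact: qP.
rewrite bigcup_mkcond; apply: countable_bigcupT_measurable => // qk.
case: ifP => // _.
rewrite (_ : _ @^-1` _ = \bigcap_(i in [set: 'I_n])
    ((fun t => tnth t i) @^-1` ball (ratr (qk.1 ord0 i) : R) qk.2.+1%:R^-1)).
  apply: fin_bigcap_measurable => // i _.
  rewrite -[X in measurable X]setTI; apply: measurable_tnth => //.
  exact: measurable_realfun.measurable_ball.
by apply/seteqP; split => t /= h i; have := h i; rewrite /= mxE => // /(_ I).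
Qed.

Definition lebesgue_Rn (n : nat) : set (borelRn n) -> \bar R :=
  pushforward (lebesgue_tuple n) (@row_of_tuple n).

Let lebesgue_Rn0 n : @lebesgue_Rn n set0 = 0%E.
Proof. by rewrite /lebesgue_Rn /pushforward preimage_set0 measure0. Qed.

Let lebesgue_Rn_ge0 n A : (0 <= @lebesgue_Rn n A)%E.
Proof. by rewrite /lebesgue_Rn /pushforward measure_ge0. Qed.

Let lebesgue_Rn_sigma_additive n : semi_sigma_additive (@lebesgue_Rn n).
Proof. exact: pushforward_semi_sigma_additive (@measurable_row_of_tuple n). Qed.

HB.instance Definition _ n := isMeasure.Build _ _ _ (@lebesgue_Rn n)
  (@lebesgue_Rn0 n) (@lebesgue_Rn_ge0 n) (@lebesgue_Rn_sigma_additive n).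

End lebesgue_measure_Rn.

Section euclidean_space.
Context {R : realType} {n : nat}.
Implicit Types (x y : 'rV[R]_n) (phi : 'rV[R]_n -> R).

Definition dot x y : R := \sum_(i < n) x ord0 i * y ord0 i.

(* The library norm on ['rV[R]_n] is the sup norm; it induces the same
   topology, but balls have to be taken for the Euclidean norm. *)
Definition enorm x : R := Num.sqrt (dot x x).

Definition eball x (r : R) : set 'rV[R]_n := [set y | enorm (y - x) < r].

Definition boundary (A : set 'rV[R]_n) : set 'rV[R]_n := closure A `\` interior A.

Definition partial (i : 'I_n) phi : 'rV[R]_n -> R := 'D_(delta_mx ord0 i) phi.

Definition gradient phi x : 'rV[R]_n := \row_i partial i phi x.

Fixpoint Ck (k : nat) phi : Prop :=
  continuous phi /\
  match k with
  | 0 => True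
  | k'.+1 => forall i, (forall x, derivable phi x (delta_mx ord0 i)) /\
                       Ck k' (partial i phi)
  end.

Definition smooth phi : Prop := forall k, Ck k phi.

Definition test_function (D : set 'rV[R]_n) phi : Prop :=
  smooth phi /\
  exists K, [/\ compact K, K `<=` D & forall x, ~ K x -> phi x = 0].

End euclidean_space.

Section p_laplace.
Context {R : realType} {n : nat}.
Variable p : R.
Implicit Types (D Omega E : set 'rV[R]_n) (u : 'rV[R]_n -> R).

Local Notation mu := (@lebesgue_Rn R n).

Definition Lp_loc D (f : 'rV[R]_n -> R) : Prop :=
  measurable_fun (D : set (borelRn n)) (f : borelRn n -> R) /\
  forall K, compact K -> K `<=` D ->
    (\int[mu]_(x in K) (`|f x| `^ p)%:E < +oo)%E.

Definition weak_gradient D u (g : 'rV[R]_n -> 'rV[R]_n) : Prop :=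
  forall phi, test_function D phi -> forall i,
    \int[mu]_(x in D) (u x * partial i phi x) =
    - \int[mu]_(x in D) (g x ord0 i * phi x).

Definition sobolev1p_loc D u (g : 'rV[R]_n -> 'rV[R]_n) : Prop :=
  [/\ Lp_loc D u, forall i, Lp_loc D (fun x => g x ord0 i)
    & weak_gradient D u g].

(* Continuous weak solutions in [D] (open) of
   [div (|grad u|^(p-2) grad u) = 0].  Where [g x = 0] the integrand is [0],
   also for [p < 2]. *)
Definition p_harmonic D u : Prop :=
  {in D, continuous u} /\
  exists2 g, sobolev1p_loc D u g &
    forall phi, test_function D phi ->
      \int[mu]_(x in D) (enorm (g x) `^ (p - 2) * dot (g x) (gradient phi x))
      = 0.

(* Only the values of [u] on [Omega] (open) matter. *)
Definition p_superharmonic Omega (u : 'rV[R]_n -> \bar R) : Prop :=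
  [/\ forall x, Omega x -> (-oo < u x)%E,
      forall x (c : R), Omega x -> (c%:E < u x)%E ->
        \forall y \near x, (c%:E < u y)%E,
      forall x, Omega x ->
        exists2 y, connected_component Omega x y & (u y < +oo)%E
    & forall D (h : 'rV[R]_n -> R),
        open D -> compact (closure D) -> closure D `<=` Omega ->
        {within closure D, continuous h} -> p_harmonic D h ->
        (forall x, boundary D x -> ((h x)%:E <= u x)%E) ->
        forall x, D x -> ((h x)%:E <= u x)%E].

Definition upper_class E Omega : set ('rV[R]_n -> \bar R) :=
  [set u | [/\ p_superharmonic Omega u,
               forall x, Omega x -> (0 <= u x)%E
             & forall xi, boundary Omega xi ->
                 ((\1_E xi)%:E <= limf_einf u (within Omega (nbhs xi)))%E]].

Definition p_harmonic_measure E (x : 'rV[R]_n) Omega : \bar R :=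
  ereal_inf [set u x | u in upper_class E Omega].

(* The constant [1] is in the upper class, so [p_harmonic_measure] takes its
   values in [0, 1].  If it vanished, the quotient below would be [0], hence
   would not tend to [q > 0]. *)
Definition p_asymptotic_power_law Omega (a : 'rV[R]_n) (q : R) : Prop :=
  0 < q /\
  forall xi, boundary Omega xi ->
    ln (fine (p_harmonic_measure (boundary Omega `&` eball xi t) a Omega)) / ln t
      @[t --> 0^'+] --> q.

End p_laplace.

Section critical_exponent.
Context {R : realType}.
Variables (n : nat) (p : R).

(* [f] is in [C^2[0, pi/2]], with [f1], [f2] the continuous extensions to
   [[0, pi/2]] of [f'] and [f'']; at an endpoint these are the one-sided
   derivatives. *)
Definition quasiradial_profile (k : R) (f f1 f2 : R -> R) : Prop :=
  [/\ [/\ {within `[0, pi / 2], continuous f},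
          {within `[0, pi / 2], continuous f1},
          {within `[0, pi / 2], continuous f2}
        & forall x, x \in `]0, pi / 2[ ->
            is_derive x 1 f (f1 x) /\ is_derive x 1 f1 (f2 x)],
      {in `]0, pi / 2[ &, {homo f : x y / x < y}},
      [/\ f 0 = 0, f (pi / 2) = 1, f1 (pi / 2) = 0 & 0 < f1 0]
    & forall x, x \in `[0, pi / 2[ ->
        ((p - 1) * f1 x ^+ 2 + k ^+ 2 * f x ^+ 2) * f2 x
        + k * ((2 * p - 3) * k + n%:R - p) * f x * f1 x ^+ 2
        + k ^+ 3 * (k * (p - 1) + n%:R - p) * f x ^+ 3
        - (n%:R - 2) * (f1 x ^+ 2 + k ^+ 2 * f x ^+ 2) * f1 x * tan x = 0].

(* The unique negative [k] admitting a profile. *)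
Definition critical_exponent : R :=
  xget 0 [set k | k < 0 /\ exists f f1 f2, quasiradial_profile k f f1 f2].

End critical_exponent.

(* Main.v *)
From HB Require Import structures.
Require Import Defs.
From mathcomp Require Import all_boot all_order all_algebra.
From mathcomp Require Import all_classical all_reals all_analysis.
From mathcomp Require Import measurable_realfun ring lra.

Set Implicit Arguments.
Unset Strict Implicit.
Unset Printing Implicit Defensive.

Import Order.TTheory GRing.Theory Num.Theory.
Import numFieldNormedType.Exports.

Local Open Scope classical_set_scope.
Local Open Scope ring_scope.

(** A profile [f] makes [h = r^k f(alpha)] positive and [p]-harmonic in a half
    space with apex on its boundary, and every estimate comes from comparison
    with such functions.  Upper bound: a multiple of [h] with apex at
    [(1 + t) xi], axis towards the ball, lies in the upper class and is
    [O(t^(-k))] at [a].  Lower bound: half balls on which [h - r^k >= 0], with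
    apex on the segment from [xi] to [0], carry a bound for [u] from a ball at
    depth about [d] to one at depth about [L d], with a loss of [kappa L^k],
    where [kappa] does not depend on [L]; iterating with [L] large gives
    [t^(-k + eps)], and a Harnack chain reaches [a].  So the law holds with
    exponent [-k] for every [k < 0] that has a profile.

    Comparison with weak solutions uses that [(1 - exp(- l U)) / l] is a strict
    supersolution when [U] is [C^1] and [p]-harmonic with nonvanishing gradient;
    mollified test functions then contradict monotonicity of
    [X |-> |X|^(p-2) X].

    Profiles exist because the phase [B] with [tan B = f' / (m f)], [m = -k],
    solves a first-order equation in [s = tan alpha], globally Lipschitz in
    [B].  One shoots in [m] for the solution with [B(0) = pi/2] that tends to
    [0] without crossing it; for [n = 2] the equation has a first integral,
    which gives [m] explicitly. *)

(** A function [h] to be compared is only a continuous weak solution with some locally $L^p$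
    gradient, so $h - v$ is no admissible test function. It is mollified, and the square of a
    positive part makes the test function $C^1$; the limit is then taken in the pairing of an $L^q$
    field with a mollified $L^p$ gradient. Strictness replaces a Poincare argument: for two
    solutions monotonicity would only equate gradients, whereas the strict term stays bounded below
    near a point where $h > v$.

    The iteration tolerates the loss [kappa] because it is paid once per ratio [L]: after $N$ steps
    with $L^N \sim 1/t$ the bound is $(\kappa L^k)^N \sim t^{-k+\epsilon}$ with $\epsilon =
    \log(1/\kappa)/\log L$. A half ball with apex at depth of order $d$ can have radius of order
    $\sqrt d$, since the sphere leaves its tangent plane quadratically; this dwarfs $Ld$ for small
    $d$, so the subtracted $r^k$ costs only a factor.

    The phase stays bounded where $f'/f$ is infinite, so its equation has solutions on the whole
    line. A positive phase means an increasing $f$. *)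

Section derivation_rules.
Context {R : realType} {V : normedModType R}.
Implicit Types (f g : V -> R) (x v : V).

Lemma der_cst x v (c : R) : is_derive x v (fun=> c) 0.
Proof. exact: is_derive_cst. Qed.

Lemma der_D f g x v (a b : R) : is_derive x v f a -> is_derive x v g b ->
  is_derive x v (fun y => f y + g y) (a + b).
Proof. by move=> ? ?; exact: is_deriveD. Qed.

Lemma der_N f x v (a : R) : is_derive x v f a -> is_derive x v (fun y => - f y) (- a).
Proof. by move=> ?; exact: is_deriveN. Qed.

Lemma der_M f g x v (a b : R) : is_derive x v f a -> is_derive x v g b ->
  is_derive x v (fun y => f y * g y) (a * g x + f x * b).
Proof.
move=> da db; apply: (is_derive_eq (is_deriveM da db)).
by rewrite addrC [g x *: a]mulrC.
Qed.

Lemma der_near f g x v (a : R) : (\near x, f x = g x) -> is_derive x v f a -> is_derive x v g a.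
Proof. exact: near_eq_is_derive. Qed.

(** Directional derivatives on [V] become ordinary derivatives along a line, so that one-variable
    calculus applies to them. *)
Lemma der_line f x v d s : is_derive (x + s *: v) v f d <->
  is_derive s (1 : R) (fun t : R => f (x + t *: v)) d.
Proof.
have E : (fun h => h^-1 *: (((fun t : R => f (x + t *: v)) \o shift s) (h *: (1:R)) - f (x + s *: v))) =
   (fun h => h^-1 *: ((f \o shift (x + s *: v)) (h *: v) - f (x + s *: v))).
  apply/funext => h /=; congr (_ *: (f _ - _)).
  by rewrite [h *: 1]mulr1 scalerDl addrCA.
split => -[].
  move=> H1 H2; split; first by rewrite /derivable E.
  by rewrite -H2 /derive E.
move=> H1 H2; split; first by move: H1; rewrite /derivable E.
by rewrite -H2 /derive E.
Qed.

Lemma der_comp (h : R -> R) g x v (a b : R) : is_derive (g x) (1 : R) h a ->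
  is_derive x v g b -> is_derive x v (fun y => h (g y)) (a * b).
Proof.
move=> dh dg.
have /(der_line g x v b 0).1 dg' : is_derive (x + 0 *: v) v g b by rewrite scale0r addr0.
rewrite -[x]addr0 -(scale0r v); apply/(der_line (fun y => h (g y))).
by apply: (@is_derive1_comp _ h (fun t : R => g (x + t *: v))) => //; rewrite scale0r addr0.
Qed.

Lemma der_exp g x v (b : R) : is_derive x v g b ->
  is_derive x v (fun y => expR (g y)) (expR (g x) * b).
Proof. by move=> dg; apply: der_comp => //; exact: is_derive_expR. Qed.

Lemma der_sin g x v (b : R) : is_derive x v g b ->
  is_derive x v (fun y => sin (g y)) (cos (g x) * b).
Proof. by move=> dg; apply: der_comp => //; exact: is_derive_sin. Qed.

Lemma der_cos g x v (b : R) : is_derive x v g b ->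
  is_derive x v (fun y => cos (g y)) (- sin (g x) * b).
Proof. by move=> dg; apply: der_comp => //; exact: is_derive_cos. Qed.

Lemma der_X g x v (b : R) n : is_derive x v g b ->
  is_derive x v (fun y => g y ^+ n) (n%:R * g x ^+ n.-1 * b).
Proof.
move=> dg; elim: n => [|n IH].
  by rewrite !mul0r; exact: der_cst.
rewrite (_ : (fun y => _) = (fun y => g y * g y ^+ n)); last by apply/funext => y; rewrite exprS.
apply: (is_derive_eq (der_M dg IH)) => /=.
case: n {IH} => [|n] /=; first by rewrite mul0r mul0r mulr0 addr0 mul1r mulrC.
by rewrite -(natr1 n.+1) exprS; ring.
Qed.

Lemma der_V g x v (b : R) : g x != 0 -> is_derive x v g b ->
  is_derive x v (fun y => (g y)^-1) (- (g x) ^- 2 * b).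
Proof.
move=> g0 dg; apply: (der_comp (h := fun y => y^-1)) => //.
apply: (is_derive_eq (@is_deriveV _ id (g x) 1 1 g0 (is_derive_id _ _))).
by rewrite [_ *: _]mulr1.
Qed.

Lemma der_continuous_at (h : R -> R) (s a : R) : is_derive s (1 : R) h a -> {for s, continuous h}.
Proof.
by move=> [d _]; apply: differentiable_continuous; exact/derivable1_diffP.
Qed.

End derivation_rules.

Lemma der_id {R : realType} (x : R) : is_derive x (1 : R) (fun y : R => y) 1.
Proof. exact: is_derive_id. Qed.

Lemma der_continuous {R : realType} (f f' : R -> R) :
  (forall x, is_derive x (1 : R) f (f' x)) -> continuous f.
Proof. by move=> df x; exact: der_continuous_at (df x). Qed.

(** Differentiates by the shape of the function, taking the derivatives of atoms from the context.
    [der] leaves the equation between the two derivative values, and a nonvanishing condition for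
    each inverse. *)
Ltac der_step :=
  first [ eassumption | exact: der_cst | exact: der_id
        | eapply der_X; der_step
        | eapply der_D; der_step | eapply der_M; der_step | eapply der_N; der_step
        | eapply der_exp; der_step | eapply der_sin; der_step | eapply der_cos; der_step
        | eapply der_V; [ | der_step] | idtac].
Ltac der := eapply is_derive_eq; [der_step | cbv beta].

Section continuity_eps_delta.
Context {R : realType} {V W : normedModType R}.

Lemma cont_distP (f : V -> W) (x : V) : {for x, continuous f} <->
  (forall e : R, 0 < e -> exists2 d : R, 0 < d & forall y, `|x - y| < d -> `|f x - f y| < e).
Proof.
split => [/(@cvgrPdist_lt _ _ _ (nbhs x) (nbhs_filter x)) H e /H /nbhs_ballP[d /= d0 dP]|H].
  by exists d => // y xy; apply: dP; rewrite -ball_normE.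
apply/(@cvgrPdist_lt _ _ _ (nbhs x) (nbhs_filter x)) => e /H[d d0 dP].
by apply/nbhs_ballP; exists d => //= y; rewrite -ball_normE; exact: dP.
Qed.

Lemma cont_subl (x y : V) : {for y, continuous (fun z : V => x - z)}.
Proof.
by apply: continuousB; [exact: cst_continuous|exact: cvg_id].
Qed.

Lemma cont_subr (x y : V) : {for y, continuous (fun z : V => z - x)}.
Proof.
by apply: continuousB; [exact: cvg_id|exact: cst_continuous].
Qed.

End continuity_eps_delta.

(** * Borel measurability of continuous functions on $\mathbb{R}^n$ *)

Section borel_Rn.
Context {R : realType} {n : nat}.
Implicit Types (D A K : set 'rV[R]_n) (f : 'rV[R]_n -> R).

Lemma open_measurable_Rn A : open A -> measurable (A : set (borelRn n)).
Proof. by move=> oA; exact: sub_sigma_algebra. Qed.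

Lemma closed_measurable_Rn A : closed A -> measurable (A : set (borelRn n)).
Proof.
move=> cA; rewrite -[A]setCK; apply: measurableC.
by apply: open_measurable_Rn; rewrite openC.
Qed.

Lemma rV_hausdorff : hausdorff_space 'rV[R]_n.
Proof. exact: norm_hausdorff. Qed.

Lemma compact_measurable_Rn A : compact A -> measurable (A : set (borelRn n)).
Proof.
by move=> cA; apply: closed_measurable_Rn; apply: compact_closed => //; exact: rV_hausdorff.
Qed.

Lemma open_continuous_measurable_Rn D f : open D ->
  {in D, continuous f} -> measurable_fun (D : set (borelRn n)) (f : borelRn n -> R).
Proof.
move=> oD cf; apply: (measurability _ (RGenOpens.measurableE R)) => _ [_ [a [b ->] <-]].
apply: open_measurable_Rn.
rewrite openE => x [Dx /= xab]; apply: filterI.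
  exact: open_nbhs_nbhs.
by apply: (cf x (mem_set Dx)); apply: open_nbhs_nbhs; split => //; exact: interval_open.
Qed.

Lemma continuous_measurable_Rn f : continuous f ->
  measurable_fun [set: borelRn n] (f : borelRn n -> R).
Proof.
move=> cf; apply: open_continuous_measurable_Rn; first exact: openT.
by move=> x _; exact: cf.
Qed.

End borel_Rn.

(** * Fubini along one coordinate *)

Section tuple_slices.
Context {R : realType}.
Local Notation T := (measurableTypeR R).

Definition tuple_upd n (t : n.-tuple T) (i : 'I_n) (x : R) : n.-tuple T :=
  [tuple if j == i then x else tnth t j | j < n].

Definition tbox n (M : R) : set (n.-tuple T) := [set t | forall i, `|tnth t i| <= M].

Lemma tbox_measurable n M : measurable (tbox M : set (n.-tuple T)).
Proof.
rewrite (_ : tbox M = \bigcap_(i in [set: 'I_n]) ((fun t => tnth t i) @^-1` `[- M, M])).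
  apply: fin_bigcap_measurable => // i _.
  by rewrite -[X in measurable X]setTI; apply: measurable_tnth.
apply/seteqP; split => t /= h i; have := h i; rewrite /= in_itv/= ler_norml//.
by move=> /(_ Logic.I).
Qed.

Let cons_pair n (z : T * n.-tuple T) : n.+1.-tuple T := [tuple of z.1 :: z.2].

Let measurable_cons_pair n : measurable_fun [set: T * n.-tuple T] (@cons_pair n).
Proof. exact: (measurable_cons measurable_fst measurable_snd). Qed.

Lemma lebesgue_tbox n M : (@lebesgue_tuple R n (tbox M) < +oo)%E.
Proof.
elim: n => [|n IH] /=; first by rewrite diracE; case: (_ \in _); rewrite ltry.
rewrite /cons_measure /pushforward.
rewrite (_ : _ @^-1` _ = `[- M, M]%classic `*` tbox M); last first.
  apply/seteqP; split => -[x t] /= h.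
    split; first by have := h ord0; rewrite tnth0 in_itv/= ler_norml.
    by move=> i; have := h (lift ord0 i); rewrite tnthS.
  move=> i; case: (unliftP ord0 i) => [j ->|->].
    by rewrite tnthS; exact: h.2.
  by rewrite tnth0; have := h.1; rewrite in_itv/= ler_norml.
rewrite product_measure1E//; last exact: tbox_measurable.
rewrite lte_mul_pinfty//.
  have := @lebesgue_measure_itv R `[- M, M]; rewrite /= => ->.
  by case: ifP.
Qed.

(** A class in which integrability is automatic and which is stable under fixing the first
    coordinate, as the induction on the dimension requires. *)
Definition bbox n (f : n.-tuple T -> R) : Prop :=
  measurable_fun setT f /\
  exists M, (forall t, `|f t| <= M) /\ (forall t, ~ tbox M t -> f t = 0).

Lemma bbox_integrable n (f : n.-tuple T -> R) : bbox f ->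
  (@lebesgue_tuple R n).-integrable setT (EFin \o f).
Proof.
move=> [mf [M [fM f0]]].
apply: (@le_integrable _ _ _ _ _ _ _ (fun t => (M * \1_(tbox M) t)%:E)) => //.
- exact/measurable_EFinP.
- move=> t _ /=; rewrite lee_fin indicE; have [tM|tM] := pselect (tbox M t).
    rewrite mem_set// mulr1; apply: le_trans (ler_norm _); exact: fM.
  by rewrite f0// normr0 normr_ge0.
under eq_fun do rewrite EFinM.
apply: integrableZl => //.
apply/integrableP; split.
  by apply/measurable_EFinP/measurable_indic; exact: tbox_measurable.
under eq_integral do rewrite gee0_abs ?lee_fin//.
rewrite integral_indic ?setIT//; [exact: lebesgue_tbox|exact: tbox_measurable].
Qed.

Lemma bbox_cons n (f : n.+1.-tuple T -> R) (x : R) : bbox f ->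
  bbox (fun t : n.-tuple T => f [tuple of x :: t]).
Proof.
move=> [mf [M [fM f0]]]; split.
  by apply: (measurableT_comp mf); apply: measurable_cons; [exact: measurable_cst|exact: measurable_id].
exists M; split => // t nt; apply: f0 => h; apply: nt => i.
by have := h (lift ord0 i); rewrite tnthS.
Qed.

Lemma integral_lebesgue_cons n (f : n.+1.-tuple T -> R) : bbox f ->
  ((lebesgue_measure \x lebesgue_tuple n).-integrable setT
     (fun z : T * n.-tuple T => (f [tuple of z.1 :: z.2])%:E) /\
  \int[@lebesgue_tuple R n.+1]_t (f t)%:E =
  \int[lebesgue_measure]_x \int[lebesgue_tuple n]_t (f [tuple of x :: t])%:E)%E.
Proof.
move=> bf; have intf := bbox_integrable bf.
have intf' : ((lebesgue_measure \x lebesgue_tuple n).-integrable setT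
     (fun z : T * n.-tuple T => (f [tuple of z.1 :: z.2])%:E))%E.
  have [mf _] := bf.
  apply/integrableP; split.
    apply/measurable_EFinP; exact: (measurableT_comp mf (@measurable_cons_pair n)).
  have /integrableP[_] := intf; rewrite [X in (X < _)%E -> _](_ : _ =
   (\int[(lebesgue_measure \x lebesgue_tuple n)%E]_(z in setT) `|(f [tuple of z.1 :: z.2])%:E|)%E) //.
  rewrite /= /cons_measure ge0_integral_pushforward//=.
- exact: measurable_cons_pair.
- exact/measurable_EFinP/measurableT_comp.
split => //.
transitivity (\int[lebesgue_measure \x lebesgue_tuple n]_z (f [tuple of z.1 :: z.2])%:E)%E.
  rewrite /= /cons_measure integral_pushforward//=.
  - exact: measurable_cons_pair.
  - by apply/measurable_EFinP; exact: bf.1.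
exact: (esym (integral12_prod_meas1 intf')).
Qed.

(** Fubini in a vanishing form, for an arbitrary coordinate: coordinates ahead of [i] are peeled off
    by induction, then the order of integration is exchanged. It serves the integral of a partial
    derivative and the nullity of the axis of a half space. *)
Lemma tuple_slice0 n (i : 'I_n) (f : n.-tuple T -> R) : bbox f ->
  (forall t, \int[lebesgue_measure]_x (f (tuple_upd t i x))%:E = 0)%E ->
  (\int[@lebesgue_tuple R n]_t (f t)%:E = 0)%E.
Proof.
elim: n => [|n IH] in i f *; first by case: i.
move=> bf f0; have [intf ->] := integral_lebesgue_cons bf.
case: (unliftP ord0 i) => [j ij|i0].
  apply: integral0_eq => x _; apply: (IH j); first exact: bbox_cons.
  move=> t; rewrite -[RHS](f0 [tuple of x :: t]); apply: eq_integral => y _.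
  congr (f _)%:E; apply: eq_from_tnth => k; rewrite ij !tnth_mktuple.
  case: (unliftP ord0 k) => [l ->|->].
    by rewrite !tnthS !tnth_mktuple (inj_eq lift_inj).
  by rewrite !tnth0 (negbTE (neq_lift _ _)).
rewrite (Fubini intf).
apply: integral0_eq => t _; rewrite -[RHS](f0 [tuple of 0 :: t]).
apply: eq_integral => y _ /=; congr (f _)%:E; apply: eq_from_tnth => k; rewrite i0 !tnth_mktuple.
case: (unliftP ord0 k) => [l ->|->].
  by rewrite !tnthS eq_sym (negbTE (neq_lift _ _)).
by rewrite !tnth0 eqxx.
Qed.

End tuple_slices.

Section lebesgue_Rn_basics.
Context {R : realType} {n : nat}.
Local Notation V := 'rV[R]_n.
Local Notation mu := (@lebesgue_Rn R n).
Implicit Types (f : V -> R) (x : V).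

Lemma le_mx_norm_rV (x : V) (M : R) : (`|x| <= M) <-> 0 <= M /\ forall i, `|x ord0 i| <= M.
Proof.
rewrite [`|x|]mx_normrE; split => [xM|[M0 xM]].
  split; first by apply: le_trans xM; exact: bigmax_ge_id.
  move=> i; apply: le_trans xM.
  exact: (@le_bigmax _ _ _ 0 (fun ij : 'I_1 * 'I_n => `|x ij.1 ij.2|) (ord0, i)).
by apply/bigmax_leP; split => // -[i j] _ /=; rewrite ord1.
Qed.

Lemma coord_le_norm (x : V) i : `|x ord0 i| <= `|x|.
Proof. by have [_] := (le_mx_norm_rV x `|x|).1 (lexx _). Qed.

Definition bcs f : Prop :=
  measurable_fun [set: borelRn n] (f : borelRn n -> R) /\
  exists M, (forall x, `|f x| <= M) /\ (forall x, M < `|x| -> f x = 0).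

Lemma bcs_bbox f : bcs f -> bbox (fun t => f (row_of_tuple t)).
Proof.
move=> [mf [M [fM f0]]]; split; first exact: (measurableT_comp mf (@measurable_row_of_tuple R n)).
have M0 : 0 <= M by apply: le_trans (fM 0); exact: normr_ge0.
exists M; split => // t; rewrite /tbox/= => nt; apply: f0; rewrite ltNge; apply/negP => /le_mx_norm_rV[_ h].
by apply: nt => i; have := h i; rewrite mxE.
Qed.

Lemma bcs_integrable f : bcs f -> mu.-integrable setT (EFin \o f).
Proof.
move=> bf; apply: integrable_pushforward => //.
- exact: measurable_row_of_tuple.
- by apply/measurable_EFinP; exact: bf.1.
- by rewrite preimage_setT; exact: (bbox_integrable (bcs_bbox bf)).
Qed.

Lemma integral_bcs f : bcs f ->
  (\int[mu]_x (f x)%:E = \int[@lebesgue_tuple R n]_t (f (row_of_tuple t))%:E)%E.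
Proof.
move=> bf; rewrite /lebesgue_Rn integral_pushforward//.
- exact: measurable_row_of_tuple.
- by apply/measurable_EFinP; exact: bf.1.
- by rewrite preimage_setT; exact: (bbox_integrable (bcs_bbox bf)).
Qed.

Definition upd x (i : 'I_n) (s : R) : V := x + (s - x ord0 i) *: delta_mx ord0 i.

Lemma updE x i s j : upd x i s ord0 j = if j == i then s else x ord0 j.
Proof.
rewrite !mxE ?eqxx/=; case: eqP => [->|_]; first by rewrite ?eqxx mulr1 addrCA subrr addr0.
by rewrite mulr0 addr0.
Qed.

Lemma integral_slice0 (i : 'I_n) f : bcs f ->
  (forall x, \int[lebesgue_measure]_s (f (upd x i s))%:E = 0)%E ->
  (\int[mu]_x (f x)%:E = 0)%E.
Proof.
move=> bf f0; rewrite integral_bcs//; apply: (tuple_slice0 (i := i)); first exact: bcs_bbox.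
move=> t; rewrite -[RHS](f0 (row_of_tuple t)); apply: eq_integral => s _; congr (f _)%:E.
by apply/rowP => j; rewrite updE !mxE tnth_mktuple.
Qed.

Lemma Rn_box_fin (M : R) : (mu [set x | (`|x| <= M)%R] < +oo)%E.
Proof.
apply: le_lt_trans (lebesgue_tbox n M); rewrite /lebesgue_Rn /pushforward.
apply: le_measure; rewrite ?inE.
- rewrite -[X in measurable X]setTI; apply: measurable_row_of_tuple => //.
  apply: closed_measurable_Rn; rewrite (_ : [set x | _] = (fun x : V => `|x|) @^-1` [set y : R | y <= M])//.
  by apply: preimage_closed => [x _|]; [exact: norm_continuous|exact: closed_le].
- exact: tbox_measurable.
by move=> t /= /le_mx_norm_rV[_ h] i; have := h i; rewrite mxE.
Qed.

Lemma Rn_measurable_box (M : R) : measurable ([set x | `|x| <= M] : set (borelRn n)).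
Proof.
apply: closed_measurable_Rn; rewrite (_ : [set x | _] = (fun x : V => `|x|) @^-1` [set y : R | y <= M])//.
by apply: preimage_closed => [x _|]; [exact: norm_continuous|exact: closed_le].
Qed.

(** Registered below as an instance, it gives access to the product measure [mu \x mu], hence to
    Fubini for convolutions. *)
Lemma lebesgue_Rn_sigma_finite : sigma_finite setT mu.
Proof.
exists (fun k => [set x | `|x| <= k%:R]).
  apply/esym/seteqP; split => // x _; exists (Num.truncn `|x|).+1 => //=.
  by apply: ltW; exact: truncnS_gt.
by move=> k; split; [exact: Rn_measurable_box|exact: Rn_box_fin].
Qed.

End lebesgue_Rn_basics.

HB.instance Definition _ (R : realType) n :=
  Measure_isSigmaFinite.Build _ _ _ (@lebesgue_Rn R n) (@lebesgue_Rn_sigma_finite R n).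

(** * Integrals of partial derivatives *)

Section lebesgue_Rn_ibp.
Context {R : realType} {n : nat}.
Local Notation V := 'rV[R]_n.
Local Notation mu := (@lebesgue_Rn R n).
Implicit Types (f : V -> R) (x : V).

Lemma compact_norm_bound (K : set V) : compact K -> exists M : R, 0 < M /\ forall x, K x -> `|x| <= M.
Proof.
move=> /compact_bounded[M [Mr h]]; exists (Num.max M 0 + 1); split.
  by rewrite ltr_pwDr// le_max lexx orbT.
by move=> x Kx; apply: (h (Num.max M 0 + 1)) => //; rewrite ltr_pwDr// le_max lexx.
Qed.

Lemma compact_nz_bounded f (K : set V) : continuous f -> compact K ->
  exists M : R, 0 < M /\ forall x, K x -> `|f x| <= M.
Proof.
move=> cf cK; have /compact_bounded[M [Mr h]] : compact (f @` K).
  by apply: continuous_compact => //; exact/continuous_subspaceT.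
exists (Num.max M 0 + 1); split; first by rewrite ltr_pwDr// le_max lexx orbT.
by move=> x Kx; apply: (h (Num.max M 0 + 1)); [rewrite ltr_pwDr// le_max lexx|exists x].
Qed.

Lemma continuous_bcs f (K : set V) : continuous f -> compact K ->
  (forall x, ~ K x -> f x = 0) -> bcs f.
Proof.
move=> cf cK f0; split; first exact: continuous_measurable_Rn.
have [M [M0 fM]] := compact_nz_bounded cf cK.
have [N [N0 KN]] := compact_norm_bound cK.
exists (M + N); split => x.
  have [Kx|Kx] := pselect (K x); first by apply: le_trans (fM _ Kx) _; rewrite lerDl ltW.
  by rewrite f0// normr0 addr_ge0// ltW.
move=> Mx; apply: f0 => /KN; apply/negP; rewrite -ltNge; apply: le_lt_trans Mx.
by rewrite lerDr ltW.
Qed.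

Lemma is_derive_upd f x i s : derivable f (upd x i s) (delta_mx ord0 i) ->
  is_derive s (1 : R) (fun t => f (upd x i t)) (partial i f (upd x i s)).
Proof.
move=> df; have /(der_line f (x - x ord0 i *: delta_mx ord0 i) _ _ s).1 :
    is_derive (x - x ord0 i *: delta_mx ord0 i + s *: delta_mx ord0 i) (delta_mx ord0 i) f (partial i f (upd x i s)).
  have -> : x - x ord0 i *: delta_mx ord0 i + s *: delta_mx ord0 i = upd x i s.
    by rewrite /upd scalerBl addrAC -addrA.
  by apply: DeriveDef.
congr is_derive; apply/funext => t; rewrite /upd; congr f.
by rewrite scalerBl addrAC -addrA.
Qed.

Lemma upd_continuous x i : continuous (fun s : R => upd x i s).
Proof.
move=> s; apply: cvgD; first exact: cvg_cst.
by apply: cvgZr_tmp; apply: cvgB; [exact: cvg_id|exact: cvg_cst].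
Qed.

Lemma is_derive_FTC2 (g dg : R -> R) (a b : R) : a < b ->
  (forall s, is_derive s (1 : R) g (dg s)) -> continuous dg ->
  (\int[lebesgue_measure]_(s in `[a, b]) (dg s)%:E = (g b)%:E - (g a)%:E)%E.
Proof.
move=> ab gd cdg.
have cg : continuous g := der_continuous gd.
rewrite (@continuous_FTC2 _ dg g) //; first exact/continuous_subspaceT.
  split; first by move=> s _; have [] := gd s.
    by apply: cvg_at_right_filter; exact: cg.
  by apply: cvg_at_left_filter; exact: cg.
by move=> s _; rewrite derive1E; have [] := gd s.
Qed.

(** On each line in direction [i] the fundamental theorem of calculus gives the difference of two
    values taken outside [K]. *)
Lemma integral_partial0 (i : 'I_n) f (K : set V) : compact K ->
  (forall x, ~ K x -> f x = 0) -> (forall x, derivable f x (delta_mx ord0 i)) ->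
  continuous (partial i f) ->
  (\int[mu]_x (partial i f x)%:E = 0)%E.
Proof.
move=> cK f0 df cf.
have [N [N0 KN]] := compact_norm_bound cK.
have oK : open (~` K) by rewrite openC; apply: compact_closed => //; exact: rV_hausdorff.
have pf0 x : ~ K x -> partial i f x = 0.
  move=> nK; rewrite /partial.
  have -> : 'D_(delta_mx ord0 i) f x = 'D_(delta_mx ord0 i) (cst (0:R)) x.
    apply: near_eq_derive.
    by near=> y; apply: f0; near: y; exact: open_nbhs_nbhs.
  by rewrite derive_cst.
apply: (integral_slice0 (i := i)); first exact: (continuous_bcs cf cK).
move=> x.
pose g s := f (upd x i s); pose dg s := partial i f (upd x i s).
have gd (s : R) : is_derive s (1 : R) g (dg s) by apply: is_derive_upd; exact: df.
have out s : N < `|s| -> ~ K (upd x i s).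
  move=> Ns /KN h; have := le_trans (coord_le_norm (upd x i s) i) h.
  by rewrite updE eqxx leNgt Ns.
have cdg : continuous dg by move=> s; apply: continuous_comp; [exact: upd_continuous|exact: cf].
rewrite [LHS](_ : _ = \int[lebesgue_measure]_(s in `[(- (N + 1))%R, (N + 1)%R]) (dg s)%:E)%E.
  rewrite (is_derive_FTC2 _ gd cdg); last by rewrite -subr_gt0; lra.
  have out1 : ~ K (upd x i (N + 1)) by apply: out; rewrite ger0_norm ?ltrDl// addr_ge0// ltW.
  have out2 : ~ K (upd x i (- (N + 1))) by apply: out; rewrite normrN ger0_norm ?ltrDl// addr_ge0// ltW.
  by rewrite /g !f0// -EFinB subrr.
rewrite [RHS]integral_mkcond; apply: eq_integral => s _.
rewrite patchE; case: ifPn => //; rewrite notin_setE/= in_itv/= => /negP; rewrite -ler_norml -ltNge => h.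
by rewrite pf0//; apply: out; apply: lt_trans h; rewrite ltrDl.
Unshelve. all: by end_near. Qed.

End lebesgue_Rn_ibp.

(** * Smooth bumps and one-dimensional mollifiers *)

Section smooth_bump.
Context {R : realType}.
Implicit Types (f g : R -> R) (x : R) (P : {poly R}).

Fixpoint smooth1 (k : nat) f : Prop :=
  if k is k'.+1 then exists2 f', (forall x, is_derive x (1 : R) f (f' x)) & smooth1 k' f'
  else continuous f.

Lemma smooth1_continuous k f : smooth1 k f -> continuous f.
Proof. by case: k => [//|k] [f' df _]; exact: der_continuous df. Qed.

Lemma smooth1W k f : smooth1 k.+1 f -> smooth1 k f.
Proof.
elim: k f => [|k IH] f; first by move=> [f' df _]; exact: der_continuous df.
by move=> [f' df sf']; exists f' => //; exact: IH.
Qed.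

Lemma smooth1D k f g : smooth1 k f -> smooth1 k g -> smooth1 k (fun x => f x + g x).
Proof.
elim: k f g => [|k IH] f g; first by move=> cf cg x; apply: cvgD; [exact: cf|exact: cg].
move=> [f' df sf] [g' dg sg]; exists (fun x => f' x + g' x); last exact: IH.
by move=> x; apply: is_deriveD.
Qed.

Lemma smooth1M k f g : smooth1 k f -> smooth1 k g -> smooth1 k (fun x => f x * g x).
Proof.
elim: k f g => [|k IH] f g; first by move=> cf cg x; apply: cvgM; [exact: cf|exact: cg].
move=> sf0 sg0; have [f' df sf] := sf0; have [g' dg sg] := sg0.
exists (fun x => f x * g' x + g x * f' x).
  by move=> x; apply: is_deriveM.
by apply: smooth1D; apply: IH => //; apply: smooth1W.
Qed.

Lemma smooth1_cst k (c : R) : smooth1 k (fun=> c).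
Proof.
elim: k c => [|k IH] c; first by move=> x; exact: cvg_cst.
by exists (fun=> 0); [move=> x; exact: is_derive_cst|exact: IH].
Qed.

Lemma smooth1_affine k f (a b : R) : smooth1 k f -> smooth1 k (fun x => f (a * x + b)).
Proof.
elim: k f => [|k IH] f.
  move=> cf x; apply: (continuous_comp (f := fun x => a * x + b)); last exact: cf.
  by apply: cvgD; [apply: cvgM; [exact: cvg_cst|exact: cvg_id]|exact: cvg_cst].
move=> [f' df sf']; exists (fun x => f' (a * x + b) * a).
  by move=> x; apply: (der_comp (h := f)) => //; der; lra.
by apply: smooth1M; [exact: IH|exact: smooth1_cst].
Qed.

Lemma poly_le_expR P : exists2 C : R, 0 < C & forall u, 0 <= u -> `|P.[u]| <= C * expR u.
Proof.
exists (\sum_(i < size P) `|P`_i| * i`!%:R + 1).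
  by rewrite ltr_wpDl// sumr_ge0// => i _; rewrite mulr_ge0// ler0n.
move=> u u0; rewrite mulrDl mul1r; apply: (@le_trans _ _ ((\sum_(i < size P) `|P`_i| * i`!%:R) * expR u)); last first.
  by rewrite lerDl expR_ge0.
rewrite horner_coef mulr_suml; apply: le_trans (ler_norm_sum _ _ _) _.
apply: ler_sum => i _; rewrite normrM -mulrA ler_wpM2l//.
rewrite ger0_norm ?exprn_ge0//.
case: (nat_of_ord i) => [|k]; first by rewrite expr0 mul1r -[leLHS]expR0 ler_expR.
rewrite -ler_pdivrMl ?ltr0n ?fact_gt0// mulrC.
by apply: le_trans (expR_ge1Dxn k u0); rewrite lerDr.
Qed.

(** The function $e^{-1/x}$ with a polynomial factor in $1/x$: this family is closed under
    differentiation, so smoothness at $0$ is an induction with a single limit to compute. *)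
Definition flat P x : R := if 0 < x then P.[x^-1] * expR (- x^-1) else 0.

Lemma flat_deriv P x : is_derive x (1 : R) (flat P) (flat ('X ^+ 2 * (P - P^`())) x).
Proof.
have [x0|x0|->] := ltgtP x 0.
- rewrite [flat _ x]/flat ltNge (ltW x0)/=.
  apply: (der_near _ (der_cst _ _ 0)).
  near=> y; rewrite /flat ltNge; case: ifP => //= /negP []; apply/ltW.
  by near: y; exact: lt_nbhsl.
- apply: (der_near (f := fun y : R => P.[y^-1] * expR (- y^-1))).
    near=> y; rewrite /flat ifT//; near: y; exact: lt_nbhsr.
  rewrite /flat x0.
  have xN0 : x != 0 by rewrite gt_eqF.
  have dV : is_derive x (1 : R) (fun y : R => y^-1) (- x ^- 2).
    by der; [|rewrite mulr1].
  have dP : is_derive x (1 : R) (fun y => P.[y^-1]) (P^`().[x^-1] * - x ^- 2).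
    by apply: (@is_derive1_comp _ (horner P) (fun y => y^-1)); exact: is_derive_poly.
  have dE : is_derive x (1 : R) (fun y => expR (- y^-1)) (expR (- x^-1) * x ^- 2).
    by der; rewrite opprK.
  apply: (is_derive_eq (der_M dP dE)).
  rewrite hornerM hornerXn hornerD hornerN exprVn; ring.
- rewrite [flat _ 0]/flat ltxx.
  (* With the extra factor ['X ^+ 2] the bound reads $|P(1/h)| e^{-1/h} \le C h^2$ for $h > 0$, so
     the difference quotient is at most $C |h|$. *)
  have [C C0 CP] := poly_le_expR ('X ^+ 2 * P).
  suff H : (fun h : R => h^-1 *: ((flat P \o shift (0:R)) (h *: (1:R)) - flat P 0)) h @[h --> 0^'] --> (0 : R).
    by split; [apply/cvg_ex; exists 0|exact/cvg_lim].
  have Z : C * `|h| @[h --> (0:R)^'] --> (0:R).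
    have : C * `|h| @[h --> (0:R)] --> C * `|0 : R|.
      by apply: cvgM; [exact: cvg_cst|apply: cvg_norm; exact: cvg_id].
    by rewrite normr0 mulr0 => H; exact: cvg_within_filter.
  apply: (@squeeze_cvgr _ _ _ _ (fun h : R => - (C * `|h|)) (fun h : R => C * `|h|)).
  + near=> h; rewrite -ler_norml /= addr0 [h *: 1]mulr1.
    have h0 : h != 0 by near: h; exact: nbhs_dnbhs_neq.
    rewrite /flat ltxx subr0; case: ifPn => [hp|_]; last by rewrite scaler0 normr0 mulr_ge0// ltW.
    have u0 : 0 <= h^-1 by rewrite invr_ge0 ltW.
    have := CP _ u0; rewrite !hornerE normrM => Q.
    rewrite normrM normrM (ger0_norm u0) (ger0_norm (expR_ge0 _)) (gtr0_norm hp) expRN.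
    move: Q; rewrite ger0_norm ?exprn_ge0// => Q.
    have e0 := expR_gt0 (h^-1).
    rewrite mulrA ler_pdivrMr// -(@ler_pM2l _ (h^-1)) ?invr_gt0//.
    rewrite (_ : h^-1 * (C * h * expR h^-1) = C * expR h^-1); last by field.
    by apply: le_trans Q; rewrite expr2 mulrA.
  + by rewrite -[X in _ --> X]oppr0; apply: cvgN.
  + by [].
Unshelve. all: by end_near. Qed.

Lemma flat_smooth1 k P : smooth1 k (flat P).
Proof.
elim: k P => [|k IH] P; first exact: (der_continuous (flat_deriv P)).
by exists (flat ('X ^+ 2 * (P - P^`()))); [exact: flat_deriv|exact: IH].
Qed.

Lemma flat1_gt0 x : 0 < x -> 0 < flat 1 x.
Proof. by move=> x0; rewrite /flat x0 hornerE mul1r expR_gt0. Qed.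

Lemma flat1_eq0 x : x <= 0 -> flat 1 x = 0.
Proof. by rewrite /flat leNgt => /negbTE ->. Qed.

Lemma flat1_ge0 x : 0 <= flat 1 x.
Proof. by have [/flat1_eq0 ->|/flat1_gt0/ltW] := leP x 0. Qed.

Definition bump x : R := flat 1 (1 * x + 1) * flat 1 ((-1) * x + 1).

Lemma bump_smooth1 k : smooth1 k bump.
Proof. by apply: smooth1M; apply: smooth1_affine; exact: flat_smooth1. Qed.

Lemma bump_ge0 x : 0 <= bump x. Proof. by rewrite mulr_ge0 ?flat1_ge0. Qed.

Lemma bump0_gt0 : 0 < bump 0. Proof. by rewrite mulr_gt0// flat1_gt0//; lra. Qed.

Lemma bump_eq0 x : 1 <= `|x| -> bump x = 0.
Proof.
rewrite /bump ler_normr => /orP[x1|x1].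
  by rewrite (_ : flat 1 (-1 * x + 1) = 0) ?mulr0//; apply: flat1_eq0; lra.
by rewrite (_ : flat 1 (1 * x + 1) = 0) ?mul0r//; apply: flat1_eq0; lra.
Qed.

(** Replaces derivability of every order by one sequence of successive derivatives; derivatives of
    tensor products then only shift indices in this sequence. *)
Lemma smooth1_chain f : (forall k, smooth1 k f) ->
  exists2 w : nat -> R -> R, w 0%N = f & forall j x, is_derive x (1 : R) (w j) (w j.+1 x).
Proof.
move=> sf; exists (fun j => f^`(j)%classic); first exact: derive1n0.
have H j : forall k, smooth1 k (f^`(j)%classic).
  elim: j => [|j IH] k; first exact: sf.
  have [f' df sf'] := IH k.+1; rewrite derive1nS (_ : (f^`(j)%classic)^`()%classic = f')//.
  by apply/funext => x; rewrite derive1E; have [_ ->] := df x.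
move=> j x; have [f' df _] := H j 1%N.
by rewrite derive1nS derive1E; have [d _] := df x; apply: DeriveDef.
Qed.

Lemma antideriv f : continuous f -> exists F, forall x, is_derive x (1 : R) F (f x).
Proof.
move=> cf.
pose I a x := (\int[lebesgue_measure]_(t in `[a, x]) f t)%R.
have intf a b : lebesgue_measure.-integrable `[a, b] (EFin \o f).
  by apply: continuous_compact_integrable; [exact: segment_compact|exact: continuous_subspaceT].
(* The lower limit moves with [x] so that both [x] and 0 lie above it; [FE] shows that any common
   lower limit gives the same value. *)
pose F x := I (- (`|x| + 1)) x - I (- (`|x| + 1)) 0.
have FE a x : a < x -> a < 0 -> F x = I a x - I a 0.
  suff H b c : b <= c -> c < x -> c < 0 -> I c x - I c 0 = I b x - I b 0.
    move=> ax a0; rewrite /F; have x1 : - (`|x| + 1) < x by have := ler_norm (- x); rewrite normrN; lra.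
    have x2 : - (`|x| + 1) < 0 by have := normr_ge0 x; lra.
    have [h|h] := leP a (- (`|x| + 1)); first exact: H.
    by apply/esym/H => //; exact: ltW.
  move=> bc cx c0.
  have E y : c < y -> I b y = I b c + I c y.
    move=> cy; apply/eqP; rewrite addrC -subr_eq /I; apply/eqP.
    rewrite (@Rintegral_itvB _ f (BLeft b) (BRight y) c) ?bnd_simp ?(ltW cy)//.
    rewrite Rintegral_itv_obnd_cbnd //.
    by apply: integrableS (intf c y) => //; apply: subset_itv_oc_cc.
  by rewrite (E x cx) (E 0 c0) opprD addrACA subrr add0r.
exists F => x.
pose a := - (`|x| + 1).
have ax : a < x by rewrite /a; have := ler_norm (- x); rewrite normrN; lra.
have a0 : a < 0 by rewrite /a; have := normr_ge0 x; lra.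
have x1 : x < x + 1 by rewrite ltrDl.
have [dI eI] := @continuous_FTC1 _ f (BLeft a) x (x + 1) x1 (intf a (x + 1)) ax (cf x).
apply: (der_near (f := fun y : R => I a y - I a 0)).
  near=> y; apply/esym/FE => //; near: y; exact: lt_nbhsr.
rewrite -[X in is_derive _ _ _ X]subr0; apply: is_deriveB.
by rewrite -eI derive1E; apply: DeriveDef.
Unshelve. all: by end_near. Qed.

(** The successive derivatives belong to the data. Both reflections of the kernel are normalised
    because evenness is not recorded and exchanging the order of integration transposes the
    kernel. *)
Definition mollifier1 (e : R) (w : nat -> R -> R) : Prop :=
  [/\ forall j x, is_derive x (1 : R) (w j) (w j.+1 x),
      forall j x, e <= `|x| -> w j x = 0,
      forall x, 0 <= w 0%N x
    & (forall (x N : R), (`|x| + e <= N)%R -> \int[lebesgue_measure]_(y in `[(- N)%R, N%R]) (w 0%N (x - y))%:E = 1)%E /\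
      (forall (x N : R), (`|x| + e <= N)%R -> \int[lebesgue_measure]_(y in `[(- N)%R, N%R]) (w 0%N (y - x))%:E = 1)%E].

Lemma mollifier1_exists e : 0 < e -> exists w, mollifier1 e w.
Proof.
move=> e0.
have cb : continuous bump := smooth1_continuous (bump_smooth1 0).
have [F dF] := antideriv cb.
have F1 (x y : R) : x < y -> exists2 c, c \in `]x, y[ & F y - F x = bump c * (y - x).
  move=> xy; apply: MVT => //.
  by apply: continuous_subspaceT; exact: der_continuous dF.
have Fc (x y : R) : (1 <= x /\ 1 <= y) \/ (x <= -1 /\ y <= -1) -> F x = F y.
  wlog xy : x y / x < y.
    move=> H h; have [xy|xy|->//] := ltgtP x y; first exact: H.
    by apply/esym/H => //; case: h => -[? ?]; [left|right].
  move=> h; have [c cxy] := F1 _ _ xy; rewrite bump_eq0 ?mul0r; first by move/eqP; rewrite subr_eq0 eq_sym => /eqP.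
  move: cxy; rewrite in_itv/= => /andP[c1 c2]; rewrite ler_normr; apply/orP.
  by case: h => -[h1 h2]; [left|right]; lra.
pose c := F 1 - F (-1).
(* [c] is the mass of [bump]. Were it zero, the nondecreasing [F] would be constant on $[-1,1]$ and
   its derivative [bump 0] would vanish. *)
have c0 : 0 < c.
  have Fm (x y : R) : x <= y -> F x <= F y.
    rewrite le_eqVlt => /predU1P[->//|xy]; have [d _ E] := F1 _ _ xy.
    by rewrite -subr_ge0 E mulr_ge0 ?bump_ge0// subr_ge0 ltW.
  rewrite lt_neqAle /c subr_ge0 Fm ?andbT; last lra.
  apply/eqP => E.
  have Fq x : x \in `]-1, 1[ -> F x = F (-1).
    rewrite in_itv/= => /andP[x1 x2]; apply/le_anti; rewrite (Fm _ _ (ltW x1)) andbT.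
    by have := Fm x 1 (ltW x2); move/eqP: E; rewrite eq_sym subr_eq0 => /eqP ->.
  have : is_derive 0 (1 : R) F 0.
    apply: (der_near _ (der_cst _ _ (F (-1)))).
    near=> x; rewrite Fq//; near: x; apply: near_in_itvoo; rewrite in_itv/=; lra.
  move=> [_]; have [_ ->] := dF 0 => /eqP; by rewrite gt_eqF// bump0_gt0.
have sm k : smooth1 k (fun x => (e * c)^-1 * bump (e^-1 * x + 0)).
  by apply: smooth1M; [exact: smooth1_cst|apply: smooth1_affine; exact: bump_smooth1].
have [w w0 dw] := smooth1_chain sm.
have ec0 : 0 < (e * c)^-1 by rewrite invr_gt0 mulr_gt0.
have W0 x : e <= `|x| -> w 0%N x = 0.
  move=> ex; rewrite w0 bump_eq0 ?mulr0// addr0 normrM gtr0_norm ?invr_gt0//.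
  by rewrite mulrC ler_pdivlMr// mul1r.
have dG (x y : R) (sg : R) : sg ^+ 2 = 1 ->
   is_derive y (1 : R) (fun y => sg * c^-1 * F (e^-1 * (sg * (y - x)))) (w 0%N (sg * (y - x))).
  move=> sg1; rewrite w0/= addr0.
  have d1 : is_derive y (1 : R) (fun y : R => e^-1 * (sg * (y - x))) (e^-1 * sg).
    by der; ring.
  have d2 := der_comp (g := fun y : R => e^-1 * (sg * (y - x))) (dF (e^-1 * (sg * (y - x)))) d1.
  der; rewrite invfM mul0r add0r.
  transitivity (sg ^+ 2 * (e^-1 * c^-1 * bump (e^-1 * (sg * (y - x))))); first ring.
  by rewrite sg1 mul1r.
have cw j : continuous (w j) := der_continuous (dw j).
have intw (x N sg : R) : sg ^+ 2 = 1 -> `|x| + e <= N ->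
   (\int[lebesgue_measure]_(y in `[(- N)%R, N]) (w 0%N (sg * (y - x)))%:E = 1)%E.
  move=> sg1 xN.
  have sgE : sg = 1 \/ sg = -1 by have /eqP := sg1; rewrite sqrf_eq1 => /orP[]/eqP ->; [left|right].
  have NN : - N < N by have := normr_ge0 x; lra.
  have xN1 := ler_norm x. have := ler_norm (- x); rewrite normrN => xN2.
  rewrite (@continuous_FTC2 _ _ (fun y => sg * c^-1 * F (e^-1 * (sg * (y - x)))) _ _ NN).
  + rewrite -EFinB -mulrBr; congr EFin.
    have A1 : 1 <= e^-1 * (N - x) by rewrite mulrC ler_pdivlMr//; lra.
    have A2 : e^-1 * (- N - x) <= -1 by rewrite mulrC ler_pdivrMr//; lra.
    case: sgE => ->.
      rewrite !mul1r (Fc _ 1) ?(Fc (e^-1 * (- N - x)) (-1)) -/c ?mulVf ?gt_eqF//; [by right|by left].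
    rewrite !mulN1r !mulrN (Fc (- _) (-1)) ?(Fc (- (e^-1 * (- N - x))) 1); first by rewrite mulNr -mulrN opprB -/c mulVf ?gt_eqF.
      by left; lra.
    by right; lra.
  + apply: continuous_subspaceT => y.
    apply: (continuous_comp (f := fun y => sg * (y - x))); last exact: cw.
    by apply: cvgM; [exact: cvg_cst|apply: cvgB; [exact: cvg_id|exact: cvg_cst]].
  + have cG := der_continuous (fun y => dG x y sg sg1).
    split; first by move=> s _; have [] := dG x s sg sg1.
      by apply: cvg_at_right_filter; exact: cG.
    by apply: cvg_at_left_filter; exact: cG.
  + by move=> s _; rewrite derive1E; have [] := dG x s sg sg1.
exists w; split => //.
- elim => [|j IH] x ex; first exact: W0.
  have H y : e < `|y| -> w j.+1 y = 0.
    move=> ey; have [_ <-] := dw j y.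
    rewrite (@near_eq_derive _ _ _ _ (cst 0)) ?derive_cst//.
    near=> z; apply: IH; apply/ltW; near: z.
    by apply: (cvgr_gt `|y|) => //; exact: norm_continuous.
  have [/H//|] := ltP e `|x|; move=> xe; have {ex xe}xe : `|x| = e by apply/eqP; rewrite eq_le ex xe.
  (* At $|x| = e$ the value is a limit from outside, along the points $x + x t$ with $t > 0$. *)
  apply: (@cvg_unique _ (@Rhausdorff R) (w j.+1 (x + x * t) @[t --> 0^'+])).
    apply: cvg_at_right_filter; rewrite -[X in _ --> w _ X](_ : x + x * 0 = x); last by rewrite mulr0 addr0.
    apply: (continuous_comp (f := fun t => x + x * t)); last exact: cw.
    by apply: cvgD; [exact: cvg_cst|apply: cvgM; [exact: cvg_cst|exact: cvg_id]].
  apply: cvg_near_cst.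
  near=> t; have t0 : 0 < t by [].
  rewrite H// -{1}[x]mulr1 -mulrDr normrM xe gtr0_norm; last lra.
  by rewrite ltr_pMr//; lra.
- by move=> x; rewrite w0 mulr_ge0 ?bump_ge0// ltW.
- split => x N xN; last by rewrite -(intw x N 1)//; [apply: eq_integral => y _; rewrite mul1r|rewrite expr1n].
  rewrite -(intw x N (-1))//; last by rewrite sqrrN expr1n.
  by apply: eq_integral => y _; rewrite mulN1r opprB.
Unshelve. all: by end_near. Qed.

End smooth_bump.

(** * Convolution with tensor-product mollifiers *)

Section convolution.
Context {R : realType} {n : nat}.
Local Notation V := 'rV[R]_n.
Local Notation mu := (@lebesgue_Rn R n).
Implicit Types (a f phi psi : V -> R) (x y : V).

(** The second point is not confined to [K], so the modulus also controls values just outside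
    [K]. *)
Lemma compact_unif_cont f (K : set V) : compact K -> (forall x, K x -> {for x, continuous f}) ->
  forall e : R, 0 < e -> exists2 d : R, 0 < d & forall x y, K x -> `|x - y| < d -> `|f x - f y| < e.
Proof.
move=> /compact_near_coveringP cK cf e e0.
pose P (d : R) (x : V) := forall y, `|x - y| < d -> `|f x - f y| < e.
have /(cK _ (0^'+) P) : forall x, K x -> \forall x' \near x & d \near 0^'+, P d x'.
  move=> x Kx; have e20 : 0 < e / 2 by rewrite divr_gt0.
  have /cvgrPdist_lt/(_ _ e20)/nbhs_ballP[d /= d0 dP] := cf x Kx.
  exists (ball x (d / 2), [set t : R | t < d / 2]) => /=.
    split; first by apply: nbhsx_ballx; rewrite divr_gt0.
    by apply: nbhs_right_lt; rewrite divr_gt0.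
  move=> [x' t] /= [xx' td] y x'y; rewrite (splitr e) -(subrK (f x) (f x')) -addrA.
  apply: le_lt_trans (ler_normD _ _) _; apply: ltrD.
    rewrite distrC; apply: dP; rewrite -ball_normE/= in xx' *.
    by apply: lt_trans xx' _; rewrite ltr_pdivrMr// ltr_pMr// ltr1n.
  apply: dP; rewrite -ball_normE/= in xx' *.
  rewrite (splitr d) -(subrK x' x) -addrA; apply: le_lt_trans (ler_normD _ _) _; apply: ltrD => //.
  exact: lt_trans td.
move=> H.
near (0:R)^'+ => d; exists d => //.
by move=> x y Kx; apply: (near H d) => //.
Unshelve. all: by end_near. Qed.

Definition ccs f := continuous f /\ exists M : R, forall x, M < `|x| -> f x = 0.

Lemma ccs_K f : ccs f -> exists K, compact K /\ forall x, ~ K x -> f x = 0.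
Proof.
move=> [cf [M fM]]; exists [set x | `|x| <= M]; split.
  apply: bounded_closed_compact.
    by exists M; split => [|N MN x /= xM]; [exact: num_real|apply: le_trans xM (ltW MN)].
  rewrite (_ : [set x | _] = (fun x : V => `|x|) @^-1` [set y : R | y <= M])//.
  by apply: preimage_closed => [x _|]; [exact: norm_continuous|exact: closed_le].
by move=> x /= /negP; rewrite -ltNge; exact: fM.
Qed.

Lemma K_ccs f K : continuous f -> compact K -> (forall x, ~ K x -> f x = 0) -> ccs f.
Proof.
move=> cf cK f0; split => //; have [M [M0 KM]] := compact_norm_bound cK.
by exists M => x Mx; apply: f0 => /KM; apply/negP; rewrite -ltNge.
Qed.

Lemma ccs_bcs f : ccs f -> bcs f.
Proof. by move=> cf; have [K [cK f0]] := ccs_K cf; exact: (continuous_bcs cf.1 cK f0). Qed.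

Lemma ccs_bound f : ccs f -> exists2 C : R, 0 < C & forall x, `|f x| <= C.
Proof.
move=> cf; have [K [cK f0]] := ccs_K cf; have [C [C0 fC]] := compact_nz_bounded cf.1 cK.
by exists C => // x; have [/fC//|/f0 ->] := pselect (K x); rewrite normr0 ltW.
Qed.

Lemma ccs_unif f : ccs f -> forall e : R, 0 < e ->
  exists2 d : R, 0 < d & forall x y, `|x - y| < d -> `|f x - f y| < e.
Proof.
move=> cf e e0; have [K [cK f0]] := ccs_K cf.
have [d d0 dP] := compact_unif_cont cK (fun x _ => cf.1 x) e0.
exists d => // x y xy; have [/dP|nx] := pselect (K x); first exact.
have [Ky|/f0 ->] := pselect (K y); first by rewrite distrC; apply: dP; rewrite // distrC.
by rewrite f0// subrr normr0.
Qed.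

Lemma continuous_sum (I : Type) (r : seq I) (F : I -> V -> R) :
  (forall i, continuous (F i)) -> continuous (fun x => \sum_(i <- r) F i x).
Proof.
move=> cF; elim: r => [|i r IH].
  by under eq_fun do rewrite big_nil; move=> x; exact: cst_continuous.
by under eq_fun do rewrite big_cons; move=> x; apply: continuousD; [exact: cF|exact: IH].
Qed.

Lemma continuous_prod (I : Type) (r : seq I) (F : I -> V -> R) :
  (forall i, continuous (F i)) -> continuous (fun x => \prod_(i <- r) F i x).
Proof.
move=> cF; elim: r => [|i r IH].
  by under eq_fun do rewrite big_nil; move=> x; exact: cst_continuous.
by under eq_fun do rewrite big_cons; move=> x; apply: continuousM; [exact: cF|exact: IH].
Qed.

Definition conv a phi x : R := \int[mu]_y (a y * phi (x - y)).

Lemma rev_measurable phi x : continuous phi ->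
  measurable_fun [set: borelRn n] (fun y : borelRn n => phi (x - (y : V)) : R).
Proof.
move=> cphi; apply: (continuous_measurable_Rn (f := fun y : V => phi (x - y))).
suff H (y : V) : phi (x - z) @[z --> y] --> phi (x - y) by move=> y; exact: H.
apply: (continuous_comp (f := fun y : V => x - y)); last exact: cphi.
exact: cont_subl.
Qed.

Lemma integrable_Mbounded a (g : V -> R) (C : R) : mu.-integrable setT (EFin \o a) ->
  measurable_fun [set: borelRn n] (g : borelRn n -> R) -> (forall y, `|g y| <= C) ->
  mu.-integrable setT (EFin \o (fun y => a y * g y)).
Proof.
move=> ia mg gC.
have ma : measurable_fun [set: borelRn n] (a : borelRn n -> R).
  by have /integrableP[/measurable_EFinP] := ia.
apply: (@le_integrable _ _ _ _ _ _ _ (fun y : borelRn n => (C * a y)%:E)) => //.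
- by apply/measurable_EFinP; exact: measurable_funM.
- move=> y _ /=; rewrite lee_fin !normrM mulrC ler_wpM2r//.
  by apply: le_trans (ler_norm _).
by under eq_fun do rewrite EFinM; exact: integrableZl.
Qed.

Lemma conv_integrable a phi x : mu.-integrable setT (EFin \o a) -> ccs phi ->
  mu.-integrable setT (EFin \o (fun y => a y * phi (x - y))).
Proof.
move=> ia cphi; have [C _ phiC] := ccs_bound cphi.
apply: (integrable_Mbounded (C := C)) => //; exact: rev_measurable cphi.1.
Qed.

Lemma integrable_norm a : mu.-integrable setT (EFin \o a) ->
  mu.-integrable setT (EFin \o (fun y => `|a y|)).
Proof. by move=> ia; apply: (integrable_norm ia). Qed.

Lemma conv_continuous a phi : mu.-integrable setT (EFin \o a) -> ccs phi ->
  continuous (conv a phi).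
Proof.
move=> ia cphi; suff H (x : V) : {for x, continuous (conv a phi)} by move=> x; exact: H.
apply/cont_distP => e2 e20; pose e := e2 / 2; have e0 : 0 < e by rewrite divr_gt0.
pose A := \int[mu]_y `|a y|.
have A0 : 0 <= A by apply: Rintegral_ge0.
have [d d0 dP] := ccs_unif cphi (divr_gt0 e0 (ltr_wpDl A0 ltr01)).
exists d => // z xz.
apply: le_lt_trans (_ : e < e2); last by rewrite ltr_pdivrMr// ltr_pMr// ltr1n.
rewrite /conv -RintegralB//; [|exact: conv_integrable|exact: conv_integrable].
under eq_Rintegral do rewrite -mulrBr.
have ii : mu.-integrable setT (EFin \o (fun y => a y * (phi (x - y) - phi (z - y)))).
  rewrite (_ : EFin \o _ = fun y => ((a y * phi (x - y))%:E - (a y * phi (z - y))%:E)%E); last first.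
    by apply/funext => y /=; rewrite -EFinB mulrBr.
  by apply: integrableB => //; exact: conv_integrable.
apply: le_trans (le_normr_Rintegral _ ii) _ => //.
apply: (@le_trans _ _ (\int[mu]_y (`|a y| * (e / (A + 1))))).
  apply: le_Rintegral => //; first exact: integrable_norm.
    rewrite (_ : EFin \o _ = fun y => (e / (A + 1))%:E * (`|a y|)%:E)%E; last first.
      by apply/funext => y /=; rewrite mulrC EFinM.
    by apply: integrableZl => //; exact: integrable_norm.
  move=> y _; rewrite normrM ler_wpM2l//; apply/ltW/dP.
  by rewrite opprB addrA subrK.
rewrite RintegralZr//; last exact: integrable_norm.
by rewrite mulrA ler_pdivrMr ?ltr_wpDl// mulrC ler_wpM2l ?(ltW e0)// lerDl.
Qed.

(** The derivative falls on the bounded kernel, and differentiation under the integral is dominated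
    by a multiple of $|a|$. *)
Lemma conv_partial a phi psi (i : 'I_n) x : mu.-integrable setT (EFin \o a) ->
  ccs phi -> ccs psi -> (forall y, is_derive y (delta_mx ord0 i) phi (psi y)) ->
  is_derive x (delta_mx ord0 i) (conv a phi) (conv a psi x).
Proof.
move=> ia cphi cpsi dphi; set v : V := delta_mx ord0 i.
pose f (s : R) y := a y * phi (x + s *: v - y).
have df s y : is_derive s (1 : R) (f^~ y) (a y * psi (x + s *: v - y)).
  have d1 : is_derive s (1 : R) (fun s : R => phi ((x - y) + s *: v)) (psi ((x - y) + s *: v)).
    by apply/(der_line phi (x - y) v _ s); exact: dphi.
  rewrite /f (_ : (fun s0 : R => _) = (fun s => a y * phi (x - y + s *: v))).
    by rewrite addrAC; der; rewrite mul0r add0r.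
  by apply/funext => t; rewrite addrAC.
have [C C0 psiC] := ccs_bound cpsi.
have dE s y : partial1of2 f s y = a y * psi (x + s *: v - y).
  by rewrite partial1of2E; have [_ ->] := df s y.
have H0 : (0 : R) \in `]-1, 1[ by rewrite in_itv/=; lra.
have If (s : R) : `]-1, 1[%classic s -> mu.-integrable [set: borelRn n] (EFin \o f s).
  by move=> _; exact: conv_integrable.
have Df (s : R) y : `]-1, 1[%classic s -> [set: borelRn n] y -> derivable (f^~ y) s 1.
  by move=> _ _; have [] := df s y.
have G0 y : 0 <= `|a y| * C by rewrite mulr_ge0// ltW.
have iG : mu.-integrable [set: borelRn n] (EFin \o (fun y => `|a y| * C)).
  rewrite (_ : EFin \o _ = fun y => C%:E * (`|a y|)%:E)%E; last first.
    by apply/funext => y /=; rewrite mulrC EFinM.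
  by apply: integrableZl => //; exact: integrable_norm.
have Gb (s : R) y : `]-1, 1[%classic s -> [set: borelRn n] y -> `|partial1of2 f s y| <= `|a y| * C.
  by move=> _ _; rewrite dE normrM ler_wpM2l.
have E := @differentiation_under_integral R _ _ mu f setT measurableT 0 (-1) 1 H0 If Df _ G0 iG Gb.
have D := @derivable_under_integral R _ _ mu f setT measurableT 0 (-1) 1 H0 If Df _ G0 iG Gb.
have DD : is_derive (0 : R) (1 : R) (fun s : R => conv a phi (x + s *: v)) (conv a psi (x + 0 *: v)).
  apply: DeriveDef => //.
  rewrite -derive1E [LHS]E; apply: eq_Rintegral => y _; exact: dE.
by have /der_line := DD; rewrite scale0r addr0.
Qed.

Section mollifier.
Variables (w : nat -> R -> R) (e : R).
Hypotheses (e0 : 0 < e) (mw : mollifier1 e w).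

(** [k] is a multi-index of derivatives of the one-dimensional kernel. A partial derivative raises
    one entry, so all orders are treated by one induction over this family. *)
Definition pmol (k : 'I_n -> nat) x : R := \prod_(i < n) w (k i) (x ord0 i).

Definition incr (k : 'I_n -> nat) (i : 'I_n) : 'I_n -> nat := fun j => (k j + (j == i))%N.

Let dw j t : is_derive t (1 : R) (w j) (w j.+1 t). Proof. by case: mw. Qed.
Let w0 j t : e <= `|t| -> w j t = 0. Proof. by case: mw => _ + _ _; exact. Qed.
Let cw j : continuous (w j). Proof. exact: der_continuous (dw j). Qed.

Lemma pmol_partial k i x : is_derive x (delta_mx ord0 i) (pmol k) (pmol (incr k i) x).
Proof.
pose c := \prod_(j < n | j != i) w (k j) (x ord0 j).
have E (t : R) : pmol k (x + t *: delta_mx ord0 i) = w (k i) (x ord0 i + t) * c.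
  rewrite /pmol (bigD1 i)//= !mxE !eqxx mulr1; congr (_ * _).
  by apply: eq_bigr => j ji; rewrite !mxE (negbTE ji) andbF mulr0 addr0.
have E' : pmol (incr k i) x = w (k i).+1 (x ord0 i) * c.
  rewrite /pmol (bigD1 i)//= /incr eqxx addn1; congr (_ * _).
  by apply: eq_bigr => j ji; rewrite (negbTE ji) addn0.
have D : is_derive (0 : R) (1 : R) (fun t : R => pmol k (x + t *: delta_mx ord0 i)) (pmol (incr k i) x).
  under eq_fun do rewrite E.
  have d1 : is_derive (0 : R) (1 : R) (fun t : R => w (k i) (x ord0 i + t)) (w (k i).+1 (x ord0 i) * 1).
    apply: (der_comp (g := fun t : R => x ord0 i + t)); first by rewrite addr0.
    by der; rewrite add0r.
  by rewrite E'; der; rewrite mulr1 mulr0 addr0.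
by have /der_line := D; rewrite scale0r addr0.
Qed.

Lemma pmol_supp k x : e <= `|x| -> pmol k x = 0.
Proof.
move=> ex.
have [i ei] : exists i, e <= `|x ord0 i|.
  apply/not_existsP => H; move: ex; rewrite leNgt => /negP; apply.
  rewrite [`|x|]mx_normrE; apply/bigmax_ltP; split => // -[i j] _ /=.
  by rewrite ord1 ltNge; apply/negP; exact: H.
by rewrite /pmol (bigD1 i)//= w0// mul0r.
Qed.

Lemma pmol_continuous k : continuous (pmol k).
Proof.
apply: continuous_prod => i x.
by apply: (continuous_comp (f := fun x : V => x ord0 i)); [exact: coord_continuous|exact: cw].
Qed.

Lemma pmol_ccs k : ccs (pmol k).
Proof. by split; [exact: pmol_continuous|exists e => x /ltW; exact: pmol_supp]. Qed.

Lemma pmol_ge0 x : 0 <= pmol (fun=> 0%N) x.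
Proof. by apply: prodr_ge0 => i _; case: mw => _ _ + _; exact. Qed.

Lemma conv_Ck a m k : mu.-integrable setT (EFin \o a) -> Ck m (conv a (pmol k)).
Proof.
move=> ia; elim: m k => [|m IH] k; first by split => //; exact: conv_continuous ia (pmol_ccs k).
split; first exact: conv_continuous ia (pmol_ccs k).
move=> i.
have D x := conv_partial x ia (pmol_ccs k) (pmol_ccs (incr k i)) (pmol_partial k i).
split; first by move=> x; have [] := D x.
rewrite (_ : partial i _ = conv a (pmol (incr k i))); first exact: IH.
by apply/funext => x; rewrite /partial; have [_ ->] := D x.
Qed.

Lemma conv_smooth a k : mu.-integrable setT (EFin \o a) -> smooth (conv a (pmol k)).
Proof. by move=> ia m; exact: conv_Ck. Qed.

Lemma conv_supp a (K : set V) k x : (forall y, ~ K y -> a y = 0) ->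
  (forall y, K y -> e <= `|x - y|) -> conv a (pmol k) x = 0.
Proof.
move=> a0 xK; rewrite /conv (_ : (fun _ => _) = cst 0) ?Rintegral_cst ?mul0r//.
apply/funext => y /=; have [Ky|Ky] := pselect (K y); last by rewrite a0// mul0r.
by rewrite pmol_supp ?mulr0//; exact: xK.
Qed.

End mollifier.
End convolution.

Import HBSimple HBNNSimple.

(** * Density of compactly supported continuous functions in $L^1$ *)

Section L1_density.
Context {R : realType} {n : nat}.
Local Notation V := 'rV[R]_n.
Local Notation mu := (@lebesgue_Rn R n).
Implicit Types (a f g phi psi : V -> R) (x y : V) (O E : set V).

(** Distance to the complement of [O], capped at 1 so that it is finite also when [O] is the whole
    space. *)
Definition inner_radius O x : R := sup [set r : R | 0 <= r <= 1 /\ forall y, `|x - y| < r -> O y].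

Let S O x := [set r : R | 0 <= r <= 1 /\ forall y, `|x - y| < r -> O y].

Let S0 O x : S O x 0.
Proof. by split; [rewrite lexx ler01|move=> y; rewrite ltNge normr_ge0]. Qed.

Let hsS O x : has_sup (S O x).
Proof. by split; [exists 0; exact: S0|exists 1 => r [/andP[]]]. Qed.

Lemma inner_radius_ge0 O x : 0 <= inner_radius O x.
Proof. by apply: ub_le_sup; [exact: (hsS O x).2|exact: S0]. Qed.

Lemma inner_radius_lip O x y : `|inner_radius O x - inner_radius O y| <= `|x - y|.
Proof.
suff H u v : inner_radius O u <= inner_radius O v + `|u - v|.
  rewrite ler_norml; apply/andP; split; last by rewrite lerBlDl; exact: H.
  by rewrite lerNl opprB lerBlDl distrC; exact: H.
apply: ge_sup; first by exists 0; exact: S0.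
move=> r [/andP[r0 r1] rO]; have [ruv|ruv] := leP r `|u - v|.
  by apply: le_trans ruv _; rewrite lerDr inner_radius_ge0.
rewrite -lerBlDr; apply: ub_le_sup; first exact: (hsS O v).2.
split; first by rewrite subr_ge0 (ltW ruv)/= lerBlDr (le_trans r1)// lerDl.
move=> z vy; apply: rO; rewrite -(subrK v u) -addrA; apply: le_lt_trans (ler_normD _ _) _.
by move: vy; rewrite ltrBrDl.
Qed.

Lemma inner_radius_continuous O : continuous (inner_radius O).
Proof.
suff H (x : V) : {for x, continuous (inner_radius O)} by move=> x; exact: H.
apply/cont_distP => e e0; exists e => // y; exact: le_lt_trans (inner_radius_lip _ _ _).
Qed.

Lemma inner_radius_out O x : ~ O x -> inner_radius O x = 0.
Proof.
move=> nO; apply/eqP; rewrite eq_le inner_radius_ge0 andbT.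
apply: ge_sup; first by exists 0; exact: S0.
move=> r [_ rO]; rewrite leNgt; apply/negP => r0; apply: nO; apply: rO.
by rewrite subrr normr0.
Qed.

Lemma inner_radius_gt0 O x : open O -> O x -> 0 < inner_radius O x.
Proof.
move=> oO Ox; have /nbhs_ballP[e /= e0 eO] : nbhs x O by exact: open_nbhs_nbhs.
have m0 : 0 < Num.min e 1 by rewrite lt_min e0 ltr01.
apply: lt_le_trans m0 _; apply: ub_le_sup; first exact: (hsS O x).2.
split; first by rewrite ge_min lexx orbT andbT le_min (ltW e0) ler01.
by move=> y; rewrite lt_min => /andP[xy _]; apply: eO; rewrite -ball_normE.
Qed.

Definition plateau O (j : nat) x : R := Num.min 1 (j%:R * inner_radius O x).

Lemma plateau_continuous O j : continuous (plateau O j).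
Proof.
suff H (x : V) : {for x, continuous (plateau O j)} by move=> x; exact: H.
apply: (@continuous_min R V (fun=> 1) (fun x => j%:R * inner_radius O x) x); first exact: cst_continuous.
by apply: continuousM; [exact: cst_continuous|exact: inner_radius_continuous].
Qed.

Lemma plateau_itv O j x : 0 <= plateau O j x <= 1.
Proof.
by rewrite ge_min lexx andbT le_min ler01/= mulr_ge0// inner_radius_ge0.
Qed.

Lemma plateau_out O j x : ~ O x -> plateau O j x = 0.
Proof. by move=> nO; rewrite /plateau inner_radius_out// mulr0; apply/min_idPr; exact: ler01. Qed.

Lemma plateau_cvg O x : open O -> plateau O j x @[j --> \oo] --> (\1_O x : R).
Proof.
move=> oO; rewrite indicE; have [Ox|nOx] := pselect (O x); last first.
  rewrite memNset//=; apply: cvg_near_cst; near=> j; exact: plateau_out.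
rewrite mem_set//=; apply: cvg_near_cst; have d0 := inner_radius_gt0 oO Ox.
near=> j; apply/min_idPl; rewrite -ler_pdivrMr// div1r.
by near: j; exact: nbhs_infty_ger.
Unshelve. all: by end_near. Qed.

Definition apx f := forall e : R, 0 < e -> exists2 phi, ccs phi & (\int[mu]_x (`|f x - phi x|)%:E <= e%:E)%E.

Definition bounded_support f := exists M : R, forall x, M < `|x| -> f x = 0.

Lemma ccs_integrable phi : ccs phi -> mu.-integrable setT (EFin \o phi).
Proof. by move=> /ccs_bcs /bcs_integrable. Qed.

Lemma integrableZ f (c : R) : mu.-integrable setT (EFin \o f) -> mu.-integrable setT (EFin \o (fun x => c * f x)).
Proof.
move=> intf; rewrite (_ : EFin \o _ = fun x => (c%:E * (f x)%:E)%E); first exact: integrableZl.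
by apply/funext => x /=; rewrite EFinM.
Qed.

Lemma integrableDr f g : mu.-integrable setT (EFin \o f) -> mu.-integrable setT (EFin \o g) ->
  mu.-integrable setT (EFin \o (fun x => f x + g x)).
Proof.
move=> intf intg; rewrite (_ : EFin \o _ = fun x => ((f x)%:E + (g x)%:E)%E); first exact: integrableD.
by apply/funext => x /=; rewrite EFinD.
Qed.

Lemma integrable_mfun f : mu.-integrable setT (EFin \o f) -> measurable_fun [set: borelRn n] (f : borelRn n -> R).
Proof. by move=> /integrableP[/measurable_EFinP]. Qed.

Lemma L1_triangle f g h : measurable_fun [set: borelRn n] (f : borelRn n -> R) ->
  measurable_fun [set: borelRn n] (g : borelRn n -> R) -> measurable_fun [set: borelRn n] (h : borelRn n -> R) ->
  (\int[mu]_x (`|f x - h x|)%:E <= \int[mu]_x (`|f x - g x|)%:E + \int[mu]_x (`|g x - h x|)%:E)%E.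
Proof.
move=> mf mg mh.
have m (u v : V -> R) : measurable_fun [set: borelRn n] (u : borelRn n -> R) -> measurable_fun [set: borelRn n] (v : borelRn n -> R) ->
   measurable_fun [set: borelRn n] (fun x : borelRn n => (`|u x - v x|)%:E).
  by move=> mu1 mv; apply/measurable_EFinP; apply: measurableT_comp => //; exact: measurable_funB.
rewrite -ge0_integralD//; [|exact: m|exact: m].
apply: ge0_le_integral => //.
- exact: m.
- by apply: emeasurable_funD; exact: m.
by move=> x _; rewrite -EFinD lee_fin; exact: ler_distD.
Qed.

Lemma ccsD phi psi : ccs phi -> ccs psi -> ccs (fun x => phi x + psi x).
Proof.
move=> [cp [M pM]] [cs [N sN]]; split.
  by move=> x; apply: continuousD; [exact: cp|exact: cs].
exists (Num.max M N) => x; rewrite gt_max => /andP[? ?]; by rewrite pM// sN// addr0.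
Qed.

Lemma ccsM phi f : ccs phi -> continuous f -> ccs (fun x => f x * phi x).
Proof.
move=> [cp [M pM]] cf; split.
  by move=> x; apply: continuousM; [exact: cf|exact: cp].
by exists M => x xM; rewrite pM// mulr0.
Qed.

Lemma ccsZ phi (c : R) : ccs phi -> ccs (fun x => c * phi x).
Proof. by move=> cp; apply: (@ccsM _ (fun=> c)) => //; exact: cst_continuous. Qed.

Lemma apxD f g : mu.-integrable setT (EFin \o f) -> mu.-integrable setT (EFin \o g) ->
  apx f -> apx g -> apx (fun x => f x + g x).
Proof.
move=> intf intg af ag e e0; have e20 : 0 < e / 2 by rewrite divr_gt0.
have [phi cphi fphi] := af _ e20; have [psi cpsi gpsi] := ag _ e20.
exists (fun x => phi x + psi x); first exact: ccsD.
have mf := integrable_mfun intf; have mg := integrable_mfun intg.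
have mp := integrable_mfun (ccs_integrable cphi); have mq := integrable_mfun (ccs_integrable cpsi).
rewrite (splitr e) EFinD; apply: le_trans (leeD fphi gpsi).
have m (u v : V -> R) : measurable_fun [set: borelRn n] (u : borelRn n -> R) -> measurable_fun [set: borelRn n] (v : borelRn n -> R) ->
   measurable_fun [set: borelRn n] (fun x : borelRn n => (`|u x - v x|)%:E).
  by move=> mu1 mv; apply/measurable_EFinP; apply: measurableT_comp => //; exact: measurable_funB.
rewrite -ge0_integralD//; [|exact: m|exact: m].
apply: ge0_le_integral => //.
- by apply: m; exact: measurable_funD.
- by apply: emeasurable_funD; exact: m.
by move=> x _; rewrite -EFinD lee_fin opprD addrACA; exact: ler_normD.
Qed.

Lemma apxZ f (c : R) : mu.-integrable setT (EFin \o f) -> apx f -> apx (fun x => c * f x).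
Proof.
move=> intf af e e0; have c1 : 0 < `|c| + 1 by rewrite ltr_wpDl.
have [phi cphi fphi] := af _ (divr_gt0 e0 c1).
exists (fun x => c * phi x); first exact: ccsZ.
have m : measurable_fun [set: borelRn n] (fun x : borelRn n => (`|f x - phi x|)%:E).
  apply/measurable_EFinP; apply: measurableT_comp => //; apply: measurable_funB.
    exact: integrable_mfun.
  exact: integrable_mfun (ccs_integrable cphi).
rewrite (_ : (fun x => _) = fun x => (`|c|%:E * (`|f x - phi x|)%:E)%E); last first.
  by apply/funext => x; rewrite -mulrBr normrM EFinM.
rewrite ge0_integralZl//; apply: le_trans (lee_pmul _ _ (lexx _) fphi) _ => //.
  by apply: integral_ge0.
rewrite -EFinM lee_fin mulrCA ger_pMr// ler_pdivrMr// mul1r lerDl //.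
Qed.

Lemma apx_lim f : mu.-integrable setT (EFin \o f) ->
  (forall e : R, 0 < e -> exists g, [/\ mu.-integrable setT (EFin \o g), apx g & (\int[mu]_x (`|f x - g x|)%:E <= e%:E)%E]) ->
  apx f.
Proof.
move=> intf H e e0; have e20 : 0 < e / 2 by rewrite divr_gt0.
have [g [ig ag fg]] := H _ e20; have [phi cphi gphi] := ag _ e20.
exists phi => //; apply: le_trans (L1_triangle (g := g) _ _ _) _; try exact: integrable_mfun.
  exact: integrable_mfun (ccs_integrable cphi).
by rewrite (splitr e) EFinD; exact: leeD.
Qed.

Definition obox (M : R) : set V := [set x | `|x| < M].

Lemma obox_open M : open (obox M).
Proof.
rewrite (_ : obox M = (fun x : V => `|x|) @^-1` [set y | y < M])//.
by apply: open_comp => [x _|]; [exact: norm_continuous|exact: open_lt].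
Qed.

Lemma obox_measurable M : measurable (obox M : set (borelRn n)).
Proof. by apply: open_measurable_Rn; exact: obox_open. Qed.

Lemma obox_fin M : (mu (obox M) < +oo)%E.
Proof.
apply: le_lt_trans (Rn_box_fin M); apply: le_measure; rewrite ?inE.
- exact: obox_measurable.
- exact: Rn_measurable_box.
by move=> x /= /ltW.
Qed.

Lemma integrable_indic_obox E M : measurable (E : set (borelRn n)) ->
  mu.-integrable setT (EFin \o (\1_(E `&` obox M) : V -> R)).
Proof.
move=> mE; apply/integrableP; split.
  apply/measurable_EFinP/measurable_indic; apply: measurableI => //.
  exact: obox_measurable.
under eq_integral do rewrite gee0_abs ?lee_fin//.
rewrite integral_indic ?setIT//; last by apply: measurableI => //; exact: obox_measurable.
apply: le_lt_trans (obox_fin M); apply: le_measure; rewrite ?inE.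
- by apply: measurableI => //; exact: obox_measurable.
- exact: obox_measurable.
exact: subIsetr.
Qed.

Lemma L1_seq_limit (f : V -> R) (h : nat -> V -> R) (G : V -> R) :
  (forall k, measurable_fun [set: borelRn n] (h k : borelRn n -> R)) ->
  measurable_fun [set: borelRn n] (f : borelRn n -> R) ->
  (forall x, h k x @[k --> \oo] --> f x) ->
  mu.-integrable setT (EFin \o G) -> (forall k x, `|h k x| <= G x) ->
  forall e : R, 0 < e -> exists k, (\int[mu]_x (`|f x - h k x|)%:E <= e%:E)%E.
Proof.
move=> mh mf cvg iG hG e e0.
have c x : (h k x)%:E @[k --> \oo] --> (f x)%:E.
  by apply/fine_cvgP; split; [exact: nearW|exact: cvg].
have mh' k : measurable_fun [set: borelRn n] (fun x : borelRn n => (h k x)%:E) by apply/measurable_EFinP.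
have mf' : measurable_fun [set: borelRn n] (fun x : borelRn n => (f x)%:E) by apply/measurable_EFinP.
have ae1 : {ae mu, forall x : borelRn n, [set: borelRn n] x -> (h k x)%:E @[k --> \oo] --> (f x)%:E}.
  by apply: aeW => x _; exact: c.
have ae2 : {ae mu, forall (x : borelRn n) k, [set: borelRn n] x -> (`|(h k x)%:E| <= (G x)%:E)%E}.
  by apply: aeW => x k _; rewrite lee_fin.
have [_ H _] := @dominated_convergence _ (borelRn n) R mu setT measurableT (fun k (x : borelRn n) => (h k x)%:E)
  (fun x : borelRn n => (f x)%:E) (fun x : borelRn n => (G x)%:E) mh' mf' ae1 iG ae2.
have /fine_cvgP[fin /cvgrPdist_le/(_ _ e0)] := H; move=> /(filterI fin)[k _ kP].
exists k; have [kfin] := kP k (leqnn k); rewrite sub0r normrN => kle.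
under eq_integral do rewrite distrC.
rewrite /= in kfin kle; rewrite -(fineK kfin) lee_fin; apply: le_trans kle; exact: ler_norm.
Qed.

Lemma apx_open O M : open O -> apx (\1_(O `&` obox M)).
Proof.
move=> oO e e0.
have oP : open (O `&` obox M) by apply: openI => //; exact: obox_open.
have [] := @L1_seq_limit (\1_(O `&` obox M)) (plateau (O `&` obox M)) (\1_(setT `&` obox M)) _ _ _ _ _ _ e0.
- by move=> k; apply: continuous_measurable_Rn; exact: plateau_continuous.
- by apply: measurable_indic; exact: open_measurable_Rn.
- by move=> x; exact: plateau_cvg.
- exact: integrable_indic_obox.
- move=> k x; rewrite setTI indicE; have [xM|xM] := pselect (obox M x).
    by rewrite mem_set//=; have /andP[h1 h2] := plateau_itv (O `&` obox M) k x; rewrite ger0_norm.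
  by rewrite plateau_out ?normr0// => -[].
move=> k kP; exists (plateau (O `&` obox M) k) => //; split; first exact: plateau_continuous.
exists M => x Mx; apply: plateau_out => -[_]; rewrite /obox/= ltNge => /negP; apply; exact: ltW.
Qed.

(** Dynkin's argument: the open sets are closed under intersection and their traces on the box are
    approximable by [plateau] functions, while the sets with approximable trace form a
    lambda-system. *)
Lemma apx_measurable E M : measurable (E : set (borelRn n)) -> apx (\1_(E `&` obox M)).
Proof.
pose H : set (set V) := [set E | measurable (E : set (borelRn n)) /\ apx (\1_(E `&` obox M))].
suff : <<s setT, @open V >> `<=` H by move=> sH mE; have [] := sH E mE.
apply: lambda_system_subset => //.
- by move=> A B; exact: openI.
- split => //.
  + by split => //; apply: apx_open; exact: openT.
  + move=> A B BA [mB aB] [mA aA]; split; first exact: measurableD.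
    rewrite (_ : \1_((A `\` B) `&` obox M) = fun x : V => \1_(A `&` obox M) x + (-1) * \1_(B `&` obox M) x :> R).
      apply: apxD; [exact: integrable_indic_obox| |by []|].
        by apply: integrableZ; exact: integrable_indic_obox.
      by apply: apxZ => //; exact: integrable_indic_obox.
    apply/funext => x; rewrite !indicE [in LHS]in_setI classical_sets.in_setD !in_setI.
    case xA: (x \in A); case xB: (x \in B); case: (x \in obox M) => //=; rewrite ?mulr0 ?mulr1 ?addr0 ?subrr//.
    by move: xA; rewrite mem_set//; exact: BA (set_mem xB).
  + move=> F ndF HF.
    have mF k : measurable (F k : set (borelRn n)) by have [] := HF k.
    have mU : measurable (\bigcup_k F k : set (borelRn n)) by exact: bigcupT_measurable.
    split => //; apply: apx_lim; first exact: integrable_indic_obox.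
    move=> e e0.
    have [] := @L1_seq_limit (\1_((\bigcup_k F k) `&` obox M)) (fun k => \1_(F k `&` obox M)) (\1_(setT `&` obox M)) _ _ _ _ _ _ e0.
    * by move=> k; apply: measurable_indic; apply: measurableI => //; exact: obox_measurable.
    * by apply: measurable_indic; apply: measurableI => //; exact: obox_measurable.
    * move=> x; have [[k _ Fkx]|nx] := pselect ((\bigcup_k F k) x).
        apply: cvg_near_cst; near=> j; rewrite !indicE !in_setI; congr ((_ && _)%:R).
        have Fjx : F j x by move: Fkx; apply/subsetPset/ndF; near: j; exact: nbhs_infty_ge.
        by rewrite !mem_set//; exists k.
      apply: cvg_near_cst; near=> j; rewrite !indicE !in_setI; congr ((_ && _)%:R).
      by rewrite !memNset// => Fj; apply: nx; exists j.
    * exact: integrable_indic_obox.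
    * move=> k x; rewrite !indicE setTI in_setI; case: (x \in F k); case: (x \in obox M) => /=; rewrite ?normr0 ?normr1//.
    move=> k kP; exists (\1_(F k `&` obox M)); split => //; first exact: integrable_indic_obox.
    by have [] := HF k.
- by move=> O oO; split; [exact: open_measurable_Rn|exact: apx_open].
Unshelve. all: by end_near. Qed.

Lemma L1_dense f : mu.-integrable setT (EFin \o f) -> bounded_support f -> apx f.
Proof.
move=> intf [M0 f0]; pose M := M0 + 1.
have fM x : ~ obox M x -> f x = 0.
  move=> /negP; rewrite /obox/= -leNgt => Mx; apply: f0; apply: lt_le_trans Mx; by rewrite ltrDl.
apply: apx_lim => // e e0.
have [g [ig _ cg]] := approximation_sfun_integrable measurableT intf.
have /fine_cvgP[fin /cvgrPdist_le/(_ _ e0)] := cg; move=> /(filterI fin)[k _ kP].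
have [kfin] := kP k (leqnn k); rewrite sub0r normrN => kle.
pose gk : V -> R := g k.
(* The simple function may have unbounded support; cutting it to a box outside which [f] vanishes
   does not increase the error. *)
pose h := fun x : V => gk x * \1_(obox M) x.
have mo : measurable (obox M : set (borelRn n)) by exact: obox_measurable.
have ih : mu.-integrable setT (EFin \o h).
  apply: (integrable_Mbounded (C := 1)); [exact: ig|exact: measurable_indic|].
  by move=> y; rewrite indicE; case: (_ \in _); rewrite ?normr0 ?normr1.
exists h; split => //.
- rewrite (_ : h = fun x => \sum_(r <- finmap.enum_fset (fset_set (range gk))) r * \1_((gk @^-1` [set r]) `&` obox M) x); last first.
    apply/funext => x; rewrite /h.
    have -> : gk x = \sum_(r <- finmap.enum_fset (fset_set (range gk))) r * \1_(gk @^-1` [set r]) x.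
      have := fimfunE (g k) (x : borelRn n).
      by rewrite fsbig_finite; [move=> E; exact: E|exact: fimfunP].
    rewrite mulr_suml.
    by apply: eq_bigr => r _; rewrite -mulrA !indicE in_setI -natrM mulnb.
  elim: (finmap.enum_fset _) => [|r s IH].
    under eq_fun do rewrite big_nil; move=> e1 e10; exists (fun=> 0).
      by split; [move=> x; exact: cst_continuous|exists 0].
    by under eq_integral do rewrite subrr normr0; rewrite integral0 lee_fin ltW.
  have ms t : measurable (gk @^-1` [set t] : set (borelRn n)).
    by rewrite -[X in measurable X]setTI; exact: (measurable_funPT (g k)).
  under eq_fun do rewrite big_cons; apply: apxD => //.
  + by apply: integrableZ; exact: integrable_indic_obox.
  + elim: s {IH} => [|t s IH2].
      rewrite (_ : EFin \o _ = cst 0%E); first exact: integrable0.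
      by apply/funext => x /=; rewrite big_nil.
    under [X in EFin \o X]eq_fun do rewrite big_cons; apply: integrableDr => //.
    by apply: integrableZ; exact: integrable_indic_obox.
  + by apply: apxZ; [exact: integrable_indic_obox|exact: apx_measurable].
- apply: (@le_trans _ _ (\int[mu]_x `|(f x)%:E - (g k x)%:E|)%E); last first.
    rewrite -(fineK kfin) lee_fin; apply: le_trans kle; exact: ler_norm.
  apply: ge0_le_integral => //.
  + apply/measurable_EFinP; apply: measurableT_comp => //; apply: measurable_funB; exact: integrable_mfun.
  + apply: measurableT_comp => //; apply: emeasurable_funB; apply/measurable_EFinP => //; exact: integrable_mfun.
  + move=> x _; rewrite -EFinB abse_EFin lee_fin /h indicE; have [xM|xM] := pselect (obox M x).
      by rewrite mem_set// mulr1.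
    by rewrite memNset// mulr0 subr0 fM// normr0.
Qed.

End L1_density.

(** * Mass of the tensor-product kernel, and mollification as an approximate identity *)

Section tuple_product_integral.
Context {R : realType}.

Lemma tuple_prod_integral n (g : 'I_n -> R -> R) (N C : R) : 0 <= N -> 1 <= C ->
  (forall i, continuous (g i)) -> (forall i s, N < `|s| -> g i s = 0) -> (forall i s, `|g i s| <= C) ->
  (forall i, \int[lebesgue_measure]_(s in `[(- N)%R, N]) (g i s)%:E = 1)%E ->
  bbox (fun t : n.-tuple (measurableTypeR R) => \prod_(i < n) g i (tnth t i)) /\
  (\int[@lebesgue_tuple R n]_t (\prod_(i < n) g i (tnth t i))%:E = 1)%E.
Proof.
move=> N0 C1 cg g0 gC gi.
have bb m (h : 'I_m -> R -> R) : (forall i, continuous (h i)) -> (forall i s, N < `|s| -> h i s = 0) -> (forall i s, `|h i s| <= C) ->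
    bbox (fun t : m.-tuple (measurableTypeR R) => \prod_(i < m) h i (tnth t i)).
  move=> ch h0 hC; split.
    apply: measurable_prod => i _; apply: measurableT_comp; last exact: measurable_tnth.
    exact: continuous_measurable_fun.
  have Cm : 0 <= C ^+ m by rewrite exprn_ge0// (le_trans ler01).
  exists (N + C ^+ m); split.
    move=> t; rewrite normr_prod; apply: (@le_trans _ _ (C ^+ m)); last by rewrite lerDr.
    have -> : C ^+ m = \prod_(i < m) C by rewrite prodr_const card_ord.
    by apply: ler_prod => i _; rewrite normr_ge0 hC.
  move=> t nt; have [i ni] : exists i, N < `|tnth t i|.
    apply/not_existsP => H; apply: nt => i; apply: (@le_trans _ _ N); last by rewrite lerDl.
    by rewrite leNgt; apply/negP; exact: H.
  by rewrite (bigD1 i)//= h0// mul0r.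
split; first exact: bb.
elim: n g cg g0 gC gi => [|n IH] g cg g0 gC gi.
  by under eq_integral do rewrite big_ord0; rewrite integral_cst//= mul1e diracT.
have [_ ->] := integral_lebesgue_cons (bb _ g cg g0 gC).
have IH' := IH (fun i => g (lift ord0 i)) (fun i => cg _) (fun i => g0 _) (fun i => gC _) (fun i => gi _).
under eq_integral => x _.
  under eq_integral => t _.
    rewrite big_ord_recl tnth0 EFinM.
    under eq_bigr do rewrite tnthS.
    over.
  rewrite integralZl//; last first.
    exact: (bbox_integrable (bb _ (fun i => g (lift ord0 i)) (fun i => cg _) (fun i => g0 _) (fun i => gC _))).
  rewrite IH' mule1; over.
rewrite -(gi ord0) [RHS]integral_mkcond; apply: eq_integral => s _.
rewrite patchE; case: ifPn => //; rewrite notin_setE/= in_itv/= => /negP; rewrite -ler_norml -ltNge => h.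
by rewrite g0.
Qed.

End tuple_product_integral.

Section mollification.
Context {R : realType} {n : nat}.
Local Notation V := 'rV[R]_n.
Local Notation mu := (@lebesgue_Rn R n).
Implicit Types (a b f g phi psi : V -> R) (x y : V).

Lemma integral_scale (c : R) f : mu.-integrable setT (EFin \o f) ->
  (c%:E * \int[mu]_x (f x)%:E = \int[mu]_x (c * f x)%:E)%E.
Proof. by move=> intf; rewrite -integralZl. Qed.

Section kernel.
Variables (w : nat -> R -> R) (e : R).
Hypotheses (e0 : 0 < e) (mw : mollifier1 e w).

Definition mol (x : V) : R := pmol w (fun=> 0%N) x.

Lemma mol_ccs : ccs mol. Proof. exact: pmol_ccs mw _. Qed.

Lemma mol_ge0 x : 0 <= mol x. Proof. exact: pmol_ge0 mw _. Qed.

Lemma mol_supp x : e <= `|x| -> mol x = 0. Proof. exact: pmol_supp e0 mw _ _. Qed.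

Let w_bound : exists2 C : R, 1 <= C & forall s, `|w 0%N s| <= C.
Proof.
have cw : continuous (w 0%N) by case: mw => dw _ _ _; exact: der_continuous (dw 0%N).
have : compact (w 0%N @` `[- e, e]).
  by apply: continuous_compact; [exact: continuous_subspaceT|exact: segment_compact].
move=> /compact_bounded[M [Mr h]].
have M1 : M < Num.max M 0 + 1 by rewrite (@le_lt_trans _ _ (Num.max M 0)) ?le_max ?lexx ?ltrDl.
have M2 : 1 <= Num.max M 0 + 1 by rewrite lerDr le_max lexx orbT.
exists (Num.max M 0 + 1) => // s; have [se|se] := leP `|s| e.
  by apply: (h _ M1); exists s => //=; rewrite in_itv/= -ler_norml.
by case: mw => _ -> //; [rewrite normr0 (le_trans ler01)|exact: ltW].
Qed.

Lemma mol_int x : (\int[mu]_y (mol (x - y))%:E = 1)%E /\ (\int[mu]_y (mol (y - x))%:E = 1)%E.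
Proof.
have [dw w0 wge [i1 i2]] := mw.
have cw : continuous (w 0%N) := der_continuous (dw 0%N).
have [C C1 wC] := w_bound.
have N0 : 0 <= `|x| + e by rewrite addr_ge0// ltW.
have far (i : 'I_n) (s : R) : `|x| + e < `|s| -> e <= `|x ord0 i - s|.
  move=> h; rewrite distrC; apply: le_trans (lerB_dist _ _); rewrite lerBrDr.
  by apply: le_trans (ltW h); rewrite addrC lerD2r coord_le_norm.
split.
- rewrite integral_bcs; last first.
    apply: ccs_bcs; split.
      suff H (y : V) : {for y, continuous (fun z : V => mol (x - z))} by move=> y; exact: H.
      by apply: (continuous_comp (f := fun y : V => x - y)); [exact: cont_subl|exact: mol_ccs.1].
    exists (`|x| + e) => y xy; apply: mol_supp; rewrite distrC.
    by apply: le_trans (lerB_dist _ _); rewrite lerBrDr addrC ltW.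
  rewrite -[RHS](@tuple_prod_integral _ n (fun i s => w 0%N (x ord0 i - s)) (`|x| + e) C _ _ _ _ _ _).2 //.
  + by apply: eq_integral => t _; congr EFin; apply: eq_bigr => i _; rewrite !mxE.
  + move=> i s; apply: (continuous_comp (f := fun s : R => x ord0 i - s)); last exact: cw.
    by apply: cvgB; [exact: cvg_cst|exact: cvg_id].
  + by move=> i s /(far i) /w0 ->.
  + by move=> i; apply: i1; rewrite lerD2r coord_le_norm.
- rewrite integral_bcs; last first.
    apply: ccs_bcs; split.
      suff H (y : V) : {for y, continuous (fun z : V => mol (z - x))} by move=> y; exact: H.
      by apply: (continuous_comp (f := fun y : V => y - x)); [exact: cont_subr|exact: mol_ccs.1].
    exists (`|x| + e) => y xy; apply: mol_supp.
    by apply: le_trans (lerB_dist _ _); rewrite lerBrDr addrC ltW.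
  rewrite -[RHS](@tuple_prod_integral _ n (fun i s => w 0%N (s - x ord0 i)) (`|x| + e) C _ _ _ _ _ _).2 //.
  + by apply: eq_integral => t _; congr EFin; apply: eq_bigr => i _; rewrite !mxE.
  + move=> i s; apply: (continuous_comp (f := fun s : R => s - x ord0 i)); last exact: cw.
    by apply: cvgB; [exact: cvg_id|exact: cvg_cst].
  + by move=> i s /(far i) h; apply: w0; rewrite distrC.
  + by move=> i; apply: i2; rewrite lerD2r coord_le_norm.
Qed.

Lemma coord_measurable (i : 'I_n) : measurable_fun [set: borelRn n] (fun x : borelRn n => (x : V) ord0 i).
Proof. by apply: continuous_measurable_Rn; exact: coord_continuous. Qed.

Lemma mol_measurable2 : measurable_fun [set: borelRn n * borelRn n]
  (fun z : borelRn n * borelRn n => mol ((z.1 : V) - (z.2 : V))).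
Proof.
have [dw _ _ _] := mw.
rewrite (_ : (fun z => _) = (fun z : borelRn n * borelRn n => \prod_(i < n) w 0%N ((z.1 : V) ord0 i - (z.2 : V) ord0 i))).
  apply: measurable_prod => i _; apply: (measurableT_comp (continuous_measurable_fun (der_continuous (dw 0%N)))).
  apply: measurable_funB.
    by apply: (measurableT_comp (coord_measurable i)); exact: measurable_fst.
  by apply: (measurableT_comp (coord_measurable i)); exact: measurable_snd.
by apply/funext => z; rewrite /mol /pmol; apply: eq_bigr => i _; rewrite !mxE.
Qed.

Lemma mol_shift_measurable x : measurable_fun [set: borelRn n] (fun y : borelRn n => mol (x - (y : V))).
Proof. by apply: rev_measurable; exact: mol_ccs.1. Qed.

Lemma mol_shift_measurable' x : measurable_fun [set: borelRn n] (fun y : borelRn n => mol ((y : V) - x)).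
Proof.
apply: (continuous_measurable_Rn (f := fun y : V => mol (y - x))).
suff H (y : V) : {for y, continuous (fun z : V => mol (z - x))} by move=> y; exact: H.
by apply: (continuous_comp (f := fun y : V => y - x)); [exact: cont_subr|exact: mol_ccs.1].
Qed.

Lemma EFin_Rintegral f : mu.-integrable setT (EFin \o f) ->
  ((\int[mu]_x f x)%R%:E = \int[mu]_x (f x)%:E)%E.
Proof. by move=> intf; rewrite /Rintegral fineK//; exact: integrable_fin_num. Qed.

Lemma kernel_integrable a b : mu.-integrable setT (EFin \o a) -> mu.-integrable setT (EFin \o b) ->
  (mu \x mu)%E.-integrable setT (fun z : borelRn n * borelRn n => (a z.1 * b z.2 * mol (z.1 - z.2))%:E).
Proof.
move=> ia ib; have [C C0 molC] := ccs_bound mol_ccs.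
have ma := integrable_mfun ia; have mb := integrable_mfun ib.
have mf : measurable_fun [set: borelRn n * borelRn n] (fun z : borelRn n * borelRn n => (a z.1 * b z.2 * mol (z.1 - z.2))%:E).
  apply/measurable_EFinP; apply: measurable_funM; last exact: mol_measurable2.
  apply: measurable_funM; first by apply: (measurableT_comp ma); exact: measurable_fst.
  by apply: (measurableT_comp mb); exact: measurable_snd.
apply/integrable12ltyP => //=.
have Ib : (\int[mu]_y `|b y|%:E < +oo)%E by have /integrableP[] := ib.
have Ia : (\int[mu]_y `|a y|%:E < +oo)%E by have /integrableP[] := ia.
apply: (@le_lt_trans _ _ (\int[mu]_x (`|a x|%:E * (C%:E * \int[mu]_y `|b y|%:E)))%E).
  apply: ge0_le_integral => //.
  + by move=> x _; apply: integral_ge0 => y _.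
  + have m : measurable_fun [set: borelRn n * borelRn n] (fun z : borelRn n * borelRn n => `|(a z.1 * b z.2 * mol (z.1 - z.2))%:E|%E).
      exact: measurableT_comp.
    by apply: (@measurable_fun_fubini_tonelli_F _ _ _ _ R mu _ m).
  + apply: emeasurable_funM; last exact: measurable_cst.
    by apply/measurable_EFinP; exact: measurableT_comp.
  + move=> x _; rewrite muleA -EFinM -ge0_integralZl//.
    * apply: ge0_le_integral => //.
      - apply/measurable_EFinP; apply: measurableT_comp => //; apply: measurable_funM; last exact: mol_shift_measurable.
        by apply: measurable_funM => //; exact: measurable_cst.
      - apply: emeasurable_funM; first exact: measurable_cst.
        by apply/measurable_EFinP; exact: measurableT_comp.
      - move=> y _; rewrite -EFinM lee_fin !normrM -!mulrA ler_wpM2l// mulrC ler_wpM2r//.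
    * by apply/measurable_EFinP; exact: measurableT_comp.
    * by rewrite lee_fin mulr_ge0// ltW.
rewrite ge0_integralZr//.
- have Fb : (\int[mu]_y `|b y|%:E)%E \is a fin_num.
    by rewrite ge0_fin_numE// integral_ge0.
  by rewrite lte_mul_pinfty// ?ge0_fin_numE ?integral_ge0// -(fineK Fb) -EFinM ltry.
- by apply/measurable_EFinP; exact: measurableT_comp.
- by rewrite mule_ge0// ?lee_fin ?(ltW C0)// integral_ge0.
Qed.

Lemma pair_sym a b : mu.-integrable setT (EFin \o a) -> mu.-integrable setT (EFin \o b) ->
  \int[mu]_x (a x * conv b mol x) = \int[mu]_y (b y * \int[mu]_x (a x * mol (x - y))).
Proof.
move=> ia ib.
have E : (\int[mu]_x \int[mu]_y (a x * b y * mol (x - y))%:E = \int[mu]_y \int[mu]_x (a x * b y * mol (x - y))%:E)%E.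
  exact: (Fubini (kernel_integrable ia ib)).
rewrite /Rintegral; apply: congr1.
transitivity (\int[mu]_x \int[mu]_y (a x * b y * mol (x - y))%:E)%E.
  apply: eq_integral => x _; rewrite EFinM EFin_Rintegral; last exact: conv_integrable ib mol_ccs.
  rewrite integral_scale; last exact: conv_integrable ib mol_ccs.
  by apply: eq_integral => y _; rewrite mulrA.
rewrite E; apply: eq_integral => y _.
have iy : mu.-integrable setT (EFin \o (fun x => a x * mol (x - y))).
  have [C _ molC] := ccs_bound mol_ccs.
  exact: (integrable_Mbounded ia (mol_shift_measurable' y) (fun x => molC _)).
rewrite [in RHS]EFinM (EFin_Rintegral iy) (integral_scale _ iy).
by apply: eq_integral => x _; congr EFin; ring.
Qed.

(** A bound on $a(x) b(y)$ at all pairs of points passes to the convolution because the kernel has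
    mass one in each variable. With Young's inequality supplying [A] and [B], it plays the role of
    the boundedness of mollification on $L^p$. *)
Lemma pair_bound a b (A B : V -> R) : mu.-integrable setT (EFin \o a) -> mu.-integrable setT (EFin \o b) ->
  measurable_fun [set: borelRn n] (A : borelRn n -> R) -> measurable_fun [set: borelRn n] (B : borelRn n -> R) ->
  (forall x, 0 <= A x) -> (forall x, 0 <= B x) ->
  (forall x y, `|a x * b y| <= A x + B y) ->
  (\int[mu]_x (`|a x * conv b mol x|)%:E <= \int[mu]_x (A x)%:E + \int[mu]_x (B x)%:E)%E.
Proof.
move=> ia ib mA mB A0 B0 abAB.
have ma := integrable_mfun ia; have mb := integrable_mfun ib.
have m1 : measurable_fun [set: borelRn n * borelRn n] (fun z : borelRn n * borelRn n => (A z.1 * mol (z.1 - z.2))%:E).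
  apply/measurable_EFinP; apply: measurable_funM; last exact: mol_measurable2.
  by apply: (measurableT_comp mA); exact: measurable_fst.
have m2 : measurable_fun [set: borelRn n * borelRn n] (fun z : borelRn n * borelRn n => (B z.2 * mol (z.1 - z.2))%:E).
  apply/measurable_EFinP; apply: measurable_funM; last exact: mol_measurable2.
  by apply: (measurableT_comp mB); exact: measurable_snd.
have g1 z : (0 <= (A z.1 * mol (z.1 - z.2))%:E)%E by rewrite lee_fin mulr_ge0// mol_ge0.
have g2 (z : V * V) : (0 <= (B z.2 * mol (z.1 - z.2))%:E)%E by rewrite lee_fin mulr_ge0// mol_ge0.
have F1 := @measurable_fun_fubini_tonelli_F _ _ _ _ R mu _ m1 g1.
have F2 := @measurable_fun_fubini_tonelli_F _ _ _ _ R mu _ m2 g2.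
have IA : (\int[mu]_x \int[mu]_y (A x * mol (x - y))%:E = \int[mu]_x (A x)%:E)%E.
  apply: eq_integral => x _; under eq_integral do rewrite EFinM.
  rewrite ge0_integralZl ?lee_fin//; first by rewrite (mol_int x).1 mule1.
    by apply/measurable_EFinP; exact: mol_shift_measurable.
  by move=> y _; rewrite lee_fin mol_ge0.
have IB : (\int[mu]_x \int[mu]_y (B y * mol (x - y))%:E = \int[mu]_x (B x)%:E)%E.
  rewrite (@fubini_tonelli _ _ _ _ R mu mu _ m2 g2)/=.
  apply: eq_integral => y _; under eq_integral do rewrite EFinM.
  rewrite ge0_integralZl ?lee_fin//; first by rewrite (mol_int y).2 mule1.
    by apply/measurable_EFinP; exact: mol_shift_measurable'.
  by move=> x _; rewrite lee_fin mol_ge0.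
rewrite -IA -IB -ge0_integralD//; last 2 first.
- by move=> x _; apply: integral_ge0 => y _; exact: (g1 (x, y)).
- by move=> x _; apply: integral_ge0 => y _; exact: (g2 (x, y)).
have cc : continuous (conv b mol) := conv_continuous ib mol_ccs.
apply: ge0_le_integral => //.
- apply/measurable_EFinP; apply: measurableT_comp => //; apply: measurable_funM => //.
  exact: continuous_measurable_Rn.
- exact: emeasurable_funD.
move=> x _; rewrite -ge0_integralD//; last 4 first.
- by move=> y _; exact: (g1 (x, y)).
- by apply/measurable_EFinP; apply: measurable_funM; [exact: measurable_cst|exact: mol_shift_measurable].
- by move=> y _; exact: (g2 (x, y)).
- by apply/measurable_EFinP; apply: measurable_funM => //; exact: mol_shift_measurable.
have ic := conv_integrable x ib mol_ccs.
apply: (@le_trans _ _ (\int[mu]_y `|a x * (b y * mol (x - y))|%:E)%E).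
  rewrite /conv normrM EFinM EFin_normr_Rintegral//.
  under [leRHS]eq_integral do rewrite normrM EFinM.
  rewrite ge0_integralZl//; last first.
    by apply/measurable_EFinP; apply: measurableT_comp => //; exact: integrable_mfun ic.
  apply: lee_pmul => //; apply: le_abse_integral => //.
  by apply/measurable_EFinP; exact: integrable_mfun ic.
apply: ge0_le_integral => //.
- apply/measurable_EFinP; apply: measurableT_comp => //; apply: measurable_funM; first exact: measurable_cst.
  exact: integrable_mfun ic.
- apply: emeasurable_funD; apply/measurable_EFinP; apply: measurable_funM => //; exact: mol_shift_measurable.
move=> y _; rewrite -EFinD lee_fin mulrA normrM (ger0_norm (mol_ge0 _)) -mulrDl ler_wpM2r ?mol_ge0//.
Qed.

End kernel.

Lemma kernel_approx phi (K : V -> R) x (eta e C : R) :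
  measurable_fun [set: borelRn n] (phi : borelRn n -> R) -> (forall y, `|phi y| <= C) -> 0 <= eta ->
  measurable_fun [set: borelRn n] (K : borelRn n -> R) -> (forall y, 0 <= K y) ->
  (\int[mu]_y (K y)%:E = 1)%E -> (forall y, e <= `|x - y| -> K y = 0) ->
  (forall y, `|x - y| < e -> `|phi x - phi y| <= eta) ->
  `|\int[mu]_y (phi y * K y) - phi x| <= eta.
Proof.
move=> mphi phiC eta0 mK K0 K1 Ks h.
have iK : mu.-integrable setT (EFin \o K).
  apply/integrableP; split; first exact/measurable_EFinP.
  by under eq_integral do rewrite /= ger0_norm//; rewrite K1 ltry.
have RK : \int[mu]_y K y = 1 by rewrite /Rintegral K1.
have i1 : mu.-integrable setT (EFin \o (fun y => phi y * K y)).
  under [X in EFin \o X]eq_fun do rewrite mulrC.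
  exact: (integrable_Mbounded iK mphi phiC).
have -> : phi x = \int[mu]_y (phi x * K y) by rewrite RintegralZl// RK mulr1.
rewrite -RintegralB//; last exact: integrableZ.
under eq_Rintegral do rewrite -mulrBl.
have i2 : mu.-integrable setT (EFin \o (fun y => (phi y - phi x) * K y)).
  under [X in EFin \o X]eq_fun do rewrite mulrBl -mulNr.
  by apply: integrableDr => //; exact: integrableZ.
apply: le_trans (le_normr_Rintegral _ i2) _ => //.
rewrite -[leRHS]mulr1 -RK -RintegralZl//; apply: le_Rintegral => //.
- exact: integrable_norm.
- exact: integrableZ.
- move=> y _; rewrite normrM (ger0_norm (K0 y)); have [xy|xy] := ltP `|x - y| e.
    by rewrite ler_wpM2r// distrC h.
  by rewrite Ks// !mulr0.
Qed.

Lemma mol_approx phi : ccs phi -> forall eta : R, 0 < eta -> exists2 d : R, 0 < d &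
  forall e w, 0 < e -> e < d -> mollifier1 e w -> forall x,
   `|conv phi (mol w) x - phi x| <= eta /\ `|\int[mu]_y (phi y * mol w (y - x)) - phi x| <= eta.
Proof.
move=> cphi eta eta0; have [d d0 dP] := ccs_unif cphi eta0.
exists d => // e w e0 ed mw x.
have h y : `|x - y| < e -> `|phi x - phi y| <= eta.
  by move=> xy; apply/ltW/dP; exact: lt_trans ed.
have [C _ phiC] := ccs_bound cphi.
have mphi : measurable_fun [set: borelRn n] (phi : borelRn n -> R) by exact: (continuous_measurable_Rn cphi.1).
split; apply: (kernel_approx mphi phiC (ltW eta0) _ _ _ _ h).
- exact: (mol_shift_measurable e0 mw x).
- by move=> y; exact: (mol_ge0 mw _).
- exact: (mol_int e0 mw x).1.
- by move=> y xy; eapply mol_supp; eassumption.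
- exact: (mol_shift_measurable' e0 mw x).
- by move=> y; exact: (mol_ge0 mw _).
- exact: (mol_int e0 mw x).2.
- by move=> y; rewrite distrC => xy; eapply mol_supp; eassumption.
Qed.

End mollification.

(** * Density in $L^q$, and convergence of pairings under mollification *)

Section Lq_density.
Context {R : realType} {n : nat}.
Local Notation V := 'rV[R]_n.
Local Notation mu := (@lebesgue_Rn R n).
Implicit Types (a b f g phi psi : V -> R) (x y : V).

Definition lp (q : R) f := [/\ measurable_fun [set: borelRn n] (f : borelRn n -> R), bounded_support f
  & (\int[mu]_x (`|f x| `^ q)%:E < +oo)%E].

Lemma measurable_abs_powR (q : R) f : measurable_fun [set: borelRn n] (f : borelRn n -> R) ->
  measurable_fun [set: borelRn n] (fun x : borelRn n => `|f x| `^ q).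
Proof.
move=> mf; apply: (measurableT_comp (measurable_powR q)); exact: measurableT_comp.
Qed.

Lemma lp_powR_integrable (q : R) f : lp q f -> mu.-integrable setT (EFin \o (fun x => `|f x| `^ q)).
Proof.
move=> [mf _ foo]; apply/integrableP; split.
  by apply/measurable_EFinP; exact: measurable_abs_powR.
by under eq_integral do rewrite /= ger0_norm ?powR_ge0//.
Qed.

Lemma box_indic_integrable (M : R) : mu.-integrable setT (EFin \o (\1_([set x : V | `|x| <= M]) : V -> R)).
Proof.
apply/integrableP; split.
  by apply/measurable_EFinP/measurable_indic; exact: Rn_measurable_box.
under eq_integral do rewrite gee0_abs ?lee_fin//.
by rewrite integral_indic ?setIT//; [exact: Rn_box_fin|exact: Rn_measurable_box].
Qed.

Lemma le_1D_powR (q t : R) : 1 <= q -> 0 <= t -> t <= 1 + t `^ q.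
Proof.
move=> q1 t0; have [t1|t1] := leP t 1; first by rewrite (le_trans t1)// lerDl powR_ge0.
apply: (@le_trans _ _ (t `^ q)); last by rewrite lerDr.
by rewrite -{1}(powRr1 t0); apply: ler_powR => //; exact: ltW.
Qed.

Lemma lp_integrable (q : R) f : 1 <= q -> lp q f -> mu.-integrable setT (EFin \o f).
Proof.
move=> q1 lf; have [mf [M f0] _] := lf.
have iG := integrableDr (box_indic_integrable M) (lp_powR_integrable lf).
apply: (le_integrable _ _ _ iG) => //; first exact/measurable_EFinP.
move=> x _ /=; rewrite lee_fin; apply: le_trans (ler_norm _).
rewrite indicE; have [xM|xM] := leP `|x| M.
  by rewrite mem_set//; exact: le_1D_powR.
by rewrite f0// normr0 addr_ge0 ?powR_ge0.
Qed.

Definition clip (j t : R) : R := Num.max (- j) (Num.min j t).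

Lemma clip_lip (j s t : R) : `|clip j s - clip j t| <= `|s - t|.
Proof.
rewrite /clip /Num.max /Num.min; case: (ltP j s) => h1; case: (ltP j t) => h2;
  case: ltP => h3; case: ltP => h4; case: (ger0P (s - t)) => h5; rewrite ?ler_norml; try lra;
  by move: h4; rewrite subrr normr0 ?normr_lt0 ?normr_le0 // ?ltNge ?normr_ge0.
Qed.

Lemma clip_id (j t : R) : `|t| <= j -> clip j t = t.
Proof.
by rewrite ler_norml => /andP[h1 h2]; rewrite /clip (min_idPr h2); apply/max_idPr.
Qed.

Lemma clip_le (j t : R) : 0 <= j -> `|clip j t| <= j.
Proof.
move=> j0; rewrite /clip /Num.max /Num.min ler_norml.
by case: (ltP j t) => h1; case: ltP => h2; lra.
Qed.

Lemma clip0 (j : R) : 0 <= j -> clip j 0 = 0.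
Proof. by move=> j0; apply: clip_id; rewrite normr0. Qed.

Lemma clip_dist (j t : R) : 0 <= j -> `|t - clip j t| <= `|t|.
Proof.
move=> j0; rewrite /clip /Num.max /Num.min; case: (ltP j t) => h1; case: ltP => h2;
  case: (ger0P t) => h3; rewrite ler_norml; lra.
Qed.

Lemma clip_cont (j : R) : continuous (clip j).
Proof.
move=> t; apply/(cont_distP (clip j)) => e e0; exists e => // s; exact: le_lt_trans (clip_lip _ _ _).
Qed.

Lemma powR_add_le (q s t : R) : 0 <= q -> 0 <= s -> 0 <= t -> (s + t) `^ q <= 2 `^ q * (s `^ q + t `^ q).
Proof.
move=> q0 s0 t0; wlog st : s t s0 t0 / s <= t.
  move=> H; have [/H|/ltW/H] := leP s t; first exact.
  by rewrite addrC (addrC (t `^ q)); exact.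
apply: (@le_trans _ _ ((2 * t) `^ q)).
  by apply: ge0_ler_powR; rewrite ?nnegrE ?addr_ge0 ?mulr_ge0//; lra.
by rewrite powRM// ler_wpM2l ?powR_ge0// lerDr powR_ge0.
Qed.

Lemma le_powR_id (q s : R) : 1 <= q -> 0 <= s -> s <= 1 -> s `^ q <= s.
Proof.
move=> q1; rewrite le_eqVlt => /predU1P[<- _|s0 s1]; first by rewrite powR0// gt_eqF// (lt_le_trans ltr01).
rewrite -[leRHS](powRr1 (ltW s0)); apply: ger_powR => //; by rewrite s0.
Qed.

(** For values bounded by [J], $|s-t|^q \le (2J)^{q-1}|s-t|$. So [a] is truncated at a large height
    [J], and an $L^1$ approximant, truncated at the same height, is also close in $L^q$. *)
Lemma lq_dense (q : R) a : 1 <= q -> lp q a -> forall e : R, 0 < e ->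
  exists2 phi, ccs phi & (\int[mu]_x (`|a x - phi x| `^ q)%:E <= e%:E)%E.
Proof.
move=> q1 la e e0; have [ma [M a0] aoo] := la.
have q0 : 0 <= q by apply: le_trans q1.
pose c := 2 `^ q; have c0 : 0 < c by apply: powR_gt0.
pose e1 := e / (2 * c); have e10 : 0 < e1 by rewrite divr_gt0// mulr_gt0.
pose h (k : nat) x := `|a x - clip k.+1%:R (a x)| `^ q.
have mclip k : measurable_fun [set: borelRn n] (fun x : borelRn n => clip k.+1%:R (a x)).
  by apply: (measurableT_comp (continuous_measurable_fun (@clip_cont k.+1%:R))).
have mh k : measurable_fun [set: borelRn n] (h k : borelRn n -> R).
  apply: (measurable_abs_powR q (f := fun x => a x - clip k.+1%:R (a x))).
  exact: measurable_funB.
have [k hk] : exists k, (\int[mu]_x (`|0 - h k x|)%:E <= e1%:E)%E.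
  apply: (@L1_seq_limit R n (fun=> 0) h (fun x => `|a x| `^ q)) => //.
  - move=> x; apply: cvg_near_cst; near=> k; rewrite /h clip_id ?subrr ?normr0 ?powR0//.
      by rewrite gt_eqF// (lt_le_trans ltr01).
    near: k; exists (Num.truncn `|a x|) => // k /= ak.
    apply: ltW; apply: (lt_le_trans (truncnS_gt _)); by rewrite ler_nat ltnS.
  - exact: lp_powR_integrable.
  - move=> j x; rewrite ger0_norm ?powR_ge0//; apply: ge0_ler_powR; rewrite ?nnegrE//.
    exact: clip_dist.
pose J : R := k.+1%:R; have J0 : 0 < J by rewrite ltr0n.
pose ak x := clip J (a x).
have iak : mu.-integrable setT (EFin \o ak).
  apply: bcs_integrable; split; first exact: mclip.
  exists (Num.max M J); split => x; first by rewrite le_max (clip_le _ (ltW J0)) orbT.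
  by rewrite gt_max => /andP[/a0 ax _]; rewrite /ak ax clip0// ltW.
have bak : bounded_support ak by exists M => x /a0 ax; rewrite /ak ax clip0// ltW.
pose c2 := (2 * J) `^ q / (2 * J); have c20 : 0 < c2 by rewrite divr_gt0 ?powR_gt0// mulr_gt0.
have [phi cphi hphi] := L1_dense iak bak (divr_gt0 e10 c20).
pose psi x := clip J (phi x).
have cpsi : ccs psi.
  split; first by move=> x; apply: (continuous_comp (f := phi)); [exact: cphi.1|exact: clip_cont].
  by have [_ [N phiN]] := cphi; exists N => x /phiN px; rewrite /psi px clip0// ltW.
exists psi => //.
have mpsi := integrable_mfun (ccs_integrable cpsi).
have mak := integrable_mfun iak.
have mphi := integrable_mfun (ccs_integrable cphi).
have H2 : (\int[mu]_x (`|ak x - psi x| `^ q)%:E <= e1%:E)%E.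
  apply: (@le_trans _ _ (\int[mu]_x (c2%:E * `|ak x - phi x|%:E))%E).
    apply: ge0_le_integral => //.
    - apply/measurable_EFinP; apply: (measurable_abs_powR q (f := fun x => ak x - psi x)); exact: measurable_funB.
    - apply: emeasurable_funM; first exact: measurable_cst.
      by apply/measurable_EFinP; apply: measurableT_comp => //; exact: measurable_funB.
    - move=> x _; rewrite -EFinM lee_fin.
      set t := `|ak x - psi x|.
      have t1 : t <= `|ak x - phi x|.
        have E : clip J (ak x) = ak x by apply: clip_id; exact: clip_le (ltW J0).
        by rewrite /t /psi -{1}E; exact: clip_lip.
      have t2 : t <= 2 * J.
        by apply: le_trans (ler_normB _ _) _; rewrite mulr2n mulrDl !mul1r lerD// clip_le// ltW.
      have J20 : 0 < 2 * J by rewrite mulr_gt0.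
      have t0 : 0 <= t by exact: normr_ge0.
      apply: (@le_trans _ _ (c2 * t)); last by rewrite ler_wpM2l// ltW.
      have -> : t `^ q = (2 * J) `^ q * (t / (2 * J)) `^ q.
        by rewrite -powRM ?divr_ge0 ?(ltW J20)// mulrC divfK// gt_eqF.
      rewrite /c2 mulrAC -mulrA ler_wpM2l ?powR_ge0//.
      have s0 : 0 <= t / (2 * J) by rewrite divr_ge0// ltW.
      have s1 : t / (2 * J) <= 1 by rewrite ler_pdivrMr// mul1r.
      exact: le_powR_id.
  rewrite ge0_integralZl ?lee_fin ?(ltW c20)//; last first.
    by apply/measurable_EFinP; apply: measurableT_comp => //; exact: measurable_funB.
  apply: le_trans (lee_pmul _ _ (lexx _) hphi) _; rewrite ?lee_fin ?(ltW c20)//.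
    by apply: integral_ge0.
  by rewrite mulrC divfK// gt_eqF.
have H1 : (\int[mu]_x (h k x)%:E <= e1%:E)%E.
  apply: le_trans hk; rewrite le_eqVlt; apply/orP; left; apply/eqP.
  by apply: eq_integral => x _; rewrite sub0r normrN ger0_norm// powR_ge0.
apply: (@le_trans _ _ (\int[mu]_x (c%:E * ((h k x)%:E + (`|ak x - psi x| `^ q)%:E)))%E).
  apply: ge0_le_integral => //.
  - apply/measurable_EFinP; apply: (measurable_abs_powR q (f := fun x => a x - psi x)); exact: measurable_funB.
  - apply: emeasurable_funM; first exact: measurable_cst.
    apply: emeasurable_funD; apply/measurable_EFinP => //.
    apply: (measurable_abs_powR q (f := fun x => ak x - psi x)); exact: measurable_funB.
  - move=> x _; rewrite -EFinD -EFinM lee_fin.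
    apply: le_trans (powR_add_le q0 (normr_ge0 _) (normr_ge0 _)).
    apply: ge0_ler_powR; rewrite ?nnegrE ?addr_ge0//.
    exact: ler_distD.
rewrite ge0_integralZl ?lee_fin ?(ltW c0)//; last 2 first.
- apply: emeasurable_funD; apply/measurable_EFinP => //.
  apply: (measurable_abs_powR q (f := fun x => ak x - psi x)); exact: measurable_funB.
- by move=> x _; rewrite adde_ge0// lee_fin powR_ge0.
have mD : measurable_fun [set: borelRn n] (fun x : borelRn n => (`|ak x - psi x| `^ q)%:E).
  apply/measurable_EFinP; apply: (measurable_abs_powR q (f := fun x => ak x - psi x)); exact: measurable_funB.
have mhk : measurable_fun [set: borelRn n] (fun x : borelRn n => (h k x)%:E) by exact/measurable_EFinP.
rewrite ge0_integralD; [|exact: measurableT|by move=> x _; rewrite lee_fin powR_ge0|exact: mhk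
  |by move=> x _; rewrite lee_fin powR_ge0|exact: mD].
apply: (@le_trans _ _ (c%:E * (e1%:E + e1%:E))%E).
  apply: lee_pmul => //; rewrite ?lee_fin ?(ltW c0)//.
    by rewrite adde_ge0// integral_ge0// => x _; rewrite ?lee_fin ?powR_ge0.
  exact: (leeD H1 H2).
rewrite -EFinD -EFinM lee_fin /e1 le_eqVlt; apply/orP; left; apply/eqP; field.
by rewrite gt_eqF.
Unshelve. all: by end_near. Qed.

End Lq_density.

Section pairing_limit.
Context {R : realType} {n : nat}.
Local Notation V := 'rV[R]_n.
Local Notation mu := (@lebesgue_Rn R n).
Implicit Types (a b f g phi psi : V -> R) (x y : V).

Lemma Rintegral_bound f (c : R) : mu.-integrable setT (EFin \o f) ->
  (\int[mu]_x (`|f x|)%:E <= c%:E)%E -> `|\int[mu]_x f x| <= c.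
Proof.
move=> intf fc; rewrite -lee_fin EFin_normr_Rintegral//; apply: le_trans fc.
by apply: le_abse_integral => //; apply/measurable_EFinP; exact: integrable_mfun.
Qed.

Lemma conv_ccs (w : nat -> R -> R) (e : R) b : 0 < e -> mollifier1 e w -> mu.-integrable setT (EFin \o b) ->
  bounded_support b -> ccs (conv b (mol w)).
Proof.
move=> e0 mw ib [M bM]; split; first exact: (conv_continuous ib (mol_ccs e0 mw)).
exists (M + e) => x Mx; apply: (@conv_supp R n w e e0 mw b [set y | `|y| <= M]).
  by move=> y /negP; rewrite -ltNge; exact: bM.
move=> y /= yM; apply: le_trans (lerB_dist _ _); rewrite lerBrDr; apply: ltW.
by apply: le_lt_trans Mx; rewrite addrC lerD2r.
Qed.

Lemma integrableBr f g : mu.-integrable setT (EFin \o f) -> mu.-integrable setT (EFin \o g) ->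
  mu.-integrable setT (EFin \o (fun x => f x - g x)).
Proof.
move=> intf intg; rewrite (_ : EFin \o _ = fun x => ((f x)%:E - (g x)%:E)%E); first exact: integrableB.
by apply/funext => x /=; rewrite EFinB.
Qed.

Lemma integrable_le f (G : V -> R) : mu.-integrable setT (EFin \o G) ->
  measurable_fun [set: borelRn n] (f : borelRn n -> R) -> (forall x, `|f x| <= G x) ->
  mu.-integrable setT (EFin \o f).
Proof.
move=> iG mf h; apply: (le_integrable _ _ _ iG) => //; first exact/measurable_EFinP.
by move=> x _ /=; rewrite lee_fin; apply: le_trans (h x) (ler_norm _).
Qed.

Lemma norm_5h (h s t u : R) : `|s| <= h + h -> `|t| <= h + h -> `|u| <= h -> `|s - t + u| <= 5 * h.
Proof. by rewrite !ler_norml; lra. Qed.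

(** [a] is a compactly supported continuous [phi] up to a remainder [c] small in $L^q$. In the
    pairing with [phi] the mollifier moves over to [phi], where it converges uniformly. The
    remainder is controlled by Young's inequality, through [pair_bound] for the mollified factor. *)
Lemma pair_cvg (p q : R) a b : 1 < p -> 1 < q -> q^-1 + p^-1 = 1 -> lp q a -> lp p b ->
  forall eta : R, 0 < eta -> exists2 d : R, 0 < d & forall e w, 0 < e -> e < d -> mollifier1 e w ->
    `|\int[mu]_x (a x * conv b (mol w) x) - \int[mu]_x (a x * b x)| <= eta.
Proof.
move=> p1 q1 qp la lb eta eta0.
have p0 : 0 < p by apply: lt_trans p1.
have q0 : 0 < q by apply: lt_trans q1.
have ia := lp_integrable (ltW q1) la; have ib := lp_integrable (ltW p1) lb.
have ma := integrable_mfun ia; have mb := integrable_mfun ib.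
pose h := eta / 5; have h0 : 0 < h by rewrite divr_gt0.
pose Q : R := (\int[mu]_x (`|b x| `^ p))%R.
have Q0 : 0 <= Q by apply: Rintegral_ge0 => x _; exact: powR_ge0.
(* [L] shifts weight in Young's inequality: dividing $|b|$ by [L] brings its $L^p$ part below [h],
   and [c] is then taken small against $L^q$. The five errors of size [h] add up to [eta]. *)
pose L := (Q / h + 1) `^ p^-1.
have L0 : 0 < L by rewrite powR_gt0// ltr_wpDl// divr_ge0// ltW.
have Lp : L `^ p = Q / h + 1.
  by rewrite -powRrM mulVf ?gt_eqF// powRr1// addr_ge0// divr_ge0// ltW.
have Lq0 : 0 < L `^ q by exact: powR_gt0.
have [phi cphi hphi] := lq_dense (ltW q1) la (divr_gt0 h0 Lq0).
have iphi := ccs_integrable cphi; have mphi := integrable_mfun iphi.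
pose c x := a x - phi x.
have ic : mu.-integrable setT (EFin \o c) by exact: integrableBr.
have mc := integrable_mfun ic.
pose A x := (L * `|c x|) `^ q; pose B y := (`|b y| / L) `^ p.
have AE x : A x = L `^ q * `|c x| `^ q by rewrite /A powRM// ltW.
have BE x : B x = (L `^ p)^-1 * `|b x| `^ p.
  by rewrite /B mulrC powRM ?invr_ge0 ?(ltW L0)// -powR_inv1 ?(ltW L0)// -powRrM mulN1r powRN.
have A0 x : 0 <= A x by exact: powR_ge0.
have B0 x : 0 <= B x by exact: powR_ge0.
have cAB x y : `|c x * b y| <= A x + B y.
  rewrite normrM -[X in X <= _](_ : (L * `|c x|) * (`|b y| / L) = _); last by field; rewrite gt_eqF.
  apply: le_trans (@conjugate_powR R _ _ q p _ _ q0 p0 qp) _.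
  - by rewrite mulr_ge0// ltW.
  - by rewrite divr_ge0// ltW.
  by apply: lerD; apply: ler_piMr; rewrite ?powR_ge0// invf_le1// ltW.
have mA : measurable_fun [set: borelRn n] (A : borelRn n -> R).
  rewrite (_ : A = fun x => L `^ q * `|c x| `^ q); last exact/funext.
  by apply: measurable_funM; [exact: measurable_cst|exact: measurable_abs_powR].
have mB : measurable_fun [set: borelRn n] (B : borelRn n -> R).
  rewrite (_ : B = fun x => (L `^ p)^-1 * `|b x| `^ p); last exact/funext.
  by apply: measurable_funM; [exact: measurable_cst|exact: measurable_abs_powR].
have IA : (\int[mu]_x (A x)%:E <= h%:E)%E.
  under eq_integral do rewrite AE EFinM.
  rewrite ge0_integralZl; [|exact: measurableT| |by move=> x _; rewrite lee_fin powR_ge0|by rewrite lee_fin ltW]; last first.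
    by apply/measurable_EFinP; exact: measurable_abs_powR.
  apply: le_trans (lee_pmul _ _ (lexx _) hphi) _; rewrite ?lee_fin ?(ltW Lq0)//.
    by apply: integral_ge0 => x _; rewrite lee_fin powR_ge0.
  by rewrite mulrC divfK// gt_eqF.
have ibp := lp_powR_integrable lb.
have IB : (\int[mu]_x (B x)%:E <= h%:E)%E.
  have Lp0 : 0 < L `^ p by exact: powR_gt0.
  under eq_integral do rewrite BE EFinM.
  rewrite ge0_integralZl; [|exact: measurableT| |by move=> x _; rewrite lee_fin powR_ge0|by rewrite lee_fin invr_ge0 ltW]; last first.
    by apply/measurable_EFinP; exact: measurable_abs_powR.
  rewrite -(EFin_Rintegral ibp) -EFinM lee_fin -/Q mulrC ler_pdivrMr// Lp mulrDr mulr1 mulrC divfK ?gt_eqF//.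
  by rewrite lerDl ltW.
have iAB : mu.-integrable setT (EFin \o (fun x => A x + B x)).
  apply: integrableDr; apply/integrableP; split; try exact/measurable_EFinP.
    by under eq_integral do rewrite /= ger0_norm//; apply: le_lt_trans IA _; exact: ltry.
  by under eq_integral do rewrite /= ger0_norm//; apply: le_lt_trans IB _; exact: ltry.
have icb : mu.-integrable setT (EFin \o (fun x => c x * b x)).
  by apply: (integrable_le iAB) => //; exact: measurable_funM.
have [C C0 phiC] := ccs_bound cphi.
have ipb : mu.-integrable setT (EFin \o (fun x => b x * phi x)) by exact: (integrable_Mbounded ib mphi phiC).
have Hcb : `|\int[mu]_x (c x * b x)| <= h + h.
  apply: Rintegral_bound icb _; rewrite EFinD; apply: le_trans (leeD IA IB).
  rewrite -ge0_integralD; [|exact: measurableT|by move=> x _; rewrite lee_fin|exact/measurable_EFinP|by move=> x _; rewrite lee_fin|exact/measurable_EFinP].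
  apply: ge0_le_integral.
  - exact: measurableT.
  - by move=> x _; rewrite lee_fin.
  - by apply/measurable_EFinP; apply: measurableT_comp => //; exact: measurable_funM.
  - by apply: emeasurable_funD; exact/measurable_EFinP.
  - by move=> x _; rewrite -EFinD lee_fin.
pose S : R := \int[mu]_x `|b x|.
have S0 : 0 <= S by apply: Rintegral_ge0.
have S1 : 0 < S + 1 by rewrite ltr_wpDl.
have [d d0 dP] := mol_approx cphi (divr_gt0 h0 S1).
exists d => // e w e0 ed mw.
have bsb : bounded_support b by case: lb.
have ccb := conv_ccs e0 mw ib bsb.
have [C2 C20 cbC] := ccs_bound ccb.
have mcb := integrable_mfun (ccs_integrable ccb).
have i1 : mu.-integrable setT (EFin \o (fun x => c x * conv b (mol w) x)) by exact: (integrable_Mbounded ic mcb cbC).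
have i2 : mu.-integrable setT (EFin \o (fun x => phi x * conv b (mol w) x)) by exact: (integrable_Mbounded iphi mcb cbC).
have E1 : \int[mu]_x (a x * conv b (mol w) x) = \int[mu]_x (c x * conv b (mol w) x) + \int[mu]_x (phi x * conv b (mol w) x).
  rewrite -RintegralD; [|exact: measurableT|exact: i1|exact: i2].
  by apply: eq_Rintegral => x _; rewrite /c; ring.
have E2 : \int[mu]_x (a x * b x) = \int[mu]_x (c x * b x) + \int[mu]_x (b x * phi x).
  rewrite -RintegralD; [|exact: measurableT|exact: icb|exact: ipb].
  by apply: eq_Rintegral => x _; rewrite /c; ring.
have H1 : `|\int[mu]_x (c x * conv b (mol w) x)| <= h + h.
  apply: Rintegral_bound i1 _; rewrite EFinD; apply: le_trans (leeD IA IB).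
  exact: (pair_bound e0 mw ic ib mA mB A0 B0 cAB).
pose T y := \int[mu]_x (phi x * mol w (x - y)).
have Tphi y : `|T y - phi y| <= h / (S + 1) by have [] := dP e w e0 ed mw y.
have ibT : mu.-integrable setT (EFin \o (fun y => b y * T y)).
  have mT : measurable_fun [set: borelRn n] (T : borelRn n -> R).
    have : T = conv phi (fun z => mol w (- z)).
      by apply/funext => y; apply: eq_Rintegral => x _; rewrite opprB.
    move=> ->; apply: continuous_measurable_Rn; apply: conv_continuous iphi _.
    have [cm [M mM]] := (mol_ccs e0 mw : ccs (mol w : V -> R)).
    split; last by exists M => x xM; apply: mM; rewrite normrN.
    suff H (x : V) : {for x, continuous (fun z : V => mol w (- z))} by move=> x; exact: H.
    by apply: (continuous_comp (f := fun z : V => - z)); [exact: continuousN|exact: cm].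
  apply: (integrable_Mbounded ib mT (C := C + h / (S + 1))) => y.
  rewrite -[T y](subrK (phi y)) addrC; apply: le_trans (ler_normD _ _) _; exact: lerD.
have H2 : `|\int[mu]_x (phi x * conv b (mol w) x) - \int[mu]_x (b x * phi x)| <= h.
  rewrite (pair_sym e0 mw iphi ib) -RintegralB; [|exact: measurableT|exact: ibT|exact: ipb].
  have ii := integrableBr ibT ipb.
  apply: le_trans (le_normr_Rintegral _ ii) _ => //.
  apply: (@le_trans _ _ (\int[mu]_x (`|b x| * (h / (S + 1))))).
    apply: le_Rintegral; [exact: measurableT|exact: integrable_norm| |].
      under [X in EFin \o X]eq_fun do rewrite mulrC.
      by apply: integrableZ; exact: integrable_norm.
    by move=> y _; rewrite -mulrBr normrM ler_wpM2l.
  rewrite RintegralZr; [|exact: measurableT|exact: integrable_norm].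
  by rewrite -/S mulrA ler_pdivrMr// mulrC ler_wpM2l ?(ltW h0)// lerDl.
rewrite E1 E2.
set x1 := \int[mu]_x (c x * conv b (mol w) x); set x2 := \int[mu]_x (c x * b x).
rewrite (_ : _ - _ = x1 - x2 + (\int[mu]_x (phi x * conv b (mol w) x) - \int[mu]_x (b x * phi x))); last by rewrite opprD addrACA.
apply: le_trans (norm_5h H1 Hcb H2) _.
by rewrite /h mulrC divfK.
Qed.

End pairing_limit.

(** * From smooth to $C^1$ test functions *)

Section test_extension.
Context {R : realType} {n : nat}.
Local Notation V := 'rV[R]_n.
Local Notation mu := (@lebesgue_Rn R n).
Implicit Types (a b f g phi psi : V -> R) (x y : V) (D K : set V).

(** Uniform continuity on [K] of the indicator of [D], at tolerance 1, is a positive distance from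
    [K] to the complement of [D]. The compact [K1] is the sum of [K] and a closed ball. *)
Lemma compact_nbhd K D : compact K -> open D -> K `<=` D ->
  exists r K1, [/\ 0 < r, compact K1, K1 `<=` D & forall x y, K x -> `|x - y| <= r -> K1 y].
Proof.
move=> cK oD KD.
have cf x : K x -> {for x, continuous (\1_D : V -> R)}.
  move=> Kx; apply/cont_distP => e e0; have /nbhs_ballP[d /= d0 dD] : nbhs x D.
    by apply: open_nbhs_nbhs; split => //; exact: KD.
  exists d => // y xy; rewrite !indicE !mem_set ?subrr ?normr0//; last exact: KD.
  by apply: dD; rewrite -ball_normE.
have [d d0 dP] := compact_unif_cont cK cf ltr01.
have dD x y : K x -> `|x - y| < d -> D y.
  move=> Kx xy; have := dP x y Kx xy; rewrite !indicE (mem_set (KD _ Kx)).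
  by case: (boolP (y \in D)) => [/set_mem//|_]; rewrite subr0 normr1 ltxx.
pose B : set V := [set v | `|v| <= d / 2].
have cB : compact B.
  apply: bounded_closed_compact.
    by exists (d / 2); split => [|N MN x /= xM]; [exact: num_real|apply: le_trans xM (ltW MN)].
  rewrite (_ : B = (fun x : V => `|x|) @^-1` [set y : R | y <= d / 2])//.
  by apply: preimage_closed => [x _|]; [exact: norm_continuous|exact: closed_le].
exists (d / 2), ((fun z : V * V => z.1 + z.2) @` (K `*` B)); split.
- by rewrite divr_gt0.
- apply: continuous_compact; last exact: compact_setX.
  by apply: continuous_subspaceT => z; apply: cvgD; [exact: cvg_fst|exact: cvg_snd].
- move=> _ [[x v] /= [Kx Bv] <-]; apply: (dD x) => //.
  rewrite opprD addrA subrr sub0r normrN; apply: le_lt_trans Bv _.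
  by rewrite ltr_pdivrMr// ltr_pMr// ltr1n.
- move=> x y Kx xy; exists (x, y - x) => /=; last by rewrite addrC subrK.
  by split => //; rewrite /B/= distrC.
Qed.

Definition rst K f x : R := f x * \1_K x.

Lemma rst_in K f x : K x -> rst K f x = f x.
Proof. by move=> Kx; rewrite /rst indicE mem_set// mulr1. Qed.

Lemma rst_out K f x : ~ K x -> rst K f x = 0.
Proof. by move=> Kx; rewrite /rst indicE memNset// mulr0. Qed.

Lemma rst_patch K f : EFin \o rst K f = (EFin \o f) \_ K.
Proof.
apply/funext => x /=; rewrite patchE; case: ifPn => [/set_mem Kx|/negP Kx]; first by rewrite rst_in.
by rewrite rst_out// => /mem_set.
Qed.

Lemma rst_integrable K f : measurable (K : set (borelRn n)) -> mu.-integrable K (EFin \o f) ->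
  mu.-integrable setT (EFin \o rst K f).
Proof. by move=> mK intf; rewrite rst_patch; exact: (iffLR (integrable_mkcond _ mK) intf). Qed.

Lemma Rintegral_supp D K f : K `<=` D -> (forall x, ~ K x -> f x = 0) ->
  \int[mu]_(x in D) f x = \int[mu]_x f x.
Proof.
move=> KD f0; rewrite Rintegral_mkcond; apply: eq_Rintegral => x _; rewrite patchE; case: ifPn => // /negP xD.
by rewrite f0// => /KD/mem_set.
Qed.

Lemma partial_out (i : 'I_n) f K x : compact K -> (forall x, ~ K x -> f x = 0) -> ~ K x -> partial i f x = 0.
Proof.
move=> cK f0 nK; have oK : open (~` K) by rewrite openC; apply: compact_closed => //; exact: rV_hausdorff.
transitivity ('D_(delta_mx ord0 i) (cst (0:R)) x); last by rewrite derive_cst.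
by apply: near_eq_derive; near=> y; apply: f0; near: y; exact: open_nbhs_nbhs.
Unshelve. all: by end_near. Qed.

Definition c1c K phi := [/\ Ck 1 phi, compact K & forall x, ~ K x -> phi x = 0].

Lemma c1c_ccs K phi : c1c K phi -> ccs phi /\ forall i, ccs (partial i phi).
Proof.
move=> [[cphi dphi] cK phi0]; split; first exact: K_ccs cphi cK phi0.
move=> i; have [_ [cp _]] := dphi i; apply: (K_ccs cp cK) => x; exact: partial_out.
Qed.

Lemma c1c_der K phi i x : c1c K phi -> is_derive x (delta_mx ord0 i) phi (partial i phi x).
Proof. by move=> [[_ dphi] _ _]; have [d _] := dphi i; exact: DeriveDef. Qed.

Lemma mol_der (w : nat -> R -> R) (e : R) i (x : V) : mollifier1 e w ->
  is_derive x (delta_mx ord0 i) (mol w) (pmol w (incr (fun=> 0%N) i) x).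
Proof. by move=> mw; eapply pmol_partial; exact: mw. Qed.

Lemma mol_shift_der (w : nat -> R -> R) (e : R) i (x y : V) : mollifier1 e w ->
  is_derive y (delta_mx ord0 i) (fun y => mol w (x - y)) (- pmol w (incr (fun=> 0%N) i) (x - y)).
Proof.
move=> mw; pose v : V := delta_mx ord0 i.
have /(der_line (fun z => mol w (x - z)) y v _ 0) : is_derive (0 : R) (1 : R) (fun t : R => mol w (x - (y + t *: v))) (- pmol w (incr (fun=> 0%N) i) (x - y)).
  have d1 : is_derive (- (0 : R)) (1 : R) (fun s : R => mol w ((x - y) + s *: v)) (pmol w (incr (fun=> 0%N) i) ((x - y) + (- 0) *: v)).
    exact: (der_line (mol w) (x - y) v _ (- 0)).1 (mol_der i _ mw).
  have := der_comp (g := fun t : R => - t) d1 (der_N (der_id 0)).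
  rewrite mulrN1 oppr0 scale0r addr0; congr is_derive; apply/funext => t.
  by rewrite scaleNr opprD addrA.
by rewrite scale0r addr0.
Qed.

(** The derivative first falls on the kernel; the integral of the partial derivative of $\phi(y)
    w(x-y)$ in $y$ is zero, which moves it over to [phi]. *)
Lemma conv_partial_ibp (w : nat -> R -> R) (e : R) K phi i x : 0 < e -> mollifier1 e w -> c1c K phi ->
  partial i (conv phi (mol w)) x = conv (partial i phi) (mol w) x.
Proof.
move=> e0 mw cphi; have [ccphi ccp] := c1c_ccs cphi; have [_ cK phi0] := cphi.
have cm : ccs (mol w : V -> R) := mol_ccs e0 mw.
have cdm : ccs (pmol w (incr (fun=> 0%N) i) : V -> R) := pmol_ccs e0 mw _.
have [_ dE] := conv_partial x (ccs_integrable ccphi) cm cdm (fun y => mol_der i y mw).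
rewrite /partial dE /conv.
have D y : is_derive y (delta_mx ord0 i) (fun y => phi y * mol w (x - y))
   (partial i phi y * mol w (x - y) - phi y * pmol w (incr (fun=> 0%N) i) (x - y)).
  have := der_M (c1c_der i y cphi) (mol_shift_der i x y mw).
  by rewrite mulrN.
have pE : partial i (fun y => phi y * mol w (x - y)) = fun y => partial i phi y * mol w (x - y) - phi y * pmol w (incr (fun=> 0%N) i) (x - y).
  by apply/funext => y; rewrite /partial; have [_ ->] := D y.
have cshift (f : V -> R) : continuous f -> continuous (fun y : V => f (x - y)).
  move=> cf; suff H (y : V) : {for y, continuous (fun z : V => f (x - z))} by move=> y; exact: H.
  by apply: (continuous_comp (f := fun y : V => x - y)); [exact: cont_subl|exact: cf].
have := @integral_partial0 R n i (fun y => phi y * mol w (x - y)) K cK.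
rewrite pE => H.
have {}H : (\int[mu]_y (partial i phi y * mol w (x - y) - phi y * pmol w (incr (fun=> 0%N) i) (x - y))%:E = 0)%E.
  apply: H.
  - by move=> y /phi0 ->; rewrite mul0r.
  - by move=> y; have [] := D y.
  - suff Q (y : V) : {for y, continuous (fun y => partial i phi y * mol w (x - y) - phi y * pmol w (incr (fun=> 0%N) i) (x - y))}.
      by move=> y; exact: Q.
    apply: continuousB; apply: continuousM.
    + exact: (ccp i).1.
    + exact: (cshift _ cm.1 y).
    + exact: ccphi.1.
    + exact: (cshift _ cdm.1 y).
apply/esym/eqP; rewrite -subr_eq0 -RintegralB; [|exact: measurableT| |]; last 2 first.
- exact: (conv_integrable _ (ccs_integrable (ccp i)) cm).
- exact: (conv_integrable _ (ccs_integrable ccphi) cdm).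
by rewrite /Rintegral H.
Qed.

(** Mollifications of a $C^1$ function converge uniformly with their first derivatives and keep
    their supports in one compact subset of [D], so an identity with locally integrable coefficients
    passes to the limit. *)
Lemma test_extension D (A : 'I_n -> V -> R) (B : V -> R) : open D ->
  (forall K, compact K -> K `<=` D -> (forall i, mu.-integrable K (EFin \o A i)) /\ mu.-integrable K (EFin \o B)) ->
  (forall phi, test_function D phi ->
     \int[mu]_(x in D) (\sum_(i < n) A i x * partial i phi x + B x * phi x) = 0) ->
  forall K phi, c1c K phi -> K `<=` D ->
     \int[mu]_(x in D) (\sum_(i < n) A i x * partial i phi x + B x * phi x) = 0.
Proof.
move=> oD iAB H K phi cphi KD; have [ccphi ccp] := c1c_ccs cphi; have [_ cK phi0] := cphi.
have [r [K1 [r0 cK1 K1D KK1]]] := compact_nbhd cK oD KD.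
have [iA0 iB0] := iAB K1 cK1 K1D.
have mK1 := compact_measurable_Rn cK1.
pose a i := rst K1 (A i); pose b := rst K1 B.
have ia i : mu.-integrable setT (EFin \o a i) by apply: rst_integrable.
have ib : mu.-integrable setT (EFin \o b) by apply: rst_integrable.
pose F (psi : V -> R) x := \sum_(i < n) a i x * partial i psi x + b x * psi x.
have LE psi : c1c K1 psi -> \int[mu]_(x in D) (\sum_(i < n) A i x * partial i psi x + B x * psi x) = \int[mu]_x F psi x.
  move=> [_ _ psi0]; rewrite (Rintegral_supp K1D); last first.
    move=> x nx; rewrite psi0// mulr0 addr0 big1// => i _.
    by rewrite (partial_out i cK1 psi0 nx) mulr0.
  apply: eq_Rintegral => x _; rewrite /F; have [Kx|nx] := pselect (K1 x).
    by rewrite /b rst_in//; congr (_ + _); apply: eq_bigr => i _; rewrite /a rst_in.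
  rewrite psi0// !mulr0 !addr0 !big1// => i _; by rewrite (partial_out i cK1 psi0 nx) mulr0.
have KsK1 : K `<=` K1 by move=> x Kx; apply: (KK1 x) => //; rewrite subrr normr0 ltW.
have cphi1 : c1c K1 phi by have [h _ _] := cphi; split => // x nx; apply: phi0 => /KsK1.
have isum (s : seq 'I_n) (f : 'I_n -> V -> R) : (forall i, mu.-integrable setT (EFin \o f i)) -> mu.-integrable setT (EFin \o (fun x => \sum_(i <- s) f i x)).
  move=> intf; elim: s => [|i s IH].
    rewrite (_ : EFin \o _ = cst 0%E); first exact: integrable0.
    by apply/funext => x /=; rewrite big_nil.
  under [X in EFin \o X]eq_fun do rewrite big_cons; exact: integrableDr.
have iF psi : c1c K1 psi -> mu.-integrable setT (EFin \o F psi).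
  move=> cpsi; have [cc ccq] := c1c_ccs cpsi; apply: integrableDr; last first.
    have [C _ hC] := ccs_bound cc; apply: (integrable_Mbounded ib _ hC).
    exact: integrable_mfun (ccs_integrable cc).
  apply: isum => i; have [C _ hC] := ccs_bound (ccq i); apply: (integrable_Mbounded (ia i) _ hC).
  exact: integrable_mfun (ccs_integrable (ccq i)).
pose S : R := \int[mu]_x (\sum_(i < n) `|a i x| + `|b x|).
have iS : mu.-integrable setT (EFin \o (fun x => \sum_(i < n) `|a i x| + `|b x|)).
  by apply: integrableDr; [apply: isum => i|]; exact: integrable_norm.
have S0 : 0 <= S by apply: Rintegral_ge0 => x _; rewrite addr_ge0// sumr_ge0.
have S1 : 0 < S + 1 by rewrite ltr_wpDl.
rewrite (LE _ cphi1); apply/eqP; rewrite -normr_le0; apply/ler_addgt0Pr => eta eta0; rewrite add0r.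
have h0 : 0 < eta / (S + 1) by rewrite divr_gt0.
have [d0 d00 dP0] := mol_approx ccphi h0.
have /choice[dd ddP] : forall i, exists d, 0 < d /\ forall e w, 0 < e -> e < d -> mollifier1 e w -> forall x,
   `|conv (partial i phi) (mol w) x - partial i phi x| <= eta / (S + 1).
  move=> i; have [d d1 dP] := mol_approx (ccp i) h0; exists d; split => // e w e0 ed mw x.
  by have [] := dP e w e0 ed mw x.
pose m := \big[Num.min/Num.min r d0]_(i < n) dd i.
have m0 : 0 < m.
  rewrite /m; elim/big_ind : _ => [|x y x0 y0|i _]; first by rewrite lt_min r0.
    by rewrite lt_min x0.
  by have [] := ddP i.
pose e := m / 2; have e0 : 0 < e by rewrite divr_gt0.
have em : e < m by rewrite ltr_pdivrMr// ltr_pMr// ltr1n.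
have er : e < r by apply: lt_le_trans em _; apply: le_trans (bigmin_le_id _ _ _ _) _; rewrite ge_min lexx.
have ed0 : e < d0 by apply: lt_le_trans em _; apply: le_trans (bigmin_le_id _ _ _ _) _; rewrite ge_min lexx orbT.
have edd i : e < dd i by apply: lt_le_trans em _; exact: bigmin_le_cond.
have [w mw] := mollifier1_exists e0.
pose phie := conv phi (mol w).
have sm : smooth phie by exact: (conv_smooth e0 mw _ (ccs_integrable ccphi)).
have out x : ~ K1 x -> phie x = 0.
  move=> nx; apply: (conv_supp e0 mw (K := K)) => // y Ky; rewrite leNgt; apply/negP => xy; apply: nx.
  by apply: (KK1 y) => //; rewrite distrC ltW// (lt_trans xy).
have c1e : c1c K1 phie by split => //; exact: (sm 1%N).
have He : \int[mu]_x F phie x = 0.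
  rewrite -(LE _ c1e); apply: H; split => //; exists K1; split => //.
rewrite -[X in `|X|]subr0 -He -RintegralB; [|exact: measurableT|exact: iF|exact: iF].
apply: le_trans (le_normr_Rintegral _ _) _; [exact: measurableT|exact: integrableBr (iF _ _) (iF _ _)|].
apply: (@le_trans _ _ (\int[mu]_x ((eta / (S + 1)) * (\sum_(i < n) `|a i x| + `|b x|)))).
  apply: le_Rintegral; [exact: measurableT|exact: integrable_norm (integrableBr (iF _ _) (iF _ _))|exact: integrableZ|].
  move=> x _; rewrite /F opprD addrACA -sumrB -mulrBr; apply: le_trans (ler_normD _ _) _.
  rewrite [leRHS]mulrDr; apply: lerD; last first.
    rewrite normrM mulrC ler_wpM2r// distrC; by have [] := dP0 e w e0 ed0 mw x.
  apply: le_trans (ler_norm_sum _ _ _) _; rewrite mulr_sumr; apply: ler_sum => i _.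
  rewrite -mulrBr normrM mulrC ler_wpM2r// distrC (conv_partial_ibp i x e0 mw cphi).
  by have [_ Q] := ddP i; exact: (Q _ _ e0 (edd i) mw x).
rewrite RintegralZl; [|exact: measurableT|exact: iS].
by rewrite -/S mulrAC ler_pdivrMr// ler_wpM2l ?(ltW eta0)// lerDl.
Qed.

End test_extension.

(** * The field $|X|^{p-2}X$ *)

Section p_field.
Context {R : realType} {n : nat}.
Local Notation V := 'rV[R]_n.
Implicit Types (x y : V) (s t p q : R).

Lemma dotC x y : dot x y = dot y x.
Proof. by apply: eq_bigr => i _; rewrite mulrC. Qed.

Lemma dotDl x y z : dot (x + y : V) z = dot x z + dot y z.
Proof. by rewrite /dot -big_split; apply: eq_bigr => i _; rewrite !mxE mulrDl. Qed.

Lemma dotZl s x y : dot (s *: x) y = s * dot x y.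
Proof. by rewrite /dot mulr_sumr; apply: eq_bigr => i _; rewrite !mxE mulrA. Qed.

Lemma dotDr x y z : dot z (x + y : V) = dot z x + dot z y.
Proof. by rewrite !(dotC z) dotDl. Qed.

Lemma dotZr s x y : dot x (s *: y) = s * dot x y.
Proof. by rewrite !(dotC x) dotZl. Qed.

Lemma dotNl x y : dot (- x) y = - dot x y.
Proof. by rewrite -scaleN1r dotZl mulN1r. Qed.

Lemma dotNr x y : dot x (- y) = - dot x y.
Proof. by rewrite !(dotC x) dotNl. Qed.

Lemma dot_ge0 x : 0 <= dot x x.
Proof. by apply: sumr_ge0 => i _; rewrite -expr2 sqr_ge0. Qed.

Lemma enorm_ge0 x : 0 <= enorm x.
Proof. exact: sqrtr_ge0. Qed.

Lemma enorm_sq x : enorm x ^+ 2 = dot x x.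
Proof. by rewrite sqr_sqrtr// dot_ge0. Qed.

Lemma coord_le_enorm x i : `|x ord0 i| <= enorm x.
Proof.
rewrite -(@ler_sqr _ `|x ord0 i|) ?nnegrE ?enorm_ge0// enorm_sq real_normK ?num_real// expr2 /dot.
by rewrite (bigD1 i)//= lerDl sumr_ge0// => j _; rewrite -expr2 sqr_ge0.
Qed.

Lemma enorm0_eq x : enorm x = 0 -> x = 0.
Proof.
move=> x0; apply/rowP => i; rewrite mxE; apply/eqP; rewrite -normr_le0 -x0.
exact: coord_le_enorm.
Qed.

Lemma enorm0 : enorm (0 : V) = 0.
Proof. by apply/eqP; rewrite -sqrf_eq0 enorm_sq /dot big1// => i _; rewrite mxE mul0r. Qed.

Lemma enorm_le_sum x : enorm x <= \sum_i `|x ord0 i|.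
Proof.
rewrite -(@ler_sqr _ (enorm x)) ?nnegrE ?enorm_ge0 ?sumr_ge0// enorm_sq /dot expr2.
rewrite mulr_suml; apply: ler_sum => i _; rewrite -[leLHS]ger0_norm -?expr2 ?sqr_ge0// normrX expr2.
by rewrite ler_wpM2l// (bigD1 i)//= lerDl sumr_ge0.
Qed.

Lemma cauchy_schwarz x y : dot x y <= enorm x * enorm y.
Proof.
have [x0|x0] := eqVneq (enorm x) 0.
  by rewrite x0 mul0r (enorm0_eq x0) /dot big1// => i _; rewrite mxE mul0r.
have [y0|y0] := eqVneq (enorm y) 0.
  by rewrite y0 mulr0 (enorm0_eq y0) /dot big1// => i _; rewrite mxE mulr0.
have xy0 : 0 < enorm x * enorm y by rewrite mulr_gt0// lt_neqAle eq_sym ?x0 ?y0 enorm_ge0.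
have := dot_ge0 (enorm y *: x - enorm x *: y).
rewrite dotDl !dotDr !dotNl !dotNr !dotZl !dotZr -!enorm_sq (dotC y x).
set a := enorm x; set b := enorm y; set d := dot x y => H.
rewrite -subr_ge0 -(pmulr_rge0 _ xy0) -/a -/b.
have -> : a * b * (a * b - d) = (b * (b * a ^+ 2) - a * (b * d) - (a * (b * d) - a * (a * b ^+ 2))) / 2 by field.
by apply: divr_ge0 => //; move: H; rewrite -/a -/b -/d => H; apply: le_trans H _; rewrite le_eqVlt; apply/orP; left; apply/eqP; ring.
Qed.

Lemma enormN x : enorm (- x) = enorm x.
Proof. by rewrite /enorm dotNl dotNr opprK. Qed.

Lemma enormZ s x : enorm (s *: x) = `|s| * enorm x.
Proof. by rewrite /enorm dotZl dotZr mulrA -expr2 sqrtrM ?sqr_ge0// sqrtr_sqr. Qed.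

Lemma enorm_triangle x y : enorm (x + y) <= enorm x + enorm y.
Proof.
rewrite -(@ler_sqr _ (enorm (x + y))) ?nnegrE ?addr_ge0 ?enorm_ge0// enorm_sq dotDl !dotDr -!enorm_sq.
have := cauchy_schwarz x y; rewrite (dotC y x); lra.
Qed.

Lemma powR_pred p s : 1 < p -> 0 <= s -> s `^ (p - 2) * s = s `^ (p - 1).
Proof.
move=> p1; rewrite le_eqVlt => /predU1P[<-|s0].
  by rewrite mulr0 powR0// lt0r_neq0// subr_gt0.
by rewrite -{2}(powRr1 (ltW s0)) -powRD ?(gt_eqF s0)//; [congr (_ `^ _); lra|rewrite implybT].
Qed.

Definition pfield p x : V := enorm x `^ (p - 2) *: x.

Lemma pfield_enorm p x : 1 < p -> enorm (pfield p x) = enorm x `^ (p - 1).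
Proof. by move=> p1; rewrite enormZ ger0_norm ?powR_ge0// powR_pred// enorm_ge0. Qed.

(** Cauchy-Schwarz replaces the mixed products by products of lengths, which reduces the claim to
    the monotonicity of $s \mapsto s^{p-1}$ on nonnegative reals. *)
Lemma pfield_mono p x y : 1 < p -> 0 <= dot (pfield p x - pfield p y) (x - y).
Proof.
move=> p1; rewrite dotDl !dotDr !dotNl !dotNr !dotZl -!enorm_sq (dotC y x).
set S := enorm x `^ _; set T := enorm y `^ _.
have := cauchy_schwarz x y; set s := enorm x; set t := enorm y; set d := dot x y => H.
have S0 : 0 <= S by exact: powR_ge0.
have T0 : 0 <= T by exact: powR_ge0.
have st : 0 <= (S * s - T * t) * (s - t).
  have mono a b : 0 <= a -> a <= b -> a `^ (p - 1) <= b `^ (p - 1).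
    move=> a0 ab; apply: ge0_ler_powR; rewrite ?nnegrE ?subr_ge0 ?(ltW p1)//; exact: (le_trans a0 ab).
  rewrite /S /T (powR_pred p1 (enorm_ge0 x)) (powR_pred p1 (enorm_ge0 y)) -/s -/t.
  have [le|/ltW le] := leP s t.
    by apply: mulr_le0; rewrite subr_le0 ?mono// enorm_ge0.
  by apply: mulr_ge0; rewrite subr_ge0 ?mono// enorm_ge0.
have h1 : S * d <= S * (s * t) by rewrite ler_wpM2l.
have h2 : T * d <= T * (s * t) by rewrite ler_wpM2l.
by move: st; nra.
Qed.

(** The summand 1 covers the case $p = 0$ of the empty sum, whose power is then 1. *)
Lemma powR_sum_le (I : Type) (r : seq I) p : 0 <= p -> exists2 C : R, 0 <= C &
  forall a : I -> R, (forall i, 0 <= a i) -> (\sum_(i <- r) a i) `^ p <= C * (1 + \sum_(i <- r) a i `^ p).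
Proof.
move=> p0; elim: r => [|i r [C C0 IH]].
  exists 1 => // a _; rewrite !big_nil addr0 mulr1.
  have [->|pn0] := eqVneq p 0; first by rewrite powRr0.
  by rewrite powR0.
exists (2 `^ p * (1 + C)); first by rewrite mulr_ge0 ?powR_ge0 ?addr_ge0.
move=> a a0; rewrite !big_cons.
apply: le_trans (powR_add_le p0 (a0 i) _) _; first exact: sumr_ge0.
rewrite -mulrA ler_wpM2l ?powR_ge0//; have := IH _ a0.
set S := \sum_(j <- r) a j `^ p; have S0 : 0 <= S by apply: sumr_ge0 => j _; exact: powR_ge0.
have A0 : 0 <= a i `^ p by exact: powR_ge0.
have : 0 <= C * a i `^ p by exact: mulr_ge0.
move: A0 S0; set A := a i `^ p; set B := _ `^ p; lra.
Qed.

Lemma cont_coord (i : 'I_n) : continuous (fun x : V => x ord0 i).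
Proof. exact: coord_continuous. Qed.

Lemma dot_continuous (T : topologicalType) (f g : T -> V) (x : T) : {for x, continuous f} -> {for x, continuous g} ->
  {for x, continuous (fun z => dot (f z) (g z))}.
Proof.
move=> cf cg; rewrite /dot.
have H (s : seq 'I_n) : {for x, continuous (fun z => \sum_(i <- s) f z ord0 i * g z ord0 i)}.
  elim: s => [|i s IH].
    by rewrite (_ : (fun _ => _) = cst 0); [exact: cst_continuous|apply/funext => z; rewrite big_nil].
  rewrite (_ : (fun _ => _) = fun z => f z ord0 i * g z ord0 i + \sum_(i <- s) f z ord0 i * g z ord0 i); last first.
    by apply/funext => z; rewrite big_cons.
  apply: continuousD => //; apply: continuousM.
    exact: (continuous_comp (f := f) cf (@cont_coord i _)).
  exact: (continuous_comp (f := g) cg (@cont_coord i _)).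
exact: H.
Qed.

Lemma enorm_continuous : continuous (@enorm R n).
Proof.
suff H (x : V) : {for x, continuous (@enorm R n)} by move=> x; exact: H.
apply: (continuous_comp (f := fun x : V => dot x x)); last exact: sqrt_continuous.
by apply: dot_continuous; exact: cvg_id.
Qed.

End p_field.

(** * Integrability of the field and mollified weak gradients *)

Section weak_gradients.
Context {R : realType} {n : nat}.
Local Notation V := 'rV[R]_n.
Local Notation mu := (@lebesgue_Rn R n).
Implicit Types (f h : V -> R) (g : V -> V) (x y : V) (D K : set V).

Lemma compact_bounded_support K f : compact K -> (forall x, ~ K x -> f x = 0) -> bounded_support f.
Proof.
move=> cK f0; have [M [_ MK]] := compact_norm_bound cK; exists M => x Mx; apply: f0 => Kx.
by have := MK x Kx; rewrite leNgt Mx.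
Qed.

Lemma rst_measurable D K f : open D -> compact K -> K `<=` D ->
  measurable_fun (D : set (borelRn n)) (f : borelRn n -> R) ->
  measurable_fun [set: borelRn n] (rst K f : borelRn n -> R).
Proof.
move=> oD cK KD mf; have mK := compact_measurable_Rn cK.
have mKf : measurable_fun (K : set (borelRn n)) (f : borelRn n -> R).
  by apply: measurable_funS mf => //; exact: open_measurable_Rn.
rewrite (_ : (rst K f : borelRn n -> R) = (f : borelRn n -> R) \_ K).
  exact: (iffLR (measurable_restrictT _ mK) mKf).
apply/funext => x; rewrite patchE; case: ifPn => [/set_mem Kx|/negP Kx]; first by rewrite rst_in.
by rewrite rst_out// => /mem_set.
Qed.

Lemma Lp_loc_lp (p : R) D K f : 0 < p -> open D -> compact K -> K `<=` D -> Lp_loc p D f -> lp p (rst K f).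
Proof.
move=> p0 oD cK KD [mf fK]; split.
- exact: (rst_measurable oD cK KD mf).
- by apply: (compact_bounded_support cK) => x; exact: rst_out.
- have := fK K cK KD; rewrite [X in (X < _)%E -> _]integral_mkcond; congr (_ < _)%E.
  apply: eq_integral => x _; rewrite patchE; case: ifPn => [/set_mem Kx|/negP Kx]; first by rewrite rst_in.
  by rewrite rst_out ?normr0 ?powR0 ?gt_eqF// => /mem_set.
Qed.

Lemma rst_integrableP K f : compact K -> mu.-integrable setT (EFin \o rst K f) -> mu.-integrable K (EFin \o f).
Proof.
by move=> cK; rewrite rst_patch => h; exact: (iffRL (integrable_mkcond _ (compact_measurable_Rn cK)) h).
Qed.

Lemma lp_dominated (q : R) K f (G : V -> R) : compact K -> (forall x, ~ K x -> f x = 0) ->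
  measurable_fun [set: borelRn n] (f : borelRn n -> R) -> mu.-integrable setT (EFin \o G) ->
  (forall x, `|f x| `^ q <= G x) -> lp q f.
Proof.
move=> cK f0 mf iG fG; split => //; first exact: (compact_bounded_support cK f0).
have /integrableP[_] : mu.-integrable setT (EFin \o (fun x => `|f x| `^ q)).
  apply: (integrable_le iG); first exact: measurable_abs_powR.
  by move=> x; rewrite ger0_norm ?powR_ge0.
congr (_ < _)%E; apply: eq_integral => x _ /=.
by rewrite ger0_norm ?powR_ge0.
Qed.

Lemma enorm_measurable g : (forall i, measurable_fun [set: borelRn n] (fun x : borelRn n => g x ord0 i)) ->
  measurable_fun [set: borelRn n] (fun x : borelRn n => enorm (g x)).
Proof.
move=> mg; apply: (measurableT_comp (f := @Num.sqrt R)); first by apply: continuous_measurable_fun; exact: sqrt_continuous.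
by apply: measurable_sum => i; exact: measurable_funM.
Qed.

Lemma integrable_sumr (I : Type) (s : seq I) (f : I -> V -> R) :
  (forall i, mu.-integrable setT (EFin \o f i)) -> mu.-integrable setT (EFin \o (fun x => \sum_(i <- s) f i x)).
Proof.
move=> intf; elim: s => [|i s IH].
  rewrite (_ : EFin \o _ = cst 0%E); first exact: integrable0.
  by apply/funext => x /=; rewrite big_nil.
by under [X in EFin \o X]eq_fun do rewrite big_cons; exact: integrableDr.
Qed.

Lemma compact_bounded_at K f : compact K -> (forall x, K x -> {for x, continuous f}) ->
  exists M : R, 0 < M /\ forall x, K x -> `|f x| <= M.
Proof.
move=> cK cf; have /compact_bounded[M [Mr h]] : compact (f @` K).
  by apply: continuous_compact cK; apply: continuous_in_subspaceT => x /set_mem; exact: cf.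
exists (Num.max M 0 + 1); split; first by rewrite ltr_pwDr// le_max lexx orbT.
by move=> x Kx; apply: (h (Num.max M 0 + 1)); [rewrite ltr_pwDr// le_max lexx|exists x].
Qed.

Lemma rst_bcs D K f : open D -> compact K -> K `<=` D -> (forall x, D x -> {for x, continuous f}) -> bcs (rst K f).
Proof.
move=> oD cK KD cf; split.
  by apply: (rst_measurable oD cK KD); apply: open_continuous_measurable_Rn => // x /set_mem; exact: cf.
have [M [M0 fM]] := compact_bounded_at cK (fun x Kx => cf x (KD x Kx)).
have [N [N0 KN]] := compact_norm_bound cK.
exists (M + N); split => x.
  have [Kx|Kx] := pselect (K x); first by rewrite rst_in//; apply: le_trans (fM _ Kx) _; rewrite lerDl ltW.
  by rewrite rst_out// normr0 addr_ge0// ltW.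
move=> Mx; apply: rst_out => /KN; apply/negP; rewrite -ltNge; apply: le_lt_trans Mx.
by rewrite lerDr ltW.
Qed.

(** The relation $(p-1)q = p$ turns the power [q] of $|X|^{p-1}$ into $|X|^p$, which is controlled
    by the powers of the coordinates. *)
Lemma pfield_lp (p q : R) K g i : 1 < p -> (p - 1) * q = p -> compact K ->
  (forall j, lp p (rst K (fun x => g x ord0 j))) -> lp q (rst K (fun x => pfield p (g x) ord0 i)).
Proof.
move=> p1 pq cK lg; have p0 : 0 < p by apply: lt_trans p1.
have p10 : 0 < p - 1 by rewrite subr_gt0.
have q0 : 0 < q by rewrite -(pmulr_rgt0 _ p10) pq.
have mK := compact_measurable_Rn cK.
have [C C0 HC] := powR_sum_le (enum 'I_n) (ltW p0).
pose gK x : V := \row_j rst K (fun x => g x ord0 j) x.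
have gKE x : K x -> gK x = g x by move=> Kx; apply/rowP => j; rewrite mxE rst_in.
have mgK j : measurable_fun [set: borelRn n] (fun x : borelRn n => gK x ord0 j).
  rewrite (_ : (fun _ => _) = rst K (fun x => g x ord0 j)); first by have [] := lg j.
  by apply/funext => x; rewrite mxE.
have mE := enorm_measurable mgK.
have RE : rst K (fun x => pfield p (g x) ord0 i) = fun x => pfield p (gK x) ord0 i.
  apply/funext => x; have [Kx|nx] := pselect (K x); first by rewrite rst_in// gKE.
  rewrite rst_out//; rewrite (_ : gK x = 0) ?/pfield ?scaler0 ?mxE//.
  by apply/rowP => j; rewrite !mxE rst_out.
apply: (lp_dominated (K := K) (G := fun x => C * (\1_K x + \sum_(j <- enum 'I_n) `|rst K (fun x => g x ord0 j) x| `^ p)) cK).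
- by move=> x nx; exact: rst_out.
- rewrite RE; rewrite (_ : (fun _ => _) = fun x : borelRn n => (enorm (gK x)) `^ (p - 2) * gK x ord0 i).
    apply: measurable_funM; last exact: mgK.
    by apply: (measurableT_comp (f := fun t : R => t `^ (p - 2))) => //; exact: measurable_powR.
  by apply/funext => x; rewrite /pfield mxE.
- apply: integrableZ; apply: integrableDr; last first.
    by apply: integrable_sumr => j; exact: lp_powR_integrable.
  rewrite (_ : EFin \o _ = EFin \o rst K (fun=> 1)); last first.
    by apply/funext => x /=; rewrite /rst mul1r.
  by apply: bcs_integrable; apply: (rst_bcs openT cK) => // x _; exact: cst_continuous.
- move=> x; have [Kx|nx] := pselect (K x); last first.
    rewrite rst_out// normr0 powR0 ?gt_eqF// mulr_ge0// addr_ge0//.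
    by apply: sumr_ge0 => j _; exact: powR_ge0.
  have -> : (\1_K x : R) = 1 by rewrite indicE mem_set.
  have -> : \sum_(j <- enum 'I_n) `|rst K (fun x => g x ord0 j) x| `^ p = \sum_(j <- enum 'I_n) `|g x ord0 j| `^ p.
    by apply: eq_bigr => j _; rewrite rst_in.
  apply: le_trans (HC (fun j => `|g x ord0 j|) _); last by [].
  apply: (@le_trans _ _ (enorm (g x) `^ p)).
    rewrite -[in leRHS]pq powRrM; apply: ge0_ler_powR; rewrite ?nnegrE ?powR_ge0 ?(ltW q0)//.
    by rewrite rst_in// -(pfield_enorm _ p1); exact: coord_le_enorm.
  apply: ge0_ler_powR; rewrite ?nnegrE ?enorm_ge0 ?(ltW p0) ?sumr_ge0//.
  by rewrite big_enum; exact: enorm_le_sum.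
Qed.

Lemma mol_shift_smooth (w : nat -> R -> R) (e : R) x : mollifier1 e w -> smooth (fun y => mol w (x - y)).
Proof.
move=> mw m.
suff H k (c : R) : Ck m (fun y => c * pmol w k (x - y)).
  by have := H (fun=> 0%N) 1; rewrite (_ : (fun _ => _) = fun y => mol w (x - y))//; apply/funext => y; rewrite mul1r.
have der k' (c' : R) i y : is_derive y (delta_mx ord0 i) (fun y => c' * pmol w k' (x - y)) (- c' * pmol w (incr k' i) (x - y)).
  pose v : V := delta_mx ord0 i.
  have /(der_line (fun z => pmol w k' (x - z)) y v _ 0) d2 : is_derive (0 : R) (1 : R) (fun t : R => pmol w k' (x - (y + t *: v))) (- pmol w (incr k' i) (x - y)).
    have d1 : is_derive (- (0 : R)) (1 : R) (fun s : R => pmol w k' ((x - y) + s *: v)) (pmol w (incr k' i) ((x - y) + (- 0) *: v)).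
      exact: (der_line (pmol w k') (x - y) v _ (- 0)).1 (pmol_partial mw _ _ _).
    have := der_comp (g := fun t : R => - t) d1 (der_N (der_id 0)).
    rewrite mulrN1 oppr0 scale0r addr0; congr is_derive; apply/funext => t.
    by rewrite scaleNr opprD addrA.
  rewrite scale0r addr0 in d2.
  have := der_M (der_cst y (delta_mx ord0 i) c') d2.
  by rewrite mul0r add0r mulrN mulNr.
have cc k' (c' : R) : continuous (fun y => c' * pmol w k' (x - y)).
  suff Q (y : V) : {for y, continuous (fun z : V => c' * pmol w k' (x - z))} by move=> y; exact: Q.
  apply: continuousM; first exact: cst_continuous.
  by apply: (continuous_comp (f := fun y : V => x - y)); [exact: cont_subl|exact: (pmol_continuous mw)].
elim: m k c => [|m IH] k c; split; try exact: cc; try by [].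
move=> i; split; first by move=> y; have [] := der k c i y.
rewrite (_ : partial i _ = fun y => - c * pmol w (incr k i) (x - y)); first exact: IH.
by apply/funext => y; rewrite /partial; have [_ ->] := der k c i y.
Qed.

(** For [x] in [K] the kernel $y \mapsto w(x - y)$ is a test function supported in [K3], so the
    definition of the weak gradient applies to it; its sign and the one from reflecting the kernel
    cancel. *)
Lemma weak_mollify D h g K K3 (r : R) : open D -> compact K3 -> K3 `<=` D -> 0 < r ->
  (forall x y, K x -> `|x - y| <= r -> K3 y) -> (forall x, D x -> {for x, continuous h}) ->
  (forall i, mu.-integrable setT (EFin \o rst K3 (fun x => g x ord0 i))) -> weak_gradient D h g ->
  forall e w, 0 < e -> e <= r -> mollifier1 e w -> forall x, K x -> forall i,
    is_derive x (delta_mx ord0 i) (conv (rst K3 h) (mol w)) (conv (rst K3 (fun x => g x ord0 i)) (mol w) x).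
Proof.
move=> oD cK3 K3D r0 KK3 ch ig wg e w e0 er mw x Kx i.
have ih : mu.-integrable setT (EFin \o rst K3 h) by apply: bcs_integrable; exact: (rst_bcs oD).
have cm : ccs (mol w : V -> R) := mol_ccs e0 mw.
have cdm : ccs (pmol w (incr (fun=> 0%N) i) : V -> R) := pmol_ccs e0 mw _.
have mout y : ~ K3 y -> mol w (x - y) = 0.
  move=> ny; apply: (mol_supp e0 mw); rewrite leNgt; apply/negP => xy; apply: ny.
  by apply: (KK3 x) => //; rewrite ltW// (lt_le_trans xy).
have pE y : partial i (fun y => mol w (x - y)) y = - pmol w (incr (fun=> 0%N) i) (x - y).
  by have [_] := mol_shift_der i x y mw.
have tst : test_function D (fun y => mol w (x - y)).
  by split; [exact: mol_shift_smooth mw|exists K3].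
have pout y : ~ K3 y -> partial i (fun y => mol w (x - y)) y = 0 by exact: partial_out.
have := conv_partial x ih cm cdm (fun y => mol_der i y mw); congr is_derive.
have := wg _ tst i.
rewrite (Rintegral_supp K3D); last by move=> y ny; rewrite pout// mulr0.
rewrite (Rintegral_supp K3D); last by move=> y ny; rewrite mout// mulr0.
move=> H; transitivity (- \int[mu]_y (h y * partial i (fun y => mol w (x - y)) y)).
  have -> : \int[mu]_y (h y * partial i (fun y => mol w (x - y)) y) =
      \int[mu]_y (-1 * (rst K3 h y * pmol w (incr (fun=> 0%N) i) (x - y))).
    apply: eq_Rintegral => y _; have [K3y|ny] := pselect (K3 y); first by rewrite rst_in// pE mulN1r mulrN.
    by rewrite pout// rst_out// mul0r !mulr0.
  by rewrite RintegralZl; [rewrite mulN1r opprK|exact: measurableT|exact: (conv_integrable x ih cdm)].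
rewrite H opprK; apply: eq_Rintegral => y _.
by have [K3y|ny] := pselect (K3 y); [rewrite rst_in|rewrite rst_out// mout// !mulr0].
Qed.

End weak_gradients.

(** * Squares of positive parts, and gluing with zero *)

Section positive_part_square.
Context {R : realType}.

Lemma within_cont_distP {V W : normedModType R} (A : set V) (f : V -> W) : {within A, continuous f} <->
  (forall x, A x -> forall e : R, 0 < e -> exists2 d : R, 0 < d & forall y, A y -> `|x - y| < d -> `|f x - f y| < e).
Proof.
split => [/subspace_continuousP cf x Ax e e0|H].
  have /(_ (ball (f x) e))/(_ (nbhsx_ballx _ _ e0))/nbhs_ballP[d /= d0 dP] := cf x Ax.
  exists d => // y Ay xy; have : ball (f x) e (f y) by apply: dP => //; rewrite -ball_normE.
  by rewrite -ball_normE.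
apply/subspace_continuousP => x Ax; apply/cvgrPdist_lt => e e0.
have [d d0 dP] := H x Ax e e0; apply/nbhs_ballP; exists d => // y.
by rewrite -ball_normE /= => xy Ay; exact: dP.
Qed.

(** Settles the two places where rules of differentiation do not apply: the corner of the positive
    part, and the axis of a half space. *)
Lemma der_quadratic (f : R -> R) (C : R) : 0 < C -> (\forall t \near 0, `|f t - f 0| <= C * t ^+ 2) ->
  is_derive (0 : R) (1 : R) f 0.
Proof.
move=> C0 H; suff L : (fun h : R => h^-1 *: ((f \o shift (0:R)) (h *: (1:R)) - f 0)) h @[h --> 0^'] --> (0 : R).
  by split; [apply/cvg_ex; exists 0|exact/cvg_lim].
apply/cvgrPdist_lt => e e0; near=> h.
have h0 : h != 0 by near: h; exact: nbhs_dnbhs_neq.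
rewrite sub0r normrN /= addr0 [h *: _]mulr1 normrM normfV.
apply: (@le_lt_trans _ _ (C * `|h|)); last first.
  by rewrite mulrC -ltr_pdivlMr//; near: h; apply: dnbhs0_lt; rewrite divr_gt0.
rewrite mulrC ler_pdivrMr ?normr_gt0// -mulrA -expr2 real_normK ?num_real//.
by near: h; exact: nbhs_dnbhs.
Unshelve. all: by end_near. Qed.

Definition pos (s : R) : R := Num.max s 0.

Lemma pos_ge0 s : 0 <= pos s. Proof. by rewrite le_max lexx orbT. Qed.

Lemma pos_lip s t : `|pos s - pos t| <= `|s - t|.
Proof.
rewrite /pos /Num.max; case: (ltP s 0) => s0; case: (ltP t 0) => t0; rewrite ?subrr ?normr0//.
- by rewrite sub0r normrN ger0_norm// ler0_norm; lra.
- by rewrite subr0 !ger0_norm//; lra.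
Qed.

Lemma pos_id s : 0 <= s -> pos s = s. Proof. by rewrite /pos => s0; rewrite max_l. Qed.
Lemma pos_0 s : s <= 0 -> pos s = 0. Proof. by rewrite /pos => s0; rewrite max_r. Qed.

Lemma pos_continuous : continuous pos.
Proof. by move=> s; apply: continuous_max; [exact: cvg_id|exact: cst_continuous]. Qed.

Lemma der_pos2 s : is_derive s (1 : R) (fun t => pos t ^+ 2) (2 * pos s).
Proof.
have [s0|s0|->] := ltgtP s 0.
- rewrite pos_0 ?ltW// mulr0; apply: (der_near _ (der_cst _ _ 0)); near=> t.
  by rewrite pos_0 ?expr0n//; apply/ltW; near: t; exact: lt_nbhsl.
- apply: (der_near (f := fun t : R => t ^+ 2)); last first.
    by der; rewrite pos_id ?ltW// mulr1 expr1.
  near=> t; rewrite pos_id//; apply/ltW; near: t; exact: lt_nbhsr.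
- rewrite pos_0// mulr0; apply: (der_quadratic ltr01); near=> t; rewrite (@pos_0 0)// expr0n/= subr0.
  rewrite ger0_norm ?sqr_ge0//; have := pos_lip t 0; rewrite (@pos_0 0)// !subr0 => H; rewrite mul1r.
  by rewrite -(real_normK (num_real t)) -(ger0_norm (pos_ge0 t)) ler_sqr.
Unshelve. all: by end_near. Qed.

End positive_part_square.

Section glue.
Context {R : realType} {n : nat}.
Local Notation V := 'rV[R]_n.
Implicit Types (f : V -> R) (x y : V) (O K : set V).

Lemma near_eq_continuous f f' x : (\near x, f x = f' x) -> {for x, continuous f} -> {for x, continuous f'}.
Proof.
move=> E cf; have fx := nbhs_singleton E; change (f' y @[y --> x] --> f' x); rewrite -fx.
apply/(@cvgrPdist_lt _ R _ (nbhs x)) => e e0.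
near=> y; rewrite -(near E y)//; near: y.
by move/cvgrPdist_lt : cf; exact.
Unshelve. all: by end_near. Qed.

Lemma rst_near O K f x : open O -> (forall y, O y -> ~ K y -> f y = 0) -> O x -> \near x, f x = rst K f x.
Proof.
move=> oO f0 Ox; near=> y; have Oy : O y by near: y; exact: open_nbhs_nbhs.
by have [Ky|ny] := pselect (K y); [rewrite rst_in|rewrite rst_out// f0].
Unshelve. all: by end_near. Qed.

Lemma rst_near0 K f x : compact K -> ~ K x -> \near x, 0 = rst K f x.
Proof.
move=> cK nKx; have oK : open (~` K) by rewrite openC; apply: compact_closed => //; exact: rV_hausdorff.
by near=> y; rewrite rst_out//; near: y; exact: open_nbhs_nbhs.
Unshelve. all: by end_near. Qed.

Lemma rst_continuous O K f : open O -> compact K -> K `<=` O -> (forall x, O x -> ~ K x -> f x = 0) ->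
  (forall x, O x -> {for x, continuous f}) -> continuous (rst K f).
Proof.
move=> oO cK KO f0 cf x; have [Ox|nOx] := pselect (O x).
  by apply: (near_eq_continuous (rst_near oO f0 Ox)); exact: cf.
by apply: (near_eq_continuous (rst_near0 f cK _)); [move=> /KO|exact: cst_continuous].
Qed.

Lemma rst_der O K f F x v : open O -> compact K -> K `<=` O -> (forall x, O x -> ~ K x -> f x = 0) ->
  (forall x, O x -> ~ K x -> F x = 0) -> (forall x, O x -> is_derive x v f (F x)) ->
  is_derive x v (rst K f) (rst K F x).
Proof.
move=> oO cK KO f0 F0 df; have [Ox|nOx] := pselect (O x).
  rewrite -(nbhs_singleton (rst_near oO F0 Ox)).
  by apply: (der_near (rst_near oO f0 Ox)); exact: df.
have nKx : ~ K x by move=> /KO.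
by rewrite rst_out//; apply: (der_near (rst_near0 f cK nKx)); exact: der_cst.
Qed.

(** [O] and the complement of [K] are open and cover the space; the extension agrees with [f] on the
    first and with 0 on the second, so its regularity is local. *)
Lemma glue_c1c O K f (F : 'I_n -> V -> R) : open O -> compact K -> K `<=` O ->
  (forall x, O x -> ~ K x -> f x = 0) -> (forall x i, O x -> ~ K x -> F i x = 0) ->
  (forall x, O x -> {for x, continuous f}) -> (forall x i, O x -> {for x, continuous (F i)}) ->
  (forall x i, O x -> is_derive x (delta_mx ord0 i) f (F i x)) ->
  c1c K (rst K f) /\ forall i, partial i (rst K f) = rst K (F i).
Proof.
move=> oO cK KO f0 F0 cf cF df.
have dr x i : is_derive x (delta_mx ord0 i) (rst K f) (rst K (F i) x).
  exact: (rst_der _ oO cK KO f0 (fun y => F0 y i) (fun y => df y i)).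
have pE i : partial i (rst K f) = rst K (F i).
  by apply/funext => x; rewrite /partial; have [_ ->] := dr x i.
split => //; split => //; last by move=> x; exact: rst_out.
split; first exact: (rst_continuous oO).
move=> i; split; first by move=> x; have [] := dr x i.
rewrite pE; split => //; apply: (rst_continuous oO cK KO) => y Oy; [exact: F0|exact: cF].
Qed.

End glue.

(** * Limit of the energy integral under mollification *)

Section energy_limit.
Context {R : realType} {n : nat}.
Local Notation V := 'rV[R]_n.
Local Notation mu := (@lebesgue_Rn R n).
Implicit Types (a b c eta f : V -> R) (x y : V).

Lemma lp_norm (q : R) a : lp q a -> lp q (fun x => `|a x|).
Proof.
move=> [ma [M aM] ia]; split; first exact: measurableT_comp.
  by exists M => x /aM ->; rewrite normr0.
by under eq_integral do rewrite normr_id.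
Qed.

Lemma lp_bcs_mul (q : R) a f : 0 < q -> lp q a -> bcs f -> lp q (fun x => a x * f x).
Proof.
move=> q0 la [mf [C [fC _]]]; have [ma [M aM] ia] := la.
have C0 : 0 <= C by exact: le_trans (normr_ge0 _) (fC 0).
split; first exact: measurable_funM.
  by exists M => x /aM ->; rewrite mul0r.
have /integrableP[_] : mu.-integrable setT (EFin \o (fun x => `|a x * f x| `^ q)).
  apply: (integrable_le (integrableZ (C `^ q) (lp_powR_integrable la))).
    by apply: measurable_abs_powR; exact: measurable_funM.
  move=> x; rewrite ger0_norm ?powR_ge0// -powRM// mulrC normrM.
  apply: ge0_ler_powR; rewrite ?nnegrE ?mulr_ge0 ?(ltW q0)//.
  by apply: ler_wpM2r.
congr (_ < _)%E; apply: eq_integral => x _ /=.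
by rewrite ger0_norm ?powR_ge0.
Qed.

Lemma lp_mul_integrable (p q : R) a b : 0 < p -> 0 < q -> q^-1 + p^-1 = 1 -> lp q a -> lp p b ->
  mu.-integrable setT (EFin \o (fun x => a x * b x)).
Proof.
move=> p0 q0 qp la lb; have [ma _ _] := la; have [mb _ _] := lb.
apply: (integrable_le (integrableDr (integrableZ q^-1 (lp_powR_integrable la)) (integrableZ p^-1 (lp_powR_integrable lb)))).
  exact: measurable_funM.
move=> x; rewrite normrM !(mulrC _^-1).
by apply: conjugate_powR.
Qed.

Lemma conv_norm_le (w : nat -> R -> R) (e : R) b x : 0 < e -> mollifier1 e w ->
  mu.-integrable setT (EFin \o b) -> `|conv b (mol w) x| <= conv (fun y => `|b y|) (mol w) x.
Proof.
move=> e0 mw ib; have cm : ccs (mol w : V -> R) := mol_ccs e0 mw.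
apply: le_trans (le_normr_Rintegral _ _) _; [exact: measurableT|exact: (conv_integrable x ib cm)|].
rewrite le_eqVlt; apply/orP; left; apply/eqP; apply: eq_Rintegral => y _.
by rewrite normrM (ger0_norm (mol_ge0 mw _)).
Qed.

(** One coordinate of the energy integral, with the gradient [b] mollified and the factor [f]
    uniformly close to [eta]. The thresholds [d] and [s] come before [f], because in the application
    [f] itself depends on the mollification. *)
Lemma energy_term (p q : R) a b c eta : 1 < p -> 1 < q -> q^-1 + p^-1 = 1 -> lp q a -> lp p b -> bcs c -> bcs eta ->
  forall r : R, 0 < r -> exists d s, [/\ 0 < d, 0 < s & forall e w f, 0 < e -> e < d -> mollifier1 e w -> bcs f ->
    (forall x, `|f x - eta x| <= s) ->
    mu.-integrable setT (EFin \o (fun x => a x * (f x * (conv b (mol w) x - c x)))) /\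
    `|\int[mu]_x (a x * (f x * (conv b (mol w) x - c x))) - \int[mu]_x (a x * (eta x * (b x - c x)))| <= r].
Proof.
move=> p1 q1 qp la lb bc be r r0.
have p0 : 0 < p by apply: lt_trans p1.
have q0 : 0 < q by apply: lt_trans q1.
have ia := lp_integrable (ltW q1) la; have ib := lp_integrable (ltW p1) lb.
have lae := lp_bcs_mul q0 la be.
have [me [Ce [eC _]]] := be; have [mc [Cc [cC _]]] := bc.
(* Bounds the integral of $|a|$ times the mollified $|b|$ plus $|c|$; the [+ 1] is the tolerance at
   which [pair_cvg] is applied to $|a|$ and $|b|$. *)
pose M : R := \int[mu]_x (`|a x| * `|b x|) + 1 + \int[mu]_x (`|a x| * `|c x|).
have iac : mu.-integrable setT (EFin \o (fun x => `|a x| * `|c x|)).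
  apply: (@integrable_Mbounded _ _ _ _ Cc (integrable_norm ia)); first exact: measurableT_comp.
  by move=> y; rewrite normr_id.
have M1 : 1 <= M.
  rewrite /M -addrA addrCA lerDl addr_ge0//; apply: Rintegral_ge0 => x _; exact: mulr_ge0.
have M0 : 0 < M by apply: lt_le_trans M1.
have [d1 d10 H1] := pair_cvg p1 q1 qp lae lb (divr_gt0 r0 (ltr0Sn _ 1)).
have [d2 d20 H2] := pair_cvg p1 q1 qp (lp_norm la) (lp_norm lb) ltr01.
exists (Num.min d1 d2), (r / 2 / M); split; [by rewrite lt_min d10|by rewrite !divr_gt0|].
move=> e w f e0; rewrite lt_min => /andP[ed1 ed2] mw [mf [Cf [fC _]]] fs.
have {}H1 := H1 e w e0 ed1 mw; have {}H2 := H2 e w e0 ed2 mw.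
have cB := conv_ccs e0 mw ib (let: And3 _ h _ := lb in h).
have [CB CB0 BC] := ccs_bound cB; have mB := integrable_mfun (ccs_integrable cB).
have iabs := conv_ccs e0 mw (integrable_norm ib) (let: And3 _ h _ := lp_norm lb in h).
have [CA CA0 AC] := ccs_bound iabs; have mA := integrable_mfun (ccs_integrable iabs).
set B := conv b (mol w) in cB BC mB H1 *.
have mBc : measurable_fun [set: borelRn n] (fun x : borelRn n => B x - c x) by exact: measurable_funB.
have BcC x : `|B x - c x| <= CB + Cc by apply: le_trans (ler_normB _ _) (lerD (BC x) (cC x)).
have iF g Cg : measurable_fun [set: borelRn n] (g : borelRn n -> R) -> (forall x, `|g x| <= Cg) ->
    mu.-integrable setT (EFin \o (fun x => a x * (g x * (B x - c x)))).
  move=> mg gC; apply: (@integrable_Mbounded _ _ _ _ (Cg * (CB + Cc)) ia); first exact: measurable_funM.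
  by move=> x; rewrite normrM ler_pM.
split; first exact: (iF f Cf).
have iaeB : mu.-integrable setT (EFin \o (fun x => a x * eta x * B x)).
  exact: (integrable_Mbounded (lp_integrable (ltW q1) lae) mB BC).
have iaeb : mu.-integrable setT (EFin \o (fun x => a x * eta x * b x)) by exact: (lp_mul_integrable p0 q0 qp lae lb).
have iaec : mu.-integrable setT (EFin \o (fun x => a x * eta x * c x)).
  exact: (integrable_Mbounded (lp_integrable (ltW q1) lae) mc cC).
have -> : \int[mu]_x (a x * (eta x * (b x - c x))) = \int[mu]_x (a x * eta x * b x) - \int[mu]_x (a x * eta x * c x).
  rewrite -RintegralB; [|exact: measurableT|exact: iaeb|exact: iaec].
  by apply: eq_Rintegral => x _; rewrite mulrBr mulrBr !mulrA.
have ifd : mu.-integrable setT (EFin \o (fun x => a x * ((f x - eta x) * (B x - c x)))).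
  by apply: (@iF (fun x => f x - eta x) (r / 2 / M)) => //; exact: measurable_funB.
have -> : \int[mu]_x (a x * (f x * (B x - c x))) =
    \int[mu]_x (a x * ((f x - eta x) * (B x - c x))) + (\int[mu]_x (a x * eta x * B x) - \int[mu]_x (a x * eta x * c x)).
  rewrite -RintegralB; [|exact: measurableT|exact: iaeB|exact: iaec].
  rewrite -RintegralD; [|exact: measurableT|exact: ifd|exact: (integrableBr iaeB iaec)].
  by apply: eq_Rintegral => x _; ring.
have -> (u s t v : R) : u + (s - t) - (v - t) = u + (s - v) by ring.
rewrite [leRHS](splitr r); apply: le_trans (ler_normD _ _) (lerD _ H1).
apply: le_trans (le_normr_Rintegral _ ifd) _; first exact: measurableT.
have iaA : mu.-integrable setT (EFin \o (fun x => `|a x| * conv (fun y => `|b y|) (mol w) x)).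
  exact: (integrable_Mbounded (integrable_norm ia) mA AC).
apply: (@le_trans _ _ (\int[mu]_x (r / 2 / M * (`|a x| * conv (fun y => `|b y|) (mol w) x + `|a x| * `|c x|)))).
  apply: le_Rintegral; [exact: measurableT|exact: integrable_norm|exact: (integrableZ _ (integrableDr iaA iac))|].
  move=> x _; rewrite !normrM.
  rewrite -mulrDr [leRHS]mulrCA; apply: ler_wpM2l => //; apply: ler_pM => //.
  by apply: le_trans (ler_normB _ _) _; rewrite lerD2r; exact: (conv_norm_le _ e0 mw ib).
rewrite RintegralZl; [|exact: measurableT|exact: (integrableDr iaA iac)].
rewrite RintegralD; [|exact: measurableT|exact: iaA|exact: iac].
rewrite mulrAC ler_pdivrMr// ler_wpM2l ?divr_ge0 ?(ltW r0)// /M lerD2r -lerBlDl.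
exact: le_trans (ler_norm _) H2.
Qed.

Lemma energy_sum (I : Type) (l : seq I) (p q : R) (a b c : I -> V -> R) eta : 1 < p -> 1 < q -> q^-1 + p^-1 = 1 ->
  (forall i, lp q (a i)) -> (forall i, lp p (b i)) -> (forall i, bcs (c i)) -> bcs eta ->
  forall r : R, 0 < r -> exists d s, [/\ 0 < d, 0 < s & forall e w f, 0 < e -> e < d -> mollifier1 e w -> bcs f ->
    (forall x, `|f x - eta x| <= s) ->
    mu.-integrable setT (EFin \o (fun x => \sum_(i <- l) a i x * (f x * (conv (b i) (mol w) x - c i x)))) /\
    `|\int[mu]_x (\sum_(i <- l) a i x * (f x * (conv (b i) (mol w) x - c i x)))
      - \int[mu]_x (\sum_(i <- l) a i x * (eta x * (b i x - c i x)))| <= r].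
Proof.
move=> p1 q1 qp la lb bc be.
have p0 : 0 < p by apply: lt_trans p1.
have q0 : 0 < q by apply: lt_trans q1.
have i2 i : mu.-integrable setT (EFin \o (fun x => a i x * (eta x * (b i x - c i x)))).
  have lae := lp_bcs_mul q0 (la i) be.
  have h1 := lp_mul_integrable p0 q0 qp lae (lb i).
  have [mc [Cc [cC _]]] := bc i.
  have h2 := integrable_Mbounded (lp_integrable (ltW q1) lae) mc cC.
  have := integrableBr h1 h2; congr (_.-integrable _ _); apply/funext => x /=.
  by rewrite mulrBr mulrBr !mulrA.
elim: l => [|i l IH] r r0.
  exists 1, 1; split => // e w f _ _ _ _ _; split.
    rewrite (_ : EFin \o _ = cst 0%E); first exact: integrable0.
    by apply/funext => x /=; rewrite big_nil.
  under eq_Rintegral do rewrite big_nil; under [X in _ - X]eq_Rintegral do rewrite big_nil.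
  by rewrite subrr normr0 ltW.
have r2 : 0 < r / 2 by rewrite divr_gt0.
have [d1 [s1 [d10 s10 H1]]] := IH _ r2.
have [d2 [s2 [d20 s20 H2]]] := energy_term p1 q1 qp (la i) (lb i) (bc i) be r2.
exists (Num.min d1 d2), (Num.min s1 s2); split; [by rewrite lt_min d10|by rewrite lt_min s10|].
move=> e w f e0; rewrite lt_min => /andP[ed1 ed2] mw bf fs.
have fs12 x : `|f x - eta x| <= s1 /\ `|f x - eta x| <= s2 by apply/andP; have := fs x; rewrite le_min.
have [J1 K1] := H1 e w f e0 ed1 mw bf (fun x => (fs12 x).1).
have [J2 K2] := H2 e w f e0 ed2 mw bf (fun x => (fs12 x).2).
split.
  by under [X in EFin \o X]eq_fun do rewrite big_cons; exact: (integrableDr J2 J1).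
under eq_Rintegral do rewrite big_cons; under [X in _ - X]eq_Rintegral do rewrite big_cons.
rewrite RintegralD; [|exact: measurableT|exact: J2|exact: J1].
rewrite RintegralD; [|exact: measurableT|exact: i2|by apply: integrable_sumr => j; exact: i2].
rewrite opprD addrACA [leRHS](splitr r).
exact: le_trans (ler_normD _ _) (lerD K2 K1).
Qed.

End energy_limit.

(** * Comparison of weak solutions with strict supersolutions *)

Section strict_comparison.
Context {R : realType} {n : nat}.
Local Notation V := 'rV[R]_n.
Local Notation mu := (@lebesgue_Rn R n).
Implicit Types (a b c f h v kap phi : V -> R) (x y : V) (O D K : set V).

Lemma bcs_lp (q : R) f : 0 < q -> bcs f -> lp q f.
Proof.
move=> q0 [mf [M [fM f0]]].
have M0 : 0 <= M by exact: le_trans (normr_ge0 _) (fM 0).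
have b : bcs (fun x => `|f x| `^ q).
  split; first exact: measurable_abs_powR.
  exists (M `^ q + M); split => x.
    rewrite ger0_norm ?powR_ge0//; apply: (@le_trans _ _ (M `^ q)); last by rewrite lerDl.
    by apply: ge0_ler_powR; rewrite ?nnegrE ?(ltW q0).
  by move=> Mx; rewrite f0 ?normr0 ?powR0 ?gt_eqF//; apply: le_lt_trans Mx; rewrite lerDr powR_ge0.
split => //; first by exists M.
have /integrableP[_] := bcs_integrable b; congr (_ < _)%E.
by apply: eq_integral => x _ /=; rewrite ger0_norm ?powR_ge0.
Qed.

Lemma lpB (q : R) a b : 0 < q -> lp q a -> lp q b -> lp q (fun x => a x - b x).
Proof.
move=> q0 la lb; have [ma [M aM] _] := la; have [mb [N bN] _] := lb.
have mab : measurable_fun [set: borelRn n] (fun x : borelRn n => a x - b x) by exact: measurable_funB.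
split => //.
  by exists (Num.max M N) => x; rewrite gt_max => /andP[/aM -> /bN ->]; rewrite subr0.
have /integrableP[_] : mu.-integrable setT (EFin \o (fun x => `|a x - b x| `^ q)).
  apply: (integrable_le (integrableZ (2 `^ q) (integrableDr (lp_powR_integrable la) (lp_powR_integrable lb)))).
    exact: measurable_abs_powR.
  move=> x; rewrite ger0_norm ?powR_ge0//; apply: (@le_trans _ _ ((`|a x| + `|b x|) `^ q)).
    by apply: ge0_ler_powR; rewrite ?nnegrE ?addr_ge0 ?(ltW q0)// ler_normB.
  by apply: powR_add_le => //; exact: ltW.
congr (_ < _)%E; apply: eq_integral => x _ /=.
by rewrite ger0_norm ?powR_ge0.
Qed.

Lemma conjugateP (p : R) : 1 < p -> exists q : R, [/\ 1 < q, q^-1 + p^-1 = 1 & (p - 1) * q = p].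
Proof.
move=> p1; have p0 : 0 < p by apply: lt_trans p1.
have p10 : 0 < p - 1 by rewrite subr_gt0.
exists (p / (p - 1)); split; last by field; rewrite gt_eqF.
  by rewrite ltr_pdivlMr// mul1r ltrBlDr ltrDl.
by field; rewrite !gt_eqF.
Qed.

Lemma pfield_dot (p : R) (X Y : V) : enorm X `^ (p - 2) * dot X Y = \sum_i pfield p X ord0 i * Y ord0 i.
Proof. by rewrite /dot mulr_sumr; apply: eq_bigr => i _; rewrite mxE mulrA. Qed.

Lemma superlevel_compact K f (c : R) : compact K -> {within K, continuous f} ->
  compact [set x | K x /\ c <= f x].
Proof.
move=> cK /within_cont_distP cf; apply: (subclosed_compact _ cK); last by move=> x [].
have oK : open (~` K) by rewrite openC; apply: compact_closed => //; exact: rV_hausdorff.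
rewrite -openC openE => x /= nx; apply/nbhs_ballP.
have [Kx|nKx] := pselect (K x); last first.
  have /nbhs_ballP[e /= e0 eP] : nbhs x (~` K) by apply: open_nbhs_nbhs.
  by exists e => // y /eP ny [].
have fx : 0 < c - f x by rewrite subr_gt0 ltNge; apply/negP => cx; exact: nx.
have [d d0 dP] := cf x Kx _ fx; exists d => // y; rewrite -ball_normE /= => xy [Ky].
have := dP y Ky xy; rewrite ltr_norml => /andP[]; lra.
Qed.

Lemma superlevel_open D f (c : R) : open D -> (forall x, D x -> {for x, continuous f}) -> open [set x | D x /\ c < f x].
Proof.
move=> oD cf; rewrite openE => x /= [Dx fx]; near=> y; split.
  by near: y; exact: open_nbhs_nbhs.
by near: y; move/cvgrPdist_lt : (cf x Dx) => /(_ (f x - c)); rewrite subr_gt0 => /(_ fx); apply: filterS => y;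
  rewrite ltr_norml; lra.
Unshelve. all: by end_near. Qed.

Lemma mollify_uniform D h K K3 (r : R) : open D -> compact K -> compact K3 -> K3 `<=` D -> 0 < r ->
  (forall x y, K x -> `|x - y| <= r -> K3 y) -> (forall x, D x -> {for x, continuous h}) ->
  forall s : R, 0 < s -> exists2 d : R, 0 < d & forall e w, 0 < e -> e < d -> mollifier1 e w ->
    forall x, K x -> `|conv (rst K3 h) (mol w) x - h x| <= s.
Proof.
move=> oD cK cK3 K3D r0 KK3 ch s s0.
have KsK3 x : K x -> K3 x by move=> Kx; apply: (KK3 x) => //; rewrite subrr normr0 ltW.
have [d d0 dP] := compact_unif_cont cK (fun x Kx => ch x (K3D _ (KsK3 x Kx))) s0.
have [mh [C [hC _]]] := rst_bcs oD cK3 K3D ch.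
exists (Num.min d r); first by rewrite lt_min d0.
move=> e w e0; rewrite lt_min => /andP[ed er] mw x Kx.
rewrite -(rst_in h (KsK3 x Kx)).
apply: (@kernel_approx R n (rst K3 h) (fun y => mol w (x - y)) x s e C mh hC (ltW s0) (mol_shift_measurable e0 mw x)).
- by move=> y; exact: (mol_ge0 mw _).
- by have [] := mol_int e0 mw x.
- by move=> y xy; exact: (mol_supp e0 mw).
- move=> y xy; rewrite !rst_in; [|apply: (KK3 x) => //; exact: (ltW (lt_trans xy er))|exact: KsK3].
  by apply/ltW/dP => //; exact: lt_trans xy ed.
Qed.

Lemma energy_contradiction (r X Y T : R) : 0 < r -> Y = - X -> 0 <= T -> r <= X -> - (r / 2) <= Y - T -> False.
Proof. by lra. Qed.

Lemma mollified_level (d s t u : R) : `|u - t| <= d / 16 -> 15 * d / 16 <= t - s -> 3 * d / 8 <= u - s - d / 2.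
Proof. by rewrite ler_norml => /andP[]; lra. Qed.

Lemma mollified_sublevel (d s t u : R) : 0 < d -> `|u - t| <= d / 16 -> t - s < 3 * d / 8 -> u - s - d / 2 <= 0.
Proof. by move=> d0; rewrite ler_norml => /andP[]; lra. Qed.

(** If $h - v = d > 0$ at some point, both equations are tested with the square of the positive part
    of $h_e - v - d/2$, where $h_e$ is a mollification of [h]. Their difference equates an integral
    with nonnegative limit, by monotonicity of the field, to one that lies below a negative constant
    independent of $e$. *)
Lemma strict_comparison (p : R) O D v kap (Gv : V -> V) h : 1 < p -> open O -> open D ->
  compact (closure D) -> closure D `<=` O ->
  (forall x, O x -> {for x, continuous v}) -> (forall x, O x -> {for x, continuous kap}) ->
  (forall x, O x -> 0 < kap x) ->
  (forall x i, O x -> is_derive x (delta_mx ord0 i) v (Gv x ord0 i)) ->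
  (forall x i, O x -> {for x, continuous (fun y => Gv y ord0 i)}) ->
  (forall x i, O x -> {for x, continuous (fun y => pfield p (Gv y) ord0 i)}) ->
  (forall K phi, c1c K phi -> K `<=` O ->
    \int[mu]_(x in O) (\sum_i pfield p (Gv x) ord0 i * partial i phi x - kap x * phi x) = 0) ->
  {within closure D, continuous h} -> p_harmonic p D h ->
  (forall x, boundary D x -> h x <= v x) -> forall x, D x -> h x <= v x.
Proof.
move=> p1 oO oD cD DO cv ckap kap0 dv cG cF weak chcl [chD [g [_ gL wg] hg]] bd x0 Dx0.
rewrite leNgt; apply/negP => lt0.
pose d := h x0 - v x0; have d0 : 0 < d by rewrite subr_gt0.
have p0 : 0 < p by apply: lt_trans p1.
have [q [q1 qp pq]] := conjugateP p1.
have q0 : 0 < q by apply: lt_trans q1.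
have DclD : D `<=` closure D by exact: subset_closure.
have DsO : D `<=` O by apply: subset_trans DO.
have ch x : D x -> {for x, continuous h} by move=> Dx; apply: chD; exact: mem_set.
pose H x := h x - v x.
have cH x : D x -> {for x, continuous H}.
  by move=> Dx; apply: continuousB; [exact: ch|apply: cv; exact: DsO].
have cHcl : {within closure D, continuous H}.
  apply/within_cont_distP => x clx e e0.
  move/within_cont_distP : chcl => /(_ x clx _ (divr_gt0 e0 (ltr0Sn _ 1)))[d1 d10 P1].
  have [d2 d20 P2] := (cont_distP v x).1 (cv x (DO x clx)) _ (divr_gt0 e0 (ltr0Sn _ 1)).
  exists (Num.min d1 d2); first by rewrite lt_min d10.
  move=> y cly; rewrite lt_min => /andP[y1 y2].
  have -> : H x - H y = (h x - h y) - (v x - v y) by rewrite /H; ring.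
  by rewrite [e]splitr; apply: le_lt_trans (ler_normB _ _) (ltrD _ _); [exact: P1|exact: P2].
pose L (c : R) : set V := [set x | closure D x /\ c <= H x].
have cL (t : R) : compact (L t) by exact: superlevel_compact.
have LD (t : R) : 0 < t -> L t `<=` D.
  move=> t0 x [clx Hx]; apply: contrapT => nDx.
  have : h x <= v x by apply: bd; split => // /interior_subset.
  by rewrite -subr_le0 leNgt (lt_le_trans t0 Hx).
(* Levels of $H = h - v$. A mollification error of at most $d/16$ keeps the support of the
   truncation at $d/2$ inside [K1]; the open set [O'] around [K1] is where the test function is
   glued with zero, and the compact [K2] contains [O']. *)
pose K1 := L (3 * d / 8); pose K2 := L (d / 4); pose O' : set V := [set x | D x /\ d / 4 < H x].
have oO' : open O' by exact: superlevel_open.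
have cK1 : compact K1 := cL _.
have cK2 : compact K2 := cL _.
have K1D : K1 `<=` D by apply: LD; rewrite divr_gt0// mulr_gt0.
have K2D : K2 `<=` D by apply: LD; rewrite divr_gt0.
have K1O' : K1 `<=` O'.
  move=> x K1x; split; first exact: K1D.
  by have [_] := K1x; apply: lt_le_trans; move: d0; lra.
have O'K2 : O' `<=` K2 by move=> x [Dx Hx]; split; [exact: DclD|exact: ltW].
have [r [K3 [r0 cK3 K3D K2K3]]] := compact_nbhd cK2 oD K2D.
have K2s3 x : K2 x -> K3 x by move=> Kx; apply: (K2K3 x) => //; rewrite subrr normr0 ltW.
have K1s3 x : K1 x -> K3 x by move=> /K1O'/O'K2/K2s3.
pose b i := rst K3 (fun x => g x ord0 i).
have lb i : lp p (b i) := Lp_loc_lp p0 oD cK3 K3D (gL i).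
have ib i := lp_integrable (ltW p1) (lb i).
pose A i x : R := pfield p (g x) ord0 i; pose W i x : R := pfield p (Gv x) ord0 i.
have lA i K : compact K -> K `<=` D -> lp q (rst K (A i)).
  by move=> cK KD; exact: (pfield_lp i p1 pq cK (fun j => Lp_loc_lp p0 oD cK KD (gL j))).
have K1O : K1 `<=` O by move=> x /K1D/DsO.
have bW i : bcs (rst K1 (W i)) by exact: (rst_bcs oO cK1 K1O (fun x Ox => cF x i Ox)).
pose a i x := rst K1 (A i) x - rst K1 (W i) x.
have la i : lp q (a i) by apply: (lpB q0 (lA i _ cK1 K1D)); exact: bcs_lp.
pose c i := rst K1 (fun x => Gv x ord0 i).
have bc i : bcs (c i) by exact: (rst_bcs oO cK1 K1O (fun x Ox => cG x i Ox)).
pose eta := rst K1 (fun x => 2 * pos (H x - d / 2)).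
have be : bcs eta.
  apply: (rst_bcs oD cK1 K1D) => x Dx; apply: continuousM; first exact: cst_continuous.
  apply: (continuous_comp (f := fun x => H x - d / 2)); last exact: pos_continuous.
  by apply: continuousB; [exact: cH|exact: cst_continuous].
have bkap : bcs (rst K1 kap) by exact: (rst_bcs oO cK1 K1O ckap).
have [kap1 kap10 kap1P] : exists2 k1 : R, 0 < k1 & forall x, K1 x -> k1 <= kap x.
  have ck x : K1 x -> {for x, continuous (fun x => (kap x)^-1)}.
    by move=> /K1O Ox; apply: continuousV; [rewrite gt_eqF// kap0|exact: ckap].
  have [M [M0 MP]] := compact_bounded_at cK1 ck.
  exists M^-1; first by rewrite invr_gt0.
  move=> x Kx; have kx := kap0 x (K1O x Kx); have := MP x Kx.
  by rewrite ger0_norm ?invr_ge0 ?(ltW kx)// => kM; rewrite -[leRHS]invrK lef_pV2 ?posrE ?invr_gt0.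
have [rho rho0 rhoP] : exists2 rho : R, 0 < rho & forall x, `|x0 - x| < rho -> K1 x /\ 15 * d / 16 <= H x.
  have /nbhs_ballP[e1 /= e10 e1P] : nbhs x0 D by apply: open_nbhs_nbhs.
  have d16 : 0 < d / 16 by rewrite divr_gt0.
  have [e2 e20 e2P] := (cont_distP H x0).1 (cH x0 Dx0) _ d16.
  exists (Num.min e1 e2); first by rewrite lt_min e10.
  move=> x; rewrite lt_min => /andP[xe1 xe2].
  have Dx : D x by apply: e1P; rewrite -ball_normE.
  have := e2P x xe2; rewrite ltr_norml /H -/d -/(H x) => /andP[_ Hx].
  have Hx' : 15 * d / 16 <= H x by move: Hx; lra.
  by split => //; split; [exact: DclD|move: Hx' d0; lra].
(* [m0] will be a fixed bump of mass one at [x0], supported where [H] is close to [d]. There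
   [cs * m0] lies below [kap * phi], which bounds the strict term from below by [cs] whatever the
   later mollification. *)
have [w0 mw0] := mollifier1_exists rho0.
have cm0 : ccs (mol w0 : V -> R) := mol_ccs rho0 mw0.
have [Cm Cm0 mCm] := ccs_bound cm0.
pose m0 x := mol w0 (x - x0).
have im0 : \int[mu]_x m0 x = 1 by rewrite /Rintegral; have [_ ->] := mol_int rho0 mw0 x0.
pose cs := kap1 * (3 * d / 8) ^+ 2 / Cm.
have cs0 : 0 < cs by rewrite divr_gt0// mulr_gt0// exprn_gt0// divr_gt0// mulr_gt0.
have [d1 [s1 [d10 s10 ES]]] := energy_sum (index_enum 'I_n) p1 q1 qp la lb bc be (divr_gt0 cs0 (ltr0Sn _ 1)).
have sig0 : 0 < Num.min (d / 16) (s1 / 2) by rewrite lt_min !divr_gt0.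
have [d2 d20 MU] := mollify_uniform oD cK2 cK3 K3D r0 K2K3 ch sig0.
pose e := Num.min (Num.min d1 d2) r / 2.
have mn0 : 0 < Num.min (Num.min d1 d2) r by rewrite !lt_min d10 d20.
have e0 : 0 < e by rewrite divr_gt0.
have : e < Num.min (Num.min d1 d2) r by rewrite ltr_pdivrMr// ltr_pMr// ltr1n.
rewrite !lt_min => /andP[/andP[ed1 ed2] er].
have [w mw] := mollifier1_exists e0.
pose he := conv (rst K3 h) (mol w).
have heh x : K2 x -> `|he x - h x| <= d / 16 /\ `|he x - h x| <= s1 / 2.
  by move=> Kx; apply/andP; have := MU e w e0 ed2 mw x Kx; rewrite le_min.
have ih : mu.-integrable setT (EFin \o rst K3 h) by apply: bcs_integrable; exact: (rst_bcs oD).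
have cm : ccs (mol w : V -> R) := mol_ccs e0 mw.
have che : continuous he := conv_continuous ih cm.
have cB i : ccs (conv (b i) (mol w)) by apply: (conv_ccs e0 mw (ib i)); case: (lb i).
have dhe x i : K2 x -> is_derive x (delta_mx ord0 i) he (conv (b i) (mol w) x).
  move=> Kx; exact: (weak_mollify oD cK3 K3D r0 K2K3 ch ib wg e0 (ltW er) mw Kx i).
pose s x := he x - v x - d / 2.
have cs' x : O' x -> {for x, continuous s}.
  move=> [/DsO Ox _]; apply: continuousB; last exact: cst_continuous.
  by apply: continuousB; [exact: che|exact: cv].
have sneg x : O' x -> ~ K1 x -> pos (s x) = 0.
  move=> Ox nKx; have [Dx _] := Ox; apply: pos_0.
  have Hx : H x < 3 * d / 8 by rewrite ltNge; apply/negP => Hx; apply: nKx; split => //; exact: DclD.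
  by have [h1 _] := heh x (O'K2 x Ox); exact: mollified_sublevel d0 h1 Hx.
pose f := rst K1 (fun x => 2 * pos (s x)).
have bf : bcs f.
  apply: (rst_bcs oO' cK1 K1O') => x Ox; apply: continuousM; first exact: cst_continuous.
  by apply: (continuous_comp (f := s)); [exact: cs'|exact: pos_continuous].
(* The gradient of the square carries the continuous factor [f], twice the positive part; it
   multiplies the difference of the mollified gradient of [h] and the gradient of [v]. *)
pose phi := rst K1 (fun x => pos (s x) ^+ 2).
pose F i x := 2 * pos (s x) * (conv (b i) (mol w) x - Gv x ord0 i).
have [c1phi dphi] : c1c K1 phi /\ forall i, partial i phi = rst K1 (F i).
  apply: (glue_c1c oO' cK1 K1O').
  - by move=> x Ox nx; rewrite sneg// expr0n.
  - by move=> x i Ox nx; rewrite /F sneg// mulr0 mul0r.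
  - move=> x Ox; apply: (continuous_comp (f := fun x => pos (s x)) (g := fun t : R => t ^+ 2)); last exact: exprn_continuous.
    by apply: (continuous_comp (f := s)); [exact: cs'|exact: pos_continuous].
  - move=> x i Ox; apply: continuousM.
      apply: continuousM; first exact: cst_continuous.
      by apply: (continuous_comp (f := s)); [exact: cs'|exact: pos_continuous].
    apply: continuousB; first exact: (cB i).1.
    by apply: cG; have [/DsO] := Ox.
  - move=> x i Ox; apply: (der_comp (h := fun t => pos t ^+ 2) (g := s) (der_pos2 (s x))).
    have := der_D (der_D (dhe x i (O'K2 x Ox)) (der_N (dv x i (DsO _ Ox.1)))) (der_N (der_cst x (delta_mx ord0 i) (d / 2))).
    by rewrite subr0.
have dphi0 i x : ~ K1 x -> partial i phi x = 0 by move=> nx; rewrite dphi rst_out.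
have phi0 x : ~ K1 x -> phi x = 0 by exact: rst_out.
have [cphi cdphi] := c1c_ccs c1phi.
have E1 : \int[mu]_x (\sum_i A i x * partial i phi x) = 0.
  have h1 : forall K, compact K -> K `<=` D -> (forall i, mu.-integrable K (EFin \o A i)) /\ mu.-integrable K (EFin \o (fun _ : V => 0 : R)).
    move=> K cK KD; split; last first.
      by rewrite (_ : EFin \o _ = cst 0%E)//; exact: integrable0.
    by move=> i; apply: rst_integrableP => //; apply: (lp_integrable (ltW q1)); exact: lA.
  have h2 : forall psi, test_function D psi -> \int[mu]_(x in D) (\sum_(i < n) A i x * partial i psi x + (fun _ : V => 0 : R) x * psi x) = 0.
    move=> psi tpsi; rewrite -[RHS](hg psi tpsi); apply: eq_Rintegral => x _.
    rewrite mul0r addr0 pfield_dot; by apply: eq_bigr => i _; rewrite [gradient psi x ord0 i]mxE.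
  have := test_extension oD h1 h2 c1phi K1D; rewrite (Rintegral_supp K1D).
    by move=> E; rewrite -[RHS]E; apply: eq_Rintegral => x _; rewrite [X in _ = _ + X]mul0r addr0.
  move=> x nx; rewrite mul0r addr0 big1// => i _; by rewrite dphi0// mulr0.
have E2 : \int[mu]_x (\sum_i rst K1 (W i) x * partial i phi x - rst K1 kap x * phi x) = 0.
  rewrite -[RHS](weak K1 phi c1phi K1O) (Rintegral_supp K1O).
    apply: eq_Rintegral => x _; have [Kx|nx] := pselect (K1 x).
      by rewrite [rst K1 kap x]rst_in//; congr (_ - _); apply: eq_bigr => i _; rewrite rst_in.
    by rewrite phi0// !mulr0 !subr0 !big1// => i _; rewrite dphi0// mulr0.
  move=> x nx; by rewrite phi0// mulr0 subr0 big1// => i _; rewrite dphi0// mulr0.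
have fe x : `|f x - eta x| <= s1.
  have [Kx|nx] := pselect (K1 x); last by rewrite /f /eta !rst_out// subrr normr0 ltW.
  rewrite /f /eta !rst_in// -mulrBr normrM ger0_norm//.
  have [_ h1] := heh x (O'K2 x (K1O' x Kx)).
  have h2 := pos_lip (s x) (H x - d / 2).
  have h3 : s x - (H x - d / 2) = he x - h x by rewrite /s /H; ring.
  by rewrite h3 in h2; rewrite mulrC -ler_pdivlMr//; exact: le_trans h2 h1.
have [iJ EJ] := ES e w f e0 ed1 mw bf fe.
pose J x := \sum_i a i x * (f x * (conv (b i) (mol w) x - c i x)).
have iT : mu.-integrable setT (EFin \o (fun x => \sum_i rst K1 (W i) x * partial i phi x)).
  apply: integrable_sumr => i; have [C _ hC] := ccs_bound (cdphi i).
  by apply: (integrable_Mbounded (bcs_integrable (bW i)) _ hC); exact: integrable_mfun (ccs_integrable (cdphi i)).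
have ik : mu.-integrable setT (EFin \o (fun x => rst K1 kap x * phi x)).
  have [C _ hC] := ccs_bound cphi.
  by apply: (integrable_Mbounded (bcs_integrable bkap) _ hC); exact: integrable_mfun (ccs_integrable cphi).
have Jk : \int[mu]_x J x = - \int[mu]_x (rst K1 kap x * phi x).
  apply/eqP; rewrite -subr_eq0 opprK -E1.
  rewrite -[X in X == _]addr0 -[X in _ + X == _]E2.
  rewrite -RintegralD; [|exact: measurableT|exact: iJ|exact: ik].
  rewrite -RintegralD; [|exact: measurableT|exact: (integrableDr iJ ik)|exact: (integrableBr iT ik)].
  apply/eqP/eq_Rintegral => x _; rewrite addrACA subrr addr0 -big_split; apply: eq_bigr => i _.
  rewrite dphi; have [Kx|nx] := pselect (K1 x).
    by rewrite /= /a /f /c /F !rst_in//; ring.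
  by rewrite /= /a !rst_out//; ring.
have T0 : 0 <= \int[mu]_x (\sum_i a i x * (eta x * (b i x - c i x))).
  apply: Rintegral_ge0 => x _; have [Kx|nx] := pselect (K1 x); last first.
    by apply: sumr_ge0 => i _; rewrite /a !rst_out// subr0 mul0r.
  have -> : \sum_i a i x * (eta x * (b i x - c i x)) = eta x * dot (pfield p (g x) - pfield p (Gv x)) (g x - Gv x).
    rewrite /dot mulr_sumr; apply: eq_bigr => i _.
    have -> : b i x = g x ord0 i by apply: rst_in; exact: K1s3.
    have -> : c i x = Gv x ord0 i by exact: rst_in.
    have -> : a i x = A i x - W i x by rewrite /a !rst_in.
    by rewrite mulrCA /A /W /pfield !mxE.
  by rewrite mulr_ge0 ?pfield_mono// /eta rst_in// mulr_ge0// pos_ge0.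
have lbk : cs <= \int[mu]_x (rst K1 kap x * phi x).
  have im : mu.-integrable setT (EFin \o (fun x => m0 x)).
    have [b1 _] := mol_int rho0 mw0 x0; apply: ccs_integrable; split.
      suff Q (y : V) : {for y, continuous m0} by move=> y; exact: Q.
      by apply: (continuous_comp (f := fun y : V => y - x0)); [exact: cont_subr|exact: cm0.1].
    have [M MP] := cm0.2; exists (M + `|x0|) => x Mx; apply: MP.
    by apply: lt_le_trans (lerB_dist _ _); rewrite ltrBrDr.
  rewrite -[cs]mulr1 -im0 -RintegralZl; [|exact: measurableT|exact: im].
  apply: le_Rintegral; [exact: measurableT|exact: (integrableZ _ im)|exact: ik|].
  move=> x _; have [xr|rx] := ltP `|x0 - x| rho; last first.
    rewrite /m0 (mol_supp rho0 mw0) ?mulr0; last by rewrite distrC.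
    have [Kx|nx] := pselect (K1 x); last by rewrite /phi !rst_out// mulr0.
    by rewrite /phi !rst_in// mulr_ge0 ?sqr_ge0// ltW// kap0//; exact: K1O.
  have [Kx Hx] := rhoP x xr; rewrite /phi !rst_in//.
  have [h1 _] := heh x (O'K2 x (K1O' x Kx)).
  have s3 : 3 * d / 8 <= s x.
    exact: mollified_level h1 Hx.
  have s30 : 0 <= 3 * d / 8 by rewrite divr_ge0// mulr_ge0// ltW.
  rewrite pos_id; last exact: le_trans s3.
  apply: (@le_trans _ _ (kap1 * (3 * d / 8) ^+ 2)).
    rewrite /cs mulrAC ler_pdivrMr//; apply: ler_wpM2l; first exact: mulr_ge0 (ltW kap10) (sqr_ge0 _).
    exact: le_trans (ler_norm _) (mCm _).
  apply: ler_pM; rewrite ?sqr_ge0 ?(ltW kap10) ?kap1P//.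
  by rewrite ler_sqr ?nnegrE//; exact: le_trans s3.
move: EJ; rewrite ler_norml => /andP[EJ _].
exact: (energy_contradiction cs0 Jk T0 lbk EJ).
Qed.

End strict_comparison.

(** * Comparison with $C^1$ solutions without critical points *)

Section comparison.
Context {R : realType} {n : nat}.
Local Notation V := 'rV[R]_n.
Local Notation mu := (@lebesgue_Rn R n).
Implicit Types (h U phi : V -> R) (x y : V) (O D K : set V).

Lemma powR_continuous_at (a s : R) : 0 < s -> {for s, continuous (fun t : R => t `^ a)}.
Proof. by move=> s0; apply: der_continuous_at (is_derive1_powR a s0). Qed.

Lemma powR_expR (t s : R) : (expR t) `^ s = expR (s * t).
Proof. by rewrite /powR gt_eqF ?expR_gt0// expRK. Qed.

Lemma pfieldZ (p s : R) (X : V) : pfield p (expR s *: X) = expR ((p - 1) * s) *: pfield p X.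
Proof.
rewrite /pfield enormZ ger0_norm ?expR_ge0// powRM ?expR_ge0 ?enorm_ge0// powR_expR !scalerA; congr (_ *: _).
by rewrite mulrAC -expRD; congr (expR _ * _); ring.
Qed.

Lemma row_continuous (T : topologicalType) (G : T -> V) (x : T) :
  (forall i, {for x, continuous (fun z => G z ord0 i)}) -> {for x, continuous G}.
Proof.
move=> cG; apply/cvg_ballP => e e0; near=> y; split => // i j; rewrite ord1.
suff : forall j, ball (G x ord0 j) e (G y ord0 j) by exact.
by near: y; apply: filter_forall => k; exact: (cvg_ball (cG k)).
Unshelve. all: by end_near. Qed.

Lemma pfield_continuous (T : topologicalType) (p : R) (G : T -> V) (x : T) i :
  (forall i, {for x, continuous (fun z => G z ord0 i)}) -> enorm (G x) != 0 ->
  {for x, continuous (fun z => pfield p (G z) ord0 i)}.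
Proof.
move=> cG G0; rewrite (_ : (fun _ => _) = fun z => enorm (G z) `^ (p - 2) * G z ord0 i); last first.
  by apply/funext => z; rewrite mxE.
apply: continuousM; last exact: cG.
apply: (continuous_comp (f := fun z => enorm (G z)) (g := fun t : R => t `^ (p - 2))).
  by apply: (continuous_comp (f := G)); [exact: row_continuous|exact: enorm_continuous].
by apply: powR_continuous_at; rewrite lt_neqAle eq_sym G0 enorm_ge0.
Qed.

(** From $1 - s \le e^{-s}$ and $(1+s)e^{-s} \le 1$ with $s = lu$. *)
Lemma exp_quadratic_bounds (l u : R) : 0 < l -> 0 <= u ->
  (1 - expR (- (l * u))) / l <= u /\ u <= (1 - expR (- (l * u))) / l + l * u ^+ 2.
Proof.
move=> l0 u0; split.
  by rewrite ler_pdivrMr//; have := expR_ge1Dx (- (l * u)); lra.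
have s0 : 0 <= l * u by rewrite mulr_ge0// ltW.
have h : expR (- (l * u)) * (1 + l * u) <= 1.
  by rewrite -[leRHS](expRxMexpNx_1 (l * u)) mulrC ler_wpM2r ?expR_ge0// expR_ge1Dx.
have e0 : 0 < expR (- (l * u)) := expR_gt0 _.
rewrite -lerBlDr ler_pdivlMr//.
have -> : (u - l * u ^+ 2) * l = l * u - (l * u) ^+ 2 by ring.
by move: h s0 e0; set E := expR _; set s := l * u; nra.
Qed.

(** With $v = (1 - e^{-lU})/l + lM^2$ one has $U \le v \le U + lM^2$ wherever $0 \le U \le M$, so
    the boundary inequality is kept and the error vanishes with [l]. *)
Lemma comparison (p M : R) O D U (GU : V -> V) h : 1 < p -> open O -> open D ->
  compact (closure D) -> closure D `<=` O ->
  (forall x, O x -> {for x, continuous U}) -> (forall x, O x -> 0 <= U x) ->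
  (forall x, closure D x -> U x <= M) ->
  (forall x i, O x -> is_derive x (delta_mx ord0 i) U (GU x ord0 i)) ->
  (forall x i, O x -> {for x, continuous (fun y => GU y ord0 i)}) ->
  (forall x, O x -> enorm (GU x) != 0) ->
  (forall K phi, c1c K phi -> K `<=` O ->
    \int[mu]_(x in O) (\sum_i pfield p (GU x) ord0 i * partial i phi x) = 0) ->
  {within closure D, continuous h} -> p_harmonic p D h ->
  (forall x, boundary D x -> h x <= U x) -> forall x, D x -> h x <= U x.
Proof.
move=> p1 oO oD cD DO cU U0 UM dU cG G0 weak chcl hD bd x Dx.
have DclD : D `<=` closure D by exact: subset_closure.
have M0 : 0 <= M by apply: le_trans (UM x (DclD _ Dx)); apply: U0; exact/DO/DclD.
suff H (l : R) : 0 < l -> h x <= U x + l * M ^+ 2.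
  apply/ler_addgt0Pr => e e0; apply: le_trans (H (e / (M ^+ 2 + 1)) _) _.
    by rewrite divr_gt0// ltr_wpDl// sqr_ge0.
  rewrite lerD2l mulrAC ler_pdivrMr ?ltr_wpDl ?sqr_ge0// ler_wpM2l ?(ltW e0)//.
  by rewrite lerDl.
move=> l0; pose E (s : R) y := expR (s * U y).
have cE (s : R) y : O y -> {for y, continuous (E s)}.
  move=> Oy; apply: (continuous_comp (f := fun y => s * U y)); last exact: continuous_expR.
  by apply: continuousM; [exact: cst_continuous|exact: cU].
have dE (s : R) y i : O y -> is_derive y (delta_mx ord0 i) (E s) (E s y * (s * GU y ord0 i)).
  move=> Oy; apply: der_exp; have := der_M (der_cst y (delta_mx ord0 i) s) (dU y i Oy).
  by rewrite mul0r add0r.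
pose v y := (1 - E (- l) y) / l + l * M ^+ 2.
pose Gv y : V := E (- l) y *: GU y.
pose m := - l * (p - 1).
(* Minus the divergence of $e^{mU}|\nabla U|^{p-2}\nabla U$, that is $l(p-1)e^{mU}|\nabla U|^p$:
   passing from [U] to [v] multiplies the field by $e^{mU}$, and the field of [U] has no
   divergence. *)
pose kap y := - m * (E m y * (enorm (pfield p (GU y)) * enorm (GU y))).
have pE y : pfield p (Gv y) = E m y *: pfield p (GU y).
  by rewrite /Gv pfieldZ; congr (expR _ *: _); rewrite /m; ring.
have m0 : 0 < - m by rewrite /m mulNr opprK mulr_gt0// subr_gt0.
have cF y i : O y -> {for y, continuous (fun y => pfield p (GU y) ord0 i)}.
  by move=> Oy; apply: pfield_continuous; [move=> j; exact: cG|exact: G0].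
have nE (Z : V -> V) y : (forall i, {for y, continuous (fun z => Z z ord0 i)}) -> {for y, continuous (fun z => enorm (Z z))}.
  by move=> cZ; apply: (continuous_comp (f := Z)); [exact: row_continuous|exact: enorm_continuous].
have : h x <= v x.
  apply: (@strict_comparison R n p O D v kap Gv h p1 oO oD cD DO) => //.
  - move=> y Oy; apply: continuousD; last exact: cst_continuous.
    apply: continuousM; last exact: cst_continuous.
    by apply: continuousB; [exact: cst_continuous|exact: cE].
  - move=> y Oy; apply: continuousM; first exact: cst_continuous.
    apply: continuousM; first exact: cE.
    by apply: continuousM; apply: nE => i; [exact: cF|exact: cG].
  - move=> y Oy; apply: mulr_gt0 => //; apply: mulr_gt0; first exact: expR_gt0.
    rewrite pfield_enorm//; have Gp : 0 < enorm (GU y) by rewrite lt_neqAle eq_sym G0// enorm_ge0.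
    by rewrite mulr_gt0// powR_gt0.
  - move=> y i Oy; rewrite /v.
    have := der_D (der_M (der_D (der_cst y (delta_mx ord0 i) 1) (der_N (dE (- l) y i Oy))) (der_cst y (delta_mx ord0 i) l^-1)) (der_cst y (delta_mx ord0 i) (l * M ^+ 2)).
    by move/is_derive_eq; apply; rewrite mxE; field; rewrite gt_eqF.
  - move=> y i Oy; rewrite (_ : (fun _ => _) = fun y => E (- l) y * GU y ord0 i); last first.
      by apply/funext => z; rewrite mxE.
    by apply: continuousM; [exact: cE|exact: cG].
  - move=> y i Oy; rewrite (_ : (fun _ => _) = fun y => E m y * pfield p (GU y) ord0 i); last first.
      by apply/funext => z; rewrite pE mxE.
    by apply: continuousM; [exact: cE|exact: cF].
  - move=> K phi cphi KO; have [c1 cK phi0] := cphi.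
    have [ccphi ccp] := c1c_ccs cphi.
    (* The weak equation of [U] is tested with $e^{mU}\phi$, which is $C^1$ because [U] is; the
       derivative of the exponential produces [kap]. *)
    pose f y := E m y * phi y.
    pose F i y := E m y * (m * GU y ord0 i) * phi y + E m y * partial i phi y.
    have [cz dz] : c1c K (rst K f) /\ forall i, partial i (rst K f) = rst K (F i).
      apply: (glue_c1c oO cK KO).
      + by move=> y _ ny; rewrite /f phi0// mulr0.
      + by move=> y i _ ny; rewrite /F phi0// (partial_out i cK phi0)// !mulr0 addr0.
      + by move=> y Oy; apply: continuousM; [exact: cE|exact: ccphi.1].
      + move=> y i Oy; apply: continuousD; apply: continuousM; [|exact: ccphi.1|exact: cE|exact: (ccp i).1].
        apply: continuousM; first exact: cE.
        by apply: continuousM; [exact: cst_continuous|exact: cG].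
      + by move=> y i Oy; exact: (der_M (dE m y i Oy) (c1c_der i y cphi)).
    rewrite -[RHS](weak K _ cz KO); apply: eq_Rintegral => y _.
    have [Ky|ny] := pselect (K y); last first.
      rewrite phi0// mulr0 subr0 !big1// => i _; first by rewrite dz rst_out// mulr0.
      by rewrite (partial_out i cK phi0)// mulr0.
    transitivity (\sum_i (E m y * (pfield p (GU y) ord0 i * partial i phi y)
                     + m * E m y * phi y * (pfield p (GU y) ord0 i * GU y ord0 i))).
      rewrite big_split /= -!mulr_sumr; congr (_ + _).
        by rewrite mulr_sumr; apply: eq_bigr => i _; rewrite pE mxE mulrA.
      rewrite -[X in _ = _ * X]/(dot _ _) /pfield dotZl -enorm_sq /kap enormZ ger0_norm ?powR_ge0//.
      by ring.
    apply: eq_bigr => i _; rewrite dz rst_in// /F; ring.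
  - move=> y by_; apply: le_trans (bd y by_) _; have [cly _] := by_; have Oy := DO _ cly.
    have [_ h2] := exp_quadratic_bounds l0 (U0 y Oy); apply: le_trans h2 _.
    rewrite /v /E mulNr lerD2l ler_wpM2l ?(ltW l0)//.
    by rewrite ler_sqr ?nnegrE ?U0// UM.
move=> hv; apply: le_trans hv _; rewrite /v /E mulNr lerD2r.
by have [] := exp_quadratic_bounds l0 (U0 x (DO _ (DclD _ Dx))).
Qed.

End comparison.

(** * The profile as a function of the sine of the latitude *)

Section profile_in_sine.
Context {R : realType}.
Variables (n : nat) (p k : R) (f f1 f2 : R -> R).
Hypothesis P : quasiradial_profile n p k f f1 f2.
Implicit Types (s t x y : R).

Let pi2 : 0 < pi / 2 :> R.
Proof. by rewrite divr_gt0// pi_gt0. Qed.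

Lemma asin_itv s : 0 < s < 1 -> asin s \in `]0, pi / 2[.
Proof.
move=> /andP[s0 s1]; have h : -1 <= s <= 1 by rewrite (ltW s1) andbT; lra.
have [/andP[l u] e] := asin_def h; rewrite in_itv /= !lt_neqAle u andbT.
apply/andP; split; last by apply/eqP => E; move: e; rewrite E sin_pihalf => e; rewrite -e ltxx in s1.
apply/andP; split; first by apply/eqP => E; move: e; rewrite -E sin0 => e; rewrite -e ltxx in s0.
rewrite leNgt; apply/negP => a0.
have : 0 < sin (- asin s).
  apply: sin_gt0_pihalf; rewrite oppr_gt0 a0 /= lt_neqAle lerNl l andbT.
  by apply/eqP => E; move: e; rewrite -[asin s]opprK E sinN sin_pihalf; move: s0; lra.
by rewrite sinN e; move: s0; lra.
Qed.

Lemma asin1 : asin 1 = pi / 2 :> R.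
Proof. by rewrite -[X in asin X]sin_pihalf; apply: sinK; rewrite in_itv/= lexx andbT; move: pi2; lra. Qed.

Lemma asin0 : asin 0 = 0 :> R.
Proof. by rewrite -[X in asin X]sin0; apply: sinK; rewrite in_itv/=; move: pi2; lra. Qed.

Lemma asin_itvcc s : 0 <= s <= 1 -> asin s \in `[0, pi / 2].
Proof.
move=> /andP[]; rewrite !le_eqVlt => /predU1P[<- _|s0 /predU1P[->|s1]].
- by rewrite asin0 in_itv/= lexx ltW.
- by rewrite asin1 in_itv/= lexx ltW.
- by have := @asin_itv s; rewrite s0 s1 => /(_ isT); rewrite !in_itv/= => /andP[/ltW-> /ltW->].
Qed.

Lemma within_at (F : R -> R) a x : {within `[0, pi / 2], continuous F} -> x \in `[0, pi / 2] -> 0 < a ->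
  exists2 d : R, 0 < d & forall y, y \in `[0, pi / 2] -> `|x - y| < d -> `|F x - F y| < a.
Proof. by move=> /within_cont_distP H xi a0; have [d d0 dP] := H x xi a a0; exists d => // y yi; apply: dP. Qed.

Lemma within_bound (F : R -> R) : {within `[0, pi / 2], continuous F} ->
  exists2 M : R, 0 < M & forall x, x \in `[0, pi / 2] -> `|F x| <= M.
Proof.
move=> cF; have /compact_bounded[M [Mr h]] : compact (F @` `[0, pi / 2]).
  by apply: continuous_compact cF _; exact: segment_compact.
exists (Num.max M 0 + 1); first by rewrite ltr_pwDr// le_max lexx orbT.
by move=> x Kx; apply: (h (Num.max M 0 + 1)); [rewrite ltr_pwDr// le_max lexx|exists x].
Qed.

Lemma profile_mono x y : 0 <= x -> x <= y -> y <= pi / 2 -> f x <= f y.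
Proof.
move=> x0 xy y2; have [[cf _ _ _] hom _ _] := P.
have xi : x \in `[0, pi / 2] by rewrite in_itv/= x0 (le_trans xy).
have yi : y \in `[0, pi / 2] by rewrite in_itv/= y2 (le_trans x0).
move: xy; rewrite le_eqVlt => /predU1P[->//|xy].
apply/ler_addgt0Pr => e e0.
have [d1 d10 P1] := within_at cf xi (divr_gt0 e0 (ltr0Sn _ 1)).
have [d2 d20 P2] := within_at cf yi (divr_gt0 e0 (ltr0Sn _ 1)).
have xy0 : 0 < y - x by rewrite subr_gt0.
pose m := Num.min (Num.min d1 d2) (y - x) / 3.
have mn0 : 0 < Num.min (Num.min d1 d2) (y - x) by rewrite !lt_min d10 d20.
have m0 : 0 < m by rewrite divr_gt0.
have : m < Num.min (Num.min d1 d2) (y - x) by rewrite /m ltr_pdivrMr// ltr_pMr// ltr1n.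
rewrite !lt_min => /andP[/andP[md1 md2] _].
have m3 : m <= (y - x) / 3 by rewrite ler_wpM2r// ge_min lexx orbT.
have := hom (x + m) (y - m); rewrite !in_itv/= => H.
have {}H : f (x + m) < f (y - m) by apply: H; [apply/andP|apply/andP|]; move: m0 m3 x0 y2; lra.
have h1 : `|f x - f (x + m)| < e / 2.
  apply: P1; first by rewrite in_itv/=; apply/andP; move: m0 m3 x0 y2; lra.
  by rewrite opprD addrA subrr sub0r normrN gtr0_norm.
have h2 : `|f y - f (y - m)| < e / 2.
  apply: P2; first by rewrite in_itv/=; apply/andP; move: m0 m3 x0 y2; lra.
  by rewrite opprB addrC subrK gtr0_norm.
by move: h1 h2 H; rewrite !ltr_norml => /andP[_ h1] /andP[h2 _]; lra.
Qed.

Lemma profile_gt0 x : 0 < x -> x <= pi / 2 -> 0 < f x.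
Proof.
move=> x0 x2; have [[_ _ _ _] hom [f0 _ _ _] _] := P.
have : f 0 <= f (x / 3) by apply: profile_mono; move: x0 x2; lra.
rewrite f0 => h; apply: le_lt_trans h _.
apply: (@lt_le_trans _ _ (f (x / 2))); last by apply: profile_mono; move: x0 x2; lra.
by apply: hom; rewrite ?in_itv/=; [apply/andP|apply/andP|]; move: x0 x2; lra.
Qed.

(** What counts is that $\pi/2 - x$ is at most a multiple of $\cos x$ up to the pole; the constant
    is crude. *)
Lemma angle_le_cos x : 0 <= x -> x <= pi / 2 -> pi / 2 - x <= pi * cos x.
Proof.
move=> x0; rewrite le_eqVlt => /predU1P[->|x2]; first by rewrite subrr cos_pihalf mulr0.
have cx : 0 < cos x by apply: cos_gt0_pihalf; rewrite x2 andbT; move: pi2; lra.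
have [h|h] := leP (1 / 2) (cos x).
  apply: (@le_trans _ _ (pi * (1 / 2))); first by move: x0; lra.
  by rewrite ler_wpM2l// pi_ge0.
have [y] := @MVT R cos (fun x => - sin x) x (pi / 2) x2 (fun y _ => is_derive_cos y) (continuous_subspaceT (@continuous_cos R)).
rewrite in_itv/= cos_pihalf sub0r mulNr => /andP[xy y2] /oppr_inj E.
have y0 : 0 < y by exact: le_lt_trans xy.
have cyx : cos y <= cos x.
  have [z] := @MVT R cos (fun x => - sin x) x y xy (fun y _ => is_derive_cos y) (continuous_subspaceT (@continuous_cos R)).
  rewrite in_itv/= => /andP[xz zy] E2; rewrite -subr_le0 E2 mulNr oppr_le0 mulr_ge0 ?subr_ge0 ?(ltW xy)// ltW// sin_gt0_pihalf//.
  by rewrite (le_lt_trans x0 xz) (lt_trans zy y2).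
have cy : 0 <= cos y by apply: cos_ge0_pihalf; rewrite (ltW y2) andbT; move: pi2 y0; lra.
have sy : 1 / 2 <= sin y.
  have s0 : 0 < sin y by rewrite sin_gt0_pihalf// y0.
  have := cos2Dsin2 y; rewrite -(@ler_sqr _ (1 / 2)) ?nnegrE ?divr_ge0 ?(ltW s0)//.
  have c2 : cos y ^+ 2 <= (1 / 2) ^+ 2 by rewrite ler_sqr ?nnegrE ?divr_ge0//; move: h cyx; lra.
  by move: c2; rewrite !expr2; lra.
have p2 : 2 <= pi :> R by have := @pi_ge2 R.
rewrite E mulrA ler_peMl ?subr_ge0 ?(ltW x2)//.
by apply: (@le_trans _ _ (2 * (1 / 2))); [lra|rewrite ler_pM].
Qed.

(** From $f'(\pi/2) = 0$ and a bound on $f''$, by the mean value theorem twice. These two rates are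
    what makes the quasiradial function $C^1$ across the axis. *)
Lemma profile_flat : exists2 K : R, 0 < K & forall x, 0 <= x -> x <= pi / 2 ->
  `|f1 x| <= K * cos x /\ 0 <= 1 - f x <= K * cos x ^+ 2.
Proof.
have [[cf cf1 cf2 df] hom [f0 fp f1p f10] _] := P.
have [M M0 MP] := within_bound cf2; have p0 : 0 < pi :> R by exact: pi_gt0.
have sub x (F : R -> R) : 0 <= x -> {within `[0, pi / 2], continuous F} -> {within `[x, pi / 2], continuous F}.
  by move=> x0; apply: continuous_subspaceW => y /=; rewrite !in_itv/= => /andP[xy ->]; rewrite (le_trans x0).
have B x : 0 <= x -> x <= pi / 2 -> `|f1 x| <= M * pi * cos x.
  move=> x0 x2; have [] := @MVT_segment R f1 f2 x (pi / 2) x2 _ (sub x _ x0 cf1).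
    by move=> y; rewrite in_itv/= => /andP[xy y2]; have [] := df y; rewrite ?in_itv/= ?y2 ?(le_lt_trans x0).
  move=> y; rewrite in_itv/= f1p sub0r => /andP[xy y2] E; rewrite -normrN E normrM -mulrA.
  rewrite [`|pi / 2 - x|]ger0_norm ?subr_ge0//; apply: ler_pM; rewrite ?subr_ge0//.
    by apply: MP; rewrite in_itv/= y2 (le_trans x0).
  exact: angle_le_cos.
exists (Num.max (M * pi) (M * pi * pi)); first by rewrite lt_max mulr_gt0.
move=> x x0 x2; have cx : 0 <= cos x by apply: cos_ge0_pihalf; rewrite x2 andbT; move: pi2 x0; lra.
split; first by apply: le_trans (B x x0 x2) _; rewrite ler_wpM2r// le_max lexx.
rewrite -fp subr_ge0 profile_mono//=.
have [] := @MVT_segment R f f1 x (pi / 2) x2 _ (sub x _ x0 cf).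
  by move=> y; rewrite in_itv/= => /andP[xy y2]; have [] := df y; rewrite ?in_itv/= ?y2 ?(le_lt_trans x0).
move=> y; rewrite in_itv/= => /andP[xy y2] ->.
have cyx : cos y <= cos x.
  have [z] := @MVT_segment R cos (fun x => - sin x) x y xy (fun y _ => is_derive_cos y) (continuous_subspaceT (@continuous_cos R)).
  rewrite in_itv/= => /andP[xz zy] E2; rewrite -subr_le0 E2 mulNr oppr_le0 mulr_ge0 ?subr_ge0// sin_ge0_pi//.
  by rewrite (le_trans x0 xz) /=; move: pi2 zy y2; lra.
apply: (@le_trans _ _ (M * pi * cos x * (pi * cos x))).
  apply: le_trans (ler_wpM2r _ (ler_norm _)) _; first by rewrite subr_ge0.
  apply: ler_pM; rewrite ?subr_ge0//; last exact: angle_le_cos.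
  by apply: le_trans (B y (le_trans x0 xy) y2) _; apply: ler_wpM2l => //; rewrite mulr_ge0 ?(ltW M0) ?(ltW p0).
rewrite (_ : _ * _ = M * pi * pi * cos x ^+ 2); last by ring.
by rewrite ler_wpM2r ?sqr_ge0// le_max lexx orbT.
Qed.

Lemma cos_asin_gt0 s : 0 < s < 1 -> 0 < Num.sqrt (1 - s ^+ 2).
Proof. by move=> /andP[s0 s1]; rewrite sqrtr_gt0 subr_gt0 expr_lt1// ltW. Qed.

Lemma der_profile_sine s : 0 < s < 1 ->
  is_derive s (1 : R) (fun t => f (asin t)) (f1 (asin s) / Num.sqrt (1 - s ^+ 2)) /\
  is_derive s (1 : R) (fun t => f1 (asin t)) (f2 (asin s) / Num.sqrt (1 - s ^+ 2)).
Proof.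
move=> s01; have [[_ _ _ df] _ _ _] := P; have [d1 d2] := df _ (asin_itv s01).
have da : is_derive s (1 : R) (asin (R := R)) (Num.sqrt (1 - s ^+ 2))^-1.
  by apply: is_derive1_asin; move/andP : s01 => [s0 ->]; rewrite andbT; lra.
by split; apply: der_comp da.
Qed.

Lemma profile_sine_continuous (F : R -> R) s : {within `[0, pi / 2], continuous F} -> 0 <= s < 1 ->
  {for s, continuous (fun t => F (asin (Num.max t 0)))}.
Proof.
move=> cF /andP[s0 s1]; apply/cont_distP => e e0.
have ai : asin s \in `[0, pi / 2] by apply: asin_itvcc; rewrite s0 ltW.
have [d d0 dP] := within_at cF ai e0.
have sm : Num.max s 0 = s by rewrite max_l.
have ca : {for s, continuous (fun t : R => asin (Num.max t 0))}.
  apply: (continuous_comp (f := fun t : R => Num.max t 0)); first by apply: continuous_max; [exact: cvg_id|exact: cst_continuous].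
  by rewrite sm; apply: continuous_asin; rewrite s1 andbT; lra.
have [d1 d10 P1] := (cont_distP _ _).1 ca d d0.
exists (Num.min d1 (1 - s)); first by rewrite lt_min d10 subr_gt0.
move=> y; rewrite lt_min => /andP[y1 ys]; have := P1 y y1; rewrite sm => h.
apply: dP => //; apply: asin_itvcc; rewrite le_max lexx orbT ge_max ler01 andbT /=.
by move: ys; rewrite ltr_norml; lra.
Qed.

Lemma profile_sine_bounds : exists2 K : R, 0 < K & forall s, 0 <= s <= 1 ->
  `|f1 (asin s)| <= K * Num.sqrt (1 - s ^+ 2) /\ 0 <= 1 - f (asin s) <= K * (1 - s ^+ 2).
Proof.
have [K K0 KP] := profile_flat; exists K => // s /andP[s0 s1].
have := asin_itvcc (s := s); rewrite s0 s1 in_itv/= => /(_ isT)/andP[a0 a1].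
have s1' : -1 <= s <= 1 by rewrite s1 andbT; lra.
have := KP _ a0 a1; rewrite cos_asin// sqr_sqrtr// subr_ge0.
by rewrite expr_le1.
Qed.

Lemma profile_sine_ode s : 0 < s < 1 ->
  ((p - 1) * f1 (asin s) ^+ 2 + k ^+ 2 * f (asin s) ^+ 2) * f2 (asin s)
  + k * ((2 * p - 3) * k + n%:R - p) * f (asin s) * f1 (asin s) ^+ 2
  + k ^+ 3 * (k * (p - 1) + n%:R - p) * f (asin s) ^+ 3
  - (n%:R - 2) * (f1 (asin s) ^+ 2 + k ^+ 2 * f (asin s) ^+ 2) * f1 (asin s) * (s / Num.sqrt (1 - s ^+ 2)) = 0.
Proof.
move=> s01; have [_ _ _ ode] := P; have := asin_itv s01; rewrite in_itv/= => /andP[a0 a1].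
have s1' : -1 <= s <= 1 by move/andP : s01 => [s0 s1]; rewrite (ltW s1) andbT; lra.
have := ode (asin s); rewrite in_itv/= (ltW a0) a1 => /(_ isT).
by rewrite /tan cos_asin// asinK.
Qed.

Lemma profile_sine_mono s t : 0 <= s -> s <= t -> t <= 1 -> f (asin s) <= f (asin t).
Proof.
move=> s0; rewrite le_eqVlt => /predU1P[->//|st] t1.
have s1 : s <= 1 by apply: le_trans t1; exact: ltW.
have /andP[s2 _] : asin s \in `[0, pi / 2] by apply: asin_itvcc; rewrite s0.
have /andP[_ t2] : asin t \in `[0, pi / 2] by apply: asin_itvcc; rewrite t1 andbT (le_trans s0)// ltW.
apply: profile_mono => //; rewrite leNgt; apply/negP => ats.
have h x : 0 <= x -> x <= 1 -> sin (asin x) = x by move=> x0 x1; apply: asinK; rewrite in_itv/= x1 andbT; lra.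
have ti : 0 <= asin t by have := @asin_itvcc t; rewrite t1 (le_trans s0 (ltW st)) in_itv/= => /(_ isT)/andP[].
have si : asin s <= pi / 2 by have := @asin_itvcc s; rewrite s1 s0 in_itv/= => /(_ isT)/andP[].
have [y] := @MVT_segment R sin (@cos R) (asin t) (asin s) (ltW ats) (fun y _ => is_derive_sin y) (continuous_subspaceT (@continuous_sin R)).
rewrite in_itv/= !h ?(le_trans s0 (ltW st))// => /andP[y1 y2] E.
have : 0 <= s - t by rewrite E mulr_ge0 ?subr_ge0 ?(ltW ats)// cos_ge0_pihalf// (le_trans y2 si) andbT; move: pi2 ti y1; lra.
by move: st; lra.
Qed.

Lemma profile_sine_gt0 s : 0 < s -> s <= 1 -> 0 < f (asin s).
Proof.
move=> s0; rewrite le_eqVlt => /predU1P[->|s1]; first by rewrite asin1 profile_gt0.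
have := @asin_itv s; rewrite s0 s1 in_itv/= => /(_ isT)/andP[a0 a1].
by apply: profile_gt0 => //; exact: ltW.
Qed.

End profile_in_sine.

Section euclidean_derivatives.
Context {R : realType} {n : nat}.
Local Notation V := 'rV[R]_n.
Implicit Types (x v w z X : V).

Lemma dot_delta X i : dot X (delta_mx ord0 i) = X ord0 i.
Proof.
rewrite /dot (bigD1 i)//= mxE !eqxx mulr1 big1 ?addr0// => j ji.
by rewrite mxE (negPf ji) andbF mulr0.
Qed.

Lemma der_dotl z w x v : is_derive x v (fun x => dot (x - z) w) (dot v w).
Proof.
have := (der_line (fun x => dot (x - z) w) x v (dot v w) 0).2; rewrite scale0r addr0; apply.
rewrite (_ : (fun _ => _) = fun t : R => dot (x - z) w + t * dot v w); last first.
  by apply/funext => t; rewrite addrAC; move: (x - z) => X; rewrite dotDl dotZl.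
by der; ring.
Qed.

Lemma der_dot2 z x v : is_derive x v (fun x => dot (x - z) (x - z)) (2 * dot (x - z) v).
Proof.
have := (der_line (fun x => dot (x - z) (x - z)) x v (2 * dot (x - z) v) 0).2; rewrite scale0r addr0; apply.
rewrite (_ : (fun _ => _) = fun t : R => dot (x - z) (x - z) + t * (2 * dot (x - z) v) + t * t * dot v v); last first.
  by apply/funext => t; rewrite addrAC; move: (x - z) => X; rewrite dotDl !dotDr !dotZl !dotZr (dotC v); ring.
by der; ring.
Qed.

Lemma der_enorm z x v : 0 < enorm (x - z) -> is_derive x v (fun x => enorm (x - z)) (dot (x - z) v / enorm (x - z)).
Proof.
move=> r0; have d0 : 0 < dot (x - z) (x - z) by rewrite -enorm_sq exprn_gt0.
have := der_comp (g := fun x => dot (x - z) (x - z)) (is_derive1_sqrt d0) (der_dot2 z x v); move/is_derive_eq; apply.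
by rewrite -/(enorm _); field; rewrite gt_eqF.
Qed.

Lemma dotl_continuous z w : continuous (fun x : V => dot (x - z) w).
Proof.
suff H (x : V) : {for x, continuous (fun x : V => dot (x - z) w)} by move=> x; exact: H.
by apply: dot_continuous; [exact: cont_subr|exact: cst_continuous].
Qed.

Lemma enorm_shift_continuous z : continuous (fun x : V => enorm (x - z)).
Proof.
suff H (x : V) : {for x, continuous (fun x : V => enorm (x - z))} by move=> x; exact: H.
by apply: (continuous_comp (f := fun x : V => x - z)); [exact: cont_subr|exact: enorm_continuous].
Qed.

Lemma cont_squeeze (f a b : V -> R) x : (\forall y \near x, `|f y - a y| <= b y) -> {for x, continuous a} ->
  {for x, continuous b} -> b x = 0 -> {for x, continuous f}.
Proof.
move=> H ca cb b0; have fx : f x = a x.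
  by apply/eqP; rewrite -subr_eq0 -normr_le0 -b0; exact: nbhs_singleton H.
apply/(@cvgrPdist_lt _ R _ (nbhs x)) => e e0; near=> y.
have h1 : `|a x - a y| < e / 2.
  by near: y; move/cvgrPdist_lt : ca; apply; rewrite divr_gt0.
have h2 : `|b x - b y| < e / 2.
  by near: y; move/cvgrPdist_lt : cb; apply; rewrite divr_gt0.
have h3 : `|f y - a y| <= b y by near: y.
rewrite fx; move: h1 h2 h3; rewrite b0 sub0r normrN !ltr_norml ler_norml => /andP[? ?] /andP[? ?] /andP[? ?].
by apply/andP; split; lra.
Unshelve. all: by end_near. Qed.

End euclidean_derivatives.

Section clamped_profile.
Context {R : realType}.
Variables (n : nat) (p k : R) (f f1 f2 : R -> R).
Hypothesis P : quasiradial_profile n p k f f1 f2.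
Implicit Types (s t : R).

(* Profiles are composed with [asin] because the sine of the latitude is smooth
   across the axis, unlike the latitude. *)
Definition sine_fun (F : R -> R) s : R := F (asin (Num.max s 0)).

Lemma sine_funE (F : R -> R) s : 0 <= s -> sine_fun F s = F (asin s).
Proof. by move=> s0; rewrite /sine_fun max_l. Qed.

Lemma sine_fun_continuous (F : R -> R) s : {within `[0, pi / 2], continuous F} -> s < 1 ->
  {for s, continuous (sine_fun F)}.
Proof.
move=> cF s1; have m1 : 0 <= Num.max s 0 < 1 by rewrite le_max lexx orbT gt_max s1 ltr01.
rewrite (_ : sine_fun F = fun t => sine_fun F (Num.max t 0)); last first.
  by apply/funext => t; rewrite /sine_fun max_maxKx.
apply: (continuous_comp (f := fun t : R => Num.max t 0)); first by apply: continuous_max; [exact: cvg_id|exact: cst_continuous].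
exact: (profile_sine_continuous cF m1).
Qed.

Lemma sine_fun_der s : 0 < s < 1 ->
  is_derive s (1 : R) (sine_fun f) (sine_fun f1 s / Num.sqrt (1 - s ^+ 2)) /\
  is_derive s (1 : R) (sine_fun f1) (sine_fun f2 s / Num.sqrt (1 - s ^+ 2)).
Proof.
move=> s01; have [s0 s1] := andP s01; have [d1 d2] := der_profile_sine P s01.
have N (F : R -> R) : \forall t \near s, F (asin t) = sine_fun F t.
  by near=> t; rewrite sine_funE//; apply/ltW; near: t; exact: lt_nbhsr.
by rewrite !sine_funE ?(ltW s0)//; split; [apply: (der_near (N f))|apply: (der_near (N f1))].
Unshelve. all: by end_near. Qed.

End clamped_profile.

(** * The quasiradial function and its gradient *)

Section quasiradial_function.
Context {R : realType} {m : nat}.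
Local Notation V := 'rV[R]_m.
Variables (n : nat) (p k : R) (f f1 f2 : R -> R) (z e : V).
Hypothesis P : quasiradial_profile n p k f f1 f2.
Hypothesis k0 : k < 0.
Hypothesis ee : dot e e = 1.
Implicit Types (x v w : V).

Definition rad x : R := enorm (x - z).
(** The sine of the latitude seen from the apex [z], not the latitude itself. *)
Definition lat x : R := dot (x - z) e / rad x.
Definition halfspace : set V := [set x | 0 < dot (x - z) e].
Definition quasi x : R := rad x `^ k * sine_fun f (lat x).
(** The component of the axis [e] orthogonal to $x - z$; it is [rad] times the gradient of [lat]. *)
Definition tang x : V := e - (lat x / rad x) *: (x - z).
(** Derivative of the profile with respect to the sine. On the axis the denominator is zero and the
    quotient is 0 by convention; the value is harmless because [tang] vanishes there. *)
Definition slope x : R := sine_fun f1 (lat x) / Num.sqrt (1 - lat x ^+ 2).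
Definition qgrad x : V :=
  rad x `^ (k - 1) *: ((k * sine_fun f (lat x) / rad x) *: (x - z) + slope x *: tang x).

Lemma halfspace_open : open halfspace.
Proof.
rewrite openE => x /= Hx; near=> y; rewrite /halfspace /=; near: y.
by have := @dotl_continuous R m z e x; move/cvgr_gt; exact.
Unshelve. all: by end_near. Qed.

Lemma enorm_axis : enorm e = 1.
Proof. by rewrite /enorm ee sqrtr1. Qed.

Lemma halfspace_rad x : halfspace x -> 0 < rad x.
Proof.
move=> Hx; rewrite /rad lt_neqAle enorm_ge0 andbT eq_sym; apply/eqP => /enorm0_eq r0.
by move: Hx; rewrite /halfspace /= r0 /dot big1 ?ltxx// => i _; rewrite mxE mul0r.
Qed.

Lemma lat_le1 x : 0 < rad x -> lat x <= 1.
Proof.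
by move=> r0; rewrite ler_pdivrMr// mul1r; have := cauchy_schwarz (x - z) e; rewrite enorm_axis mulr1.
Qed.

Lemma halfspace_lat x : halfspace x -> 0 < lat x <= 1.
Proof. by move=> Hx; have r0 := halfspace_rad Hx; rewrite lat_le1// divr_gt0. Qed.

Lemma lat_rad x : 0 < rad x -> lat x * rad x = dot (x - z) e.
Proof. by move=> r0; rewrite divfK// gt_eqF. Qed.

Lemma dot_tang_radial x : 0 < rad x -> dot (x - z) (tang x) = 0.
Proof.
move=> r0; rewrite dotDr dotNr dotZr -enorm_sq -/(rad x) -(lat_rad r0); field.
by rewrite gt_eqF.
Qed.

Lemma dot_tang_axis x : 0 < rad x -> dot e (tang x) = 1 - lat x ^+ 2.
Proof.
move=> r0; rewrite dotDr dotNr dotZr ee (dotC e) -(lat_rad r0); field.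
by rewrite gt_eqF.
Qed.

Lemma dot_tang x : 0 < rad x -> dot (tang x) (tang x) = 1 - lat x ^+ 2.
Proof.
move=> r0; rewrite {1}/tang dotDl dotNl dotZl dot_tang_radial// mulr0 subr0.
exact: dot_tang_axis.
Qed.

Lemma lat2_le1 x : 0 < rad x -> 0 <= 1 - lat x ^+ 2.
Proof. by move=> r0; rewrite -dot_tang// dot_ge0. Qed.

Lemma tang_axis x : 0 < rad x -> lat x = 1 -> tang x = 0.
Proof.
by move=> r0 s1; apply: enorm0_eq; apply/eqP; rewrite -sqrf_eq0 enorm_sq dot_tang// s1 expr1n subrr.
Qed.

Lemma der_lat x v : 0 < rad x -> is_derive x v lat (dot (tang x) v / rad x).
Proof.
move=> r0; have rn : rad x != 0 by rewrite gt_eqF.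
apply: (is_derive_eq (der_M (der_dotl z e x v) (der_V rn (der_enorm v r0)))).
by rewrite /tang /lat -/(rad x) (dotC v); move: (x - z) rn => X rn; rewrite dotDl dotNl dotZl; field.
Qed.

Lemma der_rad_pow (a : R) x v : 0 < rad x ->
  is_derive x v (fun x => rad x `^ a) (a * rad x `^ (a - 1) * (dot (x - z) v / rad x)).
Proof. by move=> r0; apply: (der_comp (is_derive1_powR a r0) (der_enorm v r0)). Qed.

Lemma rad_continuous : continuous rad.
Proof. exact: enorm_shift_continuous. Qed.

Lemma rad_pow_continuous (a : R) x : 0 < rad x -> {for x, continuous (fun x => rad x `^ a)}.
Proof.
move=> r0; apply: (continuous_comp (f := rad) (g := fun t : R => t `^ a)); first exact: rad_continuous.
exact: powR_continuous_at.
Qed.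

Lemma rad_inv_continuous x : 0 < rad x -> {for x, continuous (fun x => (rad x)^-1)}.
Proof. by move=> r0; apply: continuousV; [rewrite gt_eqF|exact: rad_continuous]. Qed.

Lemma lat_continuous x : 0 < rad x -> {for x, continuous lat}.
Proof. by move=> r0; apply: continuousM; [exact: dotl_continuous|exact: rad_inv_continuous]. Qed.

Lemma lat2_continuous x : 0 < rad x -> {for x, continuous (fun x => 1 - lat x ^+ 2)}.
Proof.
move=> r0; apply: continuousB; first exact: cst_continuous.
by apply: (continuous_comp (f := lat) (g := fun t : R => t ^+ 2)); [exact: lat_continuous|exact: exprn_continuous].
Qed.

Lemma coord_sub_continuous i : continuous (fun x : V => (x - z) ord0 i).
Proof.
suff H (x : V) : {for x, continuous (fun x : V => (x - z) ord0 i)} by move=> x; exact: H.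
by apply: (continuous_comp (f := fun x : V => x - z) (g := fun y : V => y ord0 i)); [exact: cont_subr|exact: coord_continuous].
Qed.

Lemma tang_coord x i : tang x ord0 i = e ord0 i - lat x / rad x * (x - z) ord0 i.
Proof. by rewrite /tang !mxE. Qed.

Lemma tang_continuous x i : 0 < rad x -> {for x, continuous (fun x => tang x ord0 i)}.
Proof.
move=> r0; rewrite (_ : (fun _ => _) = fun x => e ord0 i - lat x / rad x * (x - z) ord0 i); last first.
  by apply/funext => y; rewrite tang_coord.
apply: continuousB; first exact: cst_continuous.
apply: continuousM; last exact: coord_sub_continuous.
by apply: continuousM; [exact: lat_continuous|exact: rad_inv_continuous].
Qed.

Lemma slope_bound : exists2 K : R, 0 < K & forall x, 0 < rad x -> 0 <= lat x ->
  `|slope x| <= K /\ 0 <= 1 - sine_fun f (lat x) <= K * (1 - lat x ^+ 2).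
Proof.
have [K K0 KP] := profile_sine_bounds P; exists K => // x r0 s0.
have [h1 h2] := KP (lat x) (ltac:(by rewrite s0 lat_le1)).
rewrite sine_funE//; split => //; rewrite /slope sine_funE//.
have [->|c0] := eqVneq (Num.sqrt (1 - lat x ^+ 2)) 0; first by rewrite invr0 mulr0 normr0 ltW.
have c1 : 0 < Num.sqrt (1 - lat x ^+ 2) by rewrite lt_neqAle eq_sym c0 sqrtr_ge0.
by rewrite normrM normfV [`|Num.sqrt _|]gtr0_norm// ler_pdivrMr.
Qed.

Lemma profile_lat_continuous x : 0 < rad x -> {for x, continuous (fun x => sine_fun f (lat x))}.
Proof.
move=> r0; have [[cf _ _ _] _ _ _] := P.
have := lat_le1 r0; rewrite le_eqVlt => /predU1P[s1|s1]; last first.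
  by apply: (continuous_comp (f := lat)); [exact: lat_continuous|apply: sine_fun_continuous].
have [K K0 KP] := slope_bound.
apply: (@cont_squeeze _ _ _ (fun=> 1) (fun x => K * (1 - lat x ^+ 2))).
- near=> y; have ry : 0 < rad y by near: y; have := @rad_continuous x; move/cvgr_gt; exact.
  have sy : 0 <= lat y.
    by apply: ltW; near: y; have := lat_continuous r0; move/cvgr_gt; apply; rewrite s1.
  have [_ /andP[h1 h2]] := KP y ry sy.
  by rewrite -normrN opprB ger0_norm.
- exact: cst_continuous.
- by apply: continuousM; [exact: cst_continuous|exact: lat2_continuous].
- by rewrite s1 expr1n subrr !mulr0.
Unshelve. all: by end_near. Qed.

Lemma quasi_continuous x : 0 < rad x -> {for x, continuous quasi}.
Proof.
by move=> r0; apply: continuousM; [exact: rad_pow_continuous|exact: profile_lat_continuous].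
Qed.

Lemma quasi_gt0 x : halfspace x -> 0 < quasi x.
Proof.
move=> Hx; have /andP[s0 s1] := halfspace_lat Hx.
by rewrite mulr_gt0 ?powR_gt0 ?halfspace_rad// sine_funE ?ltW// (profile_sine_gt0 P).
Qed.

Lemma qgrad_coord x i : qgrad x ord0 i =
  rad x `^ (k - 1) * (k * sine_fun f (lat x) / rad x * (x - z) ord0 i + slope x * tang x ord0 i).
Proof. by rewrite /qgrad /tang !mxE. Qed.

Lemma dot_qgrad x v : dot (qgrad x) v =
  rad x `^ (k - 1) * (k * sine_fun f (lat x) / rad x * dot (x - z) v + slope x * dot (tang x) v).
Proof. by rewrite /qgrad; move: (x - z) (tang x) => X T; rewrite dotZl dotDl !dotZl. Qed.

Lemma qgrad_continuous x i : halfspace x -> {for x, continuous (fun x => qgrad x ord0 i)}.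
Proof.
move=> Hx; have r0 := halfspace_rad Hx; have /andP[s0 s1] := halfspace_lat Hx.
have [[cf cf1 _ _] _ _ _] := P.
rewrite (_ : (fun _ => _) = fun x => rad x `^ (k - 1) * (k * sine_fun f (lat x) / rad x * (x - z) ord0 i + slope x * tang x ord0 i)); last first.
  by apply/funext => y; rewrite qgrad_coord.
apply: continuousM; first exact: rad_pow_continuous.
have cX : {for x, continuous (fun x => (x - z) ord0 i)} by exact: coord_sub_continuous.
have [K K0 KP] := slope_bound.
have cfl := profile_lat_continuous r0.
apply: continuousD.
  apply: continuousM => //; apply: continuousM; last exact: rad_inv_continuous.
  by apply: continuousM; [exact: cst_continuous|].
move: (s1); rewrite le_eqVlt => /predU1P[s1'|s1']; last first.
  apply: continuousM; last exact: tang_continuous.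
  apply: continuousM.
    by apply: (continuous_comp (f := lat)); [exact: lat_continuous|apply: sine_fun_continuous].
  apply: continuousV; first by rewrite gt_eqF// sqrtr_gt0 subr_gt0 expr_lt1// ltW.
  by apply: (continuous_comp (f := fun x => 1 - lat x ^+ 2)); [exact: lat2_continuous|exact: sqrt_continuous].
apply: (@cont_squeeze _ _ _ (fun=> 0) (fun x => K * `|tang x ord0 i|)).
- near=> y; have Hy : halfspace y by near: y; apply: open_nbhs_nbhs; split => //; exact: halfspace_open.
  have /andP[sy _] := halfspace_lat Hy.
  have [h _] := KP y (halfspace_rad Hy) (ltW sy).
  by rewrite subr0 normrM ler_wpM2r.
- exact: cst_continuous.
- apply: continuousM; first exact: cst_continuous.
  by apply: (continuous_comp (f := fun x => tang x ord0 i)); [exact: tang_continuous|exact: norm_continuous].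
- by rewrite (tang_axis r0 s1') mxE normr0 mulr0.
Unshelve. all: by end_near. Qed.

Lemma der_quasi x i : halfspace x -> is_derive x (delta_mx ord0 i) quasi (qgrad x ord0 i).
Proof.
move=> Hx; have r0 := halfspace_rad Hx; have /andP[s0 s1] := halfspace_lat Hx.
have rn : rad x != 0 by rewrite gt_eqF.
pose v : V := delta_mx ord0 i; have [[cf cf1 _ _] _ _ _] := P.
have rk : rad x `^ k = rad x `^ (k - 1) * rad x.
  by rewrite -[X in _ * X](powRr1 (ltW r0)) -powRD ?rn ?implybT// subrK.
rewrite -dot_delta -/v dot_qgrad.
move: (s1); rewrite le_eqVlt => /predU1P[s1'|s1']; last first.
  have [d1 _] := sine_fun_der P (s := lat x) (ltac:(by rewrite s0)).
  have := der_M (der_rad_pow k v r0) (der_comp d1 (der_lat v r0)).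
  by move/is_derive_eq; apply; rewrite rk -/(slope x); field.
have g1 : sine_fun f (lat x) = 1 by rewrite s1' sine_funE// asin1; have [_ _ []] := P.
rewrite (tang_axis r0 s1') g1 {2}/dot big1 ?mulr0 ?addr0; last by move=> j _; rewrite mxE mul0r.
have [K K0 KP] := slope_bound.
(* On the axis [quasi] equals $\mathrm{rad}^k$, and the defect [D] is $O(t^2)$ along every line
   through [x], so it contributes derivative 0. *)
pose D y := rad y `^ k * (1 - sine_fun f (lat y)).
have D0 : D x = 0 by rewrite /D g1 subrr mulr0.
have dD : is_derive x v D 0.
  have := (der_line D x v 0 0).2; rewrite scale0r addr0; apply.
  have cl : (x + t *: v) @[t --> (0 : R)] --> x.
    rewrite -[X in _ --> X](addr0 x) -(scale0r v); apply: cvgD; first exact: cvg_cst.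
    by apply: cvgZr_tmp; exact: cvg_id.
  pose B y := rad y `^ k * K * ((rad y)^-1 * (rad y)^-1).
  have cB : {for x, continuous B}.
    apply: continuousM; first by apply: continuousM; [exact: rad_pow_continuous|exact: cst_continuous].
    by apply: continuousM; exact: rad_inv_continuous.
  have B0 y : 0 <= B y by rewrite mulr_ge0 ?mulr_ge0 ?powR_ge0 ?(ltW K0) ?invr_ge0 ?enorm_ge0.
  have Xe : x - z = rad x *: e.
    have /eqP := tang_axis r0 s1'; rewrite subr_eq0 s1' => /eqP ->.
    by rewrite scalerA mulrCA mulfV// mul1r scale1r.
  have vv : 0 <= dot v v by exact: dot_ge0.
  apply: (@der_quadratic _ _ ((B x + 1) * (dot v v + 1))).
    by apply: mulr_gt0; apply: ltr_wpDl.
  have nB : \forall y \near x, B y < B x + 1 /\ 0 < rad y /\ 0 <= lat y.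
    near=> y; split; first by near: y; move/cvgr_lt : cB; apply; rewrite ltrDl.
    split; first by near: y; have := @rad_continuous x; move/cvgr_gt; exact.
    by apply: ltW; near: y; have := lat_continuous r0; move/cvgr_gt; apply; rewrite s1'.
  near=> t; have [By [ry sy]] : B (x + t *: v) < B x + 1 /\ 0 < rad (x + t *: v) /\ 0 <= lat (x + t *: v) by near: t; exact: (cl _ nB).
  rewrite scale0r addr0 D0 subr0; set y := x + t *: v in By ry sy *.
  have [_ /andP[h1 h2]] := KP y ry sy.
  (* As $x - z$ is parallel to [e], the squared distance of [y] from the axis is $t^2$ times the
     same quantity for [v]. *)
  have E : 1 - lat y ^+ 2 = (rad y)^-1 * (rad y)^-1 * (t ^+ 2 * (dot v v - dot v e ^+ 2)).
    have ryn : rad y != 0 by rewrite gt_eqF.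
    have -> : 1 - lat y ^+ 2 = (rad y)^-1 * (rad y)^-1 * (rad y ^+ 2 - dot (y - z) e ^+ 2).
      by rewrite /lat; field.
    congr (_ * _); rewrite enorm_sq /y addrAC Xe !dotDl !dotDr !dotZl !dotZr ee (dotC e v); ring.
  rewrite /D normrM !ger0_norm ?powR_ge0//.
  apply: le_trans (ler_wpM2l (powR_ge0 _ _) h2) _; rewrite E.
  rewrite (_ : rad y `^ k * _ = B y * (t ^+ 2 * (dot v v - dot v e ^+ 2))); last by rewrite /B; ring.
  have -> : (B x + 1) * (dot v v + 1) * t ^+ 2 = (B x + 1) * (t ^+ 2 * (dot v v + 1)) by ring.
  apply: ler_pM => //; last by apply: ler_wpM2l; [exact: sqr_ge0|have := sqr_ge0 (dot v e); lra].
    apply: mulr_ge0; first exact: sqr_ge0.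
    rewrite subr_ge0 -enorm_sq; have := cauchy_schwarz v e; have := cauchy_schwarz (- v) e.
    rewrite enormN enorm_axis mulr1 dotNl => u1 u2.
    by rewrite -(real_normK (num_real (dot v e))) ler_sqr ?nnegrE ?enorm_ge0// ler_norml; apply/andP; move: u1 u2; split; lra.
  exact: ltW.
have := der_D (der_rad_pow k v r0) (der_N dD).
rewrite subr0 => /is_derive_eq H; rewrite (_ : quasi = fun y => rad y `^ k - D y); last first.
  by apply/funext => y; rewrite /quasi /D; ring.
by apply: H; field.
Unshelve. all: by end_near. Qed.

End quasiradial_function.

(** * Divergence-free fields in weak form *)

Section divergence_free_fields.
Context {R : realType} {n : nat}.
Local Notation V := 'rV[R]_n.
Local Notation mu := (@lebesgue_Rn R n).
Implicit Types (u phi : V -> R) (x y : V) (O D K : set V).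

Lemma rst_continuous_integrable O K u phi : open O -> compact K -> K `<=` O -> (forall x, O x -> {for x, continuous u}) ->
  ccs phi -> mu.-integrable setT (EFin \o (fun x => rst K u x * phi x)).
Proof.
move=> oO cK KO cu cphi; have [C _ hC] := ccs_bound cphi.
have iu := bcs_integrable (rst_bcs oO cK KO cu).
by apply: (integrable_Mbounded iu _ hC); exact: integrable_mfun (ccs_integrable cphi).
Qed.

Lemma rst_mulr K u phi x : (forall x, ~ K x -> phi x = 0) -> u x * phi x = rst K u x * phi x.
Proof.
by move=> phi0; have [Kx|nx] := pselect (K x); [rewrite rst_in|rewrite phi0// !mulr0].
Qed.

Lemma integral_by_parts O K u (du : V -> R) phi i : open O -> K `<=` O -> c1c K phi ->
  (forall x, O x -> {for x, continuous u}) -> (forall x, O x -> {for x, continuous du}) ->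
  (forall x, O x -> is_derive x (delta_mx ord0 i) u (du x)) ->
  \int[mu]_x (u x * partial i phi x) = - \int[mu]_x (du x * phi x).
Proof.
move=> oO KO cphi cu cdu dd; have [ccphi ccp] := c1c_ccs cphi; have [_ cK phi0] := cphi.
have dphi0 x : ~ K x -> partial i phi x = 0 by exact: partial_out.
pose f x := u x * phi x; pose F x := du x * phi x + u x * partial i phi x.
have f0 x : O x -> ~ K x -> f x = 0 by move=> _ nx; rewrite /f phi0// mulr0.
have F0 x : O x -> ~ K x -> F x = 0 by move=> _ nx; rewrite /F phi0// dphi0// !mulr0 addr0.
have df x : is_derive x (delta_mx ord0 i) (rst K f) (rst K F x).
  apply: (rst_der _ oO cK KO f0 F0) => y Oy.
  exact: (der_M (dd y Oy) (c1c_der i y cphi)).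
have pE : partial i (rst K f) = rst K F.
  by apply/funext => x; rewrite /partial; have [_ ->] := df x.
have cF : continuous (rst K F).
  apply: (rst_continuous oO cK KO F0) => x Ox; apply: continuousD; apply: continuousM.
  - exact: cdu.
  - exact: ccphi.1.
  - exact: cu.
  - exact: (ccp i).1.
have I0 : \int[mu]_x (rst K F x) = 0.
  have := @integral_partial0 R n i (rst K f) K cK; rewrite pE /Rintegral => -> //.
  by move=> x; exact: rst_out.
apply/eqP; rewrite -subr_eq0 opprK -I0.
under eq_Rintegral do rewrite (rst_mulr u _ dphi0).
under [X in _ + X == _]eq_Rintegral do rewrite (rst_mulr du _ phi0).
rewrite -RintegralD; [|exact: measurableT|exact: (rst_continuous_integrable oO cK KO cu (ccp i))|
  exact: (rst_continuous_integrable oO cK KO cdu ccphi)].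
apply/eqP/eq_Rintegral => x _; have [Kx|nx] := pselect (K x); first by rewrite !rst_in// addrC.
by rewrite !rst_out// !mul0r addr0.
Qed.

Lemma divergence_free_weak O K (F dF : 'I_n -> V -> R) phi : open O -> K `<=` O -> c1c K phi ->
  (forall i x, O x -> {for x, continuous (F i)}) -> (forall i x, O x -> {for x, continuous (dF i)}) ->
  (forall i x, O x -> is_derive x (delta_mx ord0 i) (F i) (dF i x)) ->
  (forall x, O x -> \sum_i dF i x = 0) ->
  \int[mu]_x (\sum_i F i x * partial i phi x) = 0.
Proof.
move=> oO KO cphi cF cdF dF_ div0; have [ccphi ccp] := c1c_ccs cphi; have [_ cK phi0] := cphi.
have dphi0 i x : ~ K x -> partial i phi x = 0 by exact: partial_out.
have E (a : 'I_n -> V -> R) (b : 'I_n -> V -> R) (s : seq 'I_n) : (forall i, mu.-integrable setT (EFin \o (fun x => a i x * b i x))) ->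
    \int[mu]_x (\sum_(i <- s) a i x * b i x) = \sum_(i <- s) \int[mu]_x (a i x * b i x).
  move=> iab; elim: s => [|i s IH].
    under eq_Rintegral do rewrite big_nil.
    by rewrite Rintegral_cst// mul0r big_nil.
  under eq_Rintegral do rewrite big_cons.
  by rewrite RintegralD ?big_cons ?IH; [|exact: measurableT|exact: iab|exact: integrable_sumr].
transitivity (\int[mu]_x (\sum_i rst K (F i) x * partial i phi x)).
  by apply: eq_Rintegral => x _; apply: eq_bigr => i _; exact: (rst_mulr _ _ (dphi0 i)).
rewrite E; last by move=> i; exact: (rst_continuous_integrable oO cK KO (cF i) (ccp i)).
transitivity (- \sum_i \int[mu]_x (rst K (dF i) x * phi x)).
  rewrite -sumrN; apply: eq_bigr => i _.
  under eq_Rintegral do rewrite -(rst_mulr (F i) _ (dphi0 i)).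
  under [X in _ = - X]eq_Rintegral do rewrite -(rst_mulr (dF i) _ phi0).
  exact: (integral_by_parts oO KO cphi (cF i) (cdF i) (dF_ i)).
rewrite -E; last by move=> i; exact: (rst_continuous_integrable oO cK KO (cdF i) ccphi).
apply/eqP; rewrite oppr_eq0; apply/eqP.
transitivity (\int[mu]_(x in [set: V]) (0 : R)); last by rewrite Rintegral_cst// mul0r.
apply: eq_Rintegral => x _; have [Kx|nx] := pselect (K x); last first.
  by rewrite big1// => i _; rewrite phi0// mulr0.
by rewrite -mulr_suml; under eq_bigr do rewrite rst_in//; rewrite div0 ?mul0r//; exact: KO.
Qed.

End divergence_free_fields.

(** * The profile equation as a vanishing divergence *)

Section flux_of_profile.
Context {R : realType}.
Variables (n : nat) (p k : R) (f f1 f2 : R -> R).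
Hypothesis P : quasiradial_profile n p k f f1 f2.
Hypothesis k0 : k < 0.
Implicit Types (s t : R).

Local Notation g := (sine_fun f).
Local Notation g1 := (sine_fun f1).
Local Notation g2 := (sine_fun f2).
Local Notation cs s := (Num.sqrt (1 - s ^+ 2)).

(** Squared length of the gradient of [quasi] at radius 1, as a function of the sine. *)
Definition gradsq s : R := k ^+ 2 * g s ^+ 2 + g1 s ^+ 2.
Definition weight s : R := gradsq s `^ ((p - 2) / 2).
Definition dweight s : R := (p - 2) * gradsq s `^ ((p - 4) / 2) * ((k ^+ 2 * g s * g1 s + g1 s * g2 s) / cs s).
(** With $a = (k-1)(p-1)$, the field $|\nabla h|^{p-2}\nabla h$ of the quasiradial $h$ is $r^a$
    [flux_e] times [e] plus $r^{a-1}$ [flux_r] times $x - z$. In this frame one vector is constant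
    and the other has divergence equal to the dimension. *)
Definition flux_e s : R := weight s * (g1 s / cs s).
Definition dflux_e s : R := dweight s * (g1 s / cs s) + weight s * (g2 s / cs s / cs s + g1 s * (s / cs s ^+ 3)).
Definition flux_r s : R := k * (weight s * g s) - s * flux_e s.
Definition dflux_r s : R := k * (dweight s * g s + weight s * (g1 s / cs s)) - (flux_e s + s * dflux_e s).

Lemma gradsq_gt0 s : 0 < s <= 1 -> 0 < gradsq s.
Proof.
move=> /andP[s0 s1]; rewrite ltr_wpDr ?sqr_ge0// mulr_gt0// exprn_even_gt0//=; first by rewrite lt_eqF.
by rewrite gt_eqF// sine_funE ?(profile_sine_gt0 P)// ltW.
Qed.

Lemma weightE s : 0 < s <= 1 -> weight s = gradsq s * gradsq s `^ ((p - 4) / 2).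
Proof.
move=> s01; have N0 := gradsq_gt0 s01; rewrite /weight -[X in _ = X * _](powRr1 (ltW N0)) -powRD ?(gt_eqF N0) ?implybT//.
by congr (_ `^ _); field.
Qed.

Lemma der_cs s : 0 < s < 1 -> is_derive s (1 : R) (fun s => (cs s)^-1) (s / cs s ^+ 3).
Proof.
move=> s01; have c0 := cos_asin_gt0 s01.
have d0 : 0 < 1 - s ^+ 2 by rewrite -sqrtr_gt0.
have d1 : is_derive s (1 : R) (fun s => 1 - s ^+ 2) (- (2 * s)).
  by der; rewrite expr1 mulr1 add0r.
have cn : cs s != 0 by rewrite gt_eqF.
have := der_V (g := fun s => cs s) cn (der_comp (g := fun s => 1 - s ^+ 2) (is_derive1_sqrt d0) d1); move/is_derive_eq; apply.
by field.
Qed.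

Lemma der_weight s : 0 < s < 1 -> is_derive s (1 : R) weight (dweight s).
Proof.
move=> s01; have [s0 s1] := andP s01; have [d1 d2] := sine_fun_der P s01.
have N0 : 0 < gradsq s by rewrite gradsq_gt0// s0 ltW.
have dN : is_derive s (1 : R) gradsq (k ^+ 2 * (2 * g s * (g1 s / cs s)) + 2 * g1 s * (g2 s / cs s)).
  by rewrite /gradsq; der; rewrite ?expr1; ring.
have := der_comp (is_derive1_powR ((p - 2) / 2) N0) dN; move/is_derive_eq; apply.
rewrite /dweight (_ : (p - 2) / 2 - 1 = (p - 4) / 2); last by field.
by field; rewrite gt_eqF// cos_asin_gt0.
Qed.

Lemma der_flux_e s : 0 < s < 1 -> is_derive s (1 : R) flux_e (dflux_e s).
Proof.
move=> s01; have [d1 d2] := sine_fun_der P s01.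
have := der_M (der_weight s01) (der_M d2 (der_cs s01)); move/is_derive_eq; apply.
by rewrite /dflux_e.
Qed.

Lemma der_flux_r s : 0 < s < 1 -> is_derive s (1 : R) flux_r (dflux_r s).
Proof.
move=> s01; have [d1 d2] := sine_fun_der P s01; have dw := der_weight s01; have de := der_flux_e s01.
have := der_D (der_M (der_cst s 1 k) (der_M dw d1)) (der_N (der_M (der_id s) de)).
by move/is_derive_eq; apply; rewrite /dflux_r; ring.
Qed.

Lemma dflux_continuous s : 0 < s < 1 -> {for s, continuous dflux_e} /\ {for s, continuous dflux_r}.
Proof.
move=> s01; have [s0 s1] := andP s01; have [[cf cf1 cf2 _] _ _ _] := P.
have N0 : 0 < gradsq s by rewrite gradsq_gt0// s0 ltW.
have cg : {for s, continuous g} by apply: sine_fun_continuous.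
have cg1 : {for s, continuous g1} by apply: sine_fun_continuous.
have cg2 : {for s, continuous g2} by apply: sine_fun_continuous.
have ci : {for s, continuous (fun s => (cs s)^-1)} := der_continuous_at (der_cs s01).
have cX (F : R -> R) m : {for s, continuous F} -> {for s, continuous (fun s => F s ^+ m)}.
  by move=> cF; apply: (continuous_comp (f := F) (g := fun t : R => t ^+ m)); [|exact: exprn_continuous].
have cc (c : R) : {for s, continuous (fun _ : R => c)} by exact: cst_continuous.
have cN : {for s, continuous gradsq}.
  by apply: continuousD; [apply: continuousM; [exact: cc|exact: cX]|exact: cX].
have cP (b : R) : {for s, continuous (fun s => gradsq s `^ b)}.
  by apply: (continuous_comp (f := gradsq) (g := fun t : R => t `^ b)); [|exact: powR_continuous_at].
have cw : {for s, continuous weight} by exact: cP.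
have cdw : {for s, continuous dweight}.
  apply: continuousM; first by apply: continuousM; [exact: cc|exact: cP].
  apply: continuousM; last exact: ci.
  apply: continuousD; last exact: continuousM.
  by apply: continuousM; [apply: continuousM; [exact: cc|]|].
have c3 : {for s, continuous (fun s => s / cs s ^+ 3)}.
  apply: continuousM; first exact: cvg_id.
  rewrite (_ : (fun _ => _) = fun s => (cs s)^-1 ^+ 3); first exact: cX.
  by apply/funext => t; rewrite exprVn.
have cde : {for s, continuous dflux_e}.
  apply: continuousD.
    by apply: continuousM; [|apply: continuousM].
  apply: continuousM; first exact: cw.
  apply: continuousD; last exact: continuousM.
  by apply: continuousM; [apply: continuousM|].
split => //; apply: continuousB.
  apply: continuousM; first exact: cc.
  apply: continuousD; first exact: continuousM.
  by apply: continuousM; [|apply: continuousM].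
apply: continuousD; first exact: der_continuous_at (der_flux_e s01).
by apply: continuousM; [exact: cvg_id|].
Qed.

(** The profile equation multiplied by the power $(p-4)/2$ of [gradsq]; the left side is the
    divergence of the field at radius 1. *)
Lemma flux_ode s : 0 < s < 1 -> let a := (k - 1) * (p - 1) in
  (n%:R + a - 1) * flux_r s + a * s * flux_e s + (1 - s ^+ 2) * dflux_e s = 0.
Proof.
move=> s01 a; have [s0 s1] := andP s01; have c0 := cos_asin_gt0 s01.
have cn : cs s != 0 by rewrite gt_eqF.
have c2 : 1 - s ^+ 2 = cs s ^+ 2 by rewrite sqr_sqrtr// ltW// -sqrtr_gt0.
have := profile_sine_ode P s01; rewrite -!(sine_funE _ (ltW s0)) => ode.
rewrite c2 /flux_r /dflux_e /flux_e /dweight (weightE _) ?s0 ?(ltW s1)// /gradsq.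
set E := (_ `^ ((p - 4) / 2)); set c := cs s.
rewrite -[RHS](mulr0 E) -[in RHS]ode /a -/c; field.
exact: cn.
Qed.

End flux_of_profile.

Lemma powR_step {R : realType} (b r : R) : 0 < r -> r `^ b = r `^ (b - 1) * r.
Proof. by move=> r0; rewrite -[X in _ * X](powRr1 (ltW r0)) -powRD ?(gt_eqF r0) ?implybT// subrK. Qed.

(** * The field of the quasiradial function off the axis *)

Section quasiradial_flux.
Context {R : realType} {n : nat}.
Local Notation V := 'rV[R]_n.
Local Notation mu := (@lebesgue_Rn R n).
Variables (p k : R) (f f1 f2 : R -> R) (z e : V).
Hypothesis P : quasiradial_profile n p k f f1 f2.
Hypothesis k0 : k < 0.
Hypothesis p1 : 1 < p.
Hypothesis ee : dot e e = 1.
Implicit Types (x v w : V).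

Local Notation rad := (rad z).
Local Notation lat := (lat z e).
Local Notation G := (qgrad k f f1 z e).
Local Notation O := (halfspace z e).
Local Notation a := ((k - 1) * (p - 1)).

Definition off_axis : set V := [set x | O x /\ 0 < 1 - lat x ^+ 2].

Lemma off_axis_open : open off_axis.
Proof.
apply: superlevel_open; first exact: halfspace_open.
by move=> x Ox; apply: lat2_continuous; exact: (halfspace_rad Ox).
Qed.

Lemma off_axis_lat x : off_axis x -> 0 < lat x < 1.
Proof.
move=> [Ox]; rewrite subr_gt0; have /andP[s0 s1] := halfspace_lat ee Ox.
by rewrite s0 /= expr_lt1 ?(ltW s0).
Qed.

Definition flux i x : R :=
  rad x `^ (a - 1) * flux_r p k f f1 (lat x) * (x - z) ord0 i + rad x `^ a * flux_e p k f f1 (lat x) * e ord0 i.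

Lemma dot_qgrad2 x : O x -> dot (G x) (G x) =
  (rad x `^ (k - 1)) ^+ 2 * (k ^+ 2 * sine_fun f (lat x) ^+ 2 + slope f1 z e x ^+ 2 * (1 - lat x ^+ 2)).
Proof.
move=> Ox; have r0 := halfspace_rad Ox; have rn : rad x != 0 by rewrite gt_eqF.
rewrite dot_qgrad !(dotC _ (G x)) !dot_qgrad -enorm_sq -/(rad x) dot_tang// (dotC _ (x - z)) dot_tang_radial//.
by field.
Qed.

Lemma qgrad_neq0 x : O x -> enorm (G x) != 0.
Proof.
move=> Ox; rewrite -sqrf_eq0 enorm_sq dot_qgrad2// gt_eqF// mulr_gt0 ?exprn_gt0 ?powR_gt0 ?(halfspace_rad Ox)//.
have /andP[s0 s1] := halfspace_lat ee Ox.
apply: ltr_wpDr; first by rewrite mulr_ge0 ?sqr_ge0// lat2_le1// (halfspace_rad Ox).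
rewrite mulr_gt0// exprn_even_gt0//=; first by rewrite lt_eqF.
by rewrite gt_eqF// sine_funE ?(profile_sine_gt0 P)// ltW.
Qed.

Lemma pfield_flux i x : off_axis x -> pfield p (G x) ord0 i = flux i x.
Proof.
move=> x1; have [Ox t0] := x1; have s01 := off_axis_lat x1; have [s0 s1] := andP s01.
have r0 := halfspace_rad Ox; have rn : rad x != 0 by rewrite gt_eqF.
have c0 := cos_asin_gt0 s01; have cn : Num.sqrt (1 - lat x ^+ 2) != 0 by rewrite gt_eqF.
have N0 : 0 < gradsq k f f1 (lat x) by rewrite (gradsq_gt0 P k0)// s0 ltW.
have GE : enorm (G x) = rad x `^ (k - 1) * gradsq k f f1 (lat x) `^ (1 / 2).
  rewrite /enorm dot_qgrad2// sqrtrM ?sqr_ge0// sqrtr_sqr ger0_norm ?powR_ge0//; congr (_ * _).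
  rewrite /slope expr_div_n sqr_sqrtr ?(ltW t0)// divfK ?(gt_eqF t0)// -/(gradsq _ _ _ _) div1r powR12_sqrt//.
  exact: ltW.
rewrite /pfield mxE GE powRM ?powR_ge0// -!powRrM qgrad_coord tang_coord.
have -> : 1 / 2 * (p - 2) = (p - 2) / 2 by field.
rewrite -/(weight p k f f1 (lat x)).
have E1 : rad x `^ ((k - 1) * (p - 2)) * rad x `^ (k - 1) = rad x `^ a.
  by rewrite -powRD ?rn ?implybT//; congr (_ `^ _); ring.
have E2 : rad x `^ a = rad x `^ (a - 1) * rad x.
  exact: powR_step.
rewrite /flux /flux_r /flux_e -/(slope f1 z e x).
transitivity (rad x `^ a * weight p k f f1 (lat x) * (k * sine_fun f (lat x) / rad x * (x - z) ord0 i +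
   slope f1 z e x * (e ord0 i - lat x / rad x * (x - z) ord0 i))); first by rewrite -E1; ring.
by rewrite E2; field.
Qed.

Definition dflux i x : R := let T := tang z e x in
  (a - 1) * rad x `^ (a - 1 - 1) * ((x - z) ord0 i / rad x) * flux_r p k f f1 (lat x) * (x - z) ord0 i
  + rad x `^ (a - 1) * (dflux_r p k f f1 f2 (lat x) * (T ord0 i / rad x) * (x - z) ord0 i + flux_r p k f f1 (lat x))
  + a * rad x `^ (a - 1) * ((x - z) ord0 i / rad x) * flux_e p k f f1 (lat x) * e ord0 i
  + rad x `^ a * (dflux_e p k f f1 f2 (lat x) * (T ord0 i / rad x)) * e ord0 i.

Lemma der_flux i x : off_axis x -> is_derive x (delta_mx ord0 i) (flux i) (dflux i x).
Proof.
move=> x1; have [Ox _] := x1; have s01 := off_axis_lat x1.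
have r0 := halfspace_rad Ox; pose v : V := delta_mx ord0 i.
have dl := der_lat e v r0.
have dr := der_comp (der_flux_r P k0 s01) dl; have de := der_comp (der_flux_e P k0 s01) dl.
have dX : is_derive x v (fun x => (x - z) ord0 i) 1.
  have := der_dotl z v x v; rewrite dot_delta mxE !eqxx.
  by congr is_derive; apply/funext => y; rewrite dot_delta.
have := der_D (der_M (der_M (der_rad_pow (a - 1) v r0) dr) dX) (der_M (der_M (der_rad_pow a v r0) de) (der_cst x v (e ord0 i))).
move/is_derive_eq; apply; rewrite /dflux !dot_delta; ring.
Qed.

Lemma dflux_continuous_at i x : off_axis x -> {for x, continuous (dflux i)}.
Proof.
move=> x1; have [Ox _] := x1; have s01 := off_axis_lat x1.
have r0 := halfspace_rad Ox; have [cde cdr] := dflux_continuous P k0 s01.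
have cl := @lat_continuous R n z e x r0.
have L (F : R -> R) : {for lat x, continuous F} -> {for x, continuous (fun x => F (lat x))}.
  by move=> cF; apply: (continuous_comp (f := lat)).
have cr := L _ (der_continuous_at (der_flux_r P k0 s01)).
have ce := L _ (der_continuous_at (der_flux_e P k0 s01)).
have cc (c : R) : {for x, continuous (fun _ : V => c)} by exact: cst_continuous.
have cX := @coord_sub_continuous R n z i x.
have cT := @tang_continuous R n z e x i r0; have ci := rad_inv_continuous r0.
have cp (b : R) := @rad_pow_continuous R n z b x r0.
have M (F H : V -> R) : {for x, continuous F} -> {for x, continuous H} -> {for x, continuous (fun y => F y * H y)}.
  exact: continuousM.
have A (F H : V -> R) : {for x, continuous F} -> {for x, continuous H} -> {for x, continuous (fun y => F y + H y)}.
  exact: continuousD.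
have cXr := M _ _ cX ci; have cTr := M _ _ cT ci.
apply: (A _ _); last exact: (M _ _ (M _ _ (cp a) (M _ _ (L _ cde) cTr)) (cc _)).
apply: (A _ _); last exact: (M _ _ (M _ _ (M _ _ (M _ _ (cc a) (cp (a - 1))) cXr) ce) (cc _)).
apply: (A _ _); first exact: (M _ _ (M _ _ (M _ _ (M _ _ (cc (a - 1)) (cp (a - 1 - 1))) cXr) cr) cX).
exact: (M _ _ (cp (a - 1)) (A _ _ (M _ _ (M _ _ (L _ cdr) cTr) cX) cr)).
Qed.

(** The derivative of [flux_r] comes with the product of [tang] and $x - z$, which are orthogonal,
    and drops out; the rest is a power of the radius times [flux_ode]. *)
Lemma dflux_div0 x : off_axis x -> \sum_i dflux i x = 0.
Proof.
move=> x1; have [Ox _] := x1; have s01 := off_axis_lat x1.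
have r0 := halfspace_rad Ox; have rn : rad x != 0 by rewrite gt_eqF.
pose T := tang z e x; pose X := x - z.
have TX : \sum_i T ord0 i * X ord0 i = 0 by rewrite -/(dot T X) dotC dot_tang_radial.
have XX : \sum_i X ord0 i * X ord0 i = rad x ^+ 2 by rewrite -/(dot X X) -enorm_sq.
have Xe : \sum_i X ord0 i * e ord0 i = lat x * rad x by rewrite -/(dot X e) lat_rad.
have Te : \sum_i T ord0 i * e ord0 i = 1 - lat x ^+ 2 by rewrite -/(dot T e) dotC dot_tang_axis.
have E1 : rad x `^ (a - 1) = rad x `^ (a - 1 - 1) * rad x.
  exact: powR_step.
have E2 : rad x `^ a = rad x `^ (a - 1) * rad x.
  exact: powR_step.
transitivity ((a - 1) * rad x `^ (a - 1 - 1) / rad x * flux_r p k f f1 (lat x) * \sum_i X ord0 i * X ord0 i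
  + rad x `^ (a - 1) * dflux_r p k f f1 f2 (lat x) / rad x * \sum_i T ord0 i * X ord0 i
  + rad x `^ (a - 1) * flux_r p k f f1 (lat x) * n%:R
  + a * rad x `^ (a - 1) / rad x * flux_e p k f f1 (lat x) * \sum_i X ord0 i * e ord0 i
  + rad x `^ a * dflux_e p k f f1 f2 (lat x) / rad x * \sum_i T ord0 i * e ord0 i).
  rewrite -[n%:R]/(1 *+ n) -[X in 1 *+ X](card_ord n) -sumr_const !mulr_sumr -!big_split /=; apply: eq_bigr => i _.
  by rewrite /dflux -/T -/X; ring.
rewrite TX XX Xe Te E2 E1 -[RHS](mulr0 (rad x `^ (a - 1 - 1) * rad x)) -[X in _ = _ * X](flux_ode P k0 s01).
by field.
Qed.

Lemma flux_weak K phi : c1c K phi -> K `<=` off_axis ->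
  \int[mu]_x (\sum_i pfield p (G x) ord0 i * partial i phi x) = 0.
Proof.
move=> cphi KO; have [_ cK phi0] := cphi.
transitivity (\int[mu]_x (\sum_i flux i x * partial i phi x)).
  apply: eq_Rintegral => x _; apply: eq_bigr => i _.
  have [Kx|nx] := pselect (K x); first by rewrite pfield_flux//; exact: KO.
  by rewrite (partial_out i cK phi0 nx) !mulr0.
apply: (divergence_free_weak off_axis_open KO cphi) => [i x Ox|i x Ox|i x Ox|x Ox].
- apply: near_eq_continuous; last first.
    apply: (pfield_continuous (p := p) (G := G) (i := i)); last exact: (qgrad_neq0 Ox.1).
    by move=> j; exact: (@qgrad_continuous R n n p k f f1 f2 z e P ee x j Ox.1).
  by near=> y; apply: pfield_flux; near: y; apply: open_nbhs_nbhs; split => //; exact: off_axis_open.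
- exact: dflux_continuous_at.
- exact: der_flux.
- exact: dflux_div0.
Unshelve. all: by end_near. Qed.

End quasiradial_flux.

(** * The weak equation across the axis *)

Section cutoff.
Context {R : realType}.
Implicit Types (t d : R).

(** With $u = (t-d)_+/t$ the product of [t] and the derivative of $u^2$ is $2u(1-u) \le 1$,
    uniformly in [d]. This compensates a derivative of size $1/t$ by a flux of size [t]. *)
Definition cutoff d t : R := (pos (t - d) / t) ^+ 2.
Definition dcutoff d t : R := 2 * (pos (t - d) / t) * (1 - pos (t - d) / t) / t.

Lemma cutoff_ratio d t : 0 < d -> 0 < t -> 0 <= pos (t - d) / t <= 1.
Proof.
move=> d0 t0; rewrite divr_ge0 ?pos_ge0 ?(ltW t0)//= ler_pdivrMr// mul1r /pos ge_max (ltW t0) andbT.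
by rewrite gerBl ltW.
Qed.

Lemma double_parabola_le1 u : 2 * u * (1 - u) <= 1 :> R.
Proof. by have := sqr_ge0 u; have := sqr_ge0 (1 - u); rewrite !expr2; lra. Qed.

Lemma cutoff_le d t : t <= d -> cutoff d t = 0.
Proof. by move=> td; rewrite /cutoff pos_0 ?subr_le0// mul0r expr0n. Qed.

Lemma dcutoff_le d t : t <= d -> dcutoff d t = 0.
Proof. by move=> td; rewrite /dcutoff pos_0 ?subr_le0// mul0r mulr0 !mul0r. Qed.

Lemma der_cutoff d t : 0 < t -> is_derive t (1 : R) (cutoff d) (dcutoff d t).
Proof.
move=> t0; have tn : t != 0 by rewrite gt_eqF.
have d1 : is_derive t (1 : R) (fun t => t - d) 1.
  by have := der_D (der_id t) (der_N (der_cst t 1 d)); rewrite subr0.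
have d2 : is_derive t (1 : R) (fun t => pos (t - d) ^+ 2) (2 * pos (t - d)).
  by have := der_comp (g := fun t => t - d) (der_pos2 (t - d)) d1; rewrite mulr1.
have d3 : is_derive t (1 : R) (fun t => t ^+ 2) (2 * t) by der; rewrite expr1 mulr1.
have tn2 : t ^+ 2 != 0 by rewrite expf_neq0.
have := der_M d2 (der_V (g := fun t => t ^+ 2) tn2 d3).
rewrite (_ : (fun _ => _) = cutoff d); last first.
  by apply/funext => u; rewrite /cutoff expr_div_n.
have [dt|td] := leP t d; first by rewrite dcutoff_le// pos_0 ?subr_le0// mulr0 mul0r expr0n mul0r addr0.
move/is_derive_eq; apply.
rewrite /dcutoff pos_id; last by rewrite subr_ge0 ltW.
by field.
Qed.

Lemma cutoff_continuous d t : 0 < t -> {for t, continuous (cutoff d)}.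
Proof. by move=> t0; exact: der_continuous_at (der_cutoff d t0). Qed.

Lemma dcutoff_continuous d t : 0 < t -> {for t, continuous (dcutoff d)}.
Proof.
move=> t0; have ci : {for t, continuous (fun t : R => t^-1)} by apply: continuousV; [rewrite gt_eqF|exact: cvg_id].
have cr : {for t, continuous (fun t => pos (t - d) / t)}.
  apply: continuousM => //; apply: (continuous_comp (f := fun t => t - d)); last exact: pos_continuous.
  by apply: continuousB; [exact: cvg_id|exact: cst_continuous].
apply: continuousM => //; apply: continuousM; first by apply: continuousM; [exact: cst_continuous|].
by apply: continuousB; [exact: cst_continuous|].
Qed.

End cutoff.

Section quasiradial_weak.
Context {R : realType} {n : nat}.
Local Notation V := 'rV[R]_n.
Local Notation mu := (@lebesgue_Rn R n).
Variables (p k : R) (f f1 f2 : R -> R) (z e : V).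
Hypothesis P : quasiradial_profile n p k f f1 f2.
Hypothesis k0 : k < 0.
Hypothesis p1 : 1 < p.
Hypothesis n2 : (2 <= n)%N.
Hypothesis ee : dot e e = 1.
Implicit Types (x v w : V).

Local Notation rad := (rad z).
Local Notation lat := (lat z e).
Local Notation tang := (tang z e).
Local Notation slope := (slope f1 z e).
Local Notation G := (qgrad k f f1 z e).
Local Notation O := (halfspace z e).
Local Notation tau := (fun x => 1 - lat x ^+ 2).

Lemma der_lat2 x v : 0 < rad x -> is_derive x v tau (- 2 * (lat x / rad x) * dot (tang x) v).
Proof.
move=> r0; have := der_D (der_cst x v 1) (der_N (der_X 2 (der_lat e v r0))).
by move/is_derive_eq; apply; rewrite expr1; field; rewrite gt_eqF.
Qed.

(** The product of the field with the gradient of [1 - lat ^+ 2], divided by [1 - lat ^+ 2]; it is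
    bounded on compact subsets of the half space because [slope] is. *)
Definition radial_flux x : R :=
  - 2 * (lat x / rad x) * (enorm (G x) `^ (p - 2) * rad x `^ (k - 1) * slope x).

Lemma pfield_dot_tang x : O x ->
  \sum_i pfield p (G x) ord0 i * (- 2 * (lat x / rad x) * tang x ord0 i) = radial_flux x * tau x.
Proof.
move=> Ox; have r0 := halfspace_rad Ox.
transitivity (- 2 * (lat x / rad x) * dot (pfield p (G x)) (tang x)).
  by rewrite /dot mulr_sumr; apply: eq_bigr => i _; ring.
by rewrite /pfield dotZl dot_qgrad dot_tang_radial// dot_tang// mulr0 add0r /radial_flux !mulrA.
Qed.

Lemma radial_flux_bounded K : compact K -> K `<=` O -> exists2 C : R, 0 < C & forall x, K x -> `|radial_flux x| <= C.
Proof.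
move=> cK KO; have [C C0 CP] := slope_bound z P ee.
pose m x := lat x / rad x * (enorm (G x) `^ (p - 2) * rad x `^ (k - 1)).
have cm x : K x -> {for x, continuous m}.
  move=> /KO Ox; have r0 := halfspace_rad Ox.
  apply: continuousM; first by apply: continuousM; [exact: lat_continuous|exact: rad_inv_continuous].
  apply: continuousM; last exact: rad_pow_continuous.
  apply: (continuous_comp (f := fun x => enorm (G x)) (g := fun t : R => t `^ (p - 2))).
    apply: (continuous_comp (f := G)); last exact: enorm_continuous.
    by apply: row_continuous => i; exact: (@qgrad_continuous R n n p k f f1 f2 z e P ee x i Ox).
  by apply: powR_continuous_at; rewrite lt_neqAle eq_sym (qgrad_neq0 P k0 ee Ox) enorm_ge0.
have [M [M0 MP]] := compact_bounded_at cK cm.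
exists (2 * M * C); first by rewrite !mulr_gt0.
move=> x Kx; have Ox := KO x Kx; have /andP[s0 _] := halfspace_lat ee Ox.
have [h _] := CP x (halfspace_rad Ox) (ltW s0).
have -> : radial_flux x = - 2 * m x * slope x by rewrite /radial_flux /m !mulrA.
rewrite (normrM (- 2 * m x)) (normrM (- 2)) normrN [`|2|]ger0_norm//; apply: ler_pM => //.
by rewrite ler_wpM2l//; exact: MP.
Qed.

Lemma rst_mul_ccs K (u phi : V -> R) : compact K -> K `<=` O -> (forall x, O x -> {for x, continuous u}) ->
  continuous phi -> (forall x, ~ K x -> phi x = 0) -> ccs (fun x => rst K u x * phi x).
Proof.
move=> cK KO cu cphi phi0; apply: (@K_ccs _ _ _ K) => //; last by move=> x nx; rewrite phi0// mulr0.
rewrite (_ : (fun _ => _) = rst K (fun x => u x * phi x)); last by apply/funext => x; rewrite /rst; ring.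
apply: (rst_continuous (@halfspace_open _ _ z e) cK KO) => x Ox; first by move=> nx; rewrite phi0// mulr0.
by apply: continuousM; [exact: cu|exact: cphi].
Qed.

(** If [e] has a nonzero coordinate [j], a line in another coordinate direction [i] keeps coordinate
    [j] fixed and so meets the axis at most once. Slices of the axis are therefore null. *)
Lemma axis_slice x i j s t : i != j -> e ord0 j != 0 -> O (upd x i s) -> O (upd x i t) ->
  tau (upd x i s) <= 0 -> tau (upd x i t) <= 0 -> s = t.
Proof.
move=> ij ej Os Ot ls lt.
have H y : O y -> tau y <= 0 -> y - z = rad y *: e.
  move=> Oy ty; have r0 := halfspace_rad Oy; have rn : rad y != 0 by rewrite gt_eqF.
  have /andP[s0 s1] := halfspace_lat ee Oy.
  have l1 : lat y = 1.
    apply/eqP; rewrite eq_le s1 /= leNgt; apply/negP => l1.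
    by move: ty; rewrite leNgt subr_gt0 expr_lt1// ?(ltW s0)// l1.
  have /eqP := tang_axis ee r0 l1; rewrite subr_eq0 l1 => /eqP ->.
  by rewrite scalerA mulrCA mulfV// mul1r scale1r.
have hs := H _ Os ls; have ht := H _ Ot lt.
have := congr1 (fun v : V => v ord0 j) hs; have := congr1 (fun v : V => v ord0 j) ht.
have B (v : V) l : (v - z) ord0 l = v ord0 l - z ord0 l by rewrite !mxE.
have Z (r : R) l : (r *: e) ord0 l = r * e ord0 l by rewrite mxE.
rewrite !B !Z !updE eq_sym (negPf ij) => -> /(mulIf ej) rr.
have := congr1 (fun v : V => v ord0 i) hs; have := congr1 (fun v : V => v ord0 i) ht.
by rewrite !B !Z !updE eqxx rr => <- /addIr.
Qed.

Lemma other_coordinate : exists i j : 'I_n, i != j /\ e ord0 j != 0.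
Proof.
have [j ej] : exists j : 'I_n, e ord0 j != 0.
  apply/existsP; rewrite -negb_forall; apply/negP => /forallP e0.
  have : dot e e = 0 by rewrite /dot big1// => i _; move/eqP : (e0 i) => ->; rewrite mul0r.
  by rewrite ee => /eqP; rewrite oner_eq0.
have [i ij] : exists i : 'I_n, i != j.
  have [j0|j0] := eqVneq (val j) 0%N.
    by exists (Ordinal n2); rewrite -val_eqE /= j0.
  by exists (Ordinal (ltnW n2)); rewrite -val_eqE /= eq_sym.
by exists i, j.
Qed.

(* [qgrad] need not be differentiable on the axis: the test function is cut off
   there, and the error is bounded since [pfield] dotted with the gradient of
   [1 - lat ^+ 2] is [O(1 - lat ^+ 2)]. *)
Lemma quasi_weak K phi : c1c K phi -> K `<=` O ->
  \int[mu]_x (\sum_i pfield p (G x) ord0 i * partial i phi x) = 0.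
Proof.
move=> cphi KO; have [ccphi ccp] := c1c_ccs cphi; have [_ cK phi0] := cphi.
have dphi0 i x : ~ K x -> partial i phi x = 0 by exact: partial_out.
have oO : open O by exact: halfspace_open.
pose F i x : R := pfield p (G x) ord0 i.
have cF i x : O x -> {for x, continuous (F i)}.
  move=> Ox; apply: pfield_continuous; last exact: (qgrad_neq0 P k0 ee Ox).
  by move=> j; exact: (@qgrad_continuous R n n p k f f1 f2 z e P ee x j Ox).
have ctau x : O x -> {for x, continuous tau} by move=> Ox; apply: lat2_continuous; exact: halfspace_rad Ox.
have tau0 x : O x -> 0 <= tau x by move=> Ox; rewrite lat2_le1// (halfspace_rad Ox).
pose S (psi : V -> R) x := \sum_i rst K (F i) x * partial i psi x.
have iS psi L : c1c L psi -> mu.-integrable setT (EFin \o S psi).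
  move=> cpsi; have [_ cq] := c1c_ccs cpsi.
  by apply: integrable_sumr => i; exact: (rst_continuous_integrable oO cK KO (cF i) (cq i)).
pose A := S phi; have iA : mu.-integrable setT (EFin \o A) by exact: (iS _ _ cphi).
have A0 x : ~ K x -> A x = 0.
  by move=> nx; rewrite /A /S big1// => i _; rewrite dphi0// mulr0.
have cA : ccs A.
  apply: (@K_ccs _ _ _ K) => //; apply: continuous_sum => i.
  by have [] := rst_mul_ccs cK KO (cF i) (ccp i).1 (dphi0 i).
have [CA CA0 AC] := ccs_bound cA.
have [CB CB0 BC] := radial_flux_bounded cK KO.
have [CP CP0 PC] := ccs_bound ccphi.
pose Kd (d : R) : set V := [set x | K x /\ d <= tau x].
have cKd d : compact (Kd d).
  apply: superlevel_compact => //; apply/within_cont_distP => x Kx r r0.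
  have [q q0 qP] := (cont_distP _ x).1 (ctau x (KO x Kx)) r r0.
  by exists q => // y _; exact: qP.
pose phid d := rst (Kd d) (fun x => phi x * cutoff d (tau x)).
pose D d i x := partial i phi x * cutoff d (tau x) + phi x * (dcutoff d (tau x) * (- 2 * (lat x / rad x) * tang x ord0 i)).
have GL (d : R) : 0 < d -> c1c (Kd d) (phid d) /\ forall i, partial i (phid d) = rst (Kd d) (D d i).
  move=> d0.
  have KdO : Kd d `<=` off_axis z e by move=> x [Kx dx]; split; [exact: KO|exact: lt_le_trans dx].
  have Z x : off_axis z e x -> ~ Kd d x -> ~ K x \/ tau x <= d.
    move=> Ox nx; have [Kx|nK] := pselect (K x); [right|by left].
    by rewrite leNgt; apply/negP => dx; apply: nx; split => //; exact: ltW.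
  have cc x : off_axis z e x -> {for x, continuous (fun x => cutoff d (tau x))}.
    move=> [Ox t0]; apply: (continuous_comp (f := tau)); first exact: ctau.
    exact: cutoff_continuous.
  apply: (glue_c1c (@off_axis_open _ _ z e) (cKd d) KdO).
  - by move=> x Ox nx; have [/phi0 ->|h] := Z x Ox nx; [rewrite mul0r|rewrite cutoff_le// mulr0].
  - move=> x i Ox nx; rewrite /D; have [nK|h] := Z x Ox nx; first by rewrite dphi0// phi0// !mul0r addr0.
    by rewrite cutoff_le// dcutoff_le// mul0r !mulr0 addr0.
  - by move=> x Ox; apply: continuousM; [exact: ccphi.1|exact: cc].
  - move=> x i Ox; have [Ox' t0] := Ox; have r0 := halfspace_rad Ox'; apply: continuousD; apply: continuousM.
    + exact: (ccp i).1.
    + exact: cc.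
    + exact: ccphi.1.
    + apply: continuousM.
        apply: (continuous_comp (f := tau)); first exact: ctau.
        exact: dcutoff_continuous.
      apply: continuousM; last exact: tang_continuous.
      apply: continuousM; first exact: cst_continuous.
      by apply: continuousM; [exact: lat_continuous|exact: rad_inv_continuous].
  - move=> x i [Ox t0]; have dt := der_lat2 (delta_mx ord0 i) (halfspace_rad Ox).
    have := der_M (c1c_der i x cphi) (der_comp (g := tau) (der_cutoff d t0) dt).
    by rewrite dot_delta.
pose H d x := S (phid d) x.
have HE (d : R) x : 0 < d -> Kd d x -> H d x = (pos (tau x - d) / tau x) ^+ 2 * A x
    + 2 * (pos (tau x - d) / tau x) * (1 - pos (tau x - d) / tau x) * (phi x * radial_flux x).
  move=> d0 Kx; have [Kx' dx] := Kx; have [_ pE] := GL d d0.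
  have t0 : 0 < tau x by exact: lt_le_trans dx.
  have -> : 2 * (pos (tau x - d) / tau x) * (1 - pos (tau x - d) / tau x) * (phi x * radial_flux x) =
    phi x * dcutoff d (tau x) * (radial_flux x * tau x).
    by rewrite /dcutoff; move: (radial_flux x) (pos _) t0 => b u t0; field; rewrite gt_eqF.
  rewrite -(pfield_dot_tang (KO x Kx')) !mulr_sumr -big_split; apply: eq_bigr => i _ /=.
  by rewrite pE /D [rst (Kd d) _ x]rst_in// !rst_in// /F /cutoff; ring.
have H0 (d : R) x : 0 < d -> ~ Kd d x -> H d x = 0.
  by move=> d0 nx; rewrite /H /S big1// => i _; have [_ ->] := GL d d0; rewrite (rst_out (K := Kd d))// mulr0.
have IH (d : R) : 0 < d -> \int[mu]_x H d x = 0.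
  move=> d0; have [cd pE] := GL d d0.
  have KdO : Kd d `<=` off_axis z e by move=> x [Kx dx]; split; [exact: KO|exact: lt_le_trans dx].
  rewrite -[RHS](flux_weak P k0 ee cd KdO); apply: eq_Rintegral => x _; apply: eq_bigr => i _.
  have [Kx|nx] := pselect (K x); first by rewrite rst_in.
  by rewrite pE !(rst_out (K := Kd d)) ?mulr0// => -[].
have Hb (d : R) x : 0 < d -> `|H d x| <= rst K (fun=> CA + CP * CB) x.
  move=> d0; have [Kx|nx] := pselect (Kd d x); last first.
    rewrite H0// normr0; have [Kx|nK] := pselect (K x); last by rewrite rst_out.
    by rewrite rst_in// addr_ge0 ?mulr_ge0 ?ltW.
  have [Kx' dx] := Kx; have t0 : 0 < tau x by exact: lt_le_trans dx.
  have /andP[u0 u1] := cutoff_ratio d0 t0; rewrite HE// rst_in//.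
  set u := pos _ / _ in u0 u1 *; apply: le_trans (ler_normD _ _) (lerD _ _); rewrite normrM ger0_norm ?sqr_ge0//.
  - by apply: le_trans (AC x); rewrite ler_piMl// expr_le1.
  - apply: le_trans (_ : 1 * `|phi x * radial_flux x| <= _); last first.
      by rewrite mul1r normrM; apply: ler_pM => //; exact: BC.
    by rewrite ler_wpM2r// double_parabola_le1.
  - by apply: mulr_ge0; [exact: mulr_ge0|rewrite subr_ge0].
(* As the cutoff level tends to zero the integrands converge to [A'], which is [A] off the axis,
   under the fixed bound [Hb]. The difference of [A] and [A'] lives on the axis, which is null by
   slicing. *)
pose X1 : set V := off_axis z e; pose A' x := A x * \1_X1 x.
have mX1 : measurable (X1 : set (borelRn n)) by exact: open_measurable_Rn (@off_axis_open _ _ z e).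
have mI : measurable_fun [set: borelRn n] ((\1_X1 : V -> R) : borelRn n -> R) by exact: measurable_indic.
have mA' : measurable_fun [set: borelRn n] (A' : borelRn n -> R).
  by apply: measurable_funM => //; exact: integrable_mfun iA.
have Ib x : `|\1_X1 x| <= 1 :> R by rewrite indicE; case: (_ \in _); rewrite ?normr1 ?normr0.
have iA' : mu.-integrable setT (EFin \o A') by exact: (integrable_Mbounded iA mI Ib).
have L x : H (harmonic j) x @[j --> \oo] --> A' x.
  have [hx1|nx1] := pselect (X1 x); last first.
    rewrite /A' indicE memNset// mulr0; apply: cvg_near_cst; near=> j.
    apply: H0; first exact: harmonic_gt0.
    by move=> [Kx hx]; apply: nx1; split; [exact: KO|exact: lt_le_trans (harmonic_gt0 j) hx].
  rewrite /A' indicE mem_set// mulr1; have [Kx|nK] := pselect (K x); last first.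
    rewrite A0//; apply: cvg_near_cst; near=> j.
    by apply: H0; [exact: harmonic_gt0|move=> []].
  have [_ t0] := hx1; have tn : tau x != 0 by rewrite gt_eqF.
  pose r := fun j => 1 - harmonic j / tau x : R.
  have cr : r j @[j --> \oo] --> (1 : R).
    rewrite -[X in _ --> X]subr0 -[X in _ --> _ - X](mul0r (tau x)^-1).
    by apply: cvgB; [exact: cvg_cst|apply: cvgM; [exact: cvg_harmonic|exact: cvg_cst]].
  have : r j * r j * A x + 2 * r j * (1 - r j) * (phi x * radial_flux x) @[j --> \oo] --> 1 * 1 * A x + 2 * 1 * (1 - 1) * (phi x * radial_flux x).
    apply: cvgD.
      by apply: cvgM; [exact: cvgM|exact: cvg_cst].
    apply: cvgM; last exact: cvg_cst.
    apply: cvgM; first by apply: cvgM; [exact: cvg_cst|].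
    by apply: cvgB; [exact: cvg_cst|].
  rewrite subrr mulr0 mul0r addr0 !mul1r; apply: cvg_trans; apply: near_eq_cvg; near=> j.
  have hj : harmonic j < tau x.
    by near: j; move/cvgr_lt : (@cvg_harmonic R); exact.
  rewrite HE ?harmonic_gt0//; last by split => //; exact: ltW.
  have <- : r j = pos (tau x - harmonic j) / tau x.
    by rewrite pos_id ?subr_ge0 ?(ltW hj)// /r [RHS]mulrBl divff.
  by rewrite expr2.
have iG : mu.-integrable setT (EFin \o rst K (fun=> CA + CP * CB)).
  by apply: bcs_integrable; apply: (rst_bcs oO cK KO) => x _; exact: cst_continuous.
have iH j : mu.-integrable setT (EFin \o H (harmonic j)).
  by have [cd _] := GL _ (harmonic_gt0 j); exact: (iS _ _ cd).
have IA' : \int[mu]_x A' x = 0.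
  apply/eqP; rewrite -normr_le0; apply/ler_addgt0Pr => r r0; rewrite add0r.
  have [j jP] := L1_seq_limit (fun j => integrable_mfun (iH j)) mA' L iG (fun j x => Hb _ x (harmonic_gt0 j)) r0.
  rewrite -[X in `|X|]subr0 -[X in _ - X](IH _ (harmonic_gt0 j)) -RintegralB; [|exact: measurableT|exact: iA'|exact: iH].
  by apply: Rintegral_bound jP; exact: (integrableBr iA' (iH j)).
have [i0 [j0 [ij0 ej0]]] := other_coordinate.
have bA : bcs (fun x => A x - A' x).
  split; first by apply: measurable_funB => //; exact: integrable_mfun iA.
  have [N [N0 KN]] := compact_norm_bound cK.
  exists (CA + CA + N); split => x.
    apply: (@le_trans _ _ (CA + CA)); last by rewrite lerDl ltW.
    apply: le_trans (ler_normB _ _) (lerD (AC x) _); rewrite normrM.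
    by apply: le_trans (AC x); rewrite ler_piMr.
  move=> Nx; rewrite /A' A0 ?mul0r ?subrr// => /KN; apply/negP; rewrite -ltNge; apply: le_lt_trans Nx.
  by rewrite lerDr addr_ge0// ltW.
have I0 : (\int[mu]_x (A x - A' x)%:E = 0)%E.
  apply: (integral_slice0 (i := i0) bA) => x.
  have [[s0 s0P]|ns] := pselect (exists s, A (upd x i0 s) - A' (upd x i0 s) != 0); last first.
    rewrite integral0_eq// => s _; congr EFin; apply/eqP/negPn/negP => h; apply: ns.
    by exists s.
  have Q s : A (upd x i0 s) - A' (upd x i0 s) != 0 -> O (upd x i0 s) /\ tau (upd x i0 s) <= 0.
    move=> h; have Ks : K (upd x i0 s).
      by apply: contrapT => nK; move: h; rewrite /A' A0// mul0r subrr eqxx.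
    split; first exact: KO.
    rewrite leNgt; apply/negP => t0; move: h; rewrite /A' indicE mem_set ?mulr1 ?subrr ?eqxx//.
    by split => //; exact: KO.
  rewrite -[RHS](integral_set1 (fun s => (A (upd x i0 s) - A' (upd x i0 s))%:E) s0) [RHS]integral_mkcond.
  apply: eq_integral => s _; rewrite patchE; case: ifPn => // /negP ns.
  congr EFin; apply/eqP/negPn/negP => h; apply: ns; apply/mem_set => /=.
  have [Os ts] := Q s h; have [Os0 ts0] := Q s0 s0P.
  exact: (axis_slice ij0 ej0 Os Os0 ts ts0).
transitivity (\int[mu]_x A x).
  by apply: eq_Rintegral => x _; apply: eq_bigr => i _; exact: (rst_mulr _ _ (dphi0 i)).
rewrite -[LHS]subr0 -{1}IA' -RintegralB; [|exact: measurableT|exact: iA|exact: iA'].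
by rewrite /Rintegral I0.
Unshelve. all: by end_near. Qed.

End quasiradial_weak.

(** * Quasiradial functions as $p$-harmonic functions *)

Section classical_solutions.
Context {R : realType} {n : nat}.
Local Notation V := 'rV[R]_n.
Local Notation mu := (@lebesgue_Rn R n).
Implicit Types (u phi : V -> R) (x y : V) (D K : set V).

Lemma continuous_Lp_loc (q : R) D u : 0 < q -> open D -> (forall x, D x -> {for x, continuous u}) -> Lp_loc q D u.
Proof.
move=> q0 oD cu; split; first by apply: open_continuous_measurable_Rn => // x /set_mem; exact: cu.
move=> K cK KD; have [_ _] := bcs_lp q0 (rst_bcs oD cK KD cu).
rewrite [X in _ -> (X < _)%E]integral_mkcond; congr (_ < _)%E.
apply: eq_integral => x _; rewrite patchE; case: ifPn => [/set_mem Kx|/negP Kx]; first by rewrite rst_in.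
by rewrite rst_out ?normr0 ?powR0 ?gt_eqF// => /mem_set.
Qed.

Lemma test_function_c1c D phi : test_function D phi -> exists2 K, K `<=` D & c1c K phi.
Proof. by move=> [sm [K [cK KD phi0]]]; exists K => //; split => //; exact: (sm 1%N). Qed.

Lemma classical_p_harmonic (p : R) D u (G : V -> V) : 0 < p -> open D ->
  (forall x, D x -> {for x, continuous u}) ->
  (forall x i, D x -> {for x, continuous (fun y => G y ord0 i)}) ->
  (forall x i, D x -> is_derive x (delta_mx ord0 i) u (G x ord0 i)) ->
  (forall K phi, c1c K phi -> K `<=` D -> \int[mu]_x (\sum_i pfield p (G x) ord0 i * partial i phi x) = 0) ->
  p_harmonic p D u.
Proof.
move=> p0 oD cu cG du weak; split; first by move=> x /set_mem; exact: cu.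
exists G; first split.
- exact: continuous_Lp_loc.
- by move=> i; apply: continuous_Lp_loc => // x Dx; exact: cG.
- move=> phi /test_function_c1c[K KD cphi] i; have [_ cK phi0] := cphi.
  rewrite !(Rintegral_supp KD).
  + exact: (integral_by_parts oD KD cphi cu (fun x => cG x i) (fun x => du x i)).
  + by move=> x nx; rewrite phi0// mulr0.
  + by move=> x nx; rewrite (partial_out i cK phi0 nx) mulr0.
- move=> phi /test_function_c1c[K KD cphi]; have [_ cK phi0] := cphi.
  have E x : enorm (G x) `^ (p - 2) * dot (G x) (gradient phi x) = \sum_i pfield p (G x) ord0 i * partial i phi x.
    by rewrite pfield_dot; apply: eq_bigr => i _; rewrite [gradient phi x ord0 i]mxE.
  under eq_Rintegral do rewrite E.
  rewrite (Rintegral_supp KD); first exact: weak cphi KD.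
  by move=> x nx; rewrite big1// => i _; rewrite (partial_out i cK phi0 nx) mulr0.
Qed.

End classical_solutions.

Section quasiradial_solutions.
Context {R : realType} {n : nat}.
Local Notation V := 'rV[R]_n.
Local Notation mu := (@lebesgue_Rn R n).
Variables (p k : R) (f f1 f2 : R -> R) (z e : V).
Hypothesis P : quasiradial_profile n p k f f1 f2.
Hypothesis k0 : k < 0.
Hypothesis p1 : 1 < p.
Hypothesis n2 : (2 <= n)%N.
Hypothesis ee : dot e e = 1.
Implicit Types (x y : V) (D K : set V) (c b : R).

Local Notation h := (quasi k f z e).
Local Notation G := (qgrad k f f1 z e).
Local Notation O := (halfspace z e).

Lemma scaled_quasi_weak c K phi : 0 < c -> c1c K phi -> K `<=` O ->
  \int[mu]_x (\sum_i pfield p (c *: G x) ord0 i * partial i phi x) = 0.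
Proof.
move=> c0 cphi KO; have [ccphi ccp] := c1c_ccs cphi; have [_ cK phi0] := cphi.
have oO := @halfspace_open R n z e.
have cF i x : O x -> {for x, continuous (fun x => pfield p (G x) ord0 i)}.
  move=> Ox; apply: pfield_continuous; last exact: (qgrad_neq0 P k0 ee Ox).
  by move=> j; exact: (@qgrad_continuous R n n p k f f1 f2 z e P ee x j Ox).
have iS : mu.-integrable setT (EFin \o (fun x => \sum_i rst K (fun x => pfield p (G x) ord0 i) x * partial i phi x)).
  by apply: integrable_sumr => i; exact: (rst_continuous_integrable oO cK KO (cF i) (ccp i)).
transitivity (\int[mu]_x (expR ((p - 1) * ln c) * \sum_i rst K (fun x => pfield p (G x) ord0 i) x * partial i phi x)).
  apply: eq_Rintegral => x _; rewrite mulr_sumr; apply: eq_bigr => i _.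
  have dphi0 y : ~ K y -> partial i phi y = 0 by exact: partial_out.
  by rewrite -(rst_mulr (fun x => pfield p (G x) ord0 i) _ dphi0) -{1}(lnK c0) pfieldZ mxE mulrA.
rewrite RintegralZl; [|exact: measurableT|exact: iS].
rewrite -[RHS](mulr0 (expR ((p - 1) * ln c))); congr (_ * _).
rewrite -[RHS](quasi_weak P k0 n2 ee cphi KO); apply: eq_Rintegral => x _; apply: eq_bigr => i _.
by apply/esym/rst_mulr => y; exact: partial_out.
Qed.

Lemma der_scaled_quasi c b x i : O x ->
  is_derive x (delta_mx ord0 i) (fun x => c * h x + b) ((c *: G x) ord0 i).
Proof.
move=> Ox; have := der_D (der_M (der_cst x (delta_mx ord0 i) c) (der_quasi P ee i Ox)) (der_cst x (delta_mx ord0 i) b).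
by rewrite mul0r add0r addr0 [(c *: G x) ord0 i]mxE.
Qed.

Lemma scaled_quasi_continuous c b x : 0 < rad z x -> {for x, continuous (fun x => c * h x + b)}.
Proof.
move=> r0; apply: continuousD; last exact: cst_continuous.
by apply: continuousM; [exact: cst_continuous|exact: (quasi_continuous P ee r0)].
Qed.

Lemma scaled_qgrad_continuous c x i : O x -> {for x, continuous (fun x => (c *: G x) ord0 i)}.
Proof.
move=> Ox; rewrite (_ : (fun _ => _) = fun x => c * G x ord0 i); last by apply/funext => y; rewrite [(c *: G y) ord0 i]mxE.
apply: continuousM; first exact: cst_continuous.
exact: (@qgrad_continuous R n n p k f f1 f2 z e P ee x i Ox).
Qed.

Lemma quasi_p_harmonic c b D : 0 < c -> open D -> D `<=` O -> p_harmonic p D (fun x => c * h x + b).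
Proof.
move=> c0 oD DO; apply: (@classical_p_harmonic _ _ _ _ _ (fun x => c *: G x)) => //; first exact: lt_trans p1.
- by move=> x /DO Ox; apply: scaled_quasi_continuous; exact: halfspace_rad Ox.
- by move=> x i /DO Ox; exact: scaled_qgrad_continuous.
- by move=> x i /DO Ox; exact: der_scaled_quasi.
- by move=> K phi cphi KD; apply: (scaled_quasi_weak c0 cphi); exact: subset_trans DO.
Qed.

Lemma quasi_comparison c D (u : V -> R) : 0 < c -> open D -> compact (closure D) -> closure D `<=` O ->
  {within closure D, continuous u} -> p_harmonic p D u ->
  (forall x, boundary D x -> u x <= c * h x) -> forall x, D x -> u x <= c * h x.
Proof.
move=> c0 oD cD DO cu hu bd.
have cU x : O x -> {for x, continuous (fun x => c * h x + 0)}.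
  by move=> Ox; apply: scaled_quasi_continuous; exact: halfspace_rad Ox.
have [M [_ UM]] := compact_bounded_at cD (fun x clx => cU x (DO x clx)).
suff H x : D x -> u x <= c * h x + 0 by move=> x /H; rewrite addr0.
apply: (@comparison R n p M O D (fun x => c * h x + 0) (fun x => c *: G x) u p1) => //.
- exact: halfspace_open.
- by move=> y Oy; rewrite addr0 mulr_ge0 ?(ltW c0)// ltW// (quasi_gt0 P ee Oy).
- by move=> y cly; apply: le_trans (ler_norm _) (UM y cly).
- by move=> y i Oy; exact: der_scaled_quasi.
- by move=> y i Oy; exact: scaled_qgrad_continuous.
- by move=> y Oy; rewrite enormZ mulf_neq0 ?normr_eq0 ?(gt_eqF c0)// (qgrad_neq0 P k0 ee Oy).
- move=> K phi cphi KO; rewrite (Rintegral_supp KO); first exact: (scaled_quasi_weak c0 cphi KO).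
  by have [_ cK phi0] := cphi; move=> y ny; rewrite big1// => i _; rewrite (partial_out i cK phi0 ny) mulr0.
- by move=> y /bd; rewrite addr0.
Qed.

End quasiradial_solutions.

(** * Euclidean balls, closures and lower limits *)

Section euclidean_balls.
Context {R : realType} {n : nat}.
Local Notation V := 'rV[R]_n.
Local Notation B := (@eball R n 0 1).
Implicit Types (f : V -> R) (x y z : V) (D : set V) (r c : R).

Lemma unit_ballE x : B x = (enorm x < 1).
Proof. by rewrite /eball /= subr0. Qed.

Lemma eball_open x r : open (eball x r).
Proof.
rewrite openE => y /= yr; near=> u; rewrite /eball /=; near: u.
by have := @enorm_shift_continuous R n x y; move/cvgr_lt; exact.
Unshelve. all: by end_near. Qed.

Lemma norm_le_enorm x : `|x| <= enorm x.
Proof. by apply/le_mx_norm_rV; split=> [|i]; [exact: enorm_ge0|exact: coord_le_enorm]. Qed.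

Lemma closure_ge D f c x : {for x, continuous f} -> (forall y, D y -> c <= f y) -> closure D x -> c <= f x.
Proof.
move=> cf Dc clx; rewrite leNgt; apply/negP => fx.
have /clx[y [Dy fy]] : nbhs x [set y | f y < c] by move/cvgr_lt : cf; exact.
by have := Dc y Dy; rewrite leNgt fy.
Qed.

Lemma closure_le D f c x : {for x, continuous f} -> (forall y, D y -> f y <= c) -> closure D x -> f x <= c.
Proof.
move=> cf Dc clx; rewrite -lerN2; apply: (@closure_ge D (fun x => - f x) (- c)) => //.
  exact: continuousN.
by move=> y Dy; rewrite lerN2 Dc.
Qed.

Lemma closure_compact D z r : (forall x, D x -> enorm (x - z) <= r) -> compact (closure D).
Proof.
move=> Dr; apply: bounded_closed_compact; last exact: closed_closure.
exists (r + `|z|); split => [|M Mr x clx]; first exact: num_real.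
have := closure_le (@enorm_shift_continuous R n z x) Dr clx => h.
apply: le_trans (ltW Mr); rewrite -[x](subrK z); apply: le_trans (ler_normD _ _) _.
by rewrite lerD2r; apply: le_trans h; exact: norm_le_enorm.
Qed.

Lemma boundary_open D x : open D -> boundary D x -> closure D x /\ ~ D x.
Proof. by move=> oD [cl ni]; split => // Dx; apply: ni; move: oD; rewrite openE => /(_ x Dx). Qed.

Lemma unit_ball_boundary x : boundary B x <-> enorm x = 1.
Proof.
split=> [/(boundary_open (@eball_open 0 1))[cl nB]|x1].
  have h1 : enorm (x - 0) <= 1.
    by apply: (closure_le (@enorm_shift_continuous R n 0 x) _ cl) => y; exact: ltW.
  apply/eqP; rewrite eq_le; move: h1 nB; rewrite unit_ballE subr0 => -> /negP.
  by rewrite -leNgt.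
split; last by move=> /interior_subset; rewrite unit_ballE x1 ltxx.
move=> U /nbhs_ballP[d /= d0 dU]; pose s := Num.min d 1 / 2.
have m0 : 0 < Num.min d 1 by rewrite lt_min d0 /=.
have s0 : 0 < s by rewrite divr_gt0.
have sm : s < Num.min d 1 by rewrite ltr_pdivrMr// ltr_pMr// ltr1n.
have [sd s1] : s < d /\ s < 1 by apply/andP; rewrite -lt_min.
exists ((1 - s) *: x); split.
  by rewrite unit_ballE enormZ x1 mulr1 ger0_norm ?subr_ge0 ?(ltW s1)// gtrBl.
apply: dU; rewrite -ball_normE /= scalerBl scale1r opprB addrC subrK.
apply: le_lt_trans (norm_le_enorm _) _.
by rewrite enormZ x1 mulr1 gtr0_norm.
Qed.

Lemma limf_einf_ge (u : V -> \bar R) (c : R) (F : set_system V) : Filter F ->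
  (forall e : R, 0 < e -> \forall x \near F, ((c - e)%:E <= u x)%E) -> (c%:E <= limf_einf u F)%E.
Proof.
move=> FF H; apply/lee_addgt0Pr => e e0; rewrite limf_einfE -leeBlDr// -EFinB.
apply: le_trans (ereal_sup_ubound _); last by exists [set x | ((c - e)%:E <= u x)%E]; [exact: H|reflexivity].
by apply: le_ereal_inf_tmp => _ [x /= hx <-].
Qed.

Lemma limf_einf_near (u : V -> \bar R) (c e : R) (F : set_system V) : Filter F -> 0 < e ->
  (c%:E <= limf_einf u F)%E -> \forall x \near F, ((c - e)%:E <= u x)%E.
Proof.
move=> FF e0 H; have : ((c - e)%:E < limf_einf u F)%E by apply: lt_le_trans H; rewrite lte_fin gtrBl.
rewrite limf_einfE => /ereal_sup_gt[_ [U FU <-] hU]; apply: filterS FU => x Ux.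
by apply: le_trans (ltW hU) _; apply: ereal_inf_lbound; exists x.
Qed.

End euclidean_balls.

(** * Barriers in half balls *)

Section barriers.
Context {R : realType} {n : nat}.
Local Notation V := 'rV[R]_n.
Local Notation B := (@eball R n 0 1).
Variables (p k : R) (f f1 f2 : R -> R).
Hypothesis P : quasiradial_profile n p k f f1 f2.
Hypothesis k0 : k < 0.
Hypothesis p1 : 1 < p.
Hypothesis n2 : (2 <= n)%N.
Implicit Types (x y z e : V) (D K : set V) (c b r m : R) (u : V -> \bar R).

Lemma quasi_pos_halfspace z e x : 0 < rad z x -> 0 < quasi k f z e x -> halfspace z e x.
Proof.
move=> r0; rewrite /halfspace /= !ltNge; apply: contra => h.
have [_ _ [f0 _ _ _] _] := P; rewrite /quasi /sine_fun max_r ?asin0 ?f0 ?mulr0//.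
by rewrite /lat pmulr_lle0// invr_gt0.
Qed.

Lemma quasi_le_rad z e x : dot e e = 1 -> 0 < rad z x -> quasi k f z e x <= rad z x `^ k.
Proof.
move=> ee r0; have [_ _ [_ f1_ _ _] _] := P; rewrite /quasi ler_piMr ?powR_ge0// /sine_fun.
rewrite -f1_ -asin1; apply: (profile_sine_mono P) => //; first by rewrite le_max lexx orbT.
by rewrite ge_max ler01 andbT lat_le1.
Qed.

Lemma powR_nincr (a b : R) : 0 < a -> 0 < b -> (a `^ k <= b `^ k) = (b <= a).
Proof.
move=> a0 b0; have E (s : R) : 0 < s -> s `^ k = (s `^ (- k))^-1 by move=> s0; rewrite -powRN opprK.
rewrite !E// lef_pV2 ?posrE ?powR_gt0//; apply/idP/idP => [|h].
  by apply: contraLR; rewrite -!ltNge => h; rewrite gt0_ltr_powR ?oppr_gt0 ?nnegrE ?ltW.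
by rewrite ge0_ler_powR// ?oppr_ge0 ?nnegrE ?(ltW k0) ?(ltW a0) ?(ltW b0).
Qed.

Lemma powR_root c : 0 < c -> exists2 r : R, 0 < r & r `^ k = c.
Proof.
move=> c0; exists (c `^ k^-1); first exact: powR_gt0.
by rewrite -powRrM mulVf ?lt_eqF// powRr1// ltW.
Qed.

Lemma powR_Nk (a : R) : 0 < a -> a `^ (- k) * a `^ k = 1.
Proof. by move=> a0; rewrite -powRD ?(gt_eqF a0) ?implybT// addNr powRr0. Qed.

(** Lower bounds for a superharmonic [u] come straight from its definition once [quasi] is
    $p$-harmonic; the comparison theorem enters in the opposite direction, when a multiple of
    [quasi] has to be shown superharmonic. *)
Lemma lower_barrier u D z e c b : dot e e = 1 -> p_superharmonic p B u -> 0 < c -> open D ->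
  compact (closure D) -> closure D `<=` B -> closure D `<=` halfspace z e ->
  (forall x, boundary D x -> ((c * quasi k f z e x + b)%:E <= u x)%E) ->
  forall x, D x -> ((c * quasi k f z e x + b)%:E <= u x)%E.
Proof.
move=> ee [_ _ _ sup] c0 oD cD DB DO bd x Dx.
apply: (sup D (fun x => c * quasi k f z e x + b)) => //.
  apply: continuous_in_subspaceT => y /set_mem /DO Oy.
  by apply: (scaled_quasi_continuous P ee); exact: halfspace_rad Oy.
apply: (quasi_p_harmonic P k0 p1 n2 ee b c0 oD).
by apply: subset_trans DO; exact: subset_closure.
Qed.

(** [quasi] is at most the power [k] of the radius and vanishes off the half space, so a value of at
    least $r^k$ forces both the bound on the radius and the half space. *)
Lemma quasi_superlevel z e (d r : R) x : dot e e = 1 -> 0 < d -> 0 < r ->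
  closure [set x | d < rad z x /\ r `^ k < quasi k f z e x] x ->
  [/\ d <= rad z x, rad z x <= r, r `^ k <= quasi k f z e x & halfspace z e x].
Proof.
move=> ee d0 r0 clx.
have hd : d <= rad z x by apply: (closure_ge (@rad_continuous R n z x) _ clx) => y [/ltW].
have rx : 0 < rad z x by exact: lt_le_trans hd.
have hq : r `^ k <= quasi k f z e x by apply: (closure_ge (quasi_continuous P ee rx) _ clx) => y [_ /ltW].
split => //; last by apply: quasi_pos_halfspace => //; apply: lt_le_trans hq; exact: powR_gt0.
by rewrite -powR_nincr//; apply: le_trans hq _; exact: quasi_le_rad.
Qed.

Lemma quasi_superlevel_open z e (d r : R) : dot e e = 1 -> 0 < d ->
  open [set x | d < rad z x /\ r `^ k < quasi k f z e x].
Proof.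
move=> ee d0; apply: (@superlevel_open R n [set x | d < rad z x]).
  rewrite openE => x /= dx; near=> y; rewrite /=; near: y.
  by have := @rad_continuous R n z x; move/cvgr_gt; exact.
by move=> x dx; apply: (quasi_continuous P ee); exact: lt_trans dx.
Unshelve. all: by end_near. Qed.

(** On the inner sphere [quasi] is at most $d^k$, so the barrier is at most [m] there; on the rest
    of the boundary of the region it is zero. The region is a superlevel set of [quasi] and not the
    half ball, because its closure stays away from the bounding hyperplane. *)
Lemma half_ball_barrier u z e m d r : dot e e = 1 -> p_superharmonic p B u ->
  (forall x, B x -> (0 <= u x)%E) -> 0 < m -> 0 < d -> 0 < r ->
  (forall x, 0 < dot (x - z) e -> rad z x <= r -> B x) ->
  (forall x, 0 < dot (x - z) e -> rad z x = d -> (m%:E <= u x)%E) ->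
  forall x, B x -> d < rad z x -> ((m * d `^ (- k) * (quasi k f z e x - r `^ k))%:E <= u x)%E.
Proof.
move=> ee sup u0 m0 d0 r0 HB Hm x Bx dx; pose c := m * d `^ (- k).
have c0 : 0 < c by rewrite mulr_gt0// powR_gt0.
have [h|h] := ltP (r `^ k) (quasi k f z e x); last first.
  by apply: le_trans (u0 x Bx); rewrite lee_fin mulr_ge0_le0 ?(ltW c0)// subr_le0.
pose D : set V := [set x | d < rad z x /\ r `^ k < quasi k f z e x].
have -> : m * d `^ (- k) * (quasi k f z e x - r `^ k) = c * quasi k f z e x + - (c * r `^ k) by rewrite -/c; ring.
have clD := fun y => @quasi_superlevel z e d r y ee d0 r0.
have oD : open D by exact: quasi_superlevel_open.
apply: (@lower_barrier u D z e c (- (c * r `^ k)) ee sup c0 oD) => //.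
- by apply: (@closure_compact _ _ _ z r) => y Dy; have [] := clD y (subset_closure Dy).
- by move=> y /clD[_ ? _ ?]; exact: HB.
- by move=> y /clD[].
- move=> y /(boundary_open oD)[cly nDy]; have [hd hr hq Oy] := clD y cly.
  have rw : c * quasi k f z e y + - (c * r `^ k) = c * (quasi k f z e y - r `^ k) by ring.
  move: hd; rewrite le_eqVlt => /predU1P[hd|hd].
    apply: le_trans (Hm y Oy (esym hd)); rewrite lee_fin rw.
    apply: (@le_trans _ _ (c * quasi k f z e y)).
      by rewrite ler_wpM2l ?(ltW c0)// gerBl powR_ge0.
    apply: (@le_trans _ _ (c * d `^ k)); last by rewrite /c -mulrA powR_Nk// mulr1.
    by rewrite ler_wpM2l ?(ltW c0)// hd; apply: quasi_le_rad; rewrite // -hd.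
  apply: le_trans (u0 y (HB y Oy hr)); rewrite lee_fin rw mulr_ge0_le0 ?(ltW c0)// subr_le0 leNgt.
  by apply/negP => hq'; apply: nDy.
Qed.

End barriers.

(** * Two-sided bounds for the harmonic measure of a small cap *)

Section harmonic_measure_bounds.
Context {R : realType} {n : nat}.
Local Notation V := 'rV[R]_n.
Local Notation B := (@eball R n 0 1).
Variables (p k : R) (f f1 f2 : R -> R).
Hypothesis P : quasiradial_profile n p k f f1 f2.
Hypothesis k0 : k < 0.
Hypothesis p1 : 1 < p.
Hypothesis n2 : (2 <= n)%N.
Implicit Types (x y z e xi : V) (D K : set V) (c b r m d t : R) (u : V -> \bar R).

Local Notation omega xi t a := (p_harmonic_measure p (boundary B `&` eball xi t) a B).

Lemma dot_unit xi : enorm xi = 1 -> dot xi xi = 1.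
Proof. by move=> x1; rewrite -enorm_sq x1 expr1n. Qed.

Lemma dot_opp_unit xi : enorm xi = 1 -> dot (- xi) (- xi) = 1.
Proof. by move=> x1; rewrite dotNl dotNr opprK dot_unit. Qed.

Lemma dot_le_enorm xi x : enorm xi = 1 -> dot x xi <= enorm x /\ - dot x xi <= enorm x.
Proof.
move=> x1; have := cauchy_schwarz x xi; have := cauchy_schwarz x (- xi).
by rewrite enormN x1 mulr1 dotNr.
Qed.

Lemma dot_apex xi x s : enorm xi = 1 -> dot (x - s *: xi) (- xi) = s - dot x xi.
Proof. by move=> x1; rewrite dotNr dotDl dotNl dotZl (dot_unit x1); ring. Qed.

(** A point at height at least [s] over the hyperplane and within $4s$ of the apex has sine of
    latitude at least $1/4$, where the profile has a fixed positive value. *)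
Lemma quasi_cone_ge z e x s r : dot e e = 1 -> 0 < s -> s <= dot (x - z) e -> rad z x <= r -> r <= 4 * s ->
  r `^ k * f (asin (1 / 4)) <= quasi k f z e x.
Proof.
move=> ee s0 sx xr r4; have Ox : halfspace z e x by exact: lt_le_trans sx.
have r0 := halfspace_rad Ox; have rp : 0 < r by exact: lt_le_trans xr.
have l4 : 1 / 4 <= lat z e x.
  by rewrite ler_pdivlMr// mulrC mul1r ler_pdivrMr//; move: xr r4 sx; rewrite mulrC; lra.
apply: ler_pM; rewrite ?powR_ge0//.
- by apply/ltW/(profile_sine_gt0 P); lra.
- by rewrite (powR_nincr k0).
- rewrite sine_funE; last by apply: le_trans l4; lra.
  by apply: (profile_sine_mono P) => //; exact: (lat_le1 ee r0).
Qed.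

Let phi4 := f (asin (1 / 4)).
Let phi40 : 0 < phi4. Proof. by apply: (profile_sine_gt0 P); lra. Qed.

Lemma measure_upper xi a : enorm xi = 1 -> B a -> exists2 C : R, 0 < C &
  forall t, 0 < t -> (omega xi t a <= (C * t `^ (- k))%:E)%E.
Proof.
move=> x1 Ba; have a1 : 0 < 1 - enorm a by rewrite subr_gt0 -unit_ballE.
pose C := 4 `^ (- k) / phi4 * (1 - enorm a) `^ k.
exists C; first by rewrite mulr_gt0 ?divr_gt0 ?powR_gt0.
move=> t t0; pose z := (1 + t) *: xi; pose e := - xi; have ee : dot e e = 1 := dot_opp_unit x1.
(* Makes $c h \ge 1$ on the cap, whose points have height at least [t] over the hyperplane and
   distance at most $2t \le 4t$ from the apex. *)
pose c := (4 * t) `^ (- k) / phi4; have c0 : 0 < c by rewrite divr_gt0 ?powR_gt0// mulr_gt0.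
have H x : enorm x <= 1 -> t <= dot (x - z) e.
  by move=> hx; rewrite dot_apex//; have [h _] := dot_le_enorm x x1; lra.
have BO x : B x -> halfspace z e x by rewrite unit_ballE => /ltW/H; exact: lt_le_trans.
pose h := quasi k f z e; pose u x : \bar R := (c * h x)%:E.
have cu x : halfspace z e x -> {for x, continuous (fun x => c * h x)}.
  move=> Ox; apply: continuousM; first exact: cst_continuous.
  by apply: (quasi_continuous P ee); exact: halfspace_rad Ox.
have hp x : halfspace z e x -> 0 < c * h x by move=> Ox; rewrite mulr_gt0// (quasi_gt0 P ee Ox).
apply: (@le_trans _ _ (u a)); last first.
  rewrite lee_fin; apply: (@le_trans _ _ (c * (1 - enorm a) `^ k)); last first.
    by rewrite /c /C powRM ?(ltW t0)//; rewrite le_eqVlt; apply/orP; left; apply/eqP; ring.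
  rewrite ler_wpM2l ?(ltW c0)//; have Oa := BO a Ba; have ra := halfspace_rad Oa.
  apply: le_trans (quasi_le_rad P ee ra) _; rewrite (powR_nincr k0)//.
  apply: (@le_trans _ _ (dot (a - z) e)).
    by rewrite dot_apex//; have [h1 _] := dot_le_enorm a x1; lra.
  by have := cauchy_schwarz (a - z) e; rewrite (enorm_axis ee) mulr1.
apply: ereal_inf_lbound; exists u => //; split; first split.
- by move=> x _; exact: ltNyr.
- move=> x s Bx; rewrite lte_fin => sx; near=> y; rewrite lte_fin; near: y.
  by move/cvgr_gt : (cu x (BO x Bx)); exact.
- by move=> x Bx; exists x; [exact: connected_component_refl|exact: ltry].
- move=> D v oD cD DB cv hv bd x Dx; rewrite lee_fin.
  apply: (quasi_comparison P k0 p1 n2 ee c0 oD cD _ cv hv) => //; first exact: subset_trans BO.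
- by move=> x Bx; rewrite lee_fin ltW// hp//; exact: BO.
- move=> y /unit_ball_boundary y1; have ty := H y (ltac:(by rewrite y1)).
  have Oy : halfspace z e y by exact: lt_le_trans ty.
  have uy : \1_(boundary B `&` eball xi t) y <= c * h y :> R.
    rewrite indicE; case: (boolP (y \in _)) => [/set_mem[_ yt]|_]; last by rewrite ltW// hp.
    have -> : 1%:R = c * ((4 * t) `^ k * phi4) :> R.
      by rewrite /c mulrACA powR_Nk ?mulr_gt0// mulVf ?mulr1// gt_eqF.
    rewrite ler_wpM2l ?(ltW c0)//; apply: (quasi_cone_ge ee t0 ty) => //.
    apply: (@le_trans _ _ (enorm (y - xi) + enorm (xi - z))).
      by rewrite /rad -[y - z](subrKA xi); exact: enorm_triangle.
    rewrite /z scalerDl scale1r opprD addrA subrr sub0r enormN enormZ x1 mulr1 gtr0_norm//.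
    by move: yt; rewrite /eball /=; lra.
  apply: limf_einf_ge => r r0.
  suff : \forall x \near y, ((\1_(boundary B `&` eball xi t) y - r)%:E <= u x)%E by apply: cvg_within.
  near=> x; rewrite lee_fin; apply: (@le_trans _ _ (c * h y - r)); first by rewrite lerD2r.
  apply: ltW; near: x; move/cvgr_gt : (cu y Oy); apply.
  by rewrite gtrBl.
Unshelve. all: by end_near. Qed.

Local Notation upper xi t u := (upper_class p (boundary B `&` eball xi t) B u).

Definition deep_ball xi d x := enorm (x - (1 - 4 * d) *: xi) <= d.

(** The start of the chain. With the apex outside the ball, at distance [d] from [xi], the barrier
    is at most $1/2$ in the ball and positive only within $Kd$ of the apex; there the boundary data
    equal 1 as soon as $(K+2)d < t$. *)
Lemma measure_near_boundary : exists m T : R, [/\ 0 < m, 8 <= T & forall xi t d u, enorm xi = 1 -> 0 < d -> d < 1 / 8 ->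
  T * d < t -> upper xi t u -> forall x, deep_ball xi d x -> (m%:E <= u x)%E].
Proof.
pose m := 6 `^ k * phi4; have m0 : 0 < m by rewrite mulr_gt0// powR_gt0.
(* With $K^k = m/2$ the subtracted $r^k = (Kd)^k$ is half of the bound $(6d)^k$ [phi4] $= m d^k$
   that holds on the deep ball. *)
have [K K0 Kk] := powR_root k0 (divr_gt0 m0 (ltr0Sn R 1)).
exists (m / 4), (Num.max 8 (K + 2)); split; [by rewrite divr_gt0|by rewrite le_max lexx|].
move=> xi t d u x1 d0 d8 Tt [sup u0 lim] x; rewrite /deep_ball => xd.
have {}Tt : (K + 2) * d < t by apply: le_lt_trans Tt; rewrite ler_wpM2r ?(ltW d0)// le_max lexx orbT.
pose z := (1 + d) *: xi; pose e := - xi; have ee : dot e e = 1 := dot_opp_unit x1.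
have H y : enorm y <= 1 -> d <= dot (y - z) e.
  by move=> hy; rewrite dot_apex//; have [h _] := dot_le_enorm y x1; lra.
have BO y : enorm y <= 1 -> halfspace z e y by move/H; exact: lt_le_trans.
have radd y : enorm y <= 1 -> d <= rad z y.
  move=> hy; apply: le_trans (H y hy) _; have := cauchy_schwarz (y - z) e.
  by rewrite (enorm_axis ee) mulr1.
(* In the ball the radius is at least [d], so $c h \le 1/2$ for this [c]. *)
pose r := K * d; have r0 : 0 < r by rewrite mulr_gt0.
pose h := quasi k f z e; pose c := 2^-1 * d `^ (- k); have c0 : 0 < c by rewrite mulr_gt0 ?powR_gt0.
have xB : enorm x <= 1 - 3 * d.
  rewrite -[x](subrK ((1 - 4 * d) *: xi)); apply: le_trans (enorm_triangle _ _) _.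
  by rewrite enormZ x1 mulr1 ger0_norm; lra.
have x1' : enorm x <= 1 by lra.
have hx : (6 * d) `^ k * phi4 <= h x.
  have v1 := dot_le_enorm (x - (1 - 4 * d) *: xi) x1.
  have E : x - z = (x - (1 - 4 * d) *: xi) - (5 * d) *: xi.
    by rewrite -addrA -opprD -scalerDl /z; congr (_ - _ *: _); ring.
  apply: (@quasi_cone_ge z e x (4 * d)) => //; [by rewrite mulr_gt0| | |by lra].
    by rewrite E dot_apex//; lra.
  rewrite /rad E; apply: le_trans (enorm_triangle _ _) _.
  by rewrite enormN enormZ x1 mulr1 gtr0_norm ?mulr_gt0//; lra.
have wx : m / 4 <= c * h x + - (c * r `^ k).
  apply: (@le_trans _ _ (c * ((6 * d) `^ k * phi4 - r `^ k))); last by rewrite -mulrBr ler_wpM2l ?(ltW c0)// lerD2r.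
  rewrite /r !powRM ?(ltW d0) ?(ltW K0)// Kk /c.
  have E : d `^ (- k) * d `^ k = 1 by exact: powR_Nk.
  rewrite (_ : 2^-1 * _ * _ = (d `^ (- k) * d `^ k) * (2^-1 * (m - m / 2))); last by rewrite /m; ring.
  by rewrite E; lra.
apply: le_trans (_ : ((c * h x + - (c * r `^ k))%:E <= u x)%E); first by rewrite lee_fin.
have [hr|hr] := ltP (r `^ k) (h x); last first.
  apply: le_trans (u0 x _); last by rewrite unit_ballE; lra.
  by rewrite lee_fin -mulrBr mulr_ge0_le0 ?(ltW c0)// subr_le0.
pose E := boundary B `&` eball xi t.
(* The boundary condition gives $u \ge 1/2$ near each point of the compact cap [L], hence in a
   neighbourhood of [L] of uniform width [r1]. *)
pose W := interior [set y | B y -> ((2^-1 : R)%:E <= u y)%E].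
pose L : set V := [set y | enorm y = 1 /\ enorm (y - xi) <= (K + 2) * d].
have cL : compact L.
  have bL : forall y, L y -> enorm (y - xi) <= (K + 2) * d by move=> y [].
  rewrite (_ : L = closure L); first exact: (closure_compact bL).
  apply/seteqP; split; first exact: subset_closure.
  move=> y cly; split; last exact: (closure_le (@enorm_shift_continuous R n xi y) bL cly).
  apply/eqP; rewrite eq_le; apply/andP; split.
    by apply: (closure_le (@enorm_continuous R n y) _ cly) => v [-> _].
  by apply: (closure_ge (@enorm_continuous R n y) _ cly) => v [-> _].
have LW : L `<=` W.
  move=> y [y1 yt]; have Ey : E y by split; [exact/unit_ball_boundary|exact: le_lt_trans yt Tt].
  have := lim y (ltac:(by apply/unit_ball_boundary)); rewrite indicE mem_set// => /(limf_einf_near (e := 2^-1)) H1.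
  have : \forall x \near within B (nbhs y), ((1 - 2^-1)%:E <= u x)%E by apply: H1.
  have -> : 1 - 2^-1 = 2^-1 :> R by lra.
  by [].
have [r1 [K1 [r10 _ K1W LK1]]] := compact_nbhd cL (@open_interior _ _) LW.
pose s := Num.min r1 d / 2; have mn0 : 0 < Num.min r1 d by rewrite lt_min r10.
have s0 : 0 < s by rewrite divr_gt0.
have : s < Num.min r1 d by rewrite ltr_pdivrMr// ltr_pMr// ltr1n.
rewrite lt_min => /andP[sr1 sd].
(* The region keeps the distance [s] from the unit sphere since comparison takes place in sets whose
   closure lies in the ball; [s] is small enough for the new boundary part to lie within [r1] of
   [L]. *)
pose D : set V := [set y | enorm y < 1 - s /\ r `^ k < h y].
have oD : open D.
  apply: (@superlevel_open R n [set y | enorm y < 1 - s]).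
    have := @eball_open R n 0 (1 - s); congr open; apply/seteqP.
    by split => y; rewrite /eball /= subr0.
  move=> y /= ys; apply: (quasi_continuous P ee); apply: (halfspace_rad (BO y _)); lra.
have clD y : closure D y -> enorm y <= 1 - s /\ r `^ k <= h y.
  move=> cly; have ys : enorm y <= 1 - s.
    by apply: (closure_le (@enorm_continuous R n y) _ cly) => v [/ltW].
  have y1 : enorm y <= 1 by lra.
  by split => //; apply: (closure_ge (quasi_continuous P ee (halfspace_rad (BO y y1))) _ cly) => v [_ /ltW].
have rad_r y : enorm y <= 1 -> r `^ k <= h y -> rad z y <= r.
  move=> y1 hy; have ry := halfspace_rad (BO y y1).
  by rewrite -(powR_nincr k0)//; apply: le_trans hy _; exact: (quasi_le_rad P ee).
apply: (@lower_barrier R n p k f f1 f2 P k0 p1 n2 u D z e c _ ee sup c0 oD).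
- apply: (@closure_compact _ _ _ 0 1) => y [ys _]; rewrite subr0; lra.
- by move=> y /clD[ys _]; rewrite unit_ballE; lra.
- by move=> y /clD[ys _]; apply: BO; lra.
- move=> y /(boundary_open oD)[cly nDy]; have [ys hy] := clD y cly.
  have y1 : enorm y <= 1 by lra.
  have By : B y by rewrite unit_ballE; lra.
  have rw : c * h y + - (c * r `^ k) = c * (h y - r `^ k) by ring.
  rewrite rw; move: hy; rewrite le_eqVlt => /predU1P[<-|hy]; first by rewrite subrr mulr0; exact: u0.
  have ye : enorm y = 1 - s by apply/eqP; rewrite eq_le ys /= leNgt; apply/negP => ?; apply: nDy.
  apply: (@le_trans _ _ (2^-1)%:E).
    rewrite lee_fin; apply: (@le_trans _ _ (c * h y)).
      by rewrite ler_wpM2l ?(ltW c0)// gerBl powR_ge0.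
    apply: (@le_trans _ _ (c * d `^ k)); last by rewrite /c -mulrA powR_Nk// mulr1.
    rewrite ler_wpM2l ?(ltW c0)//; have ry := halfspace_rad (BO y y1).
    apply: le_trans (quasi_le_rad P ee ry) _; rewrite (powR_nincr k0)//; exact: radd.
  (* The radial projection of [y] to the sphere lies within $s + Kd + d \le (K+2)d$ of [xi], hence
     in [L]. *)
  pose y' := (1 - s)^-1 *: y.
  have s1 : 0 < 1 - s by lra.
  have yy' : enorm (y' - y) = s.
    rewrite /y' -{2}[y]scale1r -scalerBl enormZ ye ger0_norm; last by rewrite subr_ge0 invf_ge1//; lra.
    by field; rewrite gt_eqF.
  have Ly' : L y'.
    split; first by rewrite enormZ ye gtr0_norm ?invr_gt0// mulVf// gt_eqF.
    apply: (@le_trans _ _ (enorm (y' - y) + enorm (y - z) + enorm (z - xi))).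
      rewrite -[y' - xi](subrKA z) -[y' - z](subrKA y).
      by apply: le_trans (enorm_triangle _ _) _; rewrite lerD2r; exact: enorm_triangle.
    have zx : enorm (z - xi) = d.
      by rewrite /z scalerDl scale1r addrAC subrr add0r enormZ x1 mulr1 gtr0_norm.
    by rewrite yy' zx; have : enorm (y - z) <= K * d := rad_r y y1 (ltW hy); lra.
  have /K1W Wy : K1 y.
    apply: (LK1 y') => //; apply: le_trans (norm_le_enorm _) _; rewrite yy'; lra.
  exact: (interior_subset Wy) By.
- by split => //; lra.
Qed.

(* What matters is that the factor in front of [L `^ k] does not depend on [L]. *)
Lemma chain_step (L : R) : 4 <= L -> exists d1 : R, [/\ 0 < d1, d1 < 1 / 8 & forall xi u m d, enorm xi = 1 ->
  p_superharmonic p B u -> (forall x, B x -> (0 <= u x)%E) -> 0 < m -> 0 < d -> L * d <= d1 ->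
  (forall x, deep_ball xi d x -> (m%:E <= u x)%E) ->
  forall x, deep_ball xi (L * d) x -> ((m * (5 `^ k * phi4 / 2 * L `^ k))%:E <= u x)%E].
Proof.
move=> L4; have L0 : 0 < L by lra.
(* A radius $r \ge 5KLd$ makes the subtracted $r^k$ at most half of the cone bound $(5Ld)^k$ [phi4].
   For $r = 2\sqrt d$ this says that $\sqrt d$ is at most [q]. *)
have [K K0 Kk] := powR_root k0 (divr_gt0 phi40 (ltr0Sn R 1)).
pose q := 2 / (5 * K * L); have q0 : 0 < q by rewrite divr_gt0// !mulr_gt0.
have mn0 : 0 < Num.min (1 / 16) (q ^+ 2) by rewrite lt_min exprn_gt0// andbT.
exists (Num.min (1 / 16) (q ^+ 2)); split=> //; first by rewrite gt_min; apply/orP; left; lra.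
move=> xi u m d x1 sup u0 m0 d0 Ld Hm x; rewrite /deep_ball => xd.
have : d <= Num.min (1 / 16) (q ^+ 2) by apply: le_trans Ld; rewrite ler_peMl ?(ltW d0)//; lra.
move: Ld; rewrite !le_min => /andP[Ld _] /andP[d16 dq].
pose z := (1 - 4 * d) *: xi; pose e := - xi; have ee : dot e e = 1 := dot_opp_unit x1.
(* On the half space facing the centre $|y|^2 \le r^2 + |z|^2 = 4d + (1-4d)^2 < 1$, so the half ball
   of this radius lies in the unit ball. *)
pose r := 2 * Num.sqrt d; have r0 : 0 < r by rewrite mulr_gt0// sqrtr_gt0.
have r2 : r ^+ 2 = 4 * d by rewrite /r exprMn sqr_sqrtr ?(ltW d0)//; ring.
pose LD := L * d; have LD0 : 0 < LD by rewrite mulr_gt0.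
have dLD : 4 * d <= LD by rewrite ler_wpM2r// ltW.
have z1 : dot z z = (1 - 4 * d) ^+ 2 by rewrite dotZl dotZr dot_unit//; ring.
have v1 := dot_le_enorm (x - (1 - 4 * LD) *: xi) x1.
have E : x - z = (x - (1 - 4 * LD) *: xi) - (4 * (LD - d)) *: xi.
  by rewrite -addrA -opprD -scalerDl /z; congr (_ - _ *: _); ring.
have hy : 3 * LD - 4 * d <= dot (x - z) e by rewrite E dot_apex//; move: v1 xd; rewrite -/LD; lra.
have hrad : rad z x <= 5 * LD.
  rewrite /rad E; apply: le_trans (enorm_triangle _ _) _.
  by rewrite enormN enormZ x1 mulr1 ger0_norm; move: xd d0 dLD; rewrite -/LD; lra.
have dlow : d < rad z x.
  apply: (@lt_le_trans _ _ (dot (x - z) e)); first by move: hy dLD d0; lra.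
  by have := cauchy_schwarz (x - z) e; rewrite (enorm_axis ee) mulr1.
have Bx : B x.
  rewrite unit_ballE -[x](subrK ((1 - 4 * LD) *: xi)); apply: le_lt_trans (enorm_triangle _ _) _.
  by rewrite enormZ x1 mulr1 ger0_norm; move: xd Ld LD0; rewrite -/LD; lra.
have hq : (5 * LD) `^ k * phi4 <= quasi k f z e x.
  have s0 : 0 < 3 * LD - 4 * d by move: dLD d0; lra.
  by apply: (quasi_cone_ge ee s0 hy hrad); move: dLD d0; lra.
apply: le_trans (_ : ((m * d `^ (- k) * (quasi k f z e x - r `^ k))%:E <= u x)%E); last first.
  apply: (half_ball_barrier P k0 p1 n2 ee sup u0 m0 d0 r0) => // y.
  - move=> ye yr; rewrite unit_ballE -(@ltr_sqr _ _ 1) ?nnegrE ?enorm_ge0// enorm_sq expr1n.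
    have yx : dot (y - z) z < 0.
      by move: ye; rewrite dotNr /z dotZr oppr_gt0 pmulr_rlt0//; move: d16; lra.
    have -> : dot y y = rad z y ^+ 2 + 2 * dot (y - z) z + dot z z.
      by rewrite enorm_sq -{1 2}[y](subrK z); move: (y - z) => X; rewrite dotDl !dotDr (dotC z); ring.
    rewrite z1.
    have : rad z y ^+ 2 <= 4 * d by rewrite -r2 ler_sqr ?nnegrE ?enorm_ge0 ?(ltW r0).
    by move: yx d16 d0; rewrite !expr2; nra.
  - by move=> _ yd; apply: Hm; rewrite /deep_ball -[X in _ <= X]yd.
rewrite lee_fin -[leRHS]mulrA ler_wpM2l ?(ltW m0)//.
have rk : r `^ k <= (5 * LD) `^ k * (phi4 / 2).
  have -> : (5 * LD) `^ k * (phi4 / 2) = (5 * LD * K) `^ k.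
    by rewrite -Kk -powRM ?(ltW K0)// mulr_ge0// ltW.
  rewrite (powR_nincr k0 r0) ?mulr_gt0//.
  have sd : Num.sqrt d <= q by rewrite -(@ler_sqr _ _ q) ?nnegrE ?sqrtr_ge0 ?(ltW q0)// sqr_sqrtr// ltW.
  have dE : d = Num.sqrt d * Num.sqrt d by rewrite -expr2 sqr_sqrtr// ltW.
  have -> : 5 * LD * K = Num.sqrt d * (Num.sqrt d * (5 * K * L)) by rewrite /LD {1}dE; ring.
  have K5 : 0 < 5 * K * L by rewrite !mulr_gt0.
  by rewrite /r [leRHS]mulrC; apply: ler_wpM2l; rewrite ?sqrtr_ge0// -ler_pdivlMr.
have dk : d `^ (- k) * (5 * LD) `^ k = 5 `^ k * L `^ k.
  rewrite /LD !powRM ?mulr_ge0 ?(ltW d0) ?(ltW L0)//.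
  have := powR_Nk k d0; set A := d `^ (- k); set D := d `^ k => AD.
  by rewrite (_ : A * _ = A * D * (5 `^ k * L `^ k)); [rewrite AD mul1r|ring].
have -> : 5 `^ k * phi4 / 2 * L `^ k = d `^ (- k) * ((5 * LD) `^ k * phi4 - (5 * LD) `^ k * (phi4 / 2)).
  by rewrite -mulrBr mulrA dk; field.
apply: ler_wpM2l; first exact: powR_ge0.
by apply: lerB.
Qed.

Lemma chain_iter (L : R) : 4 <= L -> exists d1 : R, [/\ 0 < d1, d1 < 1 / 8 & forall xi u, enorm xi = 1 ->
  p_superharmonic p B u -> (forall x, B x -> (0 <= u x)%E) -> forall N m, 0 < m ->
  (forall x, deep_ball xi (d1 / L ^+ N) x -> (m%:E <= u x)%E) ->
  forall x, deep_ball xi d1 x -> ((m * (5 `^ k * phi4 / 2 * L `^ k) ^+ N)%:E <= u x)%E].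
Proof.
move=> L4; have [d1 [d10 d18 H]] := chain_step L4; exists d1; split=> // xi u x1 sup u0.
have L0 : 0 < L by lra.
elim=> [|N IH] m m0 Hm; first by move=> x; rewrite expr0 mulr1 -[X in deep_ball xi X]divr1 -(expr0 L); exact: Hm.
rewrite exprS mulrA; apply: IH; first by rewrite !mulr_gt0 ?powR_gt0// invr_gt0.
have dN : 0 < d1 / L ^+ N.+1 by rewrite divr_gt0// exprn_gt0.
have E : L * (d1 / L ^+ N.+1) = d1 / L ^+ N by rewrite exprS; field; rewrite expf_neq0 ?gt_eqF.
rewrite -E; apply: (H xi u m _ x1 sup u0 m0 dN _ Hm).
by rewrite E ler_pdivrMr ?exprn_gt0// ler_peMr ?(ltW d10)// exprn_ege1//; lra.
Qed.

(** In a full ball the axis may be turned towards the point [x] at hand, so that [lat] is 1 and the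
    barrier is a multiple of $\mathrm{rad}^k - r^k$. *)
Lemma ball_step u z m d r : p_superharmonic p B u -> (forall x, B x -> (0 <= u x)%E) -> 0 < m -> 0 < d -> 0 < r ->
  (forall x, enorm (x - z) <= r -> B x) -> (forall x, enorm (x - z) <= d -> (m%:E <= u x)%E) ->
  forall x, enorm (x - z) <= r / 2 -> ((m * Num.min 1 (d `^ (- k) * ((r / 2) `^ k - r `^ k)))%:E <= u x)%E.
Proof.
move=> sup u0 m0 d0 r0 HB Hm x xr.
have [xd|dx] := leP (enorm (x - z)) d.
  by apply: le_trans (Hm x xd); rewrite lee_fin ler_piMr ?(ltW m0)// ge_min lexx.
have rx : 0 < rad z x by exact: lt_trans dx.
pose e := (rad z x)^-1 *: (x - z).
have ee : dot e e = 1 by rewrite dotZl dotZr -enorm_sq -/(rad z x); field; rewrite gt_eqF.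
have lx : lat z e x = 1 by rewrite /lat dotZr -enorm_sq -/(rad z x); field; rewrite gt_eqF.
have Bx : B x by apply: HB; apply: le_trans xr _; lra.
have := half_ball_barrier P k0 p1 n2 ee sup u0 m0 d0 r0 (fun y _ => HB y) (fun y _ yd => Hm y (ltac:(by rewrite -yd))) Bx dx.
apply: le_trans; rewrite lee_fin -mulrA ler_wpM2l ?(ltW m0)// ge_min; apply/orP; right.
rewrite ler_wpM2l ?powR_ge0// lerD2r /quasi lx sine_funE// asin1.
have [_ _ [_ -> _ _] _] := P; rewrite mulr1 (powR_nincr k0)//; lra.
Qed.

(** [ball_step] along the segment from [b] to [a], with balls of radius [r] inside the unit ball.
    Centres are at most $r/4$ apart, so the ball of radius $r/4$ at the next centre lies in the ball
    of radius $r/2$ just reached. *)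
Lemma harnack_chain (a b : V) d : B a -> B b -> 0 < d -> exists2 c : R, 0 < c & forall u m,
  p_superharmonic p B u -> (forall x, B x -> (0 <= u x)%E) -> 0 < m ->
  (forall x, enorm (x - b) <= d -> (m%:E <= u x)%E) -> ((c * m)%:E <= u a)%E.
Proof.
move=> Ba Bb d0; pose M := Num.max (enorm a) (enorm b).
have M1 : M < 1 by rewrite gt_max; apply/andP; split; rewrite -unit_ballE.
pose r := (1 - M) / 2; have r0 : 0 < r by rewrite divr_gt0// subr_gt0.
pose N := (Num.truncn (4 * enorm (a - b) / r)).+1.
have NR : 4 * enorm (a - b) / r < N%:R by exact: truncnS_gt.
have N0 : 0 < N%:R :> R by rewrite ltr0Sn.
pose z j := b + (j%:R / N%:R) *: (a - b).
have zM j : (j <= N)%N -> enorm (z j) <= M.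
  move=> jN; pose s := j%:R / N%:R : R.
  have s0 : 0 <= s by rewrite divr_ge0.
  have s1 : s <= 1 by rewrite ler_pdivrMr// mul1r ler_nat.
  have -> : z j = (1 - s) *: b + s *: a by rewrite /z -/s scalerBr scalerBl scale1r addrAC addrA.
  apply: le_trans (enorm_triangle _ _) _; rewrite !enormZ !ger0_norm ?subr_ge0//.
  have : s * enorm a <= s * M by rewrite ler_wpM2l// le_max lexx.
  have : (1 - s) * enorm b <= (1 - s) * M by rewrite ler_wpM2l ?subr_ge0// le_max lexx orbT.
  lra.
have zB j x : (j <= N)%N -> enorm (x - z j) <= r -> B x.
  move=> jN xr; rewrite unit_ballE -[x](subrK (z j)); apply: le_lt_trans (enorm_triangle _ _) _.
  by have := zM j jN; move: xr; rewrite /r; lra.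
have z0 : z 0%N = b by rewrite /z mul0r scale0r addr0.
have zN : z N = a by rewrite /z divff ?gt_eqF// scale1r addrC subrK.
have zS j : enorm (z j.+1 - z j) <= r / 4.
  have -> : z j.+1 - z j = N%:R^-1 *: (a - b).
    by rewrite /z opprD addrACA subrr add0r -scalerBl; congr (_ *: _); rewrite -natr1; field; rewrite gt_eqF.
  rewrite enormZ gtr0_norm ?invr_gt0// mulrC ler_pdivrMr//.
  by move: NR; rewrite ltr_pdivrMr//; lra.
pose F (s : R) := Num.min 1 (s `^ (- k) * ((r / 2) `^ k - r `^ k)).
have F0 s : 0 < s -> 0 < F s.
  have rr : r `^ k < (r / 2) `^ k.
    have r2 : 0 < r / 2 by rewrite divr_gt0.
    have h : r / 2 < r by rewrite gtr_pMr// invf_lt1 ?ltr0n// ltr1n.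
    rewrite ltNge; apply/negP; rewrite (powR_nincr k0 r2 r0) => /(lt_le_trans h).
    by rewrite ltxx.
  by move=> s0; rewrite lt_min ltr01 mulr_gt0 ?powR_gt0// subr_gt0.
exists (F d * F (r / 4) ^+ N); first by rewrite mulr_gt0 ?exprn_gt0// F0// divr_gt0.
move=> u m sup u0 m0 Hm.
have r4 : 0 < r / 4 by rewrite divr_gt0.
have H j : (j <= N)%N -> forall x, enorm (x - z j) <= r / 2 -> ((m * F d * F (r / 4) ^+ j)%:E <= u x)%E.
  elim: j => [|j IH] jN x xr.
    rewrite expr0 mulr1; apply: (@ball_step u (z 0%N) m d r) => //; first by move=> y; exact: zB.
    by move=> y; rewrite z0; exact: Hm.
  rewrite exprSr mulrA; apply: (@ball_step u (z j.+1) _ (r / 4) r) => //.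
  - by rewrite !mulr_gt0 ?exprn_gt0 ?F0.
  - by move=> y; exact: zB.
  - move=> y yr; apply: IH; first exact: ltnW.
    rewrite -[y - z j](subrKA (z j.+1)); apply: le_trans (enorm_triangle _ _) _.
    by have := zS j; lra.
have -> : F d * F (r / 4) ^+ N * m = m * F d * F (r / 4) ^+ N by rewrite mulrC mulrA.
by apply: (H N (leqnn N)); rewrite zN subrr enorm0 divr_ge0// ltW.
Qed.

Lemma measure_lower xi a (eps : R) : enorm xi = 1 -> B a -> 0 < eps -> exists c t0 : R, [/\ 0 < c, 0 < t0 &
  forall t, 0 < t -> t < t0 -> ((c * t `^ (eps - k))%:E <= omega xi t a)%E].
Proof.
move=> x1 Ba eps0; have Neps : - eps < 0 by rewrite oppr_lt0.
pose kap := 5 `^ k * phi4 / 2; have kap0 : 0 < kap by rewrite !mulr_gt0 ?powR_gt0// invr_gt0.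
(* A ratio [L] with $L^{-\epsilon}$ at most [kap] makes one step cost no more than the factor
   $L^{k-\epsilon}$. *)
have [L1 L10 L1k] := powR_root Neps kap0.
pose L := Num.max 4 L1; have L4 : 4 <= L by rewrite le_max lexx.
have L0 : 0 < L by lra.
have Lk : L `^ (- eps) <= kap by rewrite -L1k (powR_nincr Neps)// le_max lexx orbT.
have [d1 [d10 d18 H]] := chain_iter L4.
have [m [T [m0 T8 HM]]] := measure_near_boundary.
have T0 : 0 < T by lra.
pose b := (1 - 4 * d1) *: xi.
have Bb : B b by rewrite unit_ballE enormZ x1 mulr1 ger0_norm; lra.
have [c c0 HC] := harnack_chain Ba Bb d10.
pose q := eps - k; have q0 : 0 < q by rewrite subr_gt0 (lt_trans k0).
have A0 : 0 < T * d1 * L by rewrite !mulr_gt0.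
exists (c * m * (T * d1 * L) `^ (- q)), (T * d1); split; rewrite ?mulr_gt0 ?powR_gt0//.
move=> t t0 tT.
have ex : exists N : nat, T * d1 / L ^+ N < t.
  exists (Num.truncn (T * d1 / t)).+1; rewrite ltr_pdivrMr ?exprn_gt0// [t * _]mulrC -ltr_pdivrMr//.
  apply: lt_le_trans (truncnS_gt _) _; elim: (Num.truncn _).+1 => [|j IH]; first by rewrite expr0.
  have Lj : 1 <= L ^+ j by apply: exprn_ege1; lra.
  by rewrite exprS -natr1; move: IH Lj; nra.
(* For the least number of steps, $L^{N+1}$ is at most $T d_1 L/t$, so the product of the losses is
   at least a constant times $t^{\epsilon-k}$. The number is positive because $t < T d_1$. *)
case: (ex_minnP ex) => -[|N] HN minN; first by move: HN; rewrite expr0 divr1 => /(lt_trans tT); rewrite ltxx.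
have LN : t / (T * d1 * L) <= L ^- N.+1.
  rewrite leNgt; apply/negP => h; have := minN N; rewrite ltnn => W; suff : false by [].
  apply: W; have -> : T * d1 / L ^+ N = L ^- N.+1 * (T * d1 * L).
    by rewrite exprS; field; rewrite expf_neq0 ?gt_eqF.
  by rewrite -ltr_pdivlMr.
have dN0 : 0 < d1 / L ^+ N.+1 by rewrite divr_gt0// exprn_gt0.
have dN1 : d1 / L ^+ N.+1 < 1 / 8.
  apply: le_lt_trans d18; rewrite ler_pdivrMr ?exprn_gt0// ler_peMr ?(ltW d10)// exprn_ege1// (le_trans _ L4)// ler1n//.
apply: le_ereal_inf_tmp => _ [u Uu <-]; have [sup u0 _] := Uu.
have h1 := HM xi t _ u x1 dN0 dN1 (ltac:(by rewrite mulrA)) Uu.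
have h2 := H xi u x1 sup u0 N.+1 m m0 h1.
have W0 : 0 < m * (kap * L `^ k) ^+ N.+1 by rewrite mulr_gt0 ?exprn_gt0 ?mulr_gt0 ?powR_gt0.
have := HC u _ sup u0 W0 h2; apply: le_trans; rewrite lee_fin -(mulrA (c * m)) -(mulrA c m).
apply: (ler_wpM2l (ltW c0)); apply: (ler_wpM2l (ltW m0)); rewrite -/q.
apply: (@le_trans _ _ ((L `^ (- q)) ^+ N.+1)); last first.
  apply: lerXn2r; rewrite ?nnegrE ?mulr_ge0 ?powR_ge0 ?invr_ge0 ?(ltW phi40)//.
  rewrite /q opprB addrC powRD ?(gt_eqF L0) ?implybT//.
  by apply: ler_wpM2r; first exact: powR_ge0.
have -> : (L `^ (- q)) ^+ N.+1 = (L ^- N.+1) `^ q.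
  rewrite -powR_mulrn ?powR_ge0// -powRrM -(powR_mulrn _ (ltW L0)) -powRN -powRrM; congr (_ `^ _); ring.
have -> : (T * d1 * L) `^ (- q) * t `^ q = (t / (T * d1 * L)) `^ q.
  move: (T * d1 * L) A0 => A A0.
  rewrite powRM ?(ltW t0) ?invr_ge0 ?(ltW A0)// mulrC; congr (_ * _).
  by rewrite -powR_inv1 ?(ltW A0)// -powRrM mulN1r.
by apply: ge0_ler_powR; rewrite ?nnegrE ?(ltW q0) ?divr_ge0 ?(ltW t0) ?(ltW A0) ?invr_ge0 ?exprn_ge0 ?(ltW L0).
Qed.

End harmonic_measure_bounds.

(** Constants disappear on division by $\log t \to -\infty$: [M] is chosen so that their logarithms
    amount to less than half of the tolerance, the other half being $\epsilon$. *)
Lemma log_power_limit {R : realType} (w : R -> \bar R) (q C : R) : 0 < C ->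
  (forall t, 0 < t -> (w t <= (C * t `^ q)%:E)%E) ->
  (forall eps : R, 0 < eps -> exists c t0 : R, [/\ 0 < c, 0 < t0 &
    forall t, 0 < t -> t < t0 -> ((c * t `^ (eps + q))%:E <= w t)%E]) ->
  ln (fine (w t)) / ln t @[t --> 0^'+] --> q.
Proof.
move=> C0 up low; apply/cvgrPdist_lt => e e0.
have e2 : 0 < e / 2 by rewrite divr_gt0.
have [c [t0 [c0 t00 lo]]] := low _ e2.
pose M := (`|ln C| + `|ln c| + 1) / (e / 2).
have nr : 0 < Num.min t0 (expR (- M)) by rewrite lt_min t00 expR_gt0.
near=> t; have tp : 0 < t by near: t; exact: nbhs_right_gt.
have : t < Num.min t0 (expR (- M)) by near: t; exact: nbhs_right_lt.
rewrite lt_min => /andP[tt0 tM].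
have {}tM : ln t < - M by rewrite -(expRK (- M)) ltr_ln ?posrE ?expR_gt0.
have Me : `|ln C| + `|ln c| + 1 < - ln t * (e / 2) by rewrite -ltr_pdivrMr//; move: tM; rewrite ltrNr.
have l0 : ln t < 0.
  rewrite (lt_trans tM)// oppr_lt0 divr_gt0// ltr_pwDr// addr_ge0//.
have := up t tp; have := lo t tp tt0; case: (w t) => [W| |] //; rewrite !lee_fin => WL WU /=.
have W0 : 0 < W by apply: lt_le_trans WL; rewrite mulr_gt0 ?powR_gt0.
have {}WL : ln c + (e / 2 + q) * ln t <= ln W.
  by rewrite -ln_powR -lnM ?posrE ?powR_gt0// ler_ln ?posrE ?mulr_gt0 ?powR_gt0.
have {}WU : ln W <= ln C + q * ln t.
  by rewrite -ln_powR -lnM ?posrE ?powR_gt0// ler_ln ?posrE ?mulr_gt0 ?powR_gt0.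
have := ler_norm (ln C); have := ler_norm (- ln c); rewrite normrN => h1 h2.
have := normr_ge0 (ln C); have := normr_ge0 (ln c) => h3 h4.
rewrite ltr_distlC; apply/andP; split.
  by rewrite ltr_ndivlMr//; move: Me WU; lra.
by rewrite ltr_ndivrMr//; move: Me WL; lra.
Unshelve. all: by end_near. Qed.

Lemma ball_power_law {R : realType} (n : nat) (p k : R) (f f1 f2 : R -> R) (a : 'rV[R]_n) :
  quasiradial_profile n p k f f1 f2 -> k < 0 -> 1 < p -> (2 <= n)%N -> eball 0 1 a ->
  p_asymptotic_power_law p (eball 0 1) a (- k).
Proof.
move=> P k0 p1 n2 Ba; split; first by rewrite oppr_gt0.
move=> xi /unit_ball_boundary x1.
have [C C0 up] := measure_upper P k0 p1 n2 x1 Ba.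
apply: (@log_power_limit R _ _ C C0) => // eps eps0.
exact: (measure_lower P k0 p1 n2 x1 Ba eps0).
Qed.

(** * A Gronwall inequality and global Picard iteration *)

Section differential_inequalities.
Context {R : realType}.
Implicit Types (u du : R -> R) (a b c L t : R).

Lemma mvt_der u du a b : a < b -> (forall t, a <= t <= b -> is_derive t (1 : R) u (du t)) ->
  exists2 c, a < c < b & u b - u a = du c * (b - a).
Proof.
move=> ab D; have [||c cab E] := @MVT R u du a b ab.
- by move=> t; rewrite in_itv/= => /andP[h1 h2]; apply: D; rewrite !ltW.
- apply: derivable_within_continuous => t; rewrite in_itv/= => /D[d _].
  exact: d.
- by exists c => //; move: cab; rewrite in_itv.
Qed.

(** Beyond the last time [s] at which $u \le 0$ the function $u e^{-Lt}$ is nonincreasing, so it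
    cannot become positive. Assuming the inequality where $u > 0$ suits differences of sub- and
    supersolutions. *)
Lemma gronwall_le0 u du a b L : 0 <= L -> a <= b -> (forall t, a <= t <= b -> is_derive t (1 : R) u (du t)) ->
  (forall t, a <= t <= b -> 0 < u t -> du t <= L * u t) -> u a <= 0 -> u b <= 0.
Proof.
move=> L0 ab D H ua; rewrite leNgt; apply/negP => ub.
pose S := [set t | a <= t <= b /\ u t <= 0].
have Sa : S a by split; rewrite ?lexx.
have Sub : has_sup S by split; [exists a|exists b => t [/andP[]]].
pose s := sup S; have as_ : a <= s by exact: (ub_le_sup Sub.2 Sa).
have sb : s <= b by apply: ge_sup; [exists a|move=> t [/andP[]]].
have sab : a <= s <= b by rewrite as_ sb.
have pos t : s < t -> t <= b -> 0 < u t.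
  move=> st tb; rewrite ltNge; apply/negP => h; have : t <= s.
    by apply: (ub_le_sup Sub.2); split=> //; rewrite tb andbT (le_trans as_)// ltW.
  by rewrite leNgt st.
have us : u s <= 0.
  rewrite leNgt; apply/negP => us.
  have /(@cont_distP R R^o R^o)/(_ _ us)[d d0 Hd] := der_continuous_at (D _ sab).
  have [t St ts] := sup_adherent d0 Sub.
  have ts' : t <= s by exact: (ub_le_sup Sub.2 St).
  have : `|u t - u s| < u s by rewrite distrC; apply: Hd; rewrite ger0_norm ?subr_ge0//; move: ts; rewrite -/s; lra.
  have := St.2; move=> h1; rewrite ltr_distl => /andP[]; move: h1; lra.
have sltb : s < b by rewrite lt_neqAle sb andbT; apply: contraTneq ub => <-; rewrite -leNgt.
pose v t := u t * expR (- L * t).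
have Dv t : s <= t <= b -> is_derive t (1 : R) v ((du t - L * u t) * expR (- L * t)).
  move=> /andP[h1 h2]; have Dt : is_derive t (1 : R) u (du t) by apply: D; rewrite h2 (le_trans as_).
  by rewrite /v; der; ring.
have [c /andP[sc cb] E] := mvt_der sltb Dv.
have : v b <= v s.
  rewrite -subr_le0 E; apply: mulr_le0_ge0; last by rewrite subr_ge0.
  apply: mulr_le0_ge0; last exact: expR_ge0.
  rewrite subr_le0; apply: H; last by apply: pos => //; exact: ltW.
  by rewrite (ltW cb) andbT (le_trans as_)// ltW.
rewrite leNgt => /negP; apply; apply: (@le_lt_trans _ _ 0).
  by rewrite /v mulr_le0_ge0// expR_ge0.
by rewrite /v mulr_gt0// expR_gt0.
Qed.

Lemma der_opp_arg u t d : is_derive (- t) (1 : R) u d -> is_derive t (1 : R) (fun x => u (- x)) (- d).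
Proof.
move=> D; have := @der_comp R R^o u (fun x : R => - x) t 1 d (- 1) D (der_N (der_id t)).
by move/is_derive_eq; apply; rewrite mulrN1.
Qed.

Lemma exp_bound u du c a : 0 < c -> 0 < a -> u 0 = 0 -> (forall t, is_derive t (1 : R) u (du t)) ->
  (forall t, `|du t| <= c * a * expR (a * `|t|)) -> forall t, `|u t| <= c * expR (a * `|t|).
Proof.
move=> c0 a0.
have key (w dw : R -> R) : w 0 = 0 -> (forall t, is_derive t (1 : R) w (dw t)) ->
    (forall t, dw t <= c * a * expR (a * `|t|)) -> forall t, 0 <= t -> w t <= c * expR (a * t).
  move=> w0 D H t t0; rewrite -subr_le0.
  apply: (@gronwall_le0 (fun t => w t - c * expR (a * t)) (fun t => dw t - c * a * expR (a * t)) 0 t 0) => //.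
  - move=> x _; have Dx := D x; der; ring.
  - by move=> x /andP[x0 _] _; rewrite mul0r subr_le0 -{2}(ger0_norm x0).
  - by rewrite w0 mulr0 expR0; lra.
have key2 (w dw : R -> R) : w 0 = 0 -> (forall t, is_derive t (1 : R) w (dw t)) ->
    (forall t, `|dw t| <= c * a * expR (a * `|t|)) -> forall t, w t <= c * expR (a * `|t|).
  move=> w0 D H t; have [t0|t0] := leP 0 t.
    by rewrite (ger0_norm t0); apply: (key w dw) => // x; exact: le_trans (ler_norm _) (H x).
  rewrite (ltr0_norm t0) -{1}[t]opprK; apply: (key (fun x => w (- x)) (fun x => - dw (- x))).
  - by rewrite oppr0.
  - by move=> x; exact: der_opp_arg (D (- x)).
  - move=> x; rewrite -[`|x|]normrN; apply: le_trans (H (- x)); rewrite -normrN; exact: ler_norm.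
  - by rewrite oppr_ge0 ltW.
move=> u0 D H t; rewrite ler_norml; apply/andP; split; last exact: (key2 u du).
rewrite lerNl; apply: (key2 (fun x => - u x) (fun x => - du x)).
- by rewrite u0 oppr0.
- by move=> x; rewrite normrN.
Qed.

(** The limit lies in nested intervals around the terms, which gives the rate with an explicit
    constant. *)
Lemma dyadic_limit (x : nat -> R) c : 0 <= c -> (forall j, `|x j.+1 - x j| <= c * 2^-1 ^+ j) ->
  exists l, forall j, `|l - x j| <= 2 * c * 2^-1 ^+ j.
Proof.
move=> c0 H; pose z j := x j - 2 * c * 2^-1 ^+ j; pose w j := x j + 2 * c * 2^-1 ^+ j.
have zz : nondecreasing_seq z.
  apply/nondecreasing_seqP => j; rewrite /z exprS; have := H j; rewrite ler_norml => /andP[].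
  by move: (2^-1 ^+ j) => h; lra.
have ww : nonincreasing_seq w.
  apply/nonincreasing_seqP => j; rewrite /w exprS; have := H j; rewrite ler_norml => /andP[].
  by move: (2^-1 ^+ j) => h; lra.
have zw i j : z i <= w j.
  apply: le_trans (zz _ _ (leq_maxl i j)) _; apply: le_trans _ (ww _ _ (leq_maxr i j)).
  rewrite /z /w lerD2l ge0_cp// mulr_ge0 ?exprn_ge0 ?invr_ge0// mulr_ge0//.
have hs : has_sup (range z) by split; [exists (z 0%N); exists 0%N|exists (w 0%N) => _ [i _ <-]].
exists (sup (range z)) => j; rewrite ler_distl; apply/andP; split.
  by apply: (ub_le_sup hs.2); exists j.
by apply: ge_sup; [exact: hs.1|move=> _ [i _ <-]; exact: zw].
Qed.

Lemma dyadic_small (x c : R) : (forall j, `|x| <= c * 2^-1 ^+ j) -> x = 0.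
Proof.
move=> H; apply/eqP; apply/negPn/negP => x0; have xp : 0 < `|x| by rewrite normr_gt0.
pose j := (Num.truncn (c / `|x|)).+1.
have jc : c / `|x| < j%:R by exact: truncnS_gt.
have : j%:R <= 2 ^+ j :> R by rewrite -natrX ler_nat ltnW// ltn_expl.
have := H j; rewrite exprVn ler_pdivlMr ?exprn_gt0// -ler_pdivlMl// mulrC => h1 h2.
by have := le_lt_trans (le_trans h2 h1) jc; rewrite ltxx.
Qed.

(** With the weight $e^{2L|t|}$ every iteration halves the distance on the whole line at once, so
    the solution is global. *)
Lemma picard (H : R -> R -> R) L M (y0 : R) : 0 < L -> 0 < M ->
  (forall t x y, `|H t x - H t y| <= L * `|x - y|) -> (forall t x, `|H t x| <= M) ->
  (forall y : R -> R, continuous y -> continuous (fun t => H t (y t))) ->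
  exists2 y : R -> R, y 0 = y0 & forall t, is_derive t (1 : R) y (H t (y t)).
Proof.
move=> L0 M0 HL HM Hc.
have ex (y : R -> R) : exists Y : R -> R, continuous y -> Y 0 = y0 /\ forall t, is_derive t (1 : R) Y (H t (y t)).
  have [cy|] := pselect (continuous y); last by exists y.
  have [F dF] := antideriv (Hc y cy); exists (fun t => F t - F 0 + y0) => _; split; first by rewrite subrr add0r.
  by move=> t; have Dt := dF t; der; ring.
have [Phi PhiP] := choice ex; pose y j := iter j Phi (fun=> y0).
have yc j : continuous (y j).
  elim: j => [|j IH]; first by move=> t; exact: cvg_cst.
  exact: der_continuous (PhiP _ IH).2.
have yS0 j : y j.+1 0 = y0 by exact: (PhiP _ (yc j)).1.
have y00 j : y j 0 = y0 by case: j.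
have yD j t : is_derive t (1 : R) (y j.+1) (H t (y j t)) by exact: (PhiP _ (yc j)).2.
pose a := 2 * L; have a0 : 0 < a by rewrite mulr_gt0.
pose A := M / a; have A0 : 0 < A by rewrite divr_gt0.
have e1 t : 1 <= expR (a * `|t|) by rewrite -expR0 ler_expR mulr_ge0// ltW.
have step j t : `|y j.+1 t - y j t| <= A * 2^-1 ^+ j * expR (a * `|t|).
  elim: j t => [|j IH] t.
    apply: (@exp_bound (fun t => y 1%N t - y 0%N t) (fun t => H t (y 0%N t) - 0)) => //.
    - by rewrite mulr_gt0 ?exprn_gt0// invr_gt0.
    - by rewrite !y00 subrr.
    - move=> x; rewrite subr0 expr0 mulr1 /A divfK ?gt_eqF//; apply: le_trans (HM _ _) _.
      by rewrite ler_peMr// ltW.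
  apply: (@exp_bound (fun t => y j.+2 t - y j.+1 t) (fun t => H t (y j.+1 t) - H t (y j t))) => //.
  - by rewrite mulr_gt0 ?exprn_gt0// invr_gt0.
  - by rewrite !y00 subrr.
  - move=> x; apply: le_trans (HL _ _ _) _.
    have -> : A * 2^-1 ^+ j.+1 * a * expR (a * `|x|) = L * (A * 2^-1 ^+ j * expR (a * `|x|)).
      by rewrite exprS /a; move: (2^-1 ^+ j) (expR _) => h h'; field.
    by rewrite ler_pM2l.
have lim t : exists l, forall j, `|l - y j t| <= 2 * (A * expR (a * `|t|)) * 2^-1 ^+ j.
  apply: dyadic_limit; first by rewrite mulr_ge0 ?expR_ge0// ltW.
  by move=> j; rewrite mulrAC; exact: step.
have [Y YP] := choice lim.
have lipj j s t : `|y j s - y j t| <= M * `|s - t|.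
  wlog st : s t / t < s => [W|].
    have [|/W//|->] := ltgtP s t; last by rewrite !subrr normr0 mulr0.
    by move=> /W; rewrite [in X in X -> _]distrC [`|t - s|]distrC.
  case: j => [|j]; first by rewrite subrr normr0 mulr_ge0// ltW.
  have [c _ ->] := mvt_der st (fun x _ => yD j x).
  by rewrite normrM ler_wpM2r.
have Yc : continuous Y.
  have lipY s t : `|Y s - Y t| <= M * `|s - t|.
    apply/ler_addgt0Pr => e e0; pose c := 2 * (A * expR (a * `|s|)) + 2 * (A * expR (a * `|t|)).
    have c0 : 0 < c by apply: addr_gt0; apply: mulr_gt0 => //; exact: mulr_gt0 A0 (expR_gt0 _).
    have [j jc] : exists j, c * 2^-1 ^+ j < e.
      apply: contrapT => nj; have := @dyadic_small e c; rewrite gtr0_norm// => W.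
      have : e = 0 by apply: W => j; rewrite leNgt; apply/negP => h; apply: nj; exists j.
      by move/eqP; rewrite gt_eqF.
    have -> : Y s - Y t = (Y s - y j s) + ((y j s - y j t) + (y j t - Y t)) by ring.
    have h1 := YP s j; have := YP t j; rewrite distrC => h2.
    apply: le_trans (ler_normD _ _) _; apply: le_trans (lerD (lexx _) (ler_normD _ _)) _.
    by have := lipj j s t; move: jc; rewrite /c mulrDl; lra.
  move=> s; apply/(@cont_distP R R^o R^o) => e e0; exists (e / M); first by rewrite divr_gt0.
  move=> t ts; apply: le_lt_trans (lipY s t) _; rewrite mulrC -ltr_pdivlMr//.
have [F dF] := antideriv (Hc Y Yc); pose Z t := F t - F 0 + y0.
have ZD t : is_derive t (1 : R) Z (H t (Y t)) by have Dt := dF t; rewrite /Z; der; ring.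
have YZ t : Y t = Z t.
  apply/eqP; rewrite -subr_eq0; apply/eqP.
  apply: (@dyadic_small _ (3 * (A * expR (a * `|t|)))) => j.
  have -> : Y t - Z t = (Y t - y j.+1 t) + (y j.+1 t - Z t) by ring.
  have h1 := YP t j.+1.
  have h2 : `|y j.+1 t - Z t| <= A * 2^-1 ^+ j * expR (a * `|t|).
    apply: (@exp_bound (fun t => y j.+1 t - Z t) (fun t => H t (y j t) - H t (Y t))) => //.
    - by rewrite mulr_gt0 ?exprn_gt0// invr_gt0.
    - by rewrite y00 /Z subrr add0r subrr.
    - move=> x; apply: le_trans (HL _ _ _) _; rewrite distrC.
      have -> : A * 2^-1 ^+ j * a * expR (a * `|x|) = L * (2 * (A * expR (a * `|x|)) * 2^-1 ^+ j).
        by rewrite /a; ring.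
      by rewrite ler_pM2l.
  apply: le_trans (ler_normD _ _) _; move: h1 h2; rewrite exprS; move: (2^-1 ^+ j) (expR _) => h h'.
  have -> : 2 * (A * h') * (2^-1 * h) = A * h * h' by field.
  have -> : 3 * (A * h') * h = 3 * (A * h * h') by ring.
  have := normr_ge0 (Y t - y j.+1 t); lra.
exists Y; first by rewrite YZ /Z subrr add0r.
by move=> t; have := ZD t; rewrite -(funext YZ : Y = Z).
Qed.

End differential_inequalities.

(** * The phase equation *)

Section phase_equation.
Context {R : realType}.
Variables (p d : R).
Hypothesis p1 : 1 < p.
Implicit Types (a b m s t x y : R).

Lemma lip_of_der (u du : R -> R) : (forall t, is_derive t (1 : R) u (du t)) -> (forall t, `|du t| <= 1) ->
  forall x y, `|u x - u y| <= `|x - y|.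
Proof.
move=> D H x y; wlog xy : x y / y < x => [W|].
  have [|/W|->] := ltgtP x y; [|by []|by rewrite !subrr].
  by move=> /W; rewrite distrC [`|y - x|]distrC.
by have [c _ ->] := mvt_der xy (fun t _ => D t); rewrite normrM ler_piMl.
Qed.

Lemma lip_sin x y : `|sin x - sin y| <= `|x - y|.
Proof.
apply: (lip_of_der (u := sin) (du := cos)) => t.
by rewrite ler_norml cos_geN1 cos_le1.
Qed.

Lemma lip_cos x y : `|cos x - cos y| <= `|x - y|.
Proof.
apply: (lip_of_der (u := cos) (du := fun t => - sin t)) => t.
by rewrite normrN ler_norml sin_geN1 sin_le1.
Qed.

Lemma norm_sin x : `|sin x| <= 1. Proof. by rewrite ler_norml sin_geN1 sin_le1. Qed.
Lemma norm_cos x : `|cos x| <= 1. Proof. by rewrite ler_norml cos_geN1 cos_le1. Qed.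

Lemma lip_mul_bounded (u v : R -> R) : (forall x, `|u x| <= 1) -> (forall x, `|v x| <= 1) ->
  (forall x y, `|u x - u y| <= `|x - y|) -> (forall x y, `|v x - v y| <= `|x - y|) ->
  forall x y, `|u x * v x - u y * v y| <= 2 * `|x - y|.
Proof.
move=> u1 v1 Lu Lv x y; have -> : u x * v x - u y * v y = (u x - u y) * v x + u y * (v x - v y) by ring.
apply: le_trans (ler_normD _ _) _; rewrite !normrM.
have h1 : `|u x - u y| * `|v x| <= `|x - y| * 1 by apply: ler_pM.
have h2 : `|u y| * `|v x - v y| <= 1 * `|x - y| by apply: ler_pM.
by move: h1 h2; lra.
Qed.

Definition phase_den b := (p - 1) * sin b ^+ 2 + cos b ^+ 2.

(* The quasiradial equation for the phase [b] with [f1 = m * f * tan b], in the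
   variable [s = tan alpha]; [d] is the dimension and [m = - k]. *)
Definition phase_rhs m s b :=
  - ((m * (p - 1) - (d - p) * cos b ^+ 2 - (d - 2) * s * (sin b * cos b)) / ((1 + s ^+ 2) * phase_den b)).

Let e0 := Num.min 1 (p - 1).
Let e00 : 0 < e0. Proof. by rewrite lt_min ltr01 subr_gt0. Qed.

Lemma phase_den_ge b : e0 <= phase_den b.
Proof.
have h1 : e0 <= 1 by rewrite ge_min lexx.
have h2 : e0 <= p - 1 by rewrite ge_min lexx orbT.
have := cos2Dsin2 b; have := sqr_ge0 (sin b); have := sqr_ge0 (cos b).
rewrite /phase_den; move: (sin b ^+ 2) (cos b ^+ 2) => S C C0 S0 E.
have -> : e0 = e0 * S + e0 * C by rewrite -mulrDr addrC E mulr1.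
by apply: lerD; [rewrite ler_wpM2r|rewrite -[leRHS]mul1r ler_wpM2r].
Qed.

Lemma phase_den_gt0 b : 0 < phase_den b.
Proof. exact: lt_le_trans e00 (phase_den_ge b). Qed.

Lemma lip_phase_den x y : `|phase_den x - phase_den y| <= `|p - 2| * (2 * `|x - y|).
Proof.
have sE b : sin b ^+ 2 = 1 - cos b ^+ 2 by rewrite -(cos2Dsin2 b); ring.
have -> : phase_den x - phase_den y = - (p - 2) * (cos x * cos x - cos y * cos y).
  by rewrite /phase_den !sE; ring.
rewrite normrM normrN ler_wpM2l//; exact: (lip_mul_bounded norm_cos norm_cos lip_cos lip_cos).
Qed.

Definition phase_lip := 2 / e0 + `|p - 2| * 2 / e0 ^+ 2.

Lemma phase_lip_gt0 : 0 < phase_lip.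
Proof. by apply: ltr_pwDl; [rewrite divr_gt0|rewrite divr_ge0 ?mulr_ge0 ?exprn_ge0 ?(ltW e00)]. Qed.

Lemma lip_quot_den (u : R -> R) x y : (forall b, `|u b| <= 1) -> `|u x - u y| <= 2 * `|x - y| ->
  `|u x / phase_den x - u y / phase_den y| <= phase_lip * `|x - y|.
Proof.
move=> u1 Lu; have Dx := phase_den_gt0 x; have Dy := phase_den_gt0 y.
have -> : u x / phase_den x - u y / phase_den y =
    (u x - u y) / phase_den x + u y * (- (phase_den x - phase_den y)) / (phase_den x * phase_den y).
  by field; rewrite !gt_eqF.
apply: le_trans (ler_normD _ _) _; rewrite /phase_lip [leRHS]mulrDl; apply: lerD.
  have -> : 2 / e0 * `|x - y| = 2 * `|x - y| * e0^-1 by ring.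
  rewrite normrM normfV (gtr0_norm Dx); apply: ler_pM => //; first by rewrite invr_ge0 ltW.
  by rewrite lef_pV2 ?posrE// phase_den_ge.
rewrite !normrM normfV normrN (gtr0_norm (mulr_gt0 Dx Dy)) ler_pdivrMr ?mulr_gt0//.
have h1 : `|u y| * `|phase_den x - phase_den y| <= 1 * (`|p - 2| * (2 * `|x - y|)).
  by apply: ler_pM => //; exact: lip_phase_den.
apply: le_trans h1 _; rewrite mul1r.
have -> : `|p - 2| * 2 / e0 ^+ 2 * `|x - y| * (phase_den x * phase_den y) =
   `|p - 2| * (2 * `|x - y|) * (phase_den x * phase_den y / e0 ^+ 2) by field; rewrite gt_eqF.
rewrite ler_peMr ?mulr_ge0// ler_pdivlMr ?exprn_gt0// mul1r expr2.
by apply: ler_pM; rewrite ?(ltW e00)// phase_den_ge.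
Qed.

(** Separates bounded weights in [s] from bounded Lipschitz quotients in [b]; the global bound and
    the global Lipschitz constant are read off from this form. *)
Lemma phase_rhsE m s b : phase_rhs m s b = - (m * (p - 1) / (1 + s ^+ 2) * (1 / phase_den b)
  + (p - d) / (1 + s ^+ 2) * (cos b * cos b / phase_den b)
  + (2 - d) * (s / (1 + s ^+ 2)) * (sin b * cos b / phase_den b)).
Proof.
rewrite /phase_rhs; field; rewrite (gt_eqF (phase_den_gt0 b)) /=.
by rewrite gt_eqF// ltr_pwDl// sqr_ge0.
Qed.

Lemma time_weights s : [/\ 0 < (1 + s ^+ 2)^-1, (1 + s ^+ 2)^-1 <= 1 & `|s / (1 + s ^+ 2)| <= 1].
Proof.
have s2 := sqr_ge0 s; have h : 0 < 1 + s ^+ 2 by rewrite ltr_pwDl.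
split; first by rewrite invr_gt0.
  by rewrite invf_le1// lerDl.
rewrite normrM normfV (gtr0_norm h) ler_pdivrMr// mul1r.
by rewrite -[s ^+ 2]ger0_norm// normrX; have := normr_ge0 s; move: (`|s|) => r; nra.
Qed.

Definition phase_const (c M : R) := c * (M * (p - 1) + `|p - d| + `|2 - d|).

Lemma phase_combine (M m s g1 g2 g3 c : R) : 0 <= m -> m <= M -> `|g1| <= c -> `|g2| <= c -> `|g3| <= c ->
  `|m * (p - 1) / (1 + s ^+ 2) * g1 + (p - d) / (1 + s ^+ 2) * g2 + (2 - d) * (s / (1 + s ^+ 2)) * g3|
  <= phase_const c M.
Proof.
move=> m0 mM h1 h2 h3; have [w0 w1 w2] := time_weights s; have p10 : 0 < p - 1 by rewrite subr_gt0.
have c0 : 0 <= c by exact: le_trans (normr_ge0 _) h1.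
apply: le_trans (ler_normD _ _) _; apply: le_trans (lerD (ler_normD _ _) (lexx _)) _.
have -> : phase_const c M = M * (p - 1) * c + `|p - d| * c + `|2 - d| * c by rewrite /phase_const; ring.
apply: lerD; [apply: lerD|]; rewrite normrM; apply: ler_pM => //.
- rewrite normrM (gtr0_norm w0) ger0_norm ?mulr_ge0 ?(ltW p10)//.
  by rewrite -[leRHS]mulr1; apply: ler_pM; rewrite ?mulr_ge0 ?(ltW p10) ?(ltW w0)// ler_wpM2r// ltW.
- by rewrite normrM (gtr0_norm w0) ler_piMr.
- by rewrite normrM ler_piMr.
Qed.

Lemma lip_phase_rhs (M m s x y : R) : 0 <= m -> m <= M ->
  `|phase_rhs m s x - phase_rhs m s y| <= phase_const phase_lip M * `|x - y|.
Proof.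
move=> m0 mM; rewrite !phase_rhsE.
set A := m * _ / _; set B := (p - d) / _; set C := (2 - d) * _.
have -> : - (A * (1 / phase_den x) + B * (cos x * cos x / phase_den x) + C * (sin x * cos x / phase_den x)) -
    - (A * (1 / phase_den y) + B * (cos y * cos y / phase_den y) + C * (sin y * cos y / phase_den y)) =
    A * (1 / phase_den y - 1 / phase_den x) + B * (cos y * cos y / phase_den y - cos x * cos x / phase_den x)
    + C * (sin y * cos y / phase_den y - sin x * cos x / phase_den x) by ring.
have -> : phase_const phase_lip M * `|x - y| = phase_const (phase_lip * `|x - y|) M by rewrite /phase_const; ring.
have cc b : `|cos b * cos b| <= 1 by rewrite normrM mulr_ile1 ?norm_cos.
have sc b : `|sin b * cos b| <= 1 by rewrite normrM mulr_ile1 ?norm_cos ?norm_sin.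
apply: (phase_combine s m0 mM); rewrite distrC.
- by apply: (@lip_quot_den (fun=> 1)) => [b|]; rewrite ?normr1// subrr normr0 mulr_ge0.
- by apply: (@lip_quot_den (fun b => cos b * cos b)) => //; exact: (lip_mul_bounded norm_cos norm_cos lip_cos lip_cos).
- by apply: (@lip_quot_den (fun b => sin b * cos b)) => //; exact: (lip_mul_bounded norm_sin norm_cos lip_sin lip_cos).
Qed.

Lemma phase_rhs_bounded (M m s x : R) : 0 <= m -> m <= M -> `|phase_rhs m s x| <= phase_const e0^-1 M.
Proof.
move=> m0 mM; rewrite phase_rhsE normrN; have D0 := phase_den_gt0 x.
have key u : `|u| <= 1 -> `|u / phase_den x| <= e0^-1.
  move=> u1; rewrite normrM normfV (gtr0_norm D0) -[leRHS]mul1r; apply: ler_pM => //.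
    by rewrite invr_ge0 ltW.
  by rewrite lef_pV2 ?posrE// phase_den_ge.
apply: (phase_combine s m0 mM); apply: key; rewrite ?normr1// normrM mulr_ile1 ?norm_cos ?norm_sin//.
Qed.

Lemma phase_rhs_continuous m (y : R -> R) : continuous y -> continuous (fun s => phase_rhs m s (y s)).
Proof.
move=> cy s; have cs : {for s, continuous (fun t : R => t)} by exact: cvg_id.
have c1 : {for s, continuous (fun t => sin (y t))} by apply: continuous_comp (cy s) _; exact: continuous_sin.
have c2 : {for s, continuous (fun t => cos (y t))} by apply: continuous_comp (cy s) _; exact: continuous_cos.
have c3 : {for s, continuous (fun t => (1 + t ^+ 2)^-1)}.
  apply: cvgV; first by rewrite gt_eqF// ltr_pwDl// sqr_ge0.
  by apply: cvgD; [exact: cvg_cst|exact: cvgM].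
have c4 : {for s, continuous (fun t => (phase_den (y t))^-1)}.
  apply: cvgV; first by rewrite gt_eqF// phase_den_gt0.
  by apply: cvgD; [apply: cvgM; [exact: cvg_cst|exact: cvgM]|exact: cvgM].
rewrite (_ : (fun _ => _) = fun t => - ((m * (p - 1) - (d - p) * (cos (y t) * cos (y t))
    - (d - 2) * t * (sin (y t) * cos (y t))) * ((1 + t ^+ 2)^-1 * (phase_den (y t))^-1))).
  apply: cvgN; apply: cvgM; last exact: cvgM.
  apply: cvgB; first (apply: cvgB; first exact: cvg_cst).
    by apply: cvgM; [exact: cvg_cst|exact: cvgM].
  apply: cvgM; last exact: cvgM.
  by apply: cvgM; [exact: cvg_cst|exact: cs].
by apply/funext => t; rewrite /phase_rhs invfM expr2.
Qed.

Lemma phase_solution_exists m : 0 <= m ->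
  exists2 B : R -> R, B 0 = pi / 2 & forall s, is_derive s (1 : R) B (phase_rhs m s (B s)).
Proof.
move=> m0; pose L := phase_const phase_lip m + 1; pose M := phase_const e0^-1 m + 1.
have c0 c : 0 < c -> 0 <= phase_const c m.
  by move=> c0; rewrite mulr_ge0 ?addr_ge0 ?mulr_ge0 ?(ltW c0)// subr_ge0 ltW.
have L0 : 0 < L by rewrite ltr_wpDl// c0// phase_lip_gt0.
have M0 : 0 < M by rewrite ltr_wpDl// c0// invr_gt0.
apply: (@picard R (phase_rhs m) L M (pi / 2) L0 M0).
- move=> t x y; apply: le_trans (lip_phase_rhs t x y m0 (lexx m)) _.
  by rewrite ler_wpM2r// lerDl.
- by move=> t x; apply: le_trans (phase_rhs_bounded t x m0 (lexx m)) _; rewrite lerDl.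
- exact: phase_rhs_continuous.
Qed.

End phase_equation.

(** * From a phase to a profile *)

Section profile_of_phase.
Context {R : realType}.
Implicit Types (s t x y e : R).

Lemma half_pi_gt0 : 0 < pi / 2 :> R.
Proof. by rewrite divr_gt0// pi_gt0. Qed.

(** Extends functions from $[0,\pi/2]$ to the line by their end values, so that continuity and
    antiderivatives hold everywhere. *)
Definition clamp x : R := Num.max 0 (Num.min x (pi / 2)).

Lemma clampE x : 0 <= x <= pi / 2 -> clamp x = x.
Proof. by move=> /andP[x0 x1]; rewrite /clamp min_l// max_r. Qed.

Lemma clamp_itv x : 0 <= clamp x <= pi / 2.
Proof. by rewrite /clamp le_max lexx ge_max ge_min lexx orbT (ltW half_pi_gt0). Qed.

Lemma clamp_lip x y : `|clamp x - clamp y| <= `|x - y|.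
Proof.
rewrite /clamp; move: half_pi_gt0; move: (pi / 2) => h h0; rewrite ler_norml.
by rewrite !maxEle !minEle; do ![case: ifP] => /idP; rewrite ?(ltNge, negbK) => *;
  have := ler_norm (x - y); have := ler_norm (y - x); rewrite (distrC y x); do ![move/negP; rewrite -ltNge => ?|move=> ?]; lra.
Qed.

Definition tan_extension (g : R -> R) (l : R) x := if x < pi / 2 then g (tan x) else l.

Lemma cos_neq0 x : 0 <= x -> x < pi / 2 -> cos x != 0.
Proof. by move=> x0 x1; rewrite gt_eqF// cos_gt0_pihalf// x1 andbT (lt_le_trans _ x0)// oppr_lt0 half_pi_gt0. Qed.

Lemma tan_extension_continuous (g : R -> R) (l : R) : continuous g ->
  (forall e, 0 < e -> exists s0, forall s, s0 <= s -> `|g s - l| < e) ->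
  continuous (tan_extension g l \o clamp).
Proof.
move=> cg Hl; suff H x e : 0 <= x <= pi / 2 -> 0 < e -> exists2 d, 0 < d &
    forall y, 0 <= y <= pi / 2 -> `|x - y| < d -> `|tan_extension g l x - tan_extension g l y| < e.
  move=> x; apply/(@cont_distP R R^o R^o) => e e0; have [d d0 Hd] := H _ _ (clamp_itv x) e0.
  exists d => // y xy; apply: Hd; first exact: clamp_itv.
  exact: le_lt_trans (clamp_lip x y) xy.
move=> /andP[x0 x1] e0; move: x1; rewrite le_eqVlt => /predU1P[->|x1]; rewrite /tan_extension.
  have [s0 Hs] := Hl e e0; exists (pi / 2 - atan s0); first by rewrite subr_gt0 atan_ltpi2.
  move=> y /andP[y0 y1]; rewrite ltxx ger0_norm ?subr_ge0// => hy.
  case: ifP => y2; last by rewrite subrr normr0.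
  rewrite distrC; apply: Hs; rewrite -[s0]atanK ltW// ltr_tan ?in_itv/= ?atan_ltpi2 ?atan_gtNpi2 ?y2 ?andbT.
  - by move: hy; lra.
  - by [].
  - by rewrite (lt_le_trans _ y0)// oppr_lt0 half_pi_gt0.
have cgt : {for x, continuous (fun y => g (tan y))}.
  by apply: continuous_comp; [apply: continuous_tan; exact: cos_neq0|exact: cg].
have /(@cont_distP R R^o R^o)/(_ _ e0)[d d0 Hd] := cgt.
exists (Num.min d (pi / 2 - x)); first by rewrite lt_min d0 subr_gt0.
move=> y _; rewrite lt_min => /andP[xy xy2]; rewrite x1.
have -> : y < pi / 2 by move: xy2; rewrite distrC => /(le_lt_trans (ler_norm _)); lra.
exact: Hd.
Qed.

Lemma quasiradial_identity (p d m E D u v w : R) : D != 0 -> D = (p - 1) * v ^+ 2 + u ^+ 2 -> u ^+ 2 + v ^+ 2 = 1 ->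
  let F1 := m * E * v in let F := E * u in
  let F2 := m * E / D * ((d - p) * u - m * u * ((p - 2) * v ^+ 2 + (p - 1)) + (d - 2) * w * v) in
  ((p - 1) * F1 ^+ 2 + (- m) ^+ 2 * F ^+ 2) * F2 + (- m) * ((2 * p - 3) * (- m) + d - p) * F * F1 ^+ 2
   + (- m) ^+ 3 * ((- m) * (p - 1) + d - p) * F ^+ 3 - (d - 2) * (F1 ^+ 2 + (- m) ^+ 2 * F ^+ 2) * F1 * w = 0.
Proof.
move=> D0 DE uv F1 F F2; have F2D : D * F2 = m * E * ((d - p) * u - m * u * ((p - 2) * v ^+ 2 + (p - 1)) + (d - 2) * w * v).
  by rewrite /F2; field.
have -> : ((p - 1) * F1 ^+ 2 + (- m) ^+ 2 * F ^+ 2) * F2 = m ^+ 2 * E ^+ 2 * (D * F2).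
  by rewrite DE /F1 /F; ring.
rewrite F2D /F1 /F.
transitivity (m ^+ 3 * E ^+ 3 * (1 - (u ^+ 2 + v ^+ 2)) * ((d - p) * u - m * (p - 1) * u + (d - 2) * w * v)); first by ring.
by rewrite uv subrr mulr0 mul0r.
Qed.

(** The limit [l] of $(n-2)\, s \sin B$ is the value at the pole of the term carrying $\tan\alpha$,
    and makes $f''$ continuous there; the decay of the phase gives $f'(\pi/2) = 0$. *)
Lemma profile_of_phase (n : nat) (p m l : R) (B : R -> R) : 1 < p -> 0 < m -> B 0 = pi / 2 ->
  (forall s, is_derive s (1 : R) B (phase_rhs p n%:R m s (B s))) ->
  (forall s, 0 <= s -> 0 < B s) -> (forall s, 0 <= s -> B s <= pi / 2) ->
  (forall e, 0 < e -> exists s0, forall s, s0 <= s -> `|B s - 0| < e) ->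
  (forall e, 0 < e -> exists s0, forall s, s0 <= s -> `|(n%:R - 2) * s * sin (B s) - l| < e) ->
  exists f f1 f2, quasiradial_profile n p (- m) f f1 f2.
Proof.
move=> p1 m0 B0 DB Bpos Ble Binf Winf; set d := (n%:R : R).
have cB : continuous B := der_continuous DB.
pose b := tan_extension B 0 \o clamp.
pose w := tan_extension (fun s => (d - 2) * s * sin (B s)) l \o clamp.
have cb : continuous b by exact: tan_extension_continuous.
have cw : continuous w.
  apply: tan_extension_continuous => // s; apply: cvgM; last by apply: continuous_comp (cB s) _; exact: continuous_sin.
  by apply: cvgM; [exact: cvg_cst|exact: cvg_id].
have csb : continuous (fun x => sin (b x)) by move=> x; apply: continuous_comp (cb x) _; exact: continuous_sin.
have ccb : continuous (fun x => cos (b x)) by move=> x; apply: continuous_comp (cb x) _; exact: continuous_cos.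
have cD : continuous (fun x => (phase_den p (b x))^-1).
  move=> x; apply: cvgV; first by rewrite gt_eqF// phase_den_gt0.
  by apply: cvgD; [apply: cvgM; [exact: cvg_cst|apply: cvgM; exact: csb]|apply: cvgM; exact: ccb].
(* Integrating $m \tan b$ fails at $\alpha = 0$, where $b = \pi/2$. Writing $f = E \cos b$ leaves
   $E'/E = g$ with [g] continuous up to both ends; [g] is found from $f' = m E \sin b$ and the
   equation of [b]. The normalisation $E(\pi/2) = 1$ gives $f(\pi/2) = 1$. *)
pose g x := sin (b x) * ((d - p - m * (p - 2)) * cos (b x) + w x) * (phase_den p (b x))^-1.
have cg : continuous g.
  move=> x; apply: cvgM; last exact: cD.
  apply: cvgM; first exact: csb.
  by apply: cvgD; [apply: cvgM; [exact: cvg_cst|exact: ccb]|exact: cw].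
have [G DG] := antideriv cg.
pose E x := expR (G x - G (pi / 2)).
have DE x : is_derive x (1 : R) E (E x * g x) by have Dx := DG x; rewrite /E; der; ring.
have cE : continuous E := der_continuous DE.
pose f x := E x * cos (b x); pose f1 x := m * E x * sin (b x).
pose f2 x := m * E x * (phase_den p (b x))^-1 *
  ((d - p) * cos (b x) - m * cos (b x) * ((p - 2) * sin (b x) ^+ 2 + (p - 1)) + w x).
have bE x : 0 <= x -> x < pi / 2 -> b x = B (tan x).
  by move=> x0 x1; rewrite /b /= clampE ?x0 ?ltW// /tan_extension x1.
have wE x : 0 <= x -> x < pi / 2 -> w x = (d - 2) * tan x * sin (b x).
  by move=> x0 x1; rewrite bE// /w /= clampE ?x0 ?ltW// /tan_extension x1.
have tan_ge0 x : 0 <= x -> x < pi / 2 -> 0 <= tan x.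
  move=> x0 x1; rewrite /tan divr_ge0//.
    by apply: sin_ge0_pi; rewrite x0 (le_trans (ltW x1))// ler_pdivrMr// ler_peMr ?pi_ge0// ler1n.
  by rewrite ltW// cos_gt0_pihalf// x1 andbT (lt_le_trans _ x0)// oppr_lt0 half_pi_gt0.
have sbpos x : 0 <= x -> x < pi / 2 -> 0 < sin (b x).
  move=> x0 x1; rewrite bE//; apply: sin_gt0_pi; rewrite Bpos ?tan_ge0//=.
  by rewrite (le_lt_trans (Ble _ _)) ?tan_ge0// ltr_pdivrMr// ltr_pMr ?pi_gt0// ltr1n.
have b0 : b 0 = pi / 2 by rewrite bE ?half_pi_gt0// tan0.
have bp : b (pi / 2) = 0 by rewrite /b /= clampE ?lexx ?(ltW half_pi_gt0)// /tan_extension ltxx.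
have Db x : 0 < x -> x < pi / 2 -> is_derive x (1 : R) b
    (- (m * (p - 1) - (d - p) * cos (b x) ^+ 2 - w x * cos (b x)) / phase_den p (b x)).
  move=> x0 x1; have cx := cos_neq0 (ltW x0) x1.
  have D1 : is_derive x (1 : R) (fun y => B (tan y)) (- (m * (p - 1) - (d - p) * cos (b x) ^+ 2 - w x * cos (b x)) / phase_den p (b x)).
    have := @der_comp R R^o B (fun y : R => tan y) x 1 _ _ (DB (tan x)) (is_derive_tan cx).
    move/is_derive_eq; apply; rewrite wE ?(ltW x0)// bE ?(ltW x0)// /phase_rhs.
    have -> : 1 + tan x ^+ 2 = (cos x ^+ 2)^-1 by rewrite cos2_tan2.
    by field; rewrite cx (gt_eqF (phase_den_gt0 p1 _)).
  apply: der_near D1; have xi : x \in `]0, pi / 2[ by rewrite in_itv/= x0.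
  near=> y; have : y \in `]0, pi / 2[ by near: y; exact: near_in_itvoo.
  by rewrite in_itv/= => /andP[y0 y1]; rewrite bE// ltW.
exists f, f1, f2; split.
- split.
  + by apply: continuous_subspaceT => x; apply: cvgM; [exact: cE|exact: ccb].
  + apply: continuous_subspaceT => x; apply: cvgM; last exact: csb.
    by apply: cvgM; [exact: cvg_cst|exact: cE].
  + apply: continuous_subspaceT => x; apply: cvgM.
      by apply: cvgM; [apply: cvgM; [exact: cvg_cst|exact: cE]|exact: cD].
    apply: cvgD; last exact: cw.
    apply: cvgB; first by apply: cvgM; [exact: cvg_cst|exact: ccb].
    apply: cvgM; first by apply: cvgM; [exact: cvg_cst|exact: ccb].
    apply: cvgD; last exact: cvg_cst.
    by apply: cvgM; [exact: cvg_cst|apply: cvgM; exact: csb].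
  + move=> x; rewrite in_itv/= => /andP[x0 x1]; have Dx := Db x x0 x1; have DEx := DE x.
    have dn := gt_eqF (phase_den_gt0 p1 (b x)).
    have s2 : sin (b x) ^+ 2 = 1 - cos (b x) ^+ 2 by rewrite -(cos2Dsin2 (b x)); ring.
    split.
      rewrite /f /f1; der; rewrite /g; apply: (mulIf (negbT dn)).
      by rewrite [in RHS]/phase_den [in RHS]s2; field; rewrite dn.
    rewrite /f1 /f2; der; rewrite /g; apply: (mulIf (negbT dn)).
    transitivity (m * E x * (sin (b x) ^+ 2 * ((d - p - m * (p - 2)) * cos (b x) + w x)
       - cos (b x) * (m * (p - 1) - (d - p) * cos (b x) ^+ 2 - w x * cos (b x)))); first by field; rewrite dn.
    by rewrite s2; field; rewrite dn.
- move=> x y; rewrite !in_itv/= => /andP[x0 x1] /andP[y0 y1] xy.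
  have [||c cxy fE] := @MVT R f f1 x y xy.
  + move=> t; rewrite in_itv/= => /andP[xt ty]; have t0 := lt_trans x0 xt; have t1 := lt_trans ty y1.
    have Dx := Db t t0 t1; have DEx := DE t.
    have dn := gt_eqF (phase_den_gt0 p1 (b t)).
    have s2 : sin (b t) ^+ 2 = 1 - cos (b t) ^+ 2 by rewrite -(cos2Dsin2 (b t)); ring.
    rewrite /f /f1; der; rewrite /g; apply: (mulIf (negbT dn)).
    by rewrite [in RHS]/phase_den [in RHS]s2; field; rewrite dn.
  + by apply: continuous_subspaceT => t; apply: cvgM; [exact: cE|exact: ccb].
  + rewrite -subr_gt0 fE mulr_gt0 ?subr_gt0//; move: cxy; rewrite in_itv/= => /andP[xc cy].
    by rewrite !mulr_gt0 ?expR_gt0// sbpos// ?(lt_trans cy)// ltW// (lt_trans x0).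
- rewrite /f /f1 /E b0 bp cos_pihalf sin_pihalf sin0 cos0 subrr expR0 !mulr0 !mulr1.
  by split=> //; rewrite mulr_gt0 ?expR_gt0.
- move=> x; rewrite in_itv/= => /andP[x0 x1].
  have := @quasiradial_identity p d m (E x) (phase_den p (b x)) (cos (b x)) (sin (b x)) (tan x)
    (negbT (gt_eqF (phase_den_gt0 p1 _))) erefl (cos2Dsin2 _).
  by rewrite /= /f /f1 /f2 wE.
Unshelve. all: by end_near. Qed.

End profile_of_phase.

(** * Sub- and supersolutions of the phase equation *)

Section phase_comparison.
Context {R : realType}.
Variables (p d : R).
Hypothesis p1 : 1 < p.
Implicit Types (a b m s t x y : R).

(** Gronwall's inequality for $u - v$ with the global Lipschitz constant. The bounds on phases below
    come from explicit sub- and supersolutions. *)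
Lemma phase_comparison (m : R) (u du v dv : R -> R) (a b : R) : 0 <= m -> a <= b ->
  (forall t, a <= t <= b -> is_derive t (1 : R) u (du t)) -> (forall t, a <= t <= b -> is_derive t (1 : R) v (dv t)) ->
  (forall t, a <= t <= b -> du t <= phase_rhs p d m t (u t)) ->
  (forall t, a <= t <= b -> phase_rhs p d m t (v t) <= dv t) -> u a <= v a -> u b <= v b.
Proof.
move=> m0 ab Du Dv Hu Hv uv; rewrite -subr_le0.
pose L := phase_const p d (phase_lip p) m.
have L0 : 0 <= L.
  apply: mulr_ge0; first exact/ltW/phase_lip_gt0.
  by rewrite !addr_ge0 ?mulr_ge0 ?normr_ge0// subr_ge0 ltW.
apply: (@gronwall_le0 R (fun t => u t - v t) (fun t => du t - dv t) a b L L0 ab).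
- by move=> t ht; have D1 := Du t ht; have D2 := Dv t ht; der.
- move=> t ht uvt; have := lip_phase_rhs d p1 t (u t) (v t) m0 (lexx m).
  rewrite (gtr0_norm uvt) -/L => h; have := ler_norm (phase_rhs p d m t (u t) - phase_rhs p d m t (v t)).
  by have := Hu t ht; have := Hv t ht; move: h; lra.
- by rewrite subr_le0.
Qed.

Lemma phase_rhs_pihalf m s : phase_rhs p d m s (pi / 2) = - m / (1 + s ^+ 2).
Proof.
rewrite /phase_rhs /phase_den cos_pihalf sin_pihalf; field.
by rewrite subr_eq0 (gt_eqF p1) gt_eqF// ltr_pwDl// sqr_ge0.
Qed.

Lemma phase_rhs0 m s : phase_rhs p d m s 0 = - (m * (p - 1) - (d - p)) / (1 + s ^+ 2).
Proof.
rewrite /phase_rhs /phase_den cos0 sin0; field.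
by rewrite gt_eqF// ltr_pwDl// sqr_ge0.
Qed.

Lemma time_gt0 s : 0 < 1 + s ^+ 2. Proof. by rewrite ltr_pwDl// sqr_ge0. Qed.

(** The constant $\pi/2$ is a supersolution. *)
Lemma phase_le_pihalf m (B : R -> R) : 0 <= m -> B 0 = pi / 2 ->
  (forall s, is_derive s (1 : R) B (phase_rhs p d m s (B s))) -> forall s, 0 <= s -> B s <= pi / 2.
Proof.
move=> m0 B0 DB s s0.
apply: (@phase_comparison m B (fun s => phase_rhs p d m s (B s)) (fun=> pi / 2) (fun=> 0) 0 s) => //.
- by move=> t _; rewrite phase_rhs_pihalf mulNr oppr_le0 divr_ge0// ltW// time_gt0.
- by rewrite B0.
Qed.

End phase_comparison.

(** * The planar exponent *)

Section planar_exponent.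
Context {R : realType}.
Variable p : R.
Hypothesis p1 : 1 < p.
Implicit Types (s t x y : R).

Definition planar_exponent : R := (3 - p + 2 * Num.sqrt (p ^+ 2 - 3 * p + 3)) / (3 * (p - 1)).
Local Notation m := planar_exponent.

(** The roots of this quadratic have product $-1/3$, and [m] is the positive one. *)
Lemma planar_exponent_quadratic : 3 * (p - 1) * m ^+ 2 + (2 * p - 6) * m - (p - 1) = 0.
Proof.
have h : 0 <= p ^+ 2 - 3 * p + 3.
  have -> : p ^+ 2 - 3 * p + 3 = (p - 3 / 2) ^+ 2 + 3 / 4 by field.
  by rewrite addr_ge0 ?sqr_ge0// divr_ge0.
have := sqr_sqrtr h; rewrite /planar_exponent; move: (Num.sqrt _) => S S2.
have -> : 3 * (p - 1) * ((3 - p + 2 * S) / (3 * (p - 1))) ^+ 2 + (2 * p - 6) * ((3 - p + 2 * S) / (3 * (p - 1))) - (p - 1)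
  = (4 * S ^+ 2 - (3 - p) ^+ 2 - 3 * (p - 1) ^+ 2) / (3 * (p - 1)).
  by field; rewrite subr_eq0 gt_eqF.
by rewrite S2 [X in X / _](_ : _ = 0) ?mul0r//; ring.
Qed.

Lemma planar_exponent_gt0 : 0 < m.
Proof.
have p10 : 0 < p - 1 by rewrite subr_gt0.
have h : 0 <= p ^+ 2 - 3 * p + 3.
  have -> : p ^+ 2 - 3 * p + 3 = (p - 3 / 2) ^+ 2 + 3 / 4 by field.
  by rewrite addr_ge0 ?sqr_ge0// divr_ge0.
apply: divr_gt0; last by rewrite mulr_gt0.
have := sqr_sqrtr h; have := sqrtr_ge0 (p ^+ 2 - 3 * p + 3); move: (Num.sqrt _) => S S0 S2.
by rewrite ltNge; apply/negP => le0; move: S2; nra.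
Qed.

Let A := m * (p - 1).
Let Bc := A + p - 2.
Let K := (1 + Bc) / (2 * Bc).

(* [m] is chosen for this identity, by which [K ^+ 2 = A / Bc]. *)
Let quad : (1 + Bc) ^+ 2 = 4 * A * Bc.
Proof.
apply/eqP; rewrite -subr_eq0 /Bc /A.
have -> : (1 + (m * (p - 1) + p - 2)) ^+ 2 - 4 * (m * (p - 1)) * (m * (p - 1) + p - 2) =
  - (p - 1) * (3 * (p - 1) * m ^+ 2 + (2 * p - 6) * m - (p - 1)) by ring.
by rewrite planar_exponent_quadratic mulr0.
Qed.

Let A0 : 0 < A. Proof. by rewrite mulr_gt0 ?planar_exponent_gt0// subr_gt0. Qed.

Let Bc0 : 0 < Bc.
Proof.
have h : 0 < 1 + Bc by rewrite /Bc; move: A0 p1; lra.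
have : 0 < 4 * A * Bc by rewrite -quad exprn_gt0.
by rewrite pmulr_rgt0// mulr_gt0.
Qed.

Let K12 : 1 < 2 * K.
Proof.
have -> : 2 * K = 1 + Bc^-1 by rewrite /K; field; rewrite gt_eqF.
by rewrite ltrDl invr_gt0.
Qed.

Let KK : K ^+ 2 * Bc = A.
Proof.
have -> : K ^+ 2 * Bc = (1 + Bc) ^+ 2 / (4 * Bc) by rewrite /K; field; rewrite gt_eqF.
by rewrite quad; field; rewrite gt_eqF.
Qed.

Let K0 : 0 < K. Proof. by move: K12; lra. Qed.

Variable B : R -> R.
Hypothesis B0 : B 0 = pi / 2.
Hypothesis DB : forall s, is_derive s (1 : R) B (phase_rhs p 2 m s (B s)).

Let Delta s := cos (B s) ^+ 2 + K ^+ 2 * sin (B s) ^+ 2.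

Let Delta0 s : 0 < Delta s.
Proof.
have := cos2Dsin2 (B s); have := sqr_ge0 (sin (B s)); have := sqr_ge0 (cos (B s)).
have : 0 < K ^+ 2 by rewrite exprn_gt0.
rewrite /Delta; move: (sin _ ^+ 2) (cos _ ^+ 2) (K ^+ 2) => x y z; nra.
Qed.

Let theta s := (atan s + pi / 2 - B s) / 2.

Let Dtheta s : is_derive s (1 : R) theta (- (K * phase_rhs p 2 m s (B s) / Delta s)).
Proof.
have D1 := DB s; have D2 : is_derive s (1 : R) atan (1 + s ^+ 2)^-1 by exact: is_derive1_atan.
rewrite /theta; der; have dn := phase_den_gt0 p1 (B s); have D0 := Delta0 s; have t0 := time_gt0 s.
have s2 : sin (B s) ^+ 2 = 1 - cos (B s) ^+ 2 by rewrite -(cos2Dsin2 (B s)); ring.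
(* By $K^2 Bc = A$ the numerator and the denominator of the equation are [Bc] times [Delta] and
   [2 * K - Delta]; this is why the derivative of [theta] becomes that of an arctangent of the
   phase. *)
have denE : phase_den p (B s) = Bc * (2 * K - Delta s).
  have -> : Bc * (2 * K - Delta s) = (1 + Bc) - Bc * cos (B s) ^+ 2 - K ^+ 2 * Bc * sin (B s) ^+ 2.
    by rewrite /Delta {1}/K; field; rewrite gt_eqF.
  by rewrite KK /phase_den s2 /Bc; ring.
have rhsE : phase_rhs p 2 m s (B s) = - (Delta s / ((1 + s ^+ 2) * (2 * K - Delta s))).
  have k0 : 2 * K - Delta s != 0.
    by have := dn; rewrite denE pmulr_rgt0// => /gt_eqF ->.
  rewrite /phase_rhs denE -/A.
  have -> : A - (2 - p) * cos (B s) ^+ 2 - (2 - 2) * s * (sin (B s) * cos (B s)) = Bc * Delta s.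
    have -> : Bc * Delta s = Bc * cos (B s) ^+ 2 + K ^+ 2 * Bc * sin (B s) ^+ 2 by rewrite /Delta; ring.
    by rewrite KK s2 /Bc; ring.
  by field; rewrite k0 !gt_eqF.
have k0 : 2 * K - Delta s != 0.
  by have := dn; rewrite denE pmulr_rgt0// => /gt_eqF ->.
by rewrite rhsE; field; rewrite k0 !gt_eqF.
Qed.

(** The equation separates: $\theta + \arctan(K \tan B)$ has derivative zero and starts at $\pi/2$.
    The relation $Q = 0$ expresses $\theta = \pi/2 - \arctan(K \tan B)$ free of tangents, hence also
    where $B = \pi/2$. *)
Let Q s := K * sin (B s) * sin (theta s) - cos (B s) * cos (theta s).

Let DQ s : is_derive s (1 : R) Q (phase_rhs p 2 m s (B s) * (K ^+ 2 - 1) * sin (B s) * cos (B s) * Q s / Delta s).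
Proof.
have D1 := DB s; have D2 := Dtheta s; rewrite /Q; der; have D0 := Delta0 s; have E := cos2Dsin2 (B s).
have : Delta s = cos (B s) ^+ 2 + K ^+ 2 * sin (B s) ^+ 2 by [].
move: (phase_rhs _ _ _ _ _) (Delta s) D0 => b D D0 DE.
have e1 : D - 1 = (K ^+ 2 - 1) * sin (B s) ^+ 2 by rewrite DE -{1}E; ring.
have e2 : D - K ^+ 2 = (1 - K ^+ 2) * cos (B s) ^+ 2.
  by rewrite DE -[X in _ - X]mulr1 -{1}E; ring.
apply: (mulIf (negbT (gt_eqF D0))).
transitivity (b * (K * cos (B s) * sin (theta s) * (D - 1) + sin (B s) * cos (theta s) * (D - K ^+ 2))).
  by field; rewrite gt_eqF.
by rewrite e1 e2; field; rewrite gt_eqF.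
Qed.

(* [Q ^+ 2 / Delta] is the first integral of the planar phase equation. *)
Let Q0 s : Q s = 0.
Proof.
have D (t : R) : is_derive t (1 : R) (fun t => Q t ^+ 2 / Delta t) 0.
  have D1 := DB t; have D2 := DQ t; have D0 := Delta0 t.
  have D3 : is_derive t (1 : R) Delta (2 * (K ^+ 2 - 1) * sin (B t) * cos (B t) * phase_rhs p 2 m t (B t)).
    by rewrite /Delta; der; ring.
  by der; [rewrite gt_eqF|field; rewrite gt_eqF].
have E : Q s ^+ 2 / Delta s = Q 0 ^+ 2 / Delta 0 by exact: (@is_derive_0_is_cst R (fun t => Q t ^+ 2 / Delta t) s 0 D).
have th0 : theta 0 = 0 by rewrite /theta atan0 B0; ring.
have Q00 : Q 0 = 0 by rewrite /Q th0 sin0 B0 cos_pihalf; ring.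
move/eqP: E; rewrite Q00 expr0n/= mul0r mulf_eq0 invr_eq0 (gt_eqF (Delta0 s)) orbF sqrf_eq0.
by move/eqP.
Qed.

(** At a zero of the phase [Q] would equal $-\cos\theta$ with $\theta$ half of $\arctan t + \pi/2$,
    an angle below $\pi/2$. *)
Lemma planar_phase_gt0 s : 0 <= s -> 0 < B s.
Proof.
move=> s0; rewrite ltNge; apply/negP => Bs.
have [||t + Bt] := @IVT R B 0 s 0 s0.
- by apply: continuous_subspaceT; exact: der_continuous DB.
- by rewrite B0 ge_min Bs orbT le_max (ltW half_pi_gt0).
rewrite in_itv/= => /andP[t0 ts]; have := Q0 t.
rewrite /Q Bt sin0 cos0 mulr0 mul0r mul1r sub0r => /eqP; rewrite oppr_eq0; apply/negP.
rewrite gt_eqF// cos_gt0_pihalf// /theta Bt subr0.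
by have := atan_ltpi2 t; have := le_atan t0; rewrite atan0; have := half_pi_gt0 (R := R); lra.
Qed.

(** Put $x = \pi/2 - \arctan s$; then $\theta = \pi/2 - h$ with $h = (B + x)/2$. Replacing $h$ by
    $B/2$ in $Q = 0$ costs $O(x)$ and leaves $\sin(B/2)\,(1 + 2(K-1)\cos^2(B/2))$, whose second
    factor is at least $\min(1, 2K-1) > 0$. *)
Lemma planar_phase_decay s : 0 <= s ->
  sin (B s / 2) * Num.min 1 (2 * K - 1) <= (1 + 2 * K) * (pi / 2 - atan s).
Proof.
move=> s0; have Bs := planar_phase_gt0 s0.
have Bp : B s <= pi / 2 by exact: (phase_le_pihalf p1 (ltW planar_exponent_gt0) B0 DB).
have x0 : 0 < pi / 2 - atan s by rewrite subr_gt0 atan_ltpi2.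
set x := pi / 2 - atan s in x0 *; pose h := B s / 2 + x / 2.
have thE : theta s = pi / 2 - h by rewrite /theta /h /x; field.
have := Q0 s; rewrite /Q thE -[pi / 2 - h]opprB cosN sinN.
have -> : sin (h - pi / 2) = - cos h by rewrite sinB cos_pihalf sin_pihalf; ring.
have -> : cos (h - pi / 2) = sin h by rewrite cosB cos_pihalf sin_pihalf; ring.
have ls : `|sin h - sin (B s / 2)| <= x / 2.
  by apply: le_trans (lip_sin _ _) _; rewrite /h addrAC subrr add0r gtr0_norm// divr_gt0.
have lc : `|cos h - cos (B s / 2)| <= x / 2.
  by apply: le_trans (lip_cos _ _) _; rewrite /h addrAC subrr add0r gtr0_norm// divr_gt0.
have E2 : B s = B s / 2 + B s / 2 by field.
have -> : sin (B s) = 2 * sin (B s / 2) * cos (B s / 2) by rewrite {1}E2 sinD; ring.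
have cE : cos (B s) = cos (B s / 2) * cos (B s / 2) - sin (B s / 2) * sin (B s / 2) by rewrite {1}E2 cosD.
have cB0 : 0 <= cos (B s).
  by apply: cos_ge0_pihalf; rewrite Bp andbT (le_trans _ (ltW Bs))// oppr_le0 ltW// half_pi_gt0.
have cB1 := cos_le1 (B s); rewrite opprK.
have sg : 0 <= sin (B s / 2).
  by apply: sin_ge0_pi; have := half_pi_gt0 (R := R); move: Bs Bp; lra.
have cg : 0 <= cos (B s / 2).
  by apply: cos_ge0_pihalf; have := half_pi_gt0 (R := R); move: Bs Bp; lra.
have := cos2Dsin2 (B s / 2); rewrite !expr2; move: ls lc; rewrite !ler_norml => /andP[_ l2] /andP[l1 _].
move: cB0 cB1; rewrite cE; move: sg cg l1 l2; clear cE.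
move: (sin (B s / 2)) (cos (B s / 2)) (sin h) (cos h) => sg ga sh ch sg0 ga0 l1 l2 cB0 cB1 one Qs.
have {}Qs : K * (2 * sg * ga) * ch = (ga * ga - sg * sg) * sh by move: Qs; lra.
have g1 : ga <= 1 by move: one ga0; nra.
have s1 : sg <= 1 by move: one sg0; nra.
have P0 : 0 <= K * (2 * sg * ga) by exact: (mulr_ge0 (ltW K0) (mulr_ge0 (mulr_ge0 (ler0n _ 2) sg0) ga0)).
have P1 : K * (2 * sg * ga) <= 2 * K.
  rewrite [leRHS]mulrC ler_pM2l// -mulrA -[leRHS]mulr1 ler_pM2l//; exact: mulr_ile1.
have h1 : K * (2 * sg * ga) * ga - 2 * K * (x / 2) <= K * (2 * sg * ga) * ch.
  have : K * (2 * sg * ga) * (ga - x / 2) <= K * (2 * sg * ga) * ch by rewrite ler_wpM2l//; move: l1; lra.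
  have : K * (2 * sg * ga) * (x / 2) <= 2 * K * (x / 2) by rewrite ler_wpM2r// divr_ge0// ltW.
  lra.
have h2 : (ga * ga - sg * sg) * sh <= (ga * ga - sg * sg) * sg + x / 2.
  have : (ga * ga - sg * sg) * (sh - sg) <= 1 * (x / 2).
    apply: (@le_trans _ _ ((ga * ga - sg * sg) * (x / 2))).
      by rewrite ler_wpM2l//; move: l2; lra.
    by rewrite ler_wpM2r// divr_ge0// ltW.
  lra.
have h3 : sg * (1 + 2 * (K - 1) * (ga * ga)) <= (1 + 2 * K) * (x / 2).
  have -> : sg * (1 + 2 * (K - 1) * (ga * ga)) = K * (2 * sg * ga) * ga - (ga * ga - sg * sg) * sg.
    have -> : sg * (1 + 2 * (K - 1) * (ga * ga)) = sg * ((ga * ga + sg * sg) + 2 * (K - 1) * (ga * ga)) by rewrite one.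
    ring.
  by move: h1 h2; rewrite Qs; lra.
have h4 : Num.min 1 (2 * K - 1) <= 1 + 2 * (K - 1) * (ga * ga).
  have gg1 : ga * ga <= 1 by exact: mulr_ile1.
  have gg0 : 0 <= ga * ga by exact: mulr_ge0.
  have [k1|k1] := leP 1 K.
    by rewrite ge_min; apply/orP; left; rewrite lerDl !mulr_ge0// subr_ge0.
  rewrite ge_min; apply/orP; right; move: gg1 k1; nra.
have : sg * Num.min 1 (2 * K - 1) <= sg * (1 + 2 * (K - 1) * (ga * ga)) by rewrite ler_wpM2l.
have : (1 + 2 * K) * (x / 2) <= (1 + 2 * K) * x.
  by apply: ler_wpM2l; [move: K0; lra|move: x0; lra].
lra.
Qed.

Lemma planar_phase_cvg e : 0 < e -> exists s0, forall s, s0 <= s -> `|B s - 0| < e.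
Proof.
move=> e0; pose e' := Num.min e (pi / 2).
have e'0 : 0 < e' by rewrite lt_min e0 half_pi_gt0.
have ep : e' <= pi / 2 by rewrite ge_min lexx orbT.
pose r := Num.min 1 (2 * K - 1); have r0 : 0 < r by rewrite lt_min ltr01 subr_gt0.
have sin0 : 0 < sin (e' / 2).
  by apply: sin_gt0_pi; have := half_pi_gt0 (R := R); move: e'0 ep; lra.
have k0 : 0 < 1 + 2 * K by move: K0; lra.
pose y := sin (e' / 2) * r / (1 + 2 * K); have y0 : 0 < y by rewrite divr_gt0// mulr_gt0.
pose z := Num.min (y / 2) (pi / 4).
have z0 : 0 < z by rewrite lt_min; apply/andP; split; apply: divr_gt0 => //; exact: pi_gt0.
have zp : z <= pi / 4 by rewrite ge_min lexx orbT.
have zy : z < y by apply: (@le_lt_trans _ _ (y / 2)); [rewrite ge_min lexx|move: y0; lra].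
have zI : pi / 2 - z \in `]- (pi / 2), pi / 2[.
  by rewrite in_itv/=; have := half_pi_gt0 (R := R); move: z0 zp; lra.
exists (Num.max 0 (tan (pi / 2 - z))) => s; rewrite ge_max => /andP[s0 st].
have : pi / 2 - z <= atan s by rewrite -(tanK zI) le_atan.
move=> az; rewrite subr0 (gtr0_norm (planar_phase_gt0 s0)).
apply: (@lt_le_trans _ _ e'); last by rewrite ge_min lexx.
rewrite ltNge; apply/negP => eB.
have Bp : B s <= pi / 2 by exact: (phase_le_pihalf p1 (ltW planar_exponent_gt0) B0 DB).
have h1 : sin (e' / 2) <= sin (B s / 2).
  by rewrite leNgt ltr_sin ?in_itv/= -?leNgt; have := half_pi_gt0 (R := R); move: e'0 ep eB Bp; lra.
have := planar_phase_decay s0; apply/negP; rewrite -ltNge -/r.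
apply: (@lt_le_trans _ _ (sin (e' / 2) * r)); last by rewrite ler_wpM2r// ltW.
rewrite mulrC -ltr_pdivlMr// -/y; move: az zy; lra.
Qed.

End planar_exponent.

Lemma planar_profile {R : realType} (p : R) : 1 < p ->
  exists f f1 f2, quasiradial_profile 2 p (- planar_exponent p) f f1 f2.
Proof.
move=> p1; have m0 := planar_exponent_gt0 p1.
have [B B0 DB] := phase_solution_exists (2 : R) p1 (ltW m0).
apply: (@profile_of_phase R 2 p (planar_exponent p) 0 B) => //.
- exact: planar_phase_gt0.
- exact: (phase_le_pihalf p1 (ltW m0) B0 DB).
- exact: planar_phase_cvg.
- by move=> e e0; exists 0 => s _; rewrite subrr !mul0r subrr normr0.
Qed.

(** * Shooting in dimension at least three *)

Section shooting.
Context {R : realType}.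
Variables (p d : R).
Hypothesis p1 : 1 < p.
Hypothesis d3 : 3 <= d.
Implicit Types (m s t x y T C : R).

Local Notation rhs := (phase_rhs p d).
Local Notation kappa m := (m * (p - 1) - (d - p)).

Lemma atan_le x : 0 <= x -> atan x <= x.
Proof.
move=> x0; have := @lip_of_der R atan (fun t => (1 + t ^+ 2)^-1) (fun t => is_derive1_atan t) _ x 0.
rewrite atan0 !subr0 (ger0_norm x0) => H; apply: le_trans (ler_norm _) (H _) => t.
by have [w0 w1 _] := time_weights t; rewrite gtr0_norm.
Qed.

Lemma atan_ge0 x : 0 <= x -> 0 <= atan x.
Proof. by move=> x0; rewrite -(atan0 R); exact: le_atan. Qed.

Lemma sin_atan_mul x : sin (atan x) = x * cos (atan x).
Proof.
have c0 : cos (atan x) != 0 by rewrite gt_eqF// cos_gt0_pihalf// atan_gtNpi2 atan_ltpi2.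
by rewrite -{2}(atanK x) /tan divfK.
Qed.

Lemma cos_atan_sq x : cos (atan x) ^+ 2 = (1 + x ^+ 2)^-1.
Proof.
have c0 : cos (atan x) != 0 by rewrite gt_eqF// cos_gt0_pihalf// atan_gtNpi2 atan_ltpi2.
by rewrite -[X in 1 + X ^+ 2]atanK -cos2_tan2// invrK.
Qed.

Lemma phase_rhs_atan m s T :
  rhs m s (atan T) = - (kappa m + m * (p - 1) * T ^+ 2 - (d - 2) * (s * T)) / ((1 + s ^+ 2) * (1 + (p - 1) * T ^+ 2)).
Proof.
have T0 := time_gt0 T; have s0 := time_gt0 s.
have D0 : 0 < 1 + (p - 1) * T ^+ 2 by rewrite ltr_pwDl// mulr_ge0 ?sqr_ge0// subr_ge0 ltW.
rewrite /phase_rhs /phase_den sin_atan_mul exprMn.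
have -> : T * cos (atan T) * cos (atan T) = T * cos (atan T) ^+ 2 by ring.
by rewrite cos_atan_sq; field; rewrite ?[_ + 1]addrC ?(gt_eqF T0) ?(gt_eqF s0) ?(gt_eqF D0).
Qed.

Lemma phase_rhs_mono m m' s b : m <= m' -> rhs m' s b <= rhs m s b.
Proof.
move=> mm; have D0 : 0 < (1 + s ^+ 2) * phase_den p b by rewrite mulr_gt0 ?time_gt0// phase_den_gt0.
rewrite /phase_rhs lerN2 ler_pM2r ?invr_gt0//.
by rewrite !lerD2r ler_wpM2r// subr_ge0 ltW.
Qed.

Variable B : R -> R -> R.
Hypothesis B0 : forall m, 0 <= m -> B m 0 = pi / 2.
Hypothesis DB : forall m s, 0 <= m -> is_derive s (1 : R) (B m) (rhs m s (B m s)).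

Lemma phase_antimono m m' s : 0 <= m -> m <= m' -> 0 <= s -> B m' s <= B m s.
Proof.
move=> m0 mm s0; have m'0 := le_trans m0 mm.
apply: (@phase_comparison R p d p1 m (B m') (fun t => rhs m' t (B m' t)) (B m) (fun t => rhs m t (B m t)) 0 s) => //.
- by move=> t _; exact: DB.
- by move=> t _; exact: DB.
- by move=> t _; exact: phase_rhs_mono.
- by rewrite !B0.
Qed.

(** Changing [m] changes the right-hand side by at most [eta]. The exponential rate [L + 1] exceeds
    the Lipschitz constant by one, which absorbs this change in Gronwall's inequality. *)
Lemma phase_param_lip (M s1 : R) : 0 <= M -> 0 <= s1 -> exists2 c, 0 < c & forall m m' s, 0 <= m -> m <= m' -> m' <= M ->
  0 <= s -> s <= s1 -> B m s - B m' s <= c * (m' - m).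
Proof.
move=> M0 s10; pose L := phase_const p d (phase_lip p) M; pose e0 := Num.min 1 (p - 1).
have p10 : 0 < p - 1 by rewrite subr_gt0.
have e00 : 0 < e0 by rewrite lt_min ltr01.
have L0 : 0 <= L.
  apply: mulr_ge0; first exact/ltW/phase_lip_gt0.
  by rewrite !addr_ge0 ?mulr_ge0 ?normr_ge0// ltW.
pose c := (p - 1) / e0; have c0 : 0 < c by rewrite divr_gt0.
exists (c * expR ((L + 1) * s1)); first by rewrite mulr_gt0 ?expR_gt0.
move=> m m' s m0 mm mM s0 ss; pose eta := c * (m' - m).
have eta0 : 0 <= eta by rewrite mulr_ge0 ?subr_ge0// ltW.
have m'0 := le_trans m0 mm.
have : B m s - B m' s - eta * expR ((L + 1) * s) <= 0.
  apply: (@gronwall_le0 R (fun t => B m t - B m' t - eta * expR ((L + 1) * t))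
    (fun t => rhs m t (B m t) - rhs m' t (B m' t) - (L + 1) * (eta * expR ((L + 1) * t))) 0 s L) => //.
  - by move=> t _; have D1 := DB t m0; have D2 := DB t m'0; der; ring.
  - move=> t /andP[t0 _]; set w := eta * _ => h.
    have e1 : eta <= w by rewrite ler_peMr// -expR0 ler_expR mulr_ge0// addr_ge0.
    have bb : 0 < B m t - B m' t by move: h e1 eta0; lra.
    have h1 : rhs m t (B m t) - rhs m t (B m' t) <= L * (B m t - B m' t).
      apply: le_trans (ler_norm _) _; rewrite -(gtr0_norm bb).
      by apply: lip_phase_rhs => //; exact: le_trans mM.
    have h2 : rhs m t (B m' t) - rhs m' t (B m' t) <= eta.
      have D0 := phase_den_gt0 p1 (B m' t); have [w0 w1 _] := time_weights t.
      have -> : rhs m t (B m' t) - rhs m' t (B m' t) = (m' - m) * (p - 1) * ((1 + t ^+ 2)^-1 * (phase_den p (B m' t))^-1).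
        by rewrite /phase_rhs; field; rewrite (gt_eqF D0) gt_eqF// time_gt0.
      have -> : eta = (m' - m) * (p - 1) * (1 * e0^-1) by rewrite /eta /c; ring.
      apply: ler_wpM2l; first by rewrite mulr_ge0 ?subr_ge0// ltW.
      apply: ler_pM => //; rewrite ?invr_ge0 ?(ltW w0) ?(ltW D0)//; first by move: w0; rewrite invr_gt0 => /ltW.
      by rewrite lef_pV2 ?posrE// phase_den_ge.
    by move: h1 h2 e1; lra.
  - by rewrite !B0// subrr mulr0 expR0 mulr1 sub0r oppr_le0.
rewrite subr_le0 => /le_trans; apply.
have -> : c * expR ((L + 1) * s1) * (m' - m) = eta * expR ((L + 1) * s1) by rewrite /eta; ring.
apply: ler_wpM2l => //.
by rewrite ler_expR ler_wpM2l// addr_ge0.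
Qed.

(** Along $\tan B = C/s$ the product $s \tan B$ is constant, so the subsolution condition involves
    only [C] up to powers of $C/s$: in the limit it reads $\kappa \le (d-1)C$. *)
Lemma phase_barrier m C s1 : 0 <= m -> 0 <= C -> 0 < s1 ->
  (forall s, s1 <= s -> (1 + (C / s) ^+ 2) * (kappa m - (d - 2) * C + m * (p - 1) * (C / s) ^+ 2) <= C) ->
  atan (C / s1) <= B m s1 -> forall s, s1 <= s -> atan (C / s) <= B m s.
Proof.
move=> m0 C0 s10 H h1 s ss.
apply: (@phase_comparison R p d p1 m (fun t => atan (C / t)) (fun t => - C / t ^+ 2 / (1 + (C / t) ^+ 2))
  (B m) (fun t => rhs m t (B m t)) s1 s) => //.
- move=> t /andP[t1 _]; have t0 : 0 < t by exact: lt_le_trans t1.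
  have D1 : is_derive t (1 : R) (fun t => C / t) (- C / t ^+ 2).
    by der; [rewrite gt_eqF|field; rewrite gt_eqF].
  have := @der_comp R R^o atan (fun t => C / t) t 1 _ _ (is_derive1_atan (C / t)) D1.
  by move/is_derive_eq; apply; rewrite mulrC.
- by move=> t _; exact: DB.
- move=> t /andP[t1 _]; have t0 : 0 < t by exact: lt_le_trans t1.
  have := H t t1; rewrite phase_rhs_atan.
  have tT : t * (C / t) = C by field; rewrite gt_eqF.
  rewrite tT; set T := C / t => cond.
  have T2 := sqr_ge0 T; have T0 := time_gt0 T; have tt0 := time_gt0 t.
  have p10 : 0 <= p - 1 by rewrite subr_ge0 ltW.
  have D0 : 0 < 1 + (p - 1) * T ^+ 2 by rewrite ltr_pwDl// mulr_ge0.
  rewrite !mulNr lerN2 ler_pdivrMr ?mulr_gt0//.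
  have -> : C / t ^+ 2 / (1 + T ^+ 2) * ((1 + t ^+ 2) * (1 + (p - 1) * T ^+ 2)) =
    C * ((1 + t ^+ 2) / t ^+ 2) * (1 + (p - 1) * T ^+ 2) / (1 + T ^+ 2) by field; rewrite !gt_eqF.
  rewrite ler_pdivlMr//; apply: (@le_trans _ _ C).
    by move: cond; rewrite mulrC; lra.
  rewrite -mulrA ler_peMr//.
  have h2 : 1 <= (1 + t ^+ 2) / t ^+ 2 by rewrite ler_pdivlMr ?exprn_gt0// mul1r lerDr.
  have h3 : 1 <= 1 + (p - 1) * T ^+ 2 by rewrite lerDl mulr_ge0.
  by rewrite -[leLHS]mulr1; apply: ler_pM.
Qed.

Definition crosses m := 0 <= m /\ exists2 s, 0 <= s & B m s < 0.

Lemma crosses_up m m' : crosses m -> m <= m' -> crosses m'.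
Proof.
move=> [m0 [s s0 Bs]] mm; split; first exact: le_trans mm.
by exists s => //; apply: le_lt_trans Bs; exact: phase_antimono.
Qed.

Lemma crosses_large : exists m, crosses m.
Proof.
have p10 : 0 < p - 1 by rewrite subr_gt0.
(* On $[0,1]$ the numerator is then at least $5p + 2d - (d+p) - (d-2) = 4p + 2$ and the denominator
   at most $2p$, so the phase falls with speed at least 2, and $\pi/2 < 2$. *)
pose m := (5 * p + 2 * d) / (p - 1); have m0 : 0 <= m by rewrite divr_ge0 ?(ltW p10)//; move: p1 d3; lra.
have mE : m * (p - 1) = 5 * p + 2 * d by rewrite /m divfK ?gt_eqF.
exists m; split=> //; exists 1 => //.
apply: (@le_lt_trans _ _ (pi / 2 - 2 * 1)); last by have := @pihalf_lt2 R; lra.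
apply: (@phase_comparison R p d p1 m (B m) (fun t => rhs m t (B m t)) (fun t => pi / 2 - 2 * t) (fun=> - 2) 0 1) => //.
- by move=> t _; exact: DB.
- by move=> t _; der; ring.
- move=> t /andP[t0 t1]; rewrite /phase_rhs mE lerN2.
  set b := pi / 2 - _; have D0 := phase_den_gt0 p1 b; have := cos2Dsin2 b.
  have hs := norm_sin b; have hc := norm_cos b.
  have hsc : `|t * (sin b * cos b)| <= 1 by rewrite !normrM mulr_ile1 ?(ger0_norm t0)// mulr_ile1.
  have C0 := sqr_ge0 (cos b); have S0 := sqr_ge0 (sin b).
  rewrite ler_pdivlMr ?mulr_gt0 ?time_gt0//; move: hsc; rewrite -mulrA ler_norml => /andP[_ hsc].
  rewrite /phase_den; move: (t * (sin b * cos b)) (cos b ^+ 2) (sin b ^+ 2) C0 S0 hsc => X C S C0 S0 X1 E.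
  have C1 : C <= 1 by move: E S0; lra.
  have S1 : S <= 1 by move: E C0; lra.
  have t2 : 1 + t ^+ 2 <= 2 by rewrite -[leRHS](_ : 1 + 1 = 2)// lerD2l expr_le1.
  have h1 : (1 + t ^+ 2) * ((p - 1) * S + C) <= 2 * p.
    apply: ler_pM => //; rewrite ?(ltW (time_gt0 _)) ?addr_ge0 ?mulr_ge0 ?(ltW p10)//.
    have : (p - 1) * S <= (p - 1) * 1 by rewrite ler_wpM2l// ltW.
    by move: C1; lra.
  have h2 : (d - p) * C <= d + p.
    have : d * C <= d * 1 by rewrite ler_wpM2l//; move: d3; lra.
    have : 0 <= p * C by rewrite mulr_ge0//; move: p1; lra.
    by move: p1; lra.
  have h3 : (d - 2) * X <= (d - 2) * 1 by rewrite ler_wpM2l// subr_ge0; move: d3; lra.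
  by move: h1 h2 h3 p1 d3; lra.
- by rewrite B0// mulr0 subr0.
Qed.

(** At $m = 0$ the phase stays above $\pi/2$. For small [m] it is still at least $\pi/4 =
    \arctan(C/C)$ on $[0,C]$, and from there on it stays above the barrier $\arctan(C/s)$;
    [C = 3 * p] makes the left side of the barrier condition nonpositive. *)
Lemma crosses_small : exists2 m, 0 < m & ~ crosses m.
Proof.
have p10 : 0 < p - 1 by rewrite subr_gt0.
pose C := 3 * p; have C0 : 0 < C by move: p1; rewrite /C; lra.
have [c c0 Hc] := phase_param_lip ler01 (ltW C0).
pose m := Num.min 1 (pi / 4 / c).
have pi0 := pi_gt0 R.
have m0 : 0 < m by rewrite lt_min ltr01 !divr_gt0.
have m1 : m <= 1 by rewrite ge_min lexx.
have mc : c * m <= pi / 4 by rewrite mulrC -ler_pdivlMr// ge_min lexx orbT.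
have B00 s : 0 <= s -> pi / 2 <= B 0 s.
  move=> s0; apply: (@phase_comparison R p d p1 0 (fun=> pi / 2) (fun=> 0) (B 0) (fun t => rhs 0 t (B 0 t)) 0 s) => //.
  - by move=> t _; exact: DB.
  - by move=> t _; rewrite phase_rhs_pihalf// oppr0 mul0r.
  - by rewrite B0.
have low s : 0 <= s -> s <= C -> pi / 4 <= B m s.
  move=> s0 sC; have := Hc 0 m s (lexx 0) (ltW m0) m1 s0 sC; have := B00 s s0; rewrite subr0.
  by move: mc; lra.
exists m => // -[_ [s s0]]; apply/negP; rewrite -leNgt.
have [sC|Cs] := leP s C; first by apply: le_trans (low s s0 sC); rewrite divr_ge0// ltW.
apply: le_trans (@phase_barrier m C C (ltW m0) (ltW C0) C0 _ _ s (ltW Cs)).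
- by apply: atan_ge0; rewrite divr_ge0// ltW.
- move=> t Ct; have t0 : 0 < t by exact: lt_le_trans Ct.
  apply: (@le_trans _ _ 0); last exact: ltW.
  apply: mulr_ge0_le0; first exact/ltW/time_gt0.
  have T1 : (C / t) ^+ 2 <= 1 by rewrite expr_le1 ?divr_ge0 ?(ltW C0) ?(ltW t0)// ler_pdivrMr// mul1r.
  have h1 : m * (p - 1) <= 1 * (p - 1) by rewrite ler_pM2r.
  have h2 : m * (p - 1) * (C / t) ^+ 2 <= 1 * (p - 1) * 1.
    exact: (ler_pM (mulr_ge0 (ltW m0) (ltW p10)) (sqr_ge0 _) h1 T1).
  have h3 : 3 * p <= (d - 2) * C by rewrite -[leLHS]/C ler_peMl ?(ltW C0)//; move: d3; lra.
  move: h1 h2 h3 p1 d3.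
  by move: ((d - 2) * C) (m * (p - 1) * (C / t) ^+ 2) (m * (p - 1)) => X Y Z; lra.
- by rewrite divff ?gt_eqF// atan1 low// ltW.
Qed.

(* Otherwise the constant [0] is a subsolution. *)
Lemma crosses_kappa m : crosses m -> 0 < kappa m.
Proof.
move=> [m0 [s s0]]; apply: contraTT; rewrite -!leNgt => k0.
apply: (@phase_comparison R p d p1 m (fun=> 0) (fun=> 0) (B m) (fun t => rhs m t (B m t)) 0 s) => //.
- by move=> t _; exact: DB.
- by move=> t _; rewrite phase_rhs0 divr_ge0 ?oppr_ge0// ltW// time_gt0.
- by rewrite B0// ltW// half_pi_gt0.
Qed.

(** For large $s$ the equation linearised at zero has solutions growing like $s^{d-2}$ beside one
    decaying like $\kappa/((d-1)s)$. The phase sought follows the decaying one, which separates the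
    phases that cross zero from those that stay away from it. *)
Definition critical_slope : R := inf [set m | crosses m].
Local Notation ms := critical_slope.

Lemma crosses_has_inf : has_inf [set m | crosses m].
Proof. by split; [have [m hm] := crosses_large; exists m|exists 0 => m []]. Qed.

Lemma critical_slope_gt0 : 0 < ms.
Proof.
have [m0 m0p nm0] := crosses_small; apply: lt_le_trans m0p _.
apply: lb_le_inf; first exact: crosses_has_inf.1.
move=> m /= cm; rewrite leNgt; apply/negP => mm; apply: nm0.
by apply: (crosses_up cm); exact: ltW.
Qed.

Lemma crosses_above m : ms < m -> crosses m.
Proof.
move=> mm; have [m' cm' m'm] := inf_adherent (ltac:(rewrite subr_gt0; exact: mm) : 0 < m - ms) crosses_has_inf.
by apply: (crosses_up cm'); move: m'm; rewrite -/ms; lra.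
Qed.

(** A negative value at [s] would persist for slightly smaller [m], which would then cross as
    well. *)
Lemma critical_ge0 s : 0 <= s -> 0 <= B ms s.
Proof.
move=> s0; rewrite leNgt; apply/negP => Bs.
have m0 := critical_slope_gt0.
have [c c0 Hc] := phase_param_lip (ltW m0) s0.
pose m := Num.max 0 (ms - (- B ms s) / (2 * c)).
have mge : 0 <= m by rewrite le_max lexx.
have mlt : m < ms by rewrite gt_max m0 ltrBlDr ltrDl divr_gt0 ?oppr_gt0 ?mulr_gt0.
have h : ms - m <= (- B ms s) / (2 * c).
  have : ms - (- B ms s) / (2 * c) <= m by rewrite le_max lexx orbT.
  lra.
have : B m s < 0.
  have := Hc m ms s mge (ltW mlt) (lexx _) s0 (lexx _).
  have : c * (ms - m) <= c * ((- B ms s) / (2 * c)) by rewrite ler_wpM2l// ltW.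
  have -> : c * ((- B ms s) / (2 * c)) = - B ms s / 2 by field; rewrite gt_eqF.
  by move: Bs; lra.
move=> Bm; have cm : crosses m by split => //; exists s.
by have := ge_inf crosses_has_inf.2 cm; rewrite leNgt mlt.
Qed.

(** Otherwise the value of [m] where [kappa] vanishes would lie above the infimum and cross, against
    [crosses_kappa]. *)
Lemma critical_kappa : 0 <= kappa ms.
Proof.
rewrite leNgt; apply/negP => k0; have p10 : 0 < p - 1 by rewrite subr_gt0.
pose m := ms - kappa ms / (p - 1).
have mm : ms < m by rewrite ltrDl oppr_gt0 pmulr_llt0 ?invr_gt0.
have := crosses_kappa (crosses_above mm).
have -> : kappa m = 0 by rewrite /m; field; rewrite gt_eqF.
by rewrite ltxx.
Qed.

(** If [kappa] vanishes, 0 solves the equation and the Lipschitz bound keeps the phase above a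
    decaying exponential. If [kappa] is positive, the equation points downwards at 0, so the phase
    would become negative after a zero, against [critical_ge0]. *)
Lemma critical_gt0 s : 0 <= s -> 0 < B ms s.
Proof.
move=> s0; have m0 := critical_slope_gt0; have m0' := ltW m0.
pose L := phase_const p d (phase_lip p) ms.
have L0 : 0 <= L.
  apply: mulr_ge0; first exact/ltW/phase_lip_gt0.
  by rewrite !addr_ge0 ?mulr_ge0 ?normr_ge0// ?subr_ge0 ltW.
have lip0 t b : 0 <= rhs ms t b - rhs ms t 0 + L * `|b|.
  have := lip_phase_rhs d p1 t b 0 m0' (lexx _); rewrite subr0 -/L => h.
  have := ler_norm (- (rhs ms t b - rhs ms t 0)); rewrite normrN; move: h; lra.
have := critical_kappa; rewrite le_eqVlt => /predU1P[k0|k0].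
  apply: (@lt_le_trans _ _ (pi / 2 * expR (- L * s))); first by rewrite mulr_gt0 ?expR_gt0 ?half_pi_gt0.
  apply: (@phase_comparison R p d p1 ms (fun t => pi / 2 * expR (- L * t)) (fun t => - L * (pi / 2 * expR (- L * t)))
     (B ms) (fun t => rhs ms t (B ms t)) 0 s) => //.
  - by move=> t _; der; ring.
  - by move=> t _; exact: DB.
  - move=> t _; set b := pi / 2 * _; have b0 : 0 <= b by rewrite mulr_ge0 ?expR_ge0// ltW// half_pi_gt0.
    by have := lip0 t b; rewrite phase_rhs0 -k0 oppr0 mul0r (ger0_norm b0); lra.
  - by rewrite mulr0 expR0 mulr1 B0.
rewrite lt_neqAle critical_ge0// andbT eq_sym; apply/eqP => Bs.
pose D := 1 + (s + 1) ^+ 2; have D0 : 0 < D by exact: time_gt0.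
pose e := kappa ms / D / (1 + L).
have L1 : 0 < 1 + L by rewrite ltr_pwDl.
have e0 : 0 < e by rewrite !divr_gt0.
have s1 : s <= s + 1 by rewrite lerDl.
suff : B ms (s + 1) <= - e * ((s + 1) - s).
  have := @critical_ge0 (s + 1) (addr_ge0 s0 ler01); rewrite addrAC subrr add0r mulr1; move: e0; lra.
apply: (@phase_comparison R p d p1 ms (B ms) (fun t => rhs ms t (B ms t)) (fun t => - e * (t - s)) (fun=> - e) s (s + 1)) => //.
- by move=> t _; exact: DB.
- by move=> t _; der; ring.
- move=> t /andP[t1 t2]; have ts : 0 <= t - s by rewrite subr_ge0.
  have := lip_phase_rhs d p1 t (- e * (t - s)) 0 m0' (lexx _).
  have nE : `|- e * (t - s)| = e * (t - s) by rewrite mulNr normrN ger0_norm// (mulr_ge0 (ltW e0) ts).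
  rewrite subr0 -/L nE => h.
  have h1 := le_trans (ler_norm _) h.
  have h2 : L * (e * (t - s)) <= L * (e * 1) by rewrite ler_wpM2l// ler_wpM2l ?(ltW e0)//; move: t2; lra.
  have h3 : rhs ms t 0 <= - (e * (1 + L)).
    rewrite phase_rhs0 mulNr lerN2 /e divfK ?gt_eqF// ler_pM2l// lef_pV2 ?posrE ?time_gt0// /D lerD2l.
    by rewrite lerXn2r ?nnegrE ?addr_ge0// (le_trans s0).
  by move: h1 h2 h3; lra.
- by rewrite Bs subrr mulr0.
Qed.

Local Notation slope := (kappa ms / (d - 1)).

(** If the phase exceeded $\arctan(C/s)$ at some large [s1], so would the phase of a slightly larger
    [m]. That one would be positive up to [s1] by continuity and nonnegative beyond by
    [phase_barrier], although every larger [m] crosses. *)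
Lemma critical_upper C : slope < C -> exists2 s0, 0 < s0 & forall s, s0 <= s -> B ms s <= atan (C / s).
Proof.
move=> hC; have m0 := critical_slope_gt0; have m0' := ltW m0.
have p10 : 0 < p - 1 by rewrite subr_gt0.
have d10 : 0 < d - 1 by move: d3; lra.
have C0 : 0 < C by apply: le_lt_trans hC; rewrite divr_ge0 ?(ltW d10)// critical_kappa.
(* [g] is the gap in the limiting barrier condition. Raising [m] by at most [del] uses half of it,
   and [tau] bounds $C/t$ so that the remaining powers of $C/t$ fit into [g']. *)
pose g := (d - 1) * C - kappa ms; have g0 : 0 < g by rewrite subr_gt0 [_ * C]mulrC -ltr_pdivrMr.
pose g' := Num.min (g / 2) C; have g'0 : 0 < g' by rewrite lt_min C0 divr_gt0.
have g'1 : g' <= g / 2 by rewrite ge_min lexx.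
have g'2 : g' <= C by rewrite ge_min lexx orbT.
pose del := g / (2 * (p - 1)); have del0 : 0 < del by rewrite divr_gt0 ?mulr_gt0.
pose Y := (ms + del) * (p - 1); have Y0 : 0 < Y := mulr_gt0 (addr_gt0 m0 del0) p10.
have CY : 0 < C + 2 * Y := addr_gt0 C0 (mulr_gt0 (ltr0Sn R 1) Y0).
pose tau := Num.min 1 (g' / (C + 2 * Y)); have tau0 : 0 < tau by rewrite lt_min ltr01 divr_gt0.
have tau1 : tau <= 1 by rewrite ge_min lexx.
have tau2 : tau * (C + 2 * Y) <= g' by rewrite -ler_pdivlMr// ge_min lexx orbT.
pose s0 := C / tau; have s00 : 0 < s0 by rewrite divr_gt0.
exists s0 => // s1 ss; rewrite leNgt; apply/negP => hB.
have s10 : 0 < s1 by exact: lt_le_trans ss.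
have [c0 c0i cmin] := EVT_min (ltW s10) (continuous_subspaceT (der_continuous (fun t => DB t m0'))).
have mu0 : 0 < B ms c0 by apply: critical_gt0; move: c0i; rewrite in_itv/= => /andP[].
have M0 : 0 <= ms + del by rewrite addr_ge0// ltW.
have [c cp Hc] := phase_param_lip M0 (ltW s10).
pose r := Num.min (B ms c0) (B ms s1 - atan (C / s1)).
have r0 : 0 < r by rewrite lt_min mu0 subr_gt0.
have r1 : r <= B ms c0 by rewrite ge_min lexx.
have r2 : r <= B ms s1 - atan (C / s1) by rewrite ge_min lexx orbT.
pose m := ms + Num.min del (r / c).
have mn0 : 0 < Num.min del (r / c) by rewrite lt_min del0 divr_gt0.
have mm : ms < m by rewrite ltrDl.
have mge : 0 <= m by exact: le_trans m0' (ltW mm).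
have md : m <= ms + del by rewrite lerD2l ge_min lexx.
have cm : c * (m - ms) <= r.
  by rewrite /m addrAC subrr add0r mulrC -ler_pdivlMr// ge_min lexx orbT.
have [_ [s sp]] := crosses_above mm; apply/negP; rewrite -leNgt.
have [s_s1|s1_s] := leP s s1.
  have := Hc ms m s m0' (ltW mm) md sp s_s1.
  have := cmin s; rewrite in_itv/= sp s_s1 => /(_ isT).
  by move: cm r1; lra.
apply: le_trans (@phase_barrier m C s1 mge (ltW C0) s10 _ _ s (ltW s1_s)).
- by apply: atan_ge0; rewrite divr_ge0// ltW.
- move=> t s1t; have t0 : 0 < t by exact: lt_le_trans s1t.
  have T0 : 0 <= C / t by rewrite divr_ge0 ?(ltW C0)// ltW.
  have Tt : C / t <= tau.
    by rewrite ler_pdivrMr// mulrC -ler_pdivrMr// (le_trans _ s1t).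
  have TT : (C / t) ^+ 2 <= tau.
    by rewrite expr2 -[leRHS]mulr1; apply: ler_pM => //; exact: le_trans tau1.
  have T2 := sqr_ge0 (C / t).
  have hY : m * (p - 1) <= Y by rewrite ler_pM2r.
  have hX : kappa m - (d - 2) * C <= C - g'.
    have : m * (p - 1) <= ms * (p - 1) + g / 2.
      apply: le_trans hY _; rewrite /Y mulrDl lerD2l /del.
      by rewrite [leLHS](_ : _ = g / 2)//; field; rewrite gt_eqF.
    by move: g'1; rewrite /g; lra.
  have h1 : m * (p - 1) * (C / t) ^+ 2 <= Y * (C / t) ^+ 2 by rewrite ler_wpM2r.
  apply: (@le_trans _ _ ((1 + (C / t) ^+ 2) * (C - g' + Y * (C / t) ^+ 2))).
    by apply: ler_wpM2l; [exact/ltW/time_gt0|exact: lerD].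
  have Cg : 0 <= C - g' by rewrite subr_ge0.
  have h2 : (C / t) ^+ 2 * (C - g' + Y * (C / t) ^+ 2 + Y) <= tau * (C + 2 * Y).
    apply: ler_pM => //; first exact: (addr_ge0 (addr_ge0 Cg (mulr_ge0 (ltW Y0) T2)) (ltW Y0)).
    have : Y * (C / t) ^+ 2 <= Y * 1 by rewrite ler_wpM2l ?(ltW Y0)// (le_trans TT).
    by move: g'0; lra.
  move: h2 tau2; move: ((C / t) ^+ 2) => T; lra.
- have := Hc ms m s1 m0' (ltW mm) md (ltW s10) (lexx _).
  by move: cm r2; lra.
Qed.

(** If the phase fell below $\arctan(C/s)$ at some large [s1], it would stay below a supersolution
    that reaches zero in finite time, against [critical_gt0]. *)
Lemma critical_lower C : 0 < C -> C < slope -> exists2 s0, 0 < s0 & forall s, s0 <= s -> atan (C / s) <= B ms s.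
Proof.
move=> C0 hC; have m0 := critical_slope_gt0; have m0' := ltW m0.
have p10 : 0 < p - 1 by rewrite subr_gt0.
have d10 : 0 < d - 1 by move: d3; lra.
pose g := kappa ms - (d - 1) * C; have g0 : 0 < g by rewrite subr_gt0 mulrC -ltr_pdivlMr.
pose E := 1 + 2 * (p - 1) * C ^+ 2.
have E0 : 0 < E by rewrite ltr_pwDl// !mulr_ge0 ?sqr_ge0// ltW.
pose s0 := Num.max 1 (2 * (C + g) * E / g).
have s01 : 1 <= s0 by rewrite le_max lexx.
have s0E : 2 * (C + g) * E / g <= s0 by rewrite le_max lexx orbT.
exists s0; first exact: lt_le_trans s01.
move=> s1 ss; rewrite leNgt; apply/negP => hB.
have s11 : 1 <= s1 by exact: le_trans ss.
have s10 : 0 < s1 by exact: lt_le_trans s11.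
(* The constant [C] is replaced by a slope with $t\,w'(t) = -g/2$, half of the available gap $\kappa
   - (d-1)C$. The logarithm is unbounded, so [w] vanishes at the finite time [s2]. *)
pose w t := C - g / 2 * ln (t / s1).
pose s2 := s1 * expR (C / (g / 2)).
have s12 : s1 <= s2 by rewrite ler_peMr ?(ltW s10)// -expR0 ler_expR !divr_ge0// ltW.
have w2 : w s2 = 0.
  rewrite /w /s2 [_ / s1](_ : _ = expR (C / (g / 2))); last by field; rewrite gt_eqF.
  by rewrite expRK; field; rewrite gt_eqF.
have wC t : s1 <= t -> w t <= C.
  by move=> st; rewrite gerBl mulr_ge0 ?divr_ge0 ?(ltW g0)// ln_ge0// ler_pdivlMr// mul1r.
have w0 t : s1 <= t -> t <= s2 -> 0 <= w t.
  move=> st ts; have t0 : 0 < t by exact: lt_le_trans st.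
  rewrite subr_ge0 mulrC -ler_pdivlMr ?divr_gt0// -ler_expR lnK ?posrE ?divr_gt0//.
  by rewrite ler_pdivrMr// mulrC.
have : B ms s2 <= atan (w s2 / s2); last first.
  by rewrite w2 mul0r atan0 leNgt critical_gt0// (le_trans (ltW s10)).
have Dv t : s1 <= t <= s2 -> is_derive t (1 : R) (fun t => atan (w t / t)) (- (g / 2 + w t) / t ^+ 2 / (1 + (w t / t) ^+ 2)).
  move=> /andP[t1 _]; have t0 : 0 < t by exact: lt_le_trans t1.
  have D0 : is_derive t (1 : R) (fun t => t / s1) s1^-1 by der; ring.
  have D1 : is_derive t (1 : R) (fun t => ln (t / s1)) t^-1.
    have := @der_comp R R^o (fun x => ln x) (fun t => t / s1) t 1 _ _ (is_derive1_ln (divr_gt0 t0 s10)) D0.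
    by move/is_derive_eq; apply; field; rewrite !gt_eqF.
  have D2 : is_derive t (1 : R) (fun t => w t / t) (- (g / 2 + w t) / t ^+ 2).
    by rewrite /w; der; [rewrite gt_eqF|field; rewrite gt_eqF].
  have := @der_comp R R^o atan (fun t => w t / t) t 1 _ _ (is_derive1_atan (w t / t)) D2.
  by move/is_derive_eq; apply; rewrite mulrC.
have Hv t : s1 <= t <= s2 -> rhs ms t (atan (w t / t)) <= - (g / 2 + w t) / t ^+ 2 / (1 + (w t / t) ^+ 2).
  move=> /andP[t1 t2]; have t0 : 0 < t by exact: lt_le_trans t1.
  have wt0 := w0 t t1 t2; have wtC := wC t t1; rewrite phase_rhs_atan.
  have tT : t * (w t / t) = w t by field; rewrite gt_eqF.
  have tT2 : t ^+ 2 * (w t / t) ^+ 2 = w t ^+ 2 by rewrite -exprMn tT.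
  rewrite tT; move: (w t / t) tT tT2 => T tT tT2.
  have T2 := sqr_ge0 T; have T0 := time_gt0 T; have tt0 := time_gt0 t.
  have Dp0 : 0 < 1 + (p - 1) * T ^+ 2 by rewrite ltr_pwDl// mulr_ge0// ltW.
  have tge : 1 <= t ^+ 2 by rewrite expr_ge1 ?(ltW t0)// (le_trans s11).
  have tE : 2 * (C + g) * E <= g * t ^+ 2.
    have : 2 * (C + g) * E <= t * g by rewrite -ler_pdivrMr// (le_trans s0E)// (le_trans ss).
    have : t * g <= t ^+ 2 * g by rewrite ler_pM2r// expr2 ler_peMl// ?(ltW t0)// (le_trans s11).
    by rewrite [g * _]mulrC => h1 h2; exact: le_trans h2 h1.
  rewrite [leLHS]mulNr [- (g / 2 + w t) / t ^+ 2]mulNr [leRHS]mulNr lerN2 ler_pdivlMr ?mulr_gt0//.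
  have -> : (g / 2 + w t) / t ^+ 2 / (1 + T ^+ 2) * ((1 + t ^+ 2) * (1 + (p - 1) * T ^+ 2)) =
    (g / 2 + w t) * ((1 + t ^+ 2) * (1 + (p - 1) * T ^+ 2)) / (t ^+ 2 * (1 + T ^+ 2)) by field; rewrite !gt_eqF.
  rewrite ler_pdivrMr ?mulr_gt0 ?exprn_gt0//.
  have h1 : (1 + t ^+ 2) * (1 + (p - 1) * T ^+ 2) <= t ^+ 2 + E.
    have -> : (1 + t ^+ 2) * (1 + (p - 1) * T ^+ 2) = t ^+ 2 + 1 + (p - 1) * (T ^+ 2 + t ^+ 2 * T ^+ 2) by ring.
    have h : T ^+ 2 + t ^+ 2 * T ^+ 2 <= 2 * C ^+ 2.
      have h3 : w t ^+ 2 <= C ^+ 2 by rewrite lerXn2r ?nnegrE// ltW.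
      have h4 : T ^+ 2 <= t ^+ 2 * T ^+ 2 by rewrite ler_peMl.
      by move: h4; rewrite tT2; move: h3; lra.
    have : (p - 1) * (T ^+ 2 + t ^+ 2 * T ^+ 2) <= (p - 1) * (2 * C ^+ 2) by rewrite ler_wpM2l// ltW.
    by rewrite /E; move: (_ * (T ^+ 2 + _)) (C ^+ 2) => X Z; lra.
  apply: (@le_trans _ _ ((g / 2 + w t) * (t ^+ 2 + E))).
    by rewrite ler_wpM2l// addr_ge0// divr_ge0// ltW.
  apply: (@le_trans _ _ ((w t + g) * t ^+ 2)).
    have : (g / 2 + w t) * E <= (C + g) * E by rewrite ler_pM2r//; move: wtC g0; lra.
    by move: tE; move: (t ^+ 2) => X; lra.
  apply: (@le_trans _ _ ((kappa ms + ms * (p - 1) * T ^+ 2 - (d - 2) * w t) * t ^+ 2)).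
    rewrite ler_wpM2r ?sqr_ge0//.
    have := mulr_ge0 (mulr_ge0 m0' (ltW p10)) T2.
    have : (d - 1) * w t <= (d - 1) * C by rewrite ler_wpM2l// ltW.
    by rewrite /g; lra.
  rewrite ler_wpM2l//; last by rewrite ler_peMr ?sqr_ge0// lerDl.
  have := mulr_ge0 (mulr_ge0 m0' (ltW p10)) T2.
  have : (d - 1) * w t <= (d - 1) * C by rewrite ler_wpM2l// ltW.
  by move: g0 wt0; rewrite /g; lra.
have h0 : B ms s1 <= atan (w s1 / s1).
  have -> : w s1 = C by rewrite /w divff ?gt_eqF// ln1 mulr0 subr0.
  exact: ltW.
exact: (@phase_comparison R p d p1 ms _ _ _ _ s1 s2 m0' s12 (fun t _ => DB t m0') Dv (fun t _ => lexx _) Hv h0).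
Qed.

Lemma critical_cvg e : 0 < e -> exists s0, forall s, s0 <= s -> `|B ms s - 0| < e.
Proof.
move=> e0; have C0 : 0 < slope + 1.
  by rewrite ltr_pwDr// divr_ge0 ?critical_kappa// subr_ge0; move: d3; lra.
have [|s0 s00 H] := @critical_upper (slope + 1); first by rewrite ltrDl.
exists (Num.max s0 ((slope + 1) / e + 1)) => s; rewrite ge_max => /andP[h1 h2].
have sp : 0 < s by exact: lt_le_trans h1.
rewrite subr0 gtr0_norm ?critical_gt0 ?(ltW sp)//.
apply: le_lt_trans (H s h1) _; apply: le_lt_trans (atan_le _) _; first by rewrite divr_ge0 ?(ltW C0)// ltW.
by rewrite ltr_pdivrMr// [e * s]mulrC -ltr_pdivrMr//; move: h2; lra.
Qed.

(** Sandwiches $s \sin B$ between the bounds of [critical_upper] and [critical_lower] for $C$ close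
    to the limit slope; when the slope is too small for a lower bound of that kind, positivity of
    the sine suffices. This is the limit at the pole required by [profile_of_phase]. *)
Lemma critical_slope_cvg e : 0 < e ->
  exists s0, forall s, s0 <= s -> `|(d - 2) * s * sin (B ms s) - (d - 2) * slope| < e.
Proof.
move=> e0; have d20 : 0 < d - 2 by move: d3; lra.
pose r := e / (d - 2) / 2; have r0 : 0 < r by rewrite !divr_gt0.
have sl0 : 0 <= slope by rewrite divr_ge0 ?critical_kappa// subr_ge0; move: d3; lra.
have bp s : 0 <= s -> B ms s <= pi / 2.
  by apply: (phase_le_pihalf p1 (ltW critical_slope_gt0) (B0 (ltW critical_slope_gt0))) => t; exact: DB (ltW critical_slope_gt0).
suff [s0 H] : exists s0, forall s, s0 <= s -> slope - 2 * r < s * sin (B ms s) < slope + 2 * r.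
  exists s0 => s ss; have := H s ss; rewrite -ltr_distl => h.
  rewrite -(mulrA (d - 2)) -mulrBr normrM gtr0_norm// [(d - 2) * _]mulrC -ltr_pdivlMr//.
  by have -> : e / (d - 2) = 2 * r by rewrite /r; field; rewrite gt_eqF.
have [|su su0 Hu] := @critical_upper (slope + r); first by rewrite ltrDl.
have sinm x y : 0 <= x -> x <= y -> y <= pi / 2 -> sin x <= sin y.
  move=> x0 xy yp; rewrite leNgt ltr_sin ?in_itv/= -?leNgt//; have := half_pi_gt0 (R := R); move: x0 xy yp; lra.
have up s : su <= s -> s * sin (B ms s) < slope + 2 * r.
  move=> ss; have sp : 0 < s by exact: lt_le_trans ss.
  have h : sin (B ms s) <= (slope + r) / s * 1.
    apply: le_trans (sinm _ _ (ltW (critical_gt0 (ltW sp))) (Hu s ss) (ltW (atan_ltpi2 _))) _.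
    by rewrite sin_atan_mul ler_wpM2l ?cos_le1// divr_ge0 ?addr_ge0 ?(ltW r0)// ltW.
  have : s * sin (B ms s) <= s * ((slope + r) / s * 1) by rewrite ler_pM2l.
  have -> : s * ((slope + r) / s * 1) = slope + r by rewrite mulr1 [s * _]mulrC divfK// gt_eqF.
  by move: r0; lra.
have [rs|rs] := leP slope r.
  exists su => s ss; rewrite up// andbT; have sp : 0 < s by exact: lt_le_trans ss.
  apply: (@lt_le_trans _ _ 0); first by move: rs r0; lra.
  rewrite mulr_ge0 ?(ltW sp)// -(sin0 R); apply: sinm => //; first exact/ltW/critical_gt0/ltW.
  exact/bp/ltW.
have [||sl sl0' Hl] := @critical_lower (slope - r); [by rewrite subr_gt0|by rewrite gtrBl|].
have C0 : 0 < slope - r by rewrite subr_gt0.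
exists (Num.max su (Num.max sl ((slope - r) * (slope - r) / r + 1))) => s.
rewrite !ge_max => /andP[h1 /andP[h2 h3]]; rewrite up// andbT.
have sp : 0 < s by exact: lt_le_trans h2.
have T0 : 0 <= (slope - r) / s by rewrite divr_ge0// ltW.
have h4 : sin (atan ((slope - r) / s)) <= sin (B ms s).
  by apply: sinm; [exact: atan_ge0|exact: Hl|exact/bp/ltW].
have h5 : 1 - (slope - r) / s <= cos (atan ((slope - r) / s)).
  have := lip_cos 0 (atan ((slope - r) / s)); rewrite cos0 sub0r normrN (ger0_norm (atan_ge0 T0)) => h.
  by have := le_trans (ler_norm _) h; have := atan_le T0; lra.
have h6 : (slope - r) * (1 - (slope - r) / s) <= s * sin (B ms s).
  apply: (@le_trans _ _ (s * sin (atan ((slope - r) / s)))); last by rewrite ler_pM2l.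
  have -> : s * sin (atan ((slope - r) / s)) = (slope - r) * cos (atan ((slope - r) / s)).
    by rewrite sin_atan_mul mulrA [s * _]mulrC divfK// gt_eqF.
  by rewrite ler_pM2l.
apply: lt_le_trans h6.
have h7 : (slope - r) * (slope - r) / s < r.
  by rewrite ltr_pdivrMr// [r * s]mulrC -ltr_pdivrMr//; move: h3; lra.
have -> : (slope - r) * (1 - (slope - r) / s) = (slope - r) - (slope - r) * (slope - r) / s by ring.
by move: h7; lra.
Qed.

End shooting.

(** * Existence of profiles, and the power law *)

Lemma profile_exists {R : realType} (n : nat) (p : R) : (2 <= n)%N -> 1 < p ->
  exists k, k < 0 /\ exists f f1 f2, quasiradial_profile n p k f f1 f2.
Proof.
rewrite leq_eqVlt => /predU1P[<-|n3] p1.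
  by exists (- planar_exponent p); split; [rewrite oppr_lt0 planar_exponent_gt0|exact: planar_profile].
have d3 : 3 <= n%:R :> R by rewrite ler_nat.
have ex (m : R) : exists B : R -> R, 0 <= m -> B 0 = pi / 2 /\ forall s, is_derive s (1 : R) B (phase_rhs p n%:R m s (B s)).
  have [m0|m0] := leP 0 m; last by exists (fun=> 0).
  by have [B B0 DB] := phase_solution_exists (n%:R : R) p1 m0; exists B.
have [B BP] := choice ex.
have B0 m : 0 <= m -> B m 0 = pi / 2 by move=> /BP[].
have DB m s : 0 <= m -> is_derive s (1 : R) (B m) (phase_rhs p n%:R m s (B m s)) by move=> /BP[_ H]; exact: H.
have m0 := critical_slope_gt0 p1 d3 B0 DB.
exists (- critical_slope B); split; first by rewrite oppr_lt0.
apply: (profile_of_phase p1 m0 (B0 _ (ltW m0)) (fun s => DB _ s (ltW m0))).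
- exact: (critical_gt0 p1 d3 B0 DB).
- exact: (phase_le_pihalf p1 (ltW m0) (B0 _ (ltW m0)) (fun s => DB _ s (ltW m0))).
- exact: (critical_cvg p1 d3 B0 DB).
- exact: (critical_slope_cvg p1 d3 B0 DB).
Qed.

Theorem corollary1p5 (R : realType) :
  (forall (n : nat) (a : 'rV[R]_n), (2 <= n)%N -> eball 0 1 a ->
     forall p : R, 1 < p ->
       p_asymptotic_power_law p (eball 0 1) a (- critical_exponent n p)) /\
  (forall a : 'rV[R]_2, eball 0 1 a ->
     forall p : R, 1 < p ->
       p_asymptotic_power_law p (eball 0 1) a
         ((3 - p + 2 * Num.sqrt (p ^+ 2 - 3 * p + 3)) / (3 * (p - 1)))).
Proof.
split=> [n a n2 Ba p p1|a Ba p p1].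
  (* Existence of a profile rules out the default value 0 of [xget], so the selected [k] is negative
     and has a profile. *)
  have [k0 [f [f1 [f2 P]]]] := xgetPex 0 (profile_exists n2 p1).
  exact: ball_power_law P k0 p1 n2 Ba.
have [f [f1 [f2 P]]] := planar_profile p1.
have k0 : - planar_exponent p < 0 by rewrite oppr_lt0 planar_exponent_gt0.
by have := ball_power_law P k0 p1 isT Ba; rewrite opprK.
Qed.
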